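(* Let $\mathbf{A}\in\mathbb{R}^{n\times d}$ have nonzero rows $a_1,\dots,a_n\in\mathbb{R}^d$, and assume $\mathrm{gap}>0$. There is a randomized algorithm which computes an $\epsilon$-approximate top eigenvector of $\mathbf{A}^\top\mathbf{A}$ in total running time $$O\left(\left(\mathrm{nnz}(\mathbf{A}) + \frac{\mathrm{nnz}(\mathbf{A})^{3/4}}{\sqrt{\mathrm{gap}}}\left(\sum_{i=1}^n \frac{\|a_i\|_2^2}{\lambda_1}\left(\sqrt{s_i}+\sqrt{\mathrm{sr}(\mathbf{A})}\right)\sqrt{s_i}\right)^{1/4}\right)\cdot\left(\log^2\left(\frac{d}{\mathrm{gap}}\right)+\log\left(\frac{1}{\epsilon}\right)\right)\log\left(\frac{d}{\mathrm{gap}}\right)\right).$$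
   Context: $\mathrm{nnz}(\mathbf{A})$ is the number of nonzero entries of $\mathbf{A}$. For $a\in\mathbb{R}^d$, $s(a)=\|a\|_1^2/\|a\|_2^2$ is its numerical sparsity and $s_i=s(a_i)$. $\mathrm{sr}(\mathbf{A})=\|\mathbf{A}\|_F^2/\|\mathbf{A}\|_2^2$ is the stable rank. $\lambda_1\ge\lambda_2$ are the two largest eigenvalues of $\mathbf{A}^\top\mathbf{A}$ and $\mathrm{gap}=(\lambda_1-\lambda_2)/\lambda_1$. A vector $v\in\mathbb{R}^d$ is an $\epsilon$-approximate top eigenvector if $\|v\|_2=1$ and $v^\top\mathbf{A}^\top\mathbf{A}v\ge(1-\epsilon)\lambda_1$. *)

(* Defs.v *)
From HB Require Import structures.
From mathcomp Require Export all_boot all_order all_algebra.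
From mathcomp Require Export all_classical all_reals all_analysis.

Set Implicit Arguments.
Unset Strict Implicit.
Unset Printing Implicit Defensive.

Import Order.TTheory GRing.Theory Num.Theory.

Local Open Scope ring_scope.

Section MatrixQuantities.
Variable R : realType.

Definition norm1 (d : nat) (x : 'cV[R]_d) : R := \sum_(j < d) `|x j 0|.

Definition norm2 (d : nat) (x : 'cV[R]_d) : R :=
  Num.sqrt (\sum_(j < d) x j 0 ^+ 2).

Definition numerical_sparsity (d : nat) (a : 'cV[R]_d) : R :=
  norm1 a ^+ 2 / norm2 a ^+ 2.

Section OneMatrix.
Variables (n d : nat) (A : 'M[R]_(n, d)).

Definition mxrow_vec (i : 'I_n) : 'cV[R]_d := (row i A)^T.

Definition nnz : nat := #|[set ij : 'I_n * 'I_d | A ij.1 ij.2 != 0]|.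

Definition frobenius_norm : R :=
  Num.sqrt (\sum_(i < n) \sum_(j < d) A i j ^+ 2).

Definition spectral_norm : R :=
  sup [set norm2 (A *m x) | x in [set x : 'cV[R]_d | norm2 x = 1]]%classic.

Definition stable_rank : R := frobenius_norm ^+ 2 / spectral_norm ^+ 2.

End OneMatrix.

(* [lam] lists the eigenvalues of [M], with algebraic multiplicity, in
   nonincreasing order. Such a list is unique when it exists, and it exists for
   every symmetric [M]. *)
Definition ordered_eigenvalues (d : nat) (M : 'M[R]_d) (lam : seq R) : Prop :=
  sorted >=%R lam /\ char_poly M = \prod_(x <- lam) ('X - x%:P).

Definition eigengap (l1 l2 : R) : R := (l1 - l2) / l1.

Definition approx_top_eigenvector (n d : nat) (A : 'M[R]_(n, d)) (l1 eps : R)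
    (v : 'cV[R]_d) : Prop :=
  norm2 v = 1 /\ (1 - eps) * l1 <= (v^T *m A^T *m A *m v) 0 0.

(* The expression inside the O(.). *)
Definition time_bound (n d : nat) (A : 'M[R]_(n, d)) (l1 l2 eps : R) : R :=
  let N : R := (nnz A)%:R in
  let gap := eigengap l1 l2 in
  let s i := numerical_sparsity (mxrow_vec A i) in
  let S := \sum_(i < n) norm2 (mxrow_vec A i) ^+ 2 / l1 *
             ((Num.sqrt (s i) + Num.sqrt (stable_rank A)) * Num.sqrt (s i)) in
  (N + N `^ (3 / 4) / Num.sqrt gap * S `^ (1 / 4)) *
  (ln (d%:R / gap) ^+ 2 + ln eps^-1) * ln (d%:R / gap).

End MatrixQuantities.

(* A randomized real RAM with unit-cost instructions. It has integer and real
   registers, and integer and real arrays that are indexed by integer registers.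
   Programs are uniform: they are finite and contain no real constants. There is
   no conversion from reals to integers and no product of integers, so the usual
   ways of packing a long computation into one unit-cost operation are not
   available. *)
Inductive instr : Type :=
| INum (x k : nat)
| IAdd (x y z : nat)
| ISub (x y z : nat)
| IHalf (x y : nat)
| ILoad (x a y : nat)
| IStore (a y x : nat)
| RofI (x y : nat)
| RAdd (x y z : nat)
| RSub (x y z : nat)
| RMul (x y z : nat)
| RDiv (x y z : nat)
| RSqrt (x y : nat)
| RLoad (x a y : nat)
| RStore (a y x : nat).

Inductive test : Type :=
| ILt (x y : nat)
| RLt (x y : nat).

(* [Rand x y] stores in integer register x a uniform element of
   {0, ..., m - 1}, where m is the content of integer register y. *)
Inductive program : Type :=
| Skip
| Do (i : instr)
| Rand (x y : nat)
| Seq (c1 c2 : program)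
| If (b : test) (c1 c2 : program)
| While (b : test) (c : program).

Section Machine.
Variable R : realType.

Record store : Type := Store {
  ireg : nat -> nat;
  rreg : nat -> R;
  iarr : nat -> nat -> nat;
  rarr : nat -> nat -> R }.

Definition upd (T : Type) (f : nat -> T) (x : nat) (v : T) : nat -> T :=
  fun y => if y == x then v else f y.

Definition set_ireg (s : store) (x v : nat) : store :=
  Store (upd (ireg s) x v) (rreg s) (iarr s) (rarr s).

Definition set_rreg (s : store) (x : nat) (v : R) : store :=
  Store (ireg s) (upd (rreg s) x v) (iarr s) (rarr s).

Definition set_iarr (s : store) (a k v : nat) : store :=
  Store (ireg s) (rreg s) (upd (iarr s) a (upd (iarr s a) k v)) (rarr s).

Definition set_rarr (s : store) (a k : nat) (v : R) : store :=
  Store (ireg s) (rreg s) (iarr s) (upd (rarr s) a (upd (rarr s a) k v)).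

Definition exec (c : instr) (s : store) : store :=
  match c with
  | INum x k => set_ireg s x k
  | IAdd x y z => set_ireg s x (ireg s y + ireg s z)%N
  | ISub x y z => set_ireg s x (ireg s y - ireg s z)%N
  | IHalf x y => set_ireg s x (ireg s y)./2
  | ILoad x a y => set_ireg s x (iarr s a (ireg s y))
  | IStore a y x => set_iarr s a (ireg s y) (ireg s x)
  | RofI x y => set_rreg s x (ireg s y)%:R
  | RAdd x y z => set_rreg s x (rreg s y + rreg s z)
  | RSub x y z => set_rreg s x (rreg s y - rreg s z)
  | RMul x y z => set_rreg s x (rreg s y * rreg s z)
  | RDiv x y z => set_rreg s x (rreg s y / rreg s z)
  | RSqrt x y => set_rreg s x (Num.sqrt (rreg s y))
  | RLoad x a y => set_rreg s x (rarr s a (ireg s y))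
  | RStore a y x => set_rarr s a (ireg s y) (rreg s x)
  end.

Definition holds (b : test) (s : store) : bool :=
  match b with
  | ILt x y => (ireg s x < ireg s y)%N
  | RLt x y => rreg s x < rreg s y
  end.

(* [halt_prob P t k s] is the probability, over the independent draws made by
   the [Rand] commands, that executing the commands of [k] one after the other
   from the store [s] terminates after at most [t] steps in a store that
   satisfies [P]. A draw from an empty range makes the run fail: the sum is then
   empty. *)
Fixpoint halt_prob (P : store -> Prop) (t : nat) (k : seq program) (s : store)
    : R :=
  match k, t with
  | [::], _ => if `[< P s >] then 1 else 0
  | _ :: _, 0%N => 0
  | c :: k', t'.+1 =>
    match c with
    | Skip => halt_prob P t' k' s
    | Do i => halt_prob P t' k' (exec i s)
    | Rand x y =>
      (\sum_(i < ireg s y) halt_prob P t' k' (set_ireg s x i)) / (ireg s y)%:R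
    | Seq c1 c2 => halt_prob P t' [:: c1, c2 & k'] s
    | If b c1 c2 => halt_prob P t' ((if holds b s then c1 else c2) :: k') s
    | While b c1 =>
      halt_prob P t' (if holds b s then [:: c1, c & k'] else k') s
    end
  end.

(* The input is [A] in compressed sparse row format, together with [eps]:
   integer registers 0, 1, 2 hold n, d, nnz A and real register 0 holds eps;
   integer array 0 holds the n + 1 row offsets, integer array 1 the column
   indices and real array 0 the values of the nonzero entries, row by row.
   Everything else is 0. *)
Definition row_support (n d : nat) (A : 'M[R]_(n, d)) (i : 'I_n) : seq 'I_d :=
  [seq j <- enum 'I_d | A i j != 0].

Definition csr_offsets (n d : nat) (A : 'M[R]_(n, d)) : seq nat :=
  mkseq (fun k => \sum_(i < n | (i < k)%N) size (row_support A i))%N n.+1.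

Definition csr_columns (n d : nat) (A : 'M[R]_(n, d)) : seq nat :=
  [seq nat_of_ord j | i <- enum 'I_n, j <- row_support A i].

Definition csr_values (n d : nat) (A : 'M[R]_(n, d)) : seq R :=
  [seq A i j | i <- enum 'I_n, j <- row_support A i].

Definition input_store (n d : nat) (A : 'M[R]_(n, d)) (eps : R) : store :=
  Store
    (nth 0%N [:: n; d; nnz A])
    (nth 0 [:: eps])
    (fun a => nth 0%N (nth [::] [:: csr_offsets A; csr_columns A] a))
    (fun a => nth 0 (nth [::] [:: csr_values A] a)).

(* The output is read from the first d cells of real array 1. *)
Definition output_vec (d : nat) (s : store) : 'cV[R]_d :=
  \col_(j < d) rarr s 1 j.

Definition success_prob (n d : nat) (A : 'M[R]_(n, d)) (eps : R)
    (P : 'cV[R]_d -> Prop) (t : nat) (p : program) : R :=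
  halt_prob (fun s => P (output_vec d s)) t [:: p] (input_store A eps).

End Machine.

(* Main.v *)
(** A unit vector [v] with nonzero overlap with the top eigenvector is improved by
    a Chebyshev iteration in the inverse of [sig - A^T A], where the shift [sig] is
    slightly above the top eigenvalue.  Let [rho] be the Rayleigh quotient of [v] and
    [G] an upper bound for the error [lam_1 - rho].  With [sig = rho + G + mu], about
    [sqrt (mu / G)] linear systems, each of condition number of order [lam_1 / mu],
    either shrink the residual of [v] by a polynomial factor, or show that [G] may be
    halved; [G] never drops below a constant times [lam_1 - lam_2].
    The systems are solved by variance-reduced stochastic gradients.  A row is drawn
    with probability proportional to its squared norm, and its inner product with
    the iterate is estimated from about [sqrt s_i (sqrt s_i + sqrt sr)] of its entries,
    drawn proportionally to their absolute values; the choice of [mu] makes one epoch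
    cost no more than reading the matrix.  The residual of every system is tested
    exactly, so that the output is always correct and only the running time and the
    overlap of the random starting vector are random.

    The time analysis charges [kap] for each step: [bnd k s x] says that the
    probability of not having finished well within [t] steps is at most
    [x + 1 - kap * t].  For a loop this [x] is a potential, and since the potentials
    are logarithms of squared errors, a bound on an expected contraction
    becomes a bound on the expected decrease by concavity. *)
Require Import Defs.
From mathcomp Require Import ring lra zify.
Import Order.TTheory GRing.Theory Num.Theory.
Local Open Scope ring_scope.
Set Implicit Arguments.
Unset Strict Implicit.
Unset Printing Implicit Defensive.

(** * Expected running time of programs *)

Section Logic.
Variables (R : realType) (P : store R -> Prop) (kap : R).
Hypothesis kap0 : 0 <= kap.
Implicit Types (s : store R) (k : seq program) (x y : R) (n t : nat).

(** Two scalings give the logarithms their shape. A linear system for [y] is started from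
    [y / (sig - rho)], whose error is proportional to the residual [r], and its tolerance is
    proportional to [r] as well; so [r] cancels, and a system takes O(log (d / gap)) epochs however
    small [r] has become. With [P = d F / G], a block costs about log(P)^2 passes, up to a factor of
    order [sqrt (mu / G)], and a successful block divides [r] by [P]; so the dependence on [eps] is
    only log(1 / eps) log P. The program knows neither the gap nor the overlap. That a block fails
    to divide [r] by [P] is itself the evidence for [lam_1 - lam_2 < 4 G], which makes it safe to
    halve [G]. The overlap is never tested; the invariant [(1 + r / F) / (c0 P) <= overlap] is
    carried by the analysis alone. If [r] shrinks, the falling numerator pays for the small loss of
    a block, and if [G] is halved, the doubled denominator does, so the bound does not degrade with
    the number of blocks. The constant [c0] is fixed by the failure probability granted to the
    random start. *)

Lemma halt_prob_ge0 t k s : 0 <= halt_prob P t k s.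
Proof.
elim: t k s => [|t IH] [|c k] s //=; try by case: asboolP.
case: c => // x y.
by rewrite divr_ge0 // sumr_ge0.
Qed.

(* One step costs [kap]; the loss [x] bounds the failure probability plus
   [kap] times the expected remaining running time. The limit [n] on the number
   of steps is only there to justify the rule for loops by induction. *)
Definition bnd n k s x : Prop :=
  0 <= x /\ forall t, (t <= n)%N -> kap * t%:R <= 1 ->
    1 - halt_prob P t k s <= x + 1 - kap * t%:R.

Lemma bnd_le n k s x y : x <= y -> bnd n k s x -> bnd n k s y.
Proof.
move=> xy [x0 H]; split; first exact: le_trans xy.
by move=> t tn kt; have := H t tn kt; lra.
Qed.

(** A loss of 1 permits every outcome; this is how a bad draw is written off. *)
Lemma bnd_triv n k s x : 1 <= x -> bnd n k s x.
Proof.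
move=> x1; split; first by lra.
by move=> t _ kt; have := halt_prob_ge0 t k s; lra.
Qed.

Lemma bnd_cons n c k s x (k' : seq program) s' :
  (forall t, halt_prob P t.+1 (c :: k) s = halt_prob P t k' s') ->
  bnd n k' s' (x - kap) -> bnd n.+1 (c :: k) s x.
Proof.
move=> E [x0 H]; split; first by have := kap0; lra.
move=> [|t] tn kt; first by rewrite /= mulr0; have := kap0; lra.
rewrite E; move: (kt); rewrite -natr1 mulrDr mulr1 => kt'.
by have := H t tn ltac:(have := kap0; lra); lra.
Qed.

Lemma bnd_leq m n k s x : (m <= n)%N -> bnd n k s x -> bnd m k s x.
Proof. by move=> mn [x0 H]; split=> // t tm; apply: H (leq_trans tm mn). Qed.

Lemma bnd_skip n k s x : bnd n k s (x - kap) -> bnd n (Skip :: k) s x.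
Proof. by move=> H; apply: (@bnd_leq n n.+1) => //; apply: bnd_cons H. Qed.

Lemma bnd_do n i k s x : bnd n k (exec i s) (x - kap) -> bnd n (Do i :: k) s x.
Proof. by move=> H; apply: (@bnd_leq n n.+1) => //; apply: bnd_cons H. Qed.

Lemma bnd_seq n c1 c2 k s x :
  bnd n [:: c1, c2 & k] s (x - kap) -> bnd n (Seq c1 c2 :: k) s x.
Proof. by move=> H; apply: (@bnd_leq n n.+1) => //; apply: bnd_cons H. Qed.

Lemma bnd_if n b c1 c2 k s x :
  bnd n ((if holds b s then c1 else c2) :: k) s (x - kap) ->
  bnd n (If b c1 c2 :: k) s x.
Proof. by move=> H; apply: (@bnd_leq n n.+1) => //; apply: bnd_cons H. Qed.

Lemma bnd_while_S n b c k s x :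
  bnd n (if holds b s then [:: c, While b c & k] else k) s (x - kap) ->
  bnd n.+1 (While b c :: k) s x.
Proof. by move=> H; apply: bnd_cons H. Qed.

Lemma bnd_while n b c k s x :
  bnd n (if holds b s then [:: c, While b c & k] else k) s (x - kap) ->
  bnd n (While b c :: k) s x.
Proof. by move=> H; apply: (@bnd_leq n n.+1) => //; apply: bnd_while_S. Qed.

(** Induction on the limit [n]: entering the loop uses up one step, so after the body the loop is
    only needed for a smaller limit. The potential, which is nonnegative and has to pay for every
    round, replaces a termination argument. *)
Lemma bnd_while_inv (J : store R -> R -> Prop) n b c k s x :
  (forall s x, J s x -> 0 <= x) ->
  (forall m s x, (m <= n)%N ->
     (forall s' x', J s' x' -> bnd m (While b c :: k) s' x') -> J s x ->
     bnd m (if holds b s then [:: c, While b c & k] else k) s (x - kap)) ->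
  J s x -> bnd n (While b c :: k) s x.
Proof.
move=> J0 H; elim: n s x H => [|n IH] s x H Jsx.
  split; first exact: J0 Jsx.
  by case=> // _ _; rewrite /= mulr0; have := J0 _ _ Jsx; lra.
apply: bnd_while_S; apply: (H n) => // s' x' Js'x'; apply: IH Js'x'.
by move=> m s1 x1 mn; apply: H; apply: leq_trans mn _.
Qed.

(** The inequality in [bnd] is affine in the probability and in the loss, so the loss of a draw is
    the mean of the losses of its outcomes. *)
Lemma bnd_rand n (x y : nat) k s (z : R) (f : nat -> R) :
  (0 < ireg s y)%N ->
  (forall i, (i < ireg s y)%N -> bnd n k (set_ireg s x i) (f i)) ->
  (\sum_(i < ireg s y) f i) / (ireg s y)%:R + kap <= z ->
  bnd n (Rand x y :: k) s z.
Proof.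
move=> m0 H Hz; set m := ireg s y in m0 H Hz *.
have mR : (0 : R) < m%:R by rewrite ltr0n.
have S0 : 0 <= (\sum_(i < m) f i) / m%:R.
  by rewrite divr_ge0 ?sumr_ge0 // => i _; have [] := H i (ltn_ord i).
split; first by have := kap0; lra.
move=> [|t] tn kt; first by rewrite /= mulr0; have := kap0; lra.
rewrite /= -/m; move: (kt); rewrite -natr1 mulrDr mulr1 => kt'.
have kt2 : kap * t%:R <= 1 by have := kap0; lra.
suff: 1 - (\sum_(i < m) halt_prob P t k (set_ireg s x i)) / m%:R <=
      (\sum_(i < m) f i) / m%:R + 1 - kap * t%:R by lra.
have HS : \sum_(i < m) (kap * t%:R) <=
    \sum_(i < m) f i + \sum_(i < m) halt_prob P t k (set_ireg s x i).
  rewrite -big_split; apply: ler_sum => i _ /=.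
  by have [_ /(_ t (ltnW tn) kt2)] := H i (ltn_ord i); lra.
move: HS; rewrite sumr_const card_ord -[_ *+ m]mulr_natr -ler_pdivlMr // mulrDl.
by lra.
Qed.

End Logic.

(** * Ceilings as numbers of rounds of loops with a real counter *)

Section Ceil.
Variable R : realType.

Fact nceil_ex (x : R) : exists m : nat, x <= m%:R.
Proof.
exists (Num.bound x); apply: le_trans (ler_norm x) _.
by have /ltW := archi_boundP (normr_ge0 x); rewrite /Num.bound normr_id.
Qed.

Definition nceil (x : R) : nat := ex_minn (nceil_ex x).

(** A loop that counts a real register up by ones from 0 while it is below [x] makes exactly
    [nceil x] rounds. The machine cannot convert a real to an integer, so every count obtained from
    real data takes this form. *)
Lemma nceilP (x : R) (j : nat) : (j%:R < x) = (j < nceil x)%N.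
Proof.
rewrite /nceil; case: ex_minnP => m xm mmin.
case: ltnP => [jm|mj]; last by apply/negbTE; rewrite -leNgt (le_trans xm) // ler_nat.
by rewrite ltNge; apply/negP => /mmin; rewrite leqNgt jm.
Qed.

Lemma nceil_ge (x : R) : x <= (nceil x)%:R.
Proof. by rewrite leNgt nceilP ltnn. Qed.

Lemma nceil_le (x : R) : 0 <= x -> (nceil x)%:R <= x + 1.
Proof.
move=> x0; case E: (nceil x) => [|m]; first by lra.
by have := nceilP x m; rewrite E ltnS leqnn => /ltW; rewrite -natr1; lra.
Qed.

Lemma nceil_gt0 (x : R) : 0 < x -> (0 < nceil x)%N.
Proof. by move=> x0; rewrite -nceilP. Qed.

End Ceil.

(* Straight-line code and counted loops. Integer registers below 10 are never
   written by them; register 10 is the loop counter, register 13 holds 1. *)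
Definition Blk (l : seq instr) : program := foldr (fun i c => Seq (Do i) c) Skip l.

Definition inc : seq instr := [:: INum 13 1; IAdd 10 10 13].

Definition Loop (b : nat) (l : seq instr) : program :=
  Seq (Do (INum 10 0)) (While (ILt 10 b) (Blk (l ++ inc))).

Definition wi (i : instr) : seq nat :=
  match i with
  | INum x _ | IAdd x _ _ | ISub x _ _ | IHalf x _ | ILoad x _ _ => [:: x]
  | _ => [::] end.
Definition wr (i : instr) : seq nat :=
  match i with
  | RofI x _ | RAdd x _ _ | RSub x _ _ | RMul x _ _ | RDiv x _ _ | RSqrt x _
  | RLoad x _ _ => [:: x]
  | _ => [::] end.
Definition wia (i : instr) : seq nat := if i is IStore a _ _ then [:: a] else [::].
Definition wra (i : instr) : seq nat := if i is RStore a _ _ then [:: a] else [::].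

Definition writes (w : instr -> seq nat) (l : seq instr) : seq nat :=
  flatten (map w l).

Section Frames.
Variable R : realType.
Implicit Types (s : store R) (l : seq instr).

Definition execs l s : store R := foldl (fun s i => exec i s) s l.

Lemma execs_cat l1 l2 s : execs (l1 ++ l2) s = execs l2 (execs l1 s).
Proof. by rewrite /execs foldl_cat. Qed.

Lemma execs_cons i l s : execs (i :: l) s = execs l (exec i s).
Proof. by []. Qed.

Record frm (wI wR wA wB : seq nat) s s' : Prop := Frm {
  frm_i : forall x, x \notin wI -> ireg s' x = ireg s x;
  frm_r : forall x, x \notin wR -> rreg s' x = rreg s x;
  frm_ia : forall a, a \notin wA -> iarr s' a = iarr s a;
  frm_ra : forall a, a \notin wB -> rarr s' a = rarr s a }.

Lemma frm_refl wI wR wA wB s : frm wI wR wA wB s s.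
Proof. by []. Qed.

Lemma frm_trans wI wR wA wB s s' s'' :
  frm wI wR wA wB s s' -> frm wI wR wA wB s' s'' -> frm wI wR wA wB s s''.
Proof.
move=> [a1 a2 a3 a4] [b1 b2 b3 b4]; split=> x Hx.
- by rewrite b1 // a1. - by rewrite b2 // a2. - by rewrite b3 // a3.
- by rewrite b4 // a4.
Qed.

Lemma frm_sub wI wR wA wB wI' wR' wA' wB' s s' :
  all (mem wI') wI -> all (mem wR') wR -> all (mem wA') wA -> all (mem wB') wB ->
  frm wI wR wA wB s s' -> frm wI' wR' wA' wB' s s'.
Proof.
move=> /allP h1 /allP h2 /allP h3 /allP h4 [a1 a2 a3 a4].
by split=> x Hx; [apply: a1|apply: a2|apply: a3|apply: a4]; apply: contra Hx;
  [move/h1|move/h2|move/h3|move/h4].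
Qed.

Definition frml l := frm (writes wi l) (writes wr l) (writes wia l) (writes wra l).

Lemma frm_exec i s : frm (wi i) (wr i) (wia i) (wra i) s (exec i s).
Proof.
by case: i => *; split=> ? /=; rewrite ?inE // /upd => /negbTE ->.
Qed.

Lemma frm_execs l s : frml l s (execs l s).
Proof.
elim: l s => [|i l IH] s; first exact: frm_refl.
rewrite execs_cons; have [a1 a2 a3 a4] := IH (exec i s).
have [b1 b2 b3 b4] := frm_exec i s.
by split=> x; rewrite /writes /= mem_cat negb_or => /andP[h1 h2];
  [rewrite a1 ?b1|rewrite a2 ?b2|rewrite a3 ?b3|rewrite a4 ?b4].
Qed.

(* Backward symbolic execution of straight-line code (last instruction first):
   simplification then only visits the instructions a value depends on. *)
Fixpoint ival (l : seq instr) s (x : nat) : nat :=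
  match l with
  | [::] => ireg s x
  | i :: l' => match i with
    | INum y k => if x == y then k else ival l' s x
    | IAdd y b c => if x == y then (ival l' s b + ival l' s c)%N else ival l' s x
    | ISub y b c => if x == y then (ival l' s b - ival l' s c)%N else ival l' s x
    | IHalf y b => if x == y then (ival l' s b)./2 else ival l' s x
    | ILoad y b c => if x == y then iaval l' s b (ival l' s c) else ival l' s x
    | _ => ival l' s x end
  end
with iaval (l : seq instr) s (b : nat) : nat -> nat :=
  match l with
  | [::] => iarr s b
  | i :: l' => match i with
    | IStore c y z => if b == c then upd (iaval l' s b) (ival l' s y) (ival l' s z)
                      else iaval l' s b
    | _ => iaval l' s b end
  end.

Fixpoint rval (l : seq instr) s (x : nat) : R :=
  match l with
  | [::] => rreg s x
  | i :: l' => match i with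
    | RofI y b => if x == y then (ival l' s b)%:R else rval l' s x
    | RAdd y b c => if x == y then rval l' s b + rval l' s c else rval l' s x
    | RSub y b c => if x == y then rval l' s b - rval l' s c else rval l' s x
    | RMul y b c => if x == y then rval l' s b * rval l' s c else rval l' s x
    | RDiv y b c => if x == y then rval l' s b / rval l' s c else rval l' s x
    | RSqrt y b => if x == y then Num.sqrt (rval l' s b) else rval l' s x
    | RLoad y b c => if x == y then raval l' s b (ival l' s c) else rval l' s x
    | _ => rval l' s x end
  end
with raval (l : seq instr) s (b : nat) : nat -> R :=
  match l with
  | [::] => rarr s b
  | i :: l' => match i with
    | RStore c y z => if b == c then upd (raval l' s b) (ival l' s y) (rval l' s z)
                      else raval l' s b
    | _ => raval l' s b end
  end.

Fixpoint revl (l acc : seq instr) : seq instr :=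
  if l is i :: l' then revl l' (i :: acc) else acc.

Lemma val_exec l s s0 :
  ireg s =1 ival l s0 -> (forall b, iarr s b =1 iaval l s0 b) ->
  rreg s =1 rval l s0 -> (forall b, rarr s b =1 raval l s0 b) ->
  forall i, [/\ ireg (exec i s) =1 ival (i :: l) s0,
    (forall b, iarr (exec i s) b =1 iaval (i :: l) s0 b),
    rreg (exec i s) =1 rval (i :: l) s0 &
    (forall b, rarr (exec i s) b =1 raval (i :: l) s0 b)].
Proof.
move=> h1 h2 h3 h4 i; case: i => * /=; split=> //= *; rewrite /upd ?h1 ?h2 ?h3 ?h4 //;
  do ?[case: eqP => *; subst; rewrite ?h2 ?h4 ?eqxx // /upd ?h1 ?h2 ?h3 ?h4 //].
all: by move=> z /=; rewrite ?h1 ?h2 ?h3 ?h4.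
Qed.

Lemma val_execs l s : let l' := revl l [::] in
  [/\ ireg (execs l s) =1 ival l' s, (forall b, iarr (execs l s) b =1 iaval l' s b),
      rreg (execs l s) =1 rval l' s & (forall b, rarr (execs l s) b =1 raval l' s b)].
Proof.
rewrite /=.
have H l0 acc s1 : ireg s1 =1 ival acc s -> (forall b, iarr s1 b =1 iaval acc s b) ->
  rreg s1 =1 rval acc s -> (forall b, rarr s1 b =1 raval acc s b) ->
  [/\ ireg (execs l0 s1) =1 ival (revl l0 acc) s,
      (forall b, iarr (execs l0 s1) b =1 iaval (revl l0 acc) s b),
      rreg (execs l0 s1) =1 rval (revl l0 acc) s &
      (forall b, rarr (execs l0 s1) b =1 raval (revl l0 acc) s b)].
  elim: l0 acc s1 => [|i l0 IH] acc s1 h1 h2 h3 h4; first by [].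
  by have [g1 g2 g3 g4] := val_exec h1 h2 h3 h4 i; apply: IH.
exact: (H l [::] s).
Qed.

Lemma ivalE l s x : ireg (execs l s) x = ival (revl l [::]) s x.
Proof. by have [h _ _ _] := val_execs l s. Qed.
Lemma iavalE l s b x : iarr (execs l s) b x = iaval (revl l [::]) s b x.
Proof. by have [_ h _ _] := val_execs l s; rewrite h. Qed.
Lemma rvalE l s x : rreg (execs l s) x = rval (revl l [::]) s x.
Proof. by have [_ _ h _] := val_execs l s. Qed.
Lemma ravalE l s b x : rarr (execs l s) b x = raval (revl l [::]) s b x.
Proof. by have [_ _ _ h] := val_execs l s; rewrite h. Qed.

End Frames.

(** * Loss of straight-line code and of counted loops *)

Section LogicLoops.
Variables (R : realType) (P : store R -> Prop) (kap : R).
Hypothesis kap0 : 0 <= kap.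
Implicit Types (s : store R).
Let B := @bnd R P kap.

Lemma bnd_blk n l k s x :
  B n k (execs l s) (x - kap * (2 * size l + 1)%:R) -> B n (Blk l :: k) s x.
Proof.
elim: l s x => [|i l IH] s x H.
  by apply: bnd_skip => //; move: H; rewrite /= mulr1.
apply: bnd_seq => //; apply: bnd_do => //; apply: IH.
move: H; rewrite execs_cons; apply: bnd_le; rewrite /=.
have -> : (2 * (size l).+1 + 1)%:R = (2 * size l + 1)%:R + 2 :> R.
  by rewrite -natrD; congr _%:R; lia.
lra.
Qed.

Definition loop_cost (l : seq instr) : nat := (2 * size l + 6)%N.

(* The invariant of a counted loop may assume that the store differs from the
   initial one only on what the body writes. *)
Lemma bnd_loop n b l k s x (I : nat -> store R -> Prop) :
  b \notin 10 :: 13 :: writes wi l -> 10 \notin writes wi l ->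
  let fr := frm (10 :: 13 :: writes wi l) (writes wr l) (writes wia l)
               (writes wra l) in
  I 0%N (exec (INum 10 0) s) ->
  (forall p s', (p < ireg s b)%N -> ireg s' 10 = p -> fr s s' ->
     I p s' -> I p.+1 (execs (l ++ inc) s')) ->
  (forall s', fr s s' -> I (ireg s b) s' ->
     B n k s' (x - kap * (loop_cost l * ireg s b + 4)%:R)) ->
  B n (Loop b l :: k) s x.
Proof.
move=> hb h10 fr I0 IS IN.
apply: bnd_seq => //; apply: bnd_do => //.
set s1 := exec _ s.
have f1 : fr s s1.
  split=> a //= Ha; rewrite /upd; case: eqP => // E; move: Ha.
  by rewrite E inE eqxx.
have fS s' : fr s' (execs (l ++ inc) s').
  have [a1 a2 a3 a4] := frm_execs (l ++ inc) s'.
  have W w : writes w (l ++ inc) = writes w l ++ writes w inc.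
    by rewrite /writes map_cat flatten_cat.
  split=> a Ha; [apply: a1|apply: a2|apply: a3|apply: a4]; rewrite W //= ?cats0 //.
  by move: Ha; rewrite !inE mem_cat !inE !negb_or; case: (_ \in _) => /=; lia.
have e10 s' : ireg (execs (l ++ inc) s') 10 = (ireg s' 10).+1.
  rewrite execs_cat /= /upd /= -[in RHS](@frm_i _ _ _ _ _ _ _ (frm_execs l s')) //.
  by rewrite addn1.
have h0 : ireg s1 10 = 0%N by rewrite /= /upd eqxx.
have := I0; rewrite -/s1.
move: (leq0n (ireg s b)) h0 f1; move: {1 3 4}0%N s1 => p s1.
move=> ple h0 f1 Ip.
suff: forall m p s1 y, (ireg s b - p)%N = m -> (p <= ireg s b)%N ->
   ireg s1 10 = p -> fr s s1 -> I p s1 ->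
   x - kap * (loop_cost l * p + 2)%:R <= y ->
   B n (While (ILt 10 b) (Blk (l ++ inc)) :: k) s1 y.
  move=> H; apply: (H _ p s1 _ erefl ple h0 f1 Ip).
  rewrite natrD mulrDr; have : 0 <= kap * (loop_cost l * p)%:R by rewrite mulr_ge0.
  lra.
move=> {ple h0 f1 Ip I0} m; elim: m => [|m IHm] {}p {}s1 y Em ple h0 f1 Ip Hy.
  have Ep : p = ireg s b by lia.
  apply: bnd_while => //=; rewrite h0 (frm_i f1) // Ep ltnn.
  apply: bnd_le (IN _ f1 _); last by rewrite -Ep.
  by move: Hy; rewrite Ep !natrD !mulrDr; have := kap0; lra.
have plt : (p < ireg s b)%N by lia.
apply: bnd_while => //=; rewrite h0 (frm_i f1) // plt.
apply: bnd_blk; apply: (IHm p.+1).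
- by lia.
- by [].
- by rewrite e10 h0.
- exact: frm_trans f1 (fS _).
- exact: IS.
have -> : (loop_cost l * p.+1 + 2)%:R =
   (loop_cost l * p + 2)%:R + 1 + (2 * size (l ++ inc) + 1)%:R :> R.
  by rewrite -[1]/(1%:R) -!natrD; congr _%:R; rewrite size_cat /loop_cost /=; nia.
by lra.
Qed.

End LogicLoops.

(** * Spectral theorem *)

Section Dot.
Variables (R : realType) (d : nat).
Implicit Types (x y z : 'cV[R]_d) (a b : R).

Definition dot x y : R := \sum_j x j 0 * y j 0.

Lemma dotC x y : dot x y = dot y x.
Proof. by apply: eq_bigr => j _; rewrite mulrC. Qed.
Lemma dotDl x y z : dot (x + y) z = dot x z + dot y z.
Proof. by rewrite -big_split; apply: eq_bigr => j _; rewrite mxE mulrDl. Qed.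
Lemma dotZl a x z : dot (a *: x) z = a * dot x z.
Proof. by rewrite mulr_sumr; apply: eq_bigr => j _; rewrite mxE mulrA. Qed.
Lemma dotDr x y z : dot z (x + y) = dot z x + dot z y.
Proof. by rewrite !(dotC z) dotDl. Qed.
Lemma dotZr a x z : dot z (a *: x) = a * dot z x.
Proof. by rewrite !(dotC z) dotZl. Qed.
Lemma dotNl x z : dot (- x) z = - dot x z.
Proof. by rewrite -scaleN1r dotZl mulN1r. Qed.
Lemma dotNr x z : dot z (- x) = - dot z x.
Proof. by rewrite -scaleN1r dotZr mulN1r. Qed.
Lemma dot0l z : dot 0 z = 0.
Proof. by rewrite -(scale0r 0) dotZl mul0r. Qed.
Definition dotE := (dotDl, dotDr, dotZl, dotZr, dotNl, dotNr).

Lemma dot_ge0 x : 0 <= dot x x.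
Proof. by apply: sumr_ge0 => j _; rewrite -expr2 sqr_ge0. Qed.

Lemma dot_mx x y : (x^T *m y) 0 0 = dot x y.
Proof. by rewrite mxE; apply: eq_bigr => j _; rewrite mxE. Qed.

Lemma norm2_sq x : norm2 x ^+ 2 = dot x x.
Proof.
rewrite /norm2 sqr_sqrtr; last by apply: sumr_ge0 => j _; rewrite sqr_ge0.
by apply: eq_bigr => j _; rewrite expr2.
Qed.

Lemma norm2E x : norm2 x = Num.sqrt (dot x x).
Proof. by rewrite -norm2_sq sqrtr_sqr ger0_norm // sqrtr_ge0. Qed.

Lemma norm2_ge0 x : 0 <= norm2 x. Proof. exact: sqrtr_ge0. Qed.

Lemma norm2_le x a : 0 <= a -> dot x x <= a ^+ 2 -> norm2 x <= a.
Proof.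
by move=> a0; rewrite -norm2_sq ler_pXn2r ?nnegrE ?norm2_ge0.
Qed.

Lemma dot_CS x y : dot x y ^+ 2 <= dot x x * dot y y.
Proof.
have H t : 0 <= dot x x - 2 * t * dot x y + t ^+ 2 * dot y y.
  have := dot_ge0 (x - t *: y).
  by rewrite !dotE (dotC y x); congr (_ <= _); ring.
have [y0|y0] := eqVneq (dot y y) 0.
  (* If [dot y y] vanishes, the quadratic is affine in [t], and this [t] would give it the value -1
     unless [dot x y] is 0. *)
  have := H ((dot x x + 1) / (2 * dot x y)); rewrite y0 !mulr0 addr0.
  have [->|n0] := eqVneq (dot x y) 0; first by rewrite expr0n.
  have -> : 2 * ((dot x x + 1) / (2 * dot x y)) * dot x y = dot x x + 1 by field.
  by lra.
have yp : 0 < dot y y by rewrite lt_def y0 dot_ge0.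
have := H (dot x y / dot y y).
have -> : dot x x - 2 * (dot x y / dot y y) * dot x y +
   (dot x y / dot y y) ^+ 2 * dot y y =
   (dot x x * dot y y - dot x y ^+ 2) / dot y y by field.
by rewrite pmulr_lge0 ?invr_gt0 // subr_ge0.
Qed.

Lemma norm_dot_le x y : `|dot x y| <= norm2 x * norm2 y.
Proof.
rewrite -(@ler_pXn2r _ 2) // ?nnegrE ?mulr_ge0 ?norm2_ge0 //.
by rewrite real_normK ?num_real // exprMn !norm2_sq dot_CS.
Qed.

Lemma norm2D x y : norm2 (x + y) <= norm2 x + norm2 y.
Proof.
apply: norm2_le; first by rewrite addr_ge0 ?norm2_ge0.
have := le_trans (ler_norm _) (norm_dot_le x y).
rewrite sqrrD !norm2_sq !dotE (dotC y x); lra.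
Qed.

Lemma norm2Z a x : norm2 (a *: x) = `|a| * norm2 x.
Proof.
by rewrite !norm2E !dotE mulrA -expr2 sqrtrM ?sqr_ge0 // sqrtr_sqr.
Qed.

Lemma norm20 : norm2 (0 : 'cV[R]_d) = 0.
Proof. by rewrite norm2E dot0l sqrtr0. Qed.

Lemma norm2_sum n (f : 'I_n -> 'cV[R]_d) :
  norm2 (\sum_i f i) <= \sum_i norm2 (f i).
Proof.
elim/big_rec2: _ => [|i y x _ H]; first by rewrite norm20.
by apply: le_trans (norm2D _ _) _; rewrite lerD2l.
Qed.

Lemma norm2_coord x j : `|x j 0| <= norm2 x.
Proof.
rewrite norm2E -sqrtr_sqr ler_wsqrtr // /dot (bigD1 j) //= -expr2 lerDl.
by apply: sumr_ge0 => i _; rewrite -expr2 sqr_ge0.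
Qed.

End Dot.

Section Spectral.
Variable R : realType.

(** The Householder reflection along [w = u - e], or the identity if [u = e]. *)
Lemma reflection_row d (u : 'rV[R]_d.+1) : u *m u^T = 1%:M ->
  exists H : 'M[R]_d.+1, [/\ H^T = H, H *m H = 1%:M & delta_mx 0 0 *m H = u].
Proof.
move=> u1; pose e : 'rV[R]_d.+1 := delta_mx 0 0; pose w := u - e.
have [w0|w0] := eqVneq w 0.
  exists 1%:M; rewrite trmx1 mulmx1 mulmx1; split=> //.
  by apply/esym/eqP; rewrite -subr_eq0 -/e -/w w0.
pose c := (w *m w^T) 0 0.
have cE : w *m w^T = c%:M by exact: mx11_scalar.
have c0 : c != 0.
  apply/eqP => c0; case/negP: w0; apply/eqP/rowP => j; rewrite [RHS]mxE.
  move: c0; rewrite /c mxE => /eqP.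
  rewrite psumr_eq0; last by move=> i _; rewrite [w^T _ _]mxE -expr2 sqr_ge0.
  by move/allP/(_ j (mem_index_enum _)); rewrite [w^T _ _]mxE -expr2 sqrf_eq0 => /eqP.
have ee : e *m e^T = 1%:M.
  rewrite trmx_delta mul_delta_mx; apply/matrixP => i j; rewrite !ord1 !mxE.
  by rewrite !eqxx.
have ewE : e *m w^T = (- (c / 2))%:M.
  have H : w *m w^T = (2 : R)%:M - u *m e^T - e *m u^T.
    rewrite /w linearB /= mulmxBl !mulmxBr u1 ee opprB addrA.
    apply/matrixP => i j; rewrite !mxE; lra.
  have uT : u *m e^T = e *m u^T.
    have -> : u *m e^T = (e *m u^T)^T by rewrite trmx_mul trmxK.
    by apply/matrixP => i j; rewrite !ord1 mxE.
  rewrite /w linearB /= mulmxBr ee.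
  move: H; rewrite cE uT => H; apply/matrixP => i j; rewrite !ord1.
  move/matrixP: H => /(_ 0 0); rewrite !mxE eqxx !mulr1n; lra.
have wE : w = u - e by [].
clearbody c w.
exists (1%:M - (2 / c) *: (w^T *m w)); split.
- by rewrite linearB /= trmx1 linearZ /= trmx_mul trmxK.
- have XX : (w^T *m w) *m (w^T *m w) = c *: (w^T *m w).
    by rewrite mulmxA -(mulmxA w^T) cE mul_mx_scalar scalemxAl.
  move: (w^T *m w) XX => X XX.
  rewrite mulmxBl mul1mx mulmxBr mulmx1 -scalemxAl -scalemxAr XX !scalerA.
  have -> : 2 / c * (2 / c) * c = 2 / c + 2 / c by field.
  by rewrite scalerDl opprB addrK subrK.
- rewrite -/e mulmxBr mulmx1 -scalemxAr mulmxA ewE mul_scalar_mx scalerA.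
  have -> : 2 / c * - (c / 2) = -1 by field.
  by rewrite scaleN1r opprK wE addrC subrK.
Qed.

Lemma char_poly_conj d (B H : 'M[R]_d) : H *m H = 1%:M ->
  char_poly (H *m B *m H) = char_poly B.
Proof.
move=> HH; rewrite /char_poly /char_poly_mx.
pose Hp := map_mx (@polyC R) H.
have HpHp : Hp *m Hp = 1%:M by rewrite -map_mxM HH map_mx1.
have -> : 'X%:M - map_mx (@polyC R) (H *m B *m H) =
          Hp *m ('X%:M - map_mx (@polyC R) B) *m Hp.
  rewrite mulmxBr mulmxBl !map_mxM; congr (_ - _).
  by rewrite mul_mx_scalar -scalemxAl HpHp scalemx1.
rewrite !det_mulmx mulrC mulrA -det_mulmx HpHp det1 mul1r //.
Qed.

(** Deflation along the list: a reflection moves a unit eigenvector for the head to the first axis,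
    and the complementary block has the tail as its characteristic roots. The real roots come from
    the given factorization, and the diagonal inherits the order of [lam]. *)
Lemma symmetric_diagonalization d (B : 'M[R]_d) (lam : seq R) :
  B^T = B -> char_poly B = \prod_(x <- lam) ('X - x%:P) ->
  exists Q : 'M[R]_d,
    Q *m Q^T = 1%:M /\ Q *m B = diag_mx (\row_j nth 0 lam j) *m Q.
Proof.
elim: d B lam => [|d IH] B lam sB cB.
  by exists 1%:M; split; rewrite ?trmx1 ?mulmx1 //; apply/matrixP => - [].
case: lam cB => [|l lam] cB.
  by have := size_char_poly B; rewrite cB big_nil size_poly1.
have : root (char_poly B) l by rewrite cB root_prod_XsubC inE eqxx.
rewrite -eigenvalue_root_char => /eigenvalueP[v0 v0B v00].
pose c := (v0 *m v0^T) 0 0.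
have c0 : 0 < c.
  rewrite lt_def; apply/andP; split.
    apply: contraNneq v00 => c0; apply/eqP/rowP => j; rewrite [RHS]mxE.
    move: c0; rewrite /c mxE => /eqP.
    rewrite psumr_eq0; last by move=> i _; rewrite mxE -expr2 sqr_ge0.
    by move/allP/(_ j (mem_index_enum _)); rewrite mxE -expr2 sqrf_eq0 => /eqP.
  by rewrite /c mxE; apply: sumr_ge0 => j _; rewrite mxE -expr2 sqr_ge0.
pose u := (Num.sqrt c)^-1 *: v0.
have u1 : u *m u^T = 1%:M.
  rewrite /u linearZ /= -scalemxAl -scalemxAr scalerA.
  rewrite [v0 *m _]mx11_scalar -/c scale_scalar_mx -expr2 exprVn sqr_sqrtr ?ltW //.
  by rewrite mulVf // gt_eqF.
have uB : u *m B = l *: u by rewrite /u -scalemxAl v0B !scalerA mulrC.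
have [H [sH HH eH]] := reflection_row u1.
pose e : 'rV[R]_d.+1 := delta_mx 0 0.
have [C CdE] : exists C : 'M[R]_(1 + d), C = H *m B *m H by eexists.
have sC : C^T = C by rewrite CdE !trmx_mul sH sB mulmxA.
have uH : u *m H = e by rewrite -eH -mulmxA HH mulmx1.
have eC : e *m C = l *: e.
  by rewrite CdE !mulmxA eH uB -scalemxAl uH.
have row0 j : C 0 j = l *+ (j == 0).
  have : (e *m C) 0 j = C 0 j by rewrite -rowE mxE.
  by rewrite eC !mxE eqxx /= => <-; case: (j == 0); rewrite ?mulr1 ?mulr0.
have col0 j : C j 0 = l *+ (j == 0) by rewrite -row0 -[in LHS]sC mxE.
pose B' : 'M[R]_d := drsubmx C.
have l0 : lshift d (0 : 'I_1) = 0 :> 'I_(1 + d) by apply: val_inj.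
have CE : C = block_mx (l%:M : 'M[R]_1) 0 0 B'.
  rewrite -[LHS]submxK; congr block_mx.
  - by apply/matrixP => i j; rewrite !ord1 /ulsubmx /lsubmx /usubmx !mxE l0 row0.
  - by apply/matrixP => i j; rewrite !ord1 /ursubmx /rsubmx /usubmx !mxE l0 row0.
  - by apply/matrixP => i j; rewrite !ord1 /dlsubmx /lsubmx /dsubmx !mxE l0 col0.
have sB' : B'^T = B'.
  by apply/matrixP => i j; rewrite !mxE -[in LHS]sC mxE.
have cB' : char_poly B' = \prod_(x <- lam) ('X - x%:P).
  have : char_poly C = ('X - l%:P) * char_poly B'.
    rewrite /char_poly /char_poly_mx CE map_block_mx !map_mx0 scalar_mx_block.
    rewrite opp_block_mx add_block_mx !oppr0 !addr0 det_ublock; congr (_ * _).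
    by rewrite det_mx11 !mxE eqxx !mulr1n.
  rewrite CdE (char_poly_conj B HH) cB big_cons => /mulfI -> //.
  by rewrite polyXsubC_eq0.
have [Q' [Q'1 Q'B]] := IH B' lam sB' cB'.
pose Q1 : 'M[R]_(1 + d) := block_mx 1%:M 0 0 Q'.
have Q11 : Q1 *m Q1^T = 1%:M.
  rewrite /Q1 tr_block_mx !trmx0 trmx1 mulmx_block !mulmx0 !mul0mx !mulmx1.
  by rewrite Q'1 !addr0 !add0r -scalar_mx_block.
pose D : 'M[R]_(1 + d) := block_mx (l%:M : 'M[R]_1) 0 0 (diag_mx (\row_j nth 0 lam j)).
have QC : Q1 *m C = D *m Q1.
  rewrite CE /Q1 /D mulmx_block [RHS]mulmx_block Q'B.
  by rewrite ?(mulmx0, mul0mx, addr0, add0r, mul1mx, mulmx1).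
exists (Q1 *m H); split.
  by rewrite trmx_mul sH mulmxA -(mulmxA Q1) HH mulmx1; exact: Q11.
have -> : Q1 *m H *m B = Q1 *m C *m H.
  by rewrite CdE !mulmxA -[in RHS](mulmxA _ H H) HH mulmx1.
rewrite mulmxA; congr (_ *m H).
have -> : diag_mx (\row_j nth 0 (l :: lam) j) =
    block_mx (l%:M : 'M[R]_1) 0 0 (diag_mx (\row_j nth 0 lam j)) :> 'M[R]_(1 + d).
  apply/matrixP => i j; rewrite mxE [in LHS]mxE.
  case: (split_ordP i) => i' ->; case: (split_ordP j) => j' ->;
    rewrite ?(block_mxEul, block_mxEur, block_mxEdl, block_mxEdr).
  - by rewrite !ord1 mxE eqxx.
  - by rewrite eq_lrshift mulr0n mxE.
  - by rewrite eq_rlshift mulr0n mxE.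
  - by rewrite eq_rshift !mxE.
exact: QC.
Qed.

End Spectral.

(** * Chebyshev polynomials of the second kind *)

Section Chebyshev.
Variable R : realType.
Implicit Types (x y g : R) (m k : nat).

(* [(x + sqrt (x^2-1))^m = T_m(x) + U_{m-1}(x) sqrt (x^2-1)] *)
Fixpoint cheb x m : R * R :=
  if m is m'.+1 then
    let: (t, u) := cheb x m' in (x * t + (x ^+ 2 - 1) * u, x * u + t)
  else (1, 0).

Definition chebT x m : R := (cheb x m).1.
Definition chebU x m : R := (cheb x m).2.

Lemma chebTS x m : chebT x m.+1 = x * chebT x m + (x ^+ 2 - 1) * chebU x m.
Proof. by rewrite /chebT /chebU /=; case: cheb. Qed.

Lemma chebUS x m : chebU x m.+1 = x * chebU x m + chebT x m.
Proof. by rewrite /chebT /chebU /=; case: cheb. Qed.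

Lemma chebU_rec x m : chebU x m.+2 = 2 * x * chebU x m.+1 - chebU x m.
Proof. by rewrite chebUS chebTS; have := chebUS x m; nra. Qed.

Lemma chebU0 x : chebU x 0 = 0. Proof. by []. Qed.
Lemma chebU1 x : chebU x 1 = 1. Proof. by rewrite chebUS /chebT /chebU /= mulr0 add0r. Qed.

Lemma cheb_pell x m : chebT x m ^+ 2 - (x ^+ 2 - 1) * chebU x m ^+ 2 = 1.
Proof.
elim: m => [|m IH]; first by rewrite /chebT /chebU /= expr1n expr0n mulr0 subr0.
by rewrite chebTS chebUS -[RHS]IH; ring.
Qed.

Lemma cheb_in x m : 0 <= x <= 1 -> `|chebT x m| <= 1 /\ `|chebU x m| <= m%:R.
Proof.
move=> /andP[x0 x1].
have HT k : `|chebT x k| <= 1.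
  have := cheb_pell x k => E.
  have : chebT x k ^+ 2 <= 1.
    rewrite -E lerBrDr gerDl; apply: mulr_le0_ge0; last exact: sqr_ge0.
    by nra.
  by rewrite -real_normK ?num_real // expr_le1.
split=> //; elim: m => [|m IH]; first by rewrite /chebU /= normr0.
rewrite chebUS (le_trans (ler_normD _ _)) // -natr1 lerD // normrM ger0_norm //.
by rewrite (le_trans _ IH) // ler_piMl.
Qed.

Lemma cheb_mono x y m : 1 <= x -> x <= y ->
  0 <= chebT x m <= chebT y m /\ 0 <= chebU x m <= chebU y m.
Proof.
move=> x1 xy; elim: m => [|m [/andP[t0 t1] /andP[u0 u1]]].
  by rewrite /chebT /chebU /= ler01 !lexx.
rewrite !chebTS !chebUS.
have q0 : 0 <= x ^+ 2 - 1 by rewrite subr_ge0 expr_ge1 //; lra.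
have q1 : x ^+ 2 - 1 <= y ^+ 2 - 1 by rewrite lerB // lerXn2r ?nnegrE; lra.
have x0 : 0 <= x by lra.
by split; apply/andP; split; rewrite ?addr_ge0 ?mulr_ge0 // lerD // ler_pM.
Qed.

Lemma cheb_at1 m : chebT 1 m = 1 /\ chebU 1 m = m%:R.
Proof.
elim: m => [|m [t u]]; first by [].
by rewrite chebTS chebUS t u expr1n subrr mul0r addr0 !mul1r natr1.
Qed.

(** Up to 1 the modulus is at most [m], the value at 1; beyond 1 there is monotonicity. *)
Lemma chebU_max x y m : 0 <= x <= y -> 1 <= y -> `|chebU x m| <= chebU y m.
Proof.
move=> /andP[x0 xy] y1; have [x1|x1] := leP x 1.
  have [_ /le_trans -> //] := cheb_in m (introT andP (conj x0 x1)).
  by have [_ /andP[_]] := cheb_mono m (lexx 1) y1; rewrite (cheb_at1 m).2.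
have [_ /andP[h0 h1]] := cheb_mono m (ltW x1) xy.
by rewrite ger0_norm.
Qed.

(** The growth rate exp (arcosh x) of the Chebyshev polynomials at [x >= 1]. *)
Definition chtheta x : R := x + Num.sqrt (x ^+ 2 - 1).

Lemma chtheta_ge1 x : 1 <= x -> 1 <= chtheta x.
Proof. by move=> x1; rewrite /chtheta; have := sqrtr_ge0 (x ^+ 2 - 1); lra. Qed.

Lemma chtheta_pow x m : 1 <= x ->
  chtheta x ^+ m = chebT x m + chebU x m * Num.sqrt (x ^+ 2 - 1).
Proof.
move=> x1; elim: m => [|m IH]; first by rewrite /chebT /chebU /= mul0r addr0.
have E : Num.sqrt (x ^+ 2 - 1) ^+ 2 = x ^+ 2 - 1.
  by rewrite sqr_sqrtr // subr_ge0 expr_ge1 //; lra.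
by rewrite exprS IH chebTS chebUS /chtheta; set w := Num.sqrt _ in E *; rewrite -E; ring.
Qed.

Lemma chebU_theta x m : 1 <= x ->
  chtheta x ^+ m <= chebU x m.+1 <= m.+1%:R * chtheta x ^+ m.
Proof.
move=> x1; have q0 : 0 <= x ^+ 2 - 1 by rewrite subr_ge0 expr_ge1 //; lra.
have h k := cheb_mono k x1 (lexx x).
have tx : x <= chtheta x by rewrite /chtheta lerDl sqrtr_ge0.
have th0 : 0 <= chtheta x by lra.
have tT k : chebT x k <= chtheta x ^+ k.
  rewrite chtheta_pow // lerDl mulr_ge0 ?sqrtr_ge0 //.
  by have [_ /andP[]] := h k.
apply/andP; split.
  rewrite chtheta_pow // chebUS addrC lerD2r mulrC.
  rewrite ler_wpM2r //; first by have [_ /andP[]] := h m.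
  by rewrite -[leRHS]ger0_norm ?(le_trans ler01) // -sqrtr_sqr ler_wsqrtr //; lra.
elim: m => [|m IH]; first by rewrite chebU1 mul1r.
rewrite chebUS -[m.+2%:R]natr1 mulrDl mul1r lerD //.
rewrite exprS mulrCA ler_pM //; first by lra.
by have [_ /andP[]] := h m.+1.
Qed.

Lemma chebU_gt0 x m : 1 <= x -> 0 < chebU x m.+1.
Proof.
move=> x1; have /andP[h _] := chebU_theta m x1; apply: lt_le_trans h.
by rewrite exprn_gt0 // (lt_le_trans ltr01) // chtheta_ge1.
Qed.

Lemma chebU_incr x m : 1 <= x -> chebU x m <= chebU x m.+1.
Proof.
move=> x1; have [/andP[t0 _] /andP[u0 _]] := cheb_mono m x1 (lexx x).
by rewrite chebUS; nra.
Qed.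

(** An error made in step [i] is later amplified by [chebU x (k - i)], while the iterate of that
    step has size about [chebU x i.+1]. This bound says that an error relative to the iterate of its
    time stays small relative to the final one. It follows from both sides of [chebU_theta], as
    [(k - i - 1) + i = k - 1]. *)
Lemma chebU_prod x k i : 1 <= x -> (i < k)%N ->
  chebU x (k - i) * chebU x i.+1 <= k%:R ^+ 2 * chebU x k.
Proof.
move=> x1 ik.
have [m Em] : exists m, (k - i = m.+1)%N by exists (k - i).-1; lia.
have /andP[_ h1] := chebU_theta m x1; have /andP[_ h2] := chebU_theta i x1.
have [j Ej] : exists j, k = j.+1 by exists k.-1; lia.
have /andP[h3 _] := chebU_theta j x1.
have th1 := chtheta_ge1 x1; have th0 : 0 <= chtheta x by lra.
rewrite Em (le_trans (ler_pM _ _ h1 h2)) //.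
- by rewrite ltW // chebU_gt0.
- by rewrite ltW // chebU_gt0.
have -> : m.+1%:R * chtheta x ^+ m * (i.+1%:R * chtheta x ^+ i) =
          (m.+1%:R * i.+1%:R) * chtheta x ^+ j.
  by have -> : j = (m + i)%N by [lia]; rewrite exprD; ring.
rewrite Ej ler_pM ?mulr_ge0 ?exprn_ge0 // expr2 ler_pM // ler_nat; lia.
Qed.

(* The separation of the two arguments is of the same order [g] as the distance
   of the larger one to 1, so the growth rates differ by a factor of order
   [sqrt g]. *)
Lemma chebU_ratio x y g m : 0 < g <= 1 -> 1 + g / 2 <= y <= 1 + 2 * g ->
  0 <= x <= y - g / 9 ->
  `|chebU x m.+1| <= m.+1%:R * expR (- (Num.sqrt g / 156) * m%:R) * chebU y m.+1.
Proof.
move=> /andP[g0 g1] /andP[y1 y2] /andP[x0 xy].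
(* The growth rate is available from 1 on; arguments below 1 are dominated by 1. *)
pose z := Num.max x 1.
have z1 : 1 <= z by rewrite le_max lexx orbT.
have xz : x <= z by rewrite le_max lexx.
have zy : z <= y - g / 9 by rewrite ge_max xy /=; lra.
have y1' : 1 <= y by lra.
apply: le_trans (chebU_max m.+1 _ z1) _; first by rewrite x0 xz.
have /andP[_ h1] := chebU_theta m z1; have /andP[h2 _] := chebU_theta m y1'.
apply: le_trans h1 _; rewrite -mulrA ler_wpM2l //.
pose q := Num.sqrt g.
have q0 : 0 < q by rewrite sqrtr_gt0.
have qE : q ^+ 2 = g by rewrite sqr_sqrtr // ltW.
have q1 : q <= 1 by rewrite -sqrtr1 ler_wsqrtr.
pose a := Num.sqrt (y ^+ 2 - 1); pose b := Num.sqrt (z ^+ 2 - 1).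
have aE : a ^+ 2 = y ^+ 2 - 1 by rewrite sqr_sqrtr //; nra.
have bE : b ^+ 2 = z ^+ 2 - 1 by rewrite sqr_sqrtr //; nra.
have a0 : 0 <= a by exact: sqrtr_ge0.
have b0 : 0 <= b by exact: sqrtr_ge0.
(* [a^2 = (y - 1) (y + 1) <= 8 g], and 2.84 exceeds the square root of 8. *)
have a2 : a <= 284 / 100 * q.
  rewrite -[leLHS]ger0_norm // -[leRHS]ger0_norm; last by lra.
  rewrite -!sqrtr_sqr ler_wsqrtr // aE exprMn qE; nra.
(* [a^2 - b^2 >= 2 g / 9] and [a + b <= 5.68 q]; 26 exceeds 5.68 times 9 / 2. *)
have ab : q / 26 <= a - b.
  have ba : b <= a by rewrite ler_wsqrtr // lerB //; nra.
  have H : 2 * q ^+ 2 / 9 <= (a - b) * (a + b).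
    have -> : (a - b) * (a + b) = y ^+ 2 - z ^+ 2 by rewrite -subr_sqr aE bE; ring.
    by rewrite qE; nra.
  have H2 : (a - b) * (a + b) <= (a - b) * (568 / 100 * q).
    by rewrite ler_wpM2l //; lra.
  rewrite -(@ler_pM2r _ (568 / 100 * q)); last by lra.
  by apply: le_trans (le_trans H H2); nra.
(* [chtheta y <= 3 + 2.84 <= 6], and 156 = 6 * 26. *)
have th : chtheta z <= chtheta y * (1 - q / 156).
  have : chtheta y <= 6 by rewrite /chtheta -/a; lra.
  have : chtheta z <= chtheta y - q / 26 by rewrite /chtheta -/a -/b; lra.
  by nra.
have thz := chtheta_ge1 z1; have thy := chtheta_ge1 y1'.
apply: (@le_trans _ _ ((chtheta y * (1 - q / 156)) ^+ m)).
  by rewrite lerXn2r // nnegrE; lra.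
rewrite exprMn mulrC ler_pM //.
- by rewrite exprn_ge0 //; lra.
- by rewrite exprn_ge0 //; lra.
rewrite expRM_natr lerXn2r ?nnegrE ?expR_ge0 //; first by lra.
by have := expR_ge1Dx (- (q / 156)); lra.
Qed.

End Chebyshev.

(** * Inexact Chebyshev iteration *)

Section ChebVector.
Variables (R : realType) (d : nat).
Implicit Types (f g : 'I_d -> R) (y z v : 'cV[R]_d).

Definition dmul f z : 'cV[R]_d := \col_j (f j * z j 0).

Lemma dmulD f y z : dmul f (y + z) = dmul f y + dmul f z.
Proof. by apply/colP => j; rewrite !mxE mulrDr. Qed.

Lemma dot_dmul f y z : dot (dmul f y) z = \sum_j f j * (y j 0 * z j 0).
Proof. by apply: eq_bigr => j _; rewrite mxE mulrA. Qed.

Lemma norm2_dmul f z m : 0 <= m -> (forall j, `|f j| <= m) ->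
  norm2 (dmul f z) <= m * norm2 z.
Proof.
move=> m0 H; apply: norm2_le; first by rewrite mulr_ge0 ?norm2_ge0.
rewrite exprMn norm2_sq /dot mulr_sumr; apply: ler_sum => j _.
rewrite !mxE -expr2 exprMn -expr2 ler_wpM2r ?sqr_ge0 //.
by rewrite -real_normK ?num_real // lerXn2r // nnegrE.
Qed.

Variables (xs : 'I_d -> R) (x1 w : R) (v : 'cV[R]_d).
Hypothesis x1_ge1 : 1 <= x1.
Hypothesis xs_le : forall j, 0 <= xs j <= x1.
Hypothesis v_unit : norm2 v <= 1.
Hypothesis w0 : 0 <= w.

Definition chebv k z := dmul (fun j => chebU (xs j) k) z.

Lemma norm2_chebv k z : norm2 (chebv k z) <= chebU x1 k * norm2 z.
Proof.
apply: norm2_dmul => [|j]; last exact: chebU_max.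
by have [_ /andP[]] := cheb_mono k x1_ge1 (lexx x1).
Qed.

(** State after [k] inexact steps: [y] is the current and [yo] the previous vector, and [e i] is the
    error of step [i]. With the starting values [v] and 0, the recurrence produces polynomials of
    the second kind, and these also propagate every later error; so a single family has to be
    estimated. The 2 in the bound of [e i] is the a priori bound of the iterate in
    [cheb_inv_bound]. *)
Definition cheb_inv k y yo : Prop := exists e : nat -> 'cV[R]_d,
  [/\ forall i, (i < k)%N -> norm2 (e i) <= w * (2 * chebU x1 i.+1),
      y = chebv k.+1 v + \sum_(i < k) chebv (k - i) (e i) &
      yo = chebv k v + \sum_(i < k) chebv (k.-1 - i) (e i)].

Lemma cheb_inv0 : cheb_inv 0 v 0.
Proof.
exists (fun=> 0); split=> //; rewrite big_ord0 addr0.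
  by apply/colP => j; rewrite mxE chebU1 mul1r.
by apply/colP => j; rewrite !mxE chebU0 mul0r.
Qed.

(** By [chebU_prod] each of the [k] errors contributes at most [2 w k^2] in units of [chebU x1 k].
    As long as the sum stays below one unit the iterate has at most twice its ideal size, which is
    what the next step needs. *)
Lemma cheb_inv_bound k y yo : 2 * w * k%:R ^+ 3 <= 1 -> cheb_inv k y yo ->
  norm2 (y - chebv k.+1 v) <= 2 * w * k%:R ^+ 3 * chebU x1 k.+1 /\
  norm2 y <= 2 * chebU x1 k.+1.
Proof.
move=> wk [e [He -> _]].
have U0 m : 0 <= chebU x1 m by have [_ /andP[]] := cheb_mono m x1_ge1 (lexx x1).
have HE : norm2 (\sum_(i < k) chebv (k - i) (e i)) <=
    2 * w * k%:R ^+ 3 * chebU x1 k.+1.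
  apply: le_trans (norm2_sum _) _.
  apply: (@le_trans _ _ (\sum_(i < k) (2 * w * k%:R ^+ 2 * chebU x1 k.+1))); last first.
    rewrite sumr_const card_ord -[_ *+ k]mulr_natr le_eqVlt; apply/orP; left; apply/eqP.
    ring.
  apply: ler_sum => i _; apply: le_trans (norm2_chebv _ _) _.
  apply: (@le_trans _ _ (chebU x1 (k - i) * (w * (2 * chebU x1 i.+1)))).
    by rewrite ler_wpM2l // He.
  have -> : chebU x1 (k - i) * (w * (2 * chebU x1 i.+1)) =
     2 * w * (chebU x1 (k - i) * chebU x1 i.+1) by ring.
  rewrite -[leRHS]mulrA ler_wpM2l ?mulr_ge0 //.
  apply: le_trans (chebU_prod x1_ge1 (ltn_ord i)) _.
  by rewrite ler_wpM2l ?exprn_ge0 // chebU_incr.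
split; first by rewrite addrAC subrr add0r.
apply: le_trans (norm2D _ _) _.
have := norm2_chebv k.+1 v; have := U0 k.+1.
have := norm2_ge0 v; move: HE; move: v_unit.
set a := norm2 (\sum_(i < k) _); set b := norm2 (chebv _ _).
set U := chebU _ _; set c := 2 * w * _ ^+ 3 in wk *.
by move=> *; nra.
Qed.

Lemma cheb_inv_step k y yo e0 : 2 * w * k%:R ^+ 3 <= 1 -> cheb_inv k y yo ->
  norm2 e0 <= w * norm2 y ->
  cheb_inv k.+1 (2 *: dmul xs y - yo + e0) y.
Proof.
move=> wk iv He0; have [_ yb] := cheb_inv_bound wk iv.
case: iv => e [He Ey Eyo].
exists (fun i => if (i < k)%N then e i else e0); split.
- move=> i ik; case: ifP => [|/negbT]; first exact: He.
  rewrite -leqNgt => ki; have -> : i = k by lia.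
  by apply: le_trans He0 _; rewrite ler_wpM2l.
- rewrite big_ord_recr /= ltnn subSnn.
  under eq_bigr => i _ do rewrite ltn_ord.
  rewrite addrA; congr (_ + _); last by apply/colP => j; rewrite mxE chebU1 mul1r.
  apply/colP => j; rewrite Ey Eyo !mxE !summxE.
  under eq_bigr => i _ do rewrite mxE.
  under [in X in _ - X]eq_bigr => i _ do rewrite mxE.
  under [in RHS]eq_bigr => i _ do rewrite mxE.
  have -> : \sum_(i < k) chebU (xs j) (k.+1 - i) * e i j 0 =
     2 * xs j * (\sum_(i < k) chebU (xs j) (k - i) * e i j 0) -
     \sum_(i < k) chebU (xs j) (k.-1 - i) * e i j 0.
    rewrite mulr_sumr -sumrB; apply: eq_bigr => i _.
    have [m Em] : exists m, (k - i = m.+1)%N by exists (k - i).-1; have := ltn_ord i; lia.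
    have -> : (k.+1 - i = m.+2)%N by have := ltn_ord i; lia.
    have -> : (k.-1 - i = m)%N by have := ltn_ord i; lia.
    by rewrite Em chebU_rec; ring.
  by rewrite chebU_rec; ring.
- rewrite Ey; congr (_ + _).
  rewrite big_ord_recr /= ltnn subnn.
  have -> : chebv 0 e0 = 0 by apply/colP => j; rewrite !mxE chebU0 mul0r.
  by rewrite addr0; apply: eq_bigr => i _; rewrite ltn_ord.
Qed.

End ChebVector.

(** * Effect of an approximate spectral filter on a unit vector *)

Section Block.
Variables (R : realType) (d : nat) (lam : 'I_d -> R) (j0 : 'I_d) (F G rho r : R).
Variables (c : 'cV[R]_d) (u : 'I_d -> R) (U eps gam : R) (z : 'cV[R]_d).
Local Notation L1 := (lam j0).

Definition rayl (y : 'cV[R]_d) : R := dot (dmul lam y) y.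
Definition resid (t : R) (y : 'cV[R]_d) : R := norm2 (dmul (fun j => lam j - t) y).

Hypothesis lam_ge0 : forall j, 0 <= lam j.
Hypothesis lam_le : forall j, lam j <= L1.
Hypothesis L1F : L1 <= F.
Hypothesis c1 : dot c c = 1.
Hypothesis rhoE : rho = rayl c.
Hypothesis rE : r = resid rho c.
Hypothesis U0 : 0 < U.
Hypothesis u_le : forall j, `|u j| <= U.
Hypothesis uj0 : u j0 = U.
Hypothesis zE : norm2 (z - dmul u c) <= eps * U.
Hypothesis gam0 : 0 < gam.
Hypothesis cg : gam <= `|c j0 0|.
Hypothesis eg : eps <= gam / 2.

Let c' := (norm2 z)^-1 *: z.

Lemma rayl_bounds (y : 'cV[R]_d) : dot y y = 1 -> 0 <= rayl y <= L1.
Proof.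
move=> y1; rewrite /rayl dot_dmul; apply/andP; split.
  by apply: sumr_ge0 => j _; rewrite mulr_ge0 // -expr2 sqr_ge0.
rewrite -[leRHS]mulr1 -y1 /dot mulr_sumr; apply: ler_sum => j _.
by rewrite ler_wpM2r // -expr2 sqr_ge0.
Qed.

(** For a unit vector the squared residual is a quadratic in [t] with its minimum at the Rayleigh
    quotient. *)
Lemma resid_opt (t : R) (y : 'cV[R]_d) : dot y y = 1 -> resid (rayl y) y <= resid t y.
Proof.
move=> y1; rewrite /resid !norm2E ler_wsqrtr //.
have E s : dot (dmul (fun j => lam j - s) y) (dmul (fun j => lam j - s) y) =
   dot (dmul lam y) (dmul lam y) - 2 * s * rayl y + s ^+ 2.
  have -> : dmul (fun j => lam j - s) y = dmul lam y - s *: y.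
    by apply/colP => j; rewrite !mxE mulrBl.
  by rewrite !dotE y1 (dotC y) -/(rayl y); ring.
by rewrite !E; have := sqr_ge0 (t - rayl y); rewrite sqrrB; lra.
Qed.

Lemma eps_ge0 : 0 <= eps.
Proof. by have := le_trans (norm2_ge0 _) zE; rewrite pmulr_lge0. Qed.

Lemma block_z0 : U * (`|c j0 0| - eps) <= `|z j0 0|.
Proof.
have := le_trans (norm2_coord (z - dmul u c) j0) zE; rewrite !mxE uj0 => H.
have : `|U * c j0 0| <= `|z j0 0| + `|z j0 0 - U * c j0 0|.
  by rewrite -{1}[U * _](subKr (z j0 0)); exact: ler_normB.
by rewrite normrM (gtr0_norm U0); lra.
Qed.

Lemma norm2_c : norm2 c = 1. Proof. by rewrite norm2E c1 sqrtr1. Qed.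

Lemma block_norm_le : norm2 z <= U * (1 + eps).
Proof.
rewrite -[z](subrK (dmul u c)); apply: le_trans (norm2D _ _) _.
have := norm2_dmul c (ltW U0) u_le; rewrite norm2_c.
by move: zE; lra.
Qed.

Lemma block_norm_ge : U * gam / 2 <= norm2 z.
Proof.
apply: le_trans (norm2_coord z j0); apply: le_trans block_z0.
by rewrite -mulrA ler_wpM2l ?(ltW U0) //; move: cg eg; lra.
Qed.

Lemma block_norm_gt0 : 0 < norm2 z.
Proof. by apply: lt_le_trans block_norm_ge; rewrite divr_gt0 // mulr_gt0. Qed.

Lemma block_unit : dot c' c' = 1.
Proof.
rewrite /c' !dotE -norm2_sq; have := block_norm_gt0 => n0.
by field; rewrite gt_eqF.
Qed.

(** The filter is largest at the top index, so without errors normalization could not decrease the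
    overlap; only [eps] is lost. *)
Lemma block_overlap : (`|c j0 0| - eps) / (1 + eps) <= `|c' j0 0|.
Proof.
have n0 := block_norm_gt0; have e0 := eps_ge0.
rewrite /c' mxE normrM gtr0_norm ?invr_gt0 // [leRHS]mulrC ler_pdivlMr // mulrAC.
rewrite ler_pdivrMr; last by lra.
apply: (@le_trans _ _ ((`|c j0 0| - eps) * (U * (1 + eps)))).
  by rewrite ler_wpM2l ?block_norm_le //; have := cg; have := eg; have := gam0; lra.
by have := block_z0; nra.
Qed.

Lemma block_resid_num : resid rho z <= U * (r + eps * F).
Proof.
have L0 := lam_ge0 j0.
have [r0 rL] := andP (rayl_bounds c1); rewrite -rhoE in r0 rL.
rewrite /resid -{1}[z](subrK (dmul u c)) dmulD.
apply: le_trans (norm2D _ _) _; rewrite addrC mulrDr lerD //.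
  have -> : dmul (fun j => lam j - rho) (dmul u c) = dmul u (dmul (fun j => lam j - rho) c).
    by apply/colP => j; rewrite !mxE mulrCA.
  by apply: le_trans (norm2_dmul _ (ltW U0) u_le) _; rewrite rE.
have F0 : 0 <= F by move: L1F; lra.
apply: le_trans (@norm2_dmul _ _ _ _ F F0 _) _.
  move=> j; rewrite ler_norml; have := lam_ge0 j; have := lam_le j; have := L1F; lra.
by have := zE; nra.
Qed.

(** Compared at the old [rho], the filter multiplies the residual by at most [U], whereas the norm
    of [z] is at least [U gam / 2], thanks to the top coordinate. *)
Lemma block_resid : resid (rayl c') c' <= 2 * (r + eps * F) / gam.
Proof.
apply: le_trans (resid_opt rho block_unit) _.
have n0 := block_norm_gt0.
have -> : resid rho c' = resid rho z / norm2 z.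
  rewrite /resid /c'.
  have -> : dmul (fun j => lam j - rho) ((norm2 z)^-1 *: z) =
     (norm2 z)^-1 *: dmul (fun j => lam j - rho) z.
    by apply/colP => j; rewrite !mxE mulrCA.
  by rewrite norm2Z gtr0_norm ?invr_gt0 // mulrC.
rewrite ler_pdivrMr //; apply: le_trans block_resid_num _.
have X0 : 0 <= r + eps * F.
  rewrite addr_ge0 ?rE ?norm2_ge0 // mulr_ge0 ?eps_ge0 //.
  by apply: le_trans L1F; exact: le_trans (lam_ge0 j0) _.
rewrite mulrAC ler_pdivlMr //.
by have := block_norm_ge; nra.
Qed.

(** On [S] the exact part of [z] is at most [q U] times [c], and the norm of [z] is at least
    [U gam / 2]. *)
Lemma block_low (S : pred 'I_d) q : 0 <= q -> (forall j, S j -> `|u j| <= q * U) ->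
  \sum_(j | S j) c' j 0 ^+ 2 <=
  8 * (q ^+ 2 * (\sum_(j | S j) c j 0 ^+ 2) + eps ^+ 2) / gam ^+ 2.
Proof.
move=> q0 Hq; have n0 := block_norm_gt0.
have -> : \sum_(j | S j) c' j 0 ^+ 2 = (\sum_(j | S j) z j 0 ^+ 2) / norm2 z ^+ 2.
  by rewrite mulr_suml; apply: eq_bigr => j _; rewrite /c' mxE exprMn exprVn mulrC.
have g2 : 0 < gam ^+ 2 by rewrite exprn_gt0.
have n2 : 0 < norm2 z ^+ 2 by rewrite exprn_gt0.
rewrite ler_pdivrMr // mulrAC ler_pdivlMr //.
have Hz : \sum_(j | S j) z j 0 ^+ 2 <=
   2 * U ^+ 2 * (q ^+ 2 * (\sum_(j | S j) c j 0 ^+ 2) + eps ^+ 2).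
  pose E := z - dmul u c.
  have HE : \sum_(j | S j) E j 0 ^+ 2 <= (eps * U) ^+ 2.
    apply: (@le_trans _ _ (dot E E)).
      rewrite /dot big_mkcond /=; apply: ler_sum => j _; rewrite -expr2.
      by case: ifP => // _; exact: sqr_ge0.
    by rewrite -norm2_sq lerXn2r ?nnegrE ?norm2_ge0 // mulr_ge0 ?eps_ge0 // ltW.
  have Hu : \sum_(j | S j) (u j * c j 0) ^+ 2 <= (q * U) ^+ 2 * \sum_(j | S j) c j 0 ^+ 2.
    rewrite mulr_sumr; apply: ler_sum => j Sj; rewrite exprMn ler_wpM2r ?sqr_ge0 //.
    by rewrite -real_normK ?num_real // lerXn2r ?nnegrE ?Hq // mulr_ge0 // ltW.
  apply: (@le_trans _ _ (\sum_(j | S j) (2 * (u j * c j 0) ^+ 2 + 2 * E j 0 ^+ 2))).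
    apply: ler_sum => j _.
    have -> : z j 0 = u j * c j 0 + E j 0 by rewrite !mxE; ring.
    by have := sqr_ge0 (u j * c j 0 - E j 0); rewrite sqrrB sqrrD; lra.
  rewrite big_split /= -!mulr_sumr.
  move: HE Hu; rewrite !exprMn; lra.
have S0 : 0 <= \sum_(j | S j) c j 0 ^+ 2 by apply: sumr_ge0 => j _; exact: sqr_ge0.
have A0 : 0 <= q ^+ 2 * (\sum_(j | S j) c j 0 ^+ 2) + eps ^+ 2.
  by rewrite addr_ge0 ?sqr_ge0 // mulr_ge0 ?sqr_ge0.
have Hn : U ^+ 2 * gam ^+ 2 / 4 <= norm2 z ^+ 2.
  have -> : U ^+ 2 * gam ^+ 2 / 4 = (U * gam / 2) ^+ 2 by field.
  rewrite lerXn2r ?nnegrE ?norm2_ge0 ?block_norm_ge //.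
  by rewrite divr_ge0 // mulr_ge0 // ltW.
apply: le_trans (ler_wpM2r (ltW g2) Hz) _.
move: A0 Hn; set A := q ^+ 2 * _ + _; set N := norm2 z ^+ 2; set a := U ^+ 2; set b := gam ^+ 2.
by move=> A0 Hn; nra.
Qed.

(** Coordinates with an eigenvalue within [G / 4] of the top lose at most [G / 4] in the Rayleigh
    quotient; the others lose at most [F] times their mass, which [block_low] makes small. *)
Lemma block_acc q : 0 <= q -> 0 <= G ->
  (forall j, lam j < L1 - G / 4 -> `|u j| <= q * U) ->
  L1 - rayl c' <= G / 4 + F * (8 * (q ^+ 2 + eps ^+ 2) / gam ^+ 2).
Proof.
move=> q0 G0 Hq; have := block_low q0 Hq; set Sc := \sum_(j | _) c j 0 ^+ 2.
have Sc1 : Sc <= 1.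
  rewrite -c1 /dot /Sc big_mkcond /=; apply: ler_sum => j _; rewrite -expr2.
  by case: ifP => // _; exact: sqr_ge0.
move=> HS.
have F0 : 0 <= F by apply: le_trans L1F; exact: le_trans (lam_ge0 j0) _.
apply: (@le_trans _ _ (G / 4 + F * \sum_(j | lam j < L1 - G / 4) c' j 0 ^+ 2)).
  have -> : L1 - rayl c' = \sum_j (L1 - lam j) * c' j 0 ^+ 2.
    rewrite -{1}[L1]mulr1 -block_unit /rayl dot_dmul /dot mulr_sumr -sumrB.
    by apply: eq_bigr => j _; rewrite expr2; ring.
  have EG : G / 4 = \sum_j G / 4 * c' j 0 ^+ 2.
    rewrite -mulr_sumr (_ : \sum_j c' j 0 ^+ 2 = 1) ?mulr1 // -[RHS]block_unit.
    by apply: eq_bigr => j _; rewrite expr2.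
  have -> : G / 4 + F * (\sum_(j | lam j < L1 - G / 4) c' j 0 ^+ 2) =
      \sum_j (G / 4 * c' j 0 ^+ 2 + if lam j < L1 - G / 4 then F * c' j 0 ^+ 2 else 0).
    by rewrite big_split /= -EG -big_mkcond mulr_sumr.
  apply: ler_sum => j _; have := sqr_ge0 (c' j 0).
  set t := c' j 0 ^+ 2 => t0; have := lam_ge0 j; have := L1F; case: ltP => ? ? ?; nra.
rewrite lerD2l ler_wpM2l //; apply: le_trans HS _.
rewrite ler_wpM2r ?invr_ge0 ?sqr_ge0 // ler_wpM2l // lerD2r.
by rewrite ler_piMr ?sqr_ge0.
Qed.

(** The case of an isolated top eigenvalue. All other eigenvalues are at distance at least [3 G]
    from [rho], so the mass of [c] outside the top coordinate is at most [(r / (3 G))^2]. This makes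
    the new residual proportional to the old one, up to [eps]. *)
Lemma block_gap q : 0 <= q -> 0 < G -> L1 <= rho + G ->
  (forall j, j != j0 -> `|u j| <= q * U /\ lam j <= L1 - 4 * G) ->
  resid (rayl c') c' <= 3 * F * (q * (r / (3 * G)) + eps) / gam.
Proof.
move=> q0 G0 LG H.
have Hq j : j != j0 -> `|u j| <= q * U by move/H => [].
have := block_low q0 Hq; set Sc := \sum_(j | _) c j 0 ^+ 2 => HS.
have F0 : 0 <= F by apply: le_trans L1F; exact: le_trans (lam_ge0 j0) _.
have Sc0 : 0 <= Sc by apply: sumr_ge0 => j _; exact: sqr_ge0.
have r0 : 0 <= r by rewrite rE norm2_ge0.
have HSc : Sc <= (r / (3 * G)) ^+ 2.
  rewrite expr_div_n ler_pdivlMr ?exprn_gt0 ?mulr_gt0 //.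
  rewrite rE norm2_sq /Sc mulr_suml /dot [leRHS](bigID (fun j => j != j0)) /=.
  rewrite -[leLHS]addr0 lerD //; last by apply: sumr_ge0 => j _; rewrite -expr2 sqr_ge0.
  apply: ler_sum => j /H[_ Hj]; rewrite !mxE.
  have -> : (lam j - rho) * c j 0 * ((lam j - rho) * c j 0) =
     c j 0 ^+ 2 * (lam j - rho) ^+ 2 by ring.
  rewrite ler_wpM2l ?sqr_ge0 // -[leRHS]sqrrN lerXn2r ?nnegrE //; lra.
(* With [L1] in place of the Rayleigh quotient, the top coordinate drops out of the residual. *)
apply: le_trans (resid_opt L1 block_unit) _.
have e0 := eps_ge0.
have a0 : 0 <= q * (r / (3 * G)) + eps.
  by rewrite addr_ge0 // mulr_ge0 // divr_ge0 //; lra.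
apply: norm2_le; first by rewrite divr_ge0 ?mulr_ge0 // ltW.
apply: (@le_trans _ _ (F ^+ 2 * \sum_(j | j != j0) c' j 0 ^+ 2)).
  rewrite /dot (bigD1 j0) //= !mxE subrr !mul0r add0r mulr_sumr.
  apply: ler_sum => j _; rewrite !mxE -expr2 exprMn ler_wpM2r ?sqr_ge0 //.
  rewrite -sqrrN lerXn2r ?nnegrE //; have := lam_le j; have := lam_ge0 j; have := L1F; lra.
apply: le_trans (ler_wpM2l (sqr_ge0 F) HS) _.
have g2 : 0 < gam ^+ 2 by rewrite exprn_gt0.
rewrite mulrA ler_pdivrMr // expr_div_n mulfVK ?gt_eqF // !exprMn.
have -> : 3 ^+ 2 * F ^+ 2 * (q * (r / (3 * G)) + eps) ^+ 2 =
   F ^+ 2 * (9 * (q * (r / (3 * G)) + eps) ^+ 2) by ring.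
rewrite ler_wpM2l ?sqr_ge0 //.
have : q ^+ 2 * Sc <= (q * (r / (3 * G))) ^+ 2 by rewrite exprMn ler_wpM2l ?sqr_ge0.
have b0 : 0 <= q * (r / (3 * G)) by rewrite mulr_ge0 // divr_ge0 //; lra.
rewrite sqrrD; set b := q * (r / _) in b0 *; have := mulr_ge0 b0 e0.
set b2 := b ^+ 2; set e2 := eps ^+ 2.
have : 0 <= b2 by exact: sqr_ge0.
have : 0 <= e2 by exact: sqr_ge0.
move=> ? ? ? ?; lra.
Qed.

(* The residual test certifies the Rayleigh quotient. *)
Lemma rayl_certificate : (L1 - rho) * `|c j0 0| <= r.
Proof.
rewrite rE; apply: le_trans (norm2_coord _ j0); rewrite mxE normrM.
by rewrite ler_wpM2r // ler_norm.
Qed.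

End Block.

(** * Stochastic gradient step *)

Section Rows.
Variables (R : realType) (n d : nat) (A : 'M[R]_(n, d)).
Implicit Types (x y w : 'cV[R]_d).

Local Notation a i := (mxrow_vec A i).
Definition gram : 'M[R]_d := A^T *m A.

Lemma mulmx_row i x : (A *m x) i 0 = dot (a i) x.
Proof. by rewrite mxE; apply: eq_bigr => j _; rewrite !mxE. Qed.

Lemma gram_sym : gram^T = gram.
Proof. by rewrite /gram trmx_mul trmxK. Qed.

Lemma dot_gram x y : dot x (gram *m y) = \sum_i dot (a i) x * dot (a i) y.
Proof.
rewrite -dot_mx /gram mulmxA mulmxA -trmx_mul -mulmxA dot_mx.
by apply: eq_bigr => i _; rewrite !mulmx_row.
Qed.

Definition frob2 : R := \sum_i dot (a i) (a i).

Lemma frob2_ge0 : 0 <= frob2.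
Proof. by apply: sumr_ge0 => i _; exact: dot_ge0. Qed.

Lemma norm1_ge0 m (x : 'cV[R]_m) : 0 <= norm1 x.
Proof. by apply: sumr_ge0 => j _. Qed.

Lemma norm2_le_norm1 m (x : 'cV[R]_m) : norm2 x <= norm1 x.
Proof.
apply: norm2_le; first exact: norm1_ge0.
rewrite expr2 {2}/norm1 mulr_sumr; apply: ler_sum => j _.
apply: le_trans (ler_norm _) _; rewrite normrM ler_wpM2r //.
by rewrite /norm1 (bigD1 j) //= lerDl; apply: sumr_ge0.
Qed.

Hypothesis arow : forall i, 0 < dot (a i) (a i).

Lemma norm2_row_gt0 i : 0 < norm2 (a i).
Proof. by rewrite norm2E sqrtr_gt0. Qed.

(** The square root of the numerical sparsity of row [i]. *)
Definition rsp i : R := norm1 (a i) / norm2 (a i).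

Lemma rsp_ge1 i : 1 <= rsp i.
Proof. by rewrite /rsp ler_pdivlMr ?norm2_row_gt0 // mul1r norm2_le_norm1. Qed.

Lemma rsp_norm i : rsp i * norm2 (a i) = norm1 (a i).
Proof. by rewrite /rsp mulfVK // gt_eqF // norm2_row_gt0. Qed.

Variables (lam1 Lam : R).
Hypothesis Lam0 : 0 < Lam.
Hypothesis lamLam : lam1 <= Lam.
Hypothesis Hlam : forall x, dot x (gram *m x) <= lam1 * dot x x.

Local Notation F := frob2.
(** The square root of the stable rank, with the upper bound [Lam] in place of the top
    eigenvalue. *)
Definition sF : R := Num.sqrt (F / Lam).

Lemma col_sq_le j : \sum_i A i j ^+ 2 <= Lam.
Proof.
apply: le_trans lamLam.
have := Hlam (delta_mx j 0); rewrite dot_gram.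
have -> : dot (delta_mx j 0) (delta_mx j 0) = 1 :> R.
  rewrite /dot (bigD1 j) //= !mxE !eqxx mulr1 big1 ?addr0 // => k kj.
  by rewrite !mxE (negbTE kj) mulr0.
rewrite mulr1; apply: le_trans; apply: ler_sum => i _.
have -> : dot (a i) (delta_mx j 0) = A i j.
  rewrite /dot (bigD1 j) //= !mxE !eqxx mulr1 big1 ?addr0 // => k kj.
  by rewrite !mxE (negbTE kj) mulr0.
by rewrite expr2.
Qed.

(** Cauchy-Schwarz between the row norms, with sum of squares [F], and column [j], with sum of
    squares at most [Lam]. *)
Lemma mixed_col_le j : 0 < F ->
  \sum_i norm2 (a i) * `|A i j| <= Num.sqrt (F * Lam).
Proof.
move=> F0.
pose p : 'cV[R]_n := \col_i norm2 (a i); pose q : 'cV[R]_n := \col_i `|A i j|.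
have -> : \sum_i norm2 (a i) * `|A i j| = dot p q.
  by apply: eq_bigr => i _; rewrite !mxE.
apply: le_trans (ler_norm _) _; apply: le_trans (norm_dot_le _ _) _.
rewrite !norm2E -sqrtrM ?dot_ge0 // ler_wsqrtr //.
have -> : dot p p = F by apply: eq_bigr => i _; rewrite !mxE -expr2 norm2_sq.
rewrite ler_wpM2l ?(ltW F0) //; apply: le_trans (col_sq_le j).
by apply: ler_sum => i _; rewrite !mxE -expr2 real_normK ?num_real.
Qed.

(** A row is estimated by the mean of [m i] sampled entries, and its inner product with [w] by the
    mean of [m i] further, independent samples, so the second moments multiply. Here [f i] is an
    inverse row probability, and [v2 i], [v1 i] are the second moments of one sample of the vector
    and of the inner product. The part [rsp^2] of the batch size keeps the first factor of order
    [|a_i|^2]; the part [rsp * sF] bounds the added term of the second one so that [mixed_col_le]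
    sums it to [Lam |w|^2]. *)
Lemma svrg_variance (f v1 v2 m : 'I_n -> R) w : 0 < F ->
  (forall i, 0 <= f i /\ f i * dot (a i) (a i) <= 2 * F) ->
  (forall i, 0 <= v2 i <= 4 * norm1 (a i) ^+ 2) ->
  (forall i, 0 <= v1 i <= 2 * norm1 (a i) * \sum_j `|A i j| * w j 0 ^+ 2) ->
  (forall i, rsp i * (rsp i + sF) <= m i) ->
  \sum_i f i * ((dot (a i) (a i) + v2 i / m i) * (dot (a i) w ^+ 2 + v1 i / m i))
   <= 30 * F * Lam * dot w w.
Proof.
move=> F0 Hf Hv2 Hv1 Hm.
have sF0 : 0 < sF by rewrite sqrtr_gt0 divr_gt0.
have step i : f i * ((dot (a i) (a i) + v2 i / m i) * (dot (a i) w ^+ 2 + v1 i / m i))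
   <= 10 * F * (dot (a i) w ^+ 2 +
        2 / sF * \sum_j norm2 (a i) * `|A i j| * w j 0 ^+ 2).
  have n0 := norm2_row_gt0 i; have r1 := rsp_ge1 i.
  have m0 : 0 < m i by apply: lt_le_trans (Hm i); nra.
  have l1E := rsp_norm i.
  have h2 : v2 i / m i <= 4 * dot (a i) (a i).
    rewrite ler_pdivrMr //; have /andP[_ h] := Hv2 i; apply: le_trans h _.
    rewrite -norm2_sq -l1E.
    have -> : 4 * (rsp i * norm2 (a i)) ^+ 2 = 4 * norm2 (a i) ^+ 2 * rsp i ^+ 2 by ring.
    rewrite ler_wpM2l ?mulr_ge0 ?norm2_ge0 //.
    by apply: le_trans (Hm i); nra.
  set T := \sum_j _ * w j 0 ^+ 2; have TE : T = norm2 (a i) * \sum_j `|A i j| * w j 0 ^+ 2.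
    by rewrite /T mulr_sumr; apply: eq_bigr => j _; rewrite -mulrA.
  have S0 : 0 <= \sum_j `|A i j| * w j 0 ^+ 2.
    by apply: sumr_ge0 => j _; rewrite mulr_ge0 ?sqr_ge0.
  have h1 : v1 i / m i <= 2 / sF * T.
    rewrite ler_pdivrMr //; have /andP[_ h] := Hv1 i; apply: le_trans h _.
    rewrite -l1E TE; set S := \sum_j _ in S0 *; set nn := norm2 _ in n0 *.
    have -> : 2 * (rsp i * nn) * S = 2 / sF * (nn * S) * (rsp i * sF).
      by field; rewrite gt_eqF.
    rewrite ler_wpM2l //; first by rewrite !mulr_ge0 ?invr_ge0 // ltW.
    by apply: le_trans (Hm i); nra.
  have [f0 fF] := Hf i; have /andP[v10 _] := Hv1 i; have /andP[v20 _] := Hv2 i.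
  have X0 : 0 <= dot (a i) w ^+ 2 by exact: sqr_ge0.
  have Y0 : 0 <= v1 i / m i by rewrite divr_ge0 // ltW.
  apply: (@le_trans _ _ (f i * ((5 * dot (a i) (a i)) * (dot (a i) w ^+ 2 + 2 / sF * T)))).
    rewrite ler_wpM2l // ler_pM //; first by rewrite addr_ge0 ?dot_ge0 // divr_ge0 // ltW.
    - by rewrite addr_ge0.
    - by lra.
    - by rewrite lerD2l.
  rewrite mulrA; have -> : f i * (5 * dot (a i) (a i)) = 5 * (f i * dot (a i) (a i)) by ring.
  rewrite ler_wpM2r //; last by lra.
  by rewrite addr_ge0 //; apply: le_trans Y0 h1.
apply: le_trans (ler_sum _ (fun i _ => step i)) _.
rewrite -mulr_sumr big_split /= -mulr_sumr.
have -> : \sum_i dot (a i) w ^+ 2 = dot w (gram *m w).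
  by rewrite dot_gram; apply: eq_bigr => i _; rewrite expr2.
have h1 : dot w (gram *m w) <= Lam * dot w w.
  by apply: le_trans (Hlam w) _; rewrite ler_wpM2r ?dot_ge0.
have h2 : \sum_i \sum_j norm2 (a i) * `|A i j| * w j 0 ^+ 2 <= Num.sqrt (F * Lam) * dot w w.
  rewrite exchange_big /= /dot mulr_sumr; apply: ler_sum => j _.
  rewrite -mulr_suml -expr2 ler_wpM2r ?sqr_ge0 //; exact: mixed_col_le.
have h3 : 2 / sF * (Num.sqrt (F * Lam) * dot w w) = 2 * Lam * dot w w.
  rewrite /sF sqrtrM ?(ltW F0) // sqrtrM ?(ltW F0) // sqrtrV ?(ltW Lam0) //.
  have E (q l W : R) : 0 < q -> 0 < l -> 2 / (q * l^-1) * (q * l * W) = 2 * l ^+ 2 * W.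
    by move=> q0 l0; field; rewrite !gt_eqF.
  by rewrite E ?sqrtr_gt0 // sqr_sqrtr // ltW.
have h4 : 2 / sF * (\sum_i \sum_j norm2 (a i) * `|A i j| * w j 0 ^+ 2) <=
    2 * Lam * dot w w.
  by rewrite -h3 ler_wpM2l // divr_ge0 // ltW.
have := dot_ge0 w; set W := dot w w in h1 h3 h4 *.
move=> W0; have -> : 30 * F * Lam * W = 10 * F * (Lam * W + 2 * Lam * W) by ring.
by rewrite ler_wpM2l ?lerD // mulr_ge0 // ltW.
Qed.

End Rows.

(** * Expected contraction of one gradient step *)

Section Contraction.
Variables (R : realType) (d : nat) (B : 'M[R]_d) (sig mu eta V : R).
Implicit Types (w ws rr x u : 'cV[R]_d).
Definition shift x : 'cV[R]_d := sig *: x - B *m x.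
Hypothesis Hmu : forall x, mu * dot x x <= dot x (shift x).
Hypothesis Hsig : forall x, dot (shift x) (shift x) <= sig * dot x (shift x).
Hypothesis mu0 : 0 < mu.
Hypothesis V0 : 0 < V.
Hypothesis etaE : eta = mu / (8 * V).
Hypothesis etasig : eta * sig <= 1.

(** The next error is [u] plus [eta] times an unbiased estimate of [B w], and the left side bounds
    its expected square. The noise is proportional to [|w|^2 <= 2 |w - ws|^2 + 2 |ws|^2], and
    [eta = mu / (8 V)] makes its coefficients a quarter of the gain [eta mu]. The term in [|ws|^2]
    is why each epoch solves for a correction only, starting at 0. *)
Lemma svrg_contraction w ws rr u : shift ws = rr ->
  u = (1 - eta * sig) *: w + eta *: rr - ws ->
  dot u u + 2 * eta * dot u (B *m w) + eta ^+ 2 * dot (B *m w) (B *m w)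
    + eta ^+ 2 * V * dot w w <=
  (1 - 3 / 4 * (eta * mu)) * dot (w - ws) (w - ws) + eta * mu / 4 * dot ws ws.
Proof.
move=> Hws Eu; pose e := w - ws.
have e0 : 0 < eta by rewrite etaE divr_gt0 // mulr_gt0.
have uE : u + eta *: (B *m w) = e - eta *: shift e.
  rewrite Eu -Hws /e /shift !scalerBr !mulmxBr !scalerBl scale1r !scalerBr !scalerA.
  by move: (B *m w) (B *m ws) => p q; apply/colP => j; rewrite !mxE; ring.
have -> : dot u u + 2 * eta * dot u (B *m w) + eta ^+ 2 * dot (B *m w) (B *m w)
   = dot (u + eta *: (B *m w)) (u + eta *: (B *m w)).
  by rewrite !dotE (dotC (B *m w) u); ring.
rewrite uE.
have h1 (x : 'cV[R]_d) : dot (x - eta *: shift x) (x - eta *: shift x) <= (1 - eta * mu) * dot x x.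
  move: (Hsig x) (Hmu x); move: (shift x) => sx ht hq.
  rewrite !dotE (dotC sx x); have := dot_ge0 sx; have := dot_ge0 x.
  set p := dot x x in hq *; set q := dot x _ in hq ht *; set t := dot sx _ in ht *.
  move=> p0 t0.
  have : eta * eta * t <= eta * q.
    have : eta * t <= eta * (sig * q) by rewrite ler_wpM2l // ltW.
    have q0 : 0 <= q by apply: le_trans hq; rewrite mulr_ge0 // ltW.
    move=> h; apply: (@le_trans _ _ (eta * (eta * (sig * q)))).
      by rewrite -mulrA ler_wpM2l // ltW.
    by rewrite ler_wpM2l ?(ltW e0) // mulrA ler_piMl.
  have : eta * (mu * p) <= eta * q by rewrite ler_wpM2l // ltW.
  by lra.
have h2 : dot w w <= 2 * (dot e e + dot ws ws).
  have H (p q : 'cV[R]_d) : dot (p + q) (p + q) <= 2 * (dot p p + dot q q).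
    by have := dot_ge0 (p - q); rewrite !dotE (dotC q p); lra.
  by have := H e ws; rewrite subrK.
have h3 : eta ^+ 2 * V = eta * mu / 8.
  by rewrite expr2 -mulrA {2}etaE; field; rewrite gt_eqF.
have {}h1 := h1 e; rewrite h3 -/e; have em : 0 < eta * mu by rewrite mulr_gt0.
by nra.
Qed.

End Contraction.

(** Bernoulli's inequality for the reciprocal; enough to bring a geometric factor below a constant
    after about [1 / a] steps. *)
Lemma geometric_le_inv (R : realType) (a : R) (m : nat) :
  0 <= a <= 1 -> (1 - a) ^+ m * (1 + a * m%:R) <= 1.
Proof.
move=> /andP[a0 a1]; elim: m => [|m IH]; first by rewrite mulr0 addr0 mulr1.
rewrite exprS -natr1.
have p0 : 0 <= (1 - a) ^+ m by rewrite exprn_ge0 //; lra.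
have m0 : 0 <= a * m%:R by rewrite mulr_ge0.
move: IH p0 m0; set p := (1 - a) ^+ m; set q := a * m%:R => IH p0 m0.
have -> : (1 - a) * p * (1 + a * (m%:R + 1)) = p * (1 + q) - a * p * (q + a) by rewrite /q; ring.
have : 0 <= a * p * (q + a) by rewrite !mulr_ge0 // addr_ge0.
by lra.
Qed.

Lemma shiftE (R : realType) d (B : 'M[R]_d) sig x : shift B sig x = sig *: x - B *m x.
Proof. by []. Qed.

(** * The program *)

(* Conventions, with [F] the squared Frobenius norm. The preparation fixes
   - integer registers 3, 4: number of nonzero columns, length of the row table;
   - integer arrays 2 to 6: row of each entry, list of the nonzero columns, entry
     table, positions of its blocks, row table;
   - real arrays 5, 6, 7: value over probability of an entry, inverse probability
     of a row, [sqrt s_i];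
   - real registers 1, 2, 3: [F], sum of [|a_i|_1^2], sum of [|a_i|_2 |a_i|_1].
   The main loop keeps the vector in real array 1 and, in real registers 5 to 9,
   its Rayleigh quotient [rho], its residual, [G], [d F / G] and an upper bound for
   the logarithm of the latter; 43 is the stopping threshold and 44 the previous
   residual. A block uses
   - real registers 10 to 19: [Lam = rho + G], [mu], [sig = Lam + mu], twice
     [mu + 2 G], [sig - rho], step size, epoch length, [sqrt (F / Lam)], number of
     Chebyshev steps, squared relative tolerance;
   - real arrays 8, 9: the last two Chebyshev vectors; 10, 11: approximate
     solution of the system and its residual; 12 and registers 23, 24: the inner
     iterate, as register 23 times array 12 plus register 24 times array 11, which
     makes a step sparse. *)
Fixpoint Seqs (l : seq program) : program :=
  if l is c :: l' then Seq c (Seqs l') else Skip.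

(* rreg t := <array a, array b>, over the list of nonzero columns *)
Definition Dot (a b t : nat) : program := Seqs [::
  Blk [:: INum 11 0; RofI t 11];
  Loop 3 [:: ILoad 11 3 10; RLoad 40 a 11; RLoad 41 b 11; RMul 40 40 41;
             RAdd t t 40] ].

(* array 14 := A^T A (array a); array 13 holds A (array a) *)
Definition MatVec (a : nat) : program := Seqs [::
  Loop 2 [:: ILoad 11 1 10; ILoad 12 2 10; INum 14 0; RofI 40 14;
             RStore 13 12 40; RStore 14 11 40];
  Loop 2 [:: ILoad 11 1 10; ILoad 12 2 10; RLoad 40 0 10; RLoad 41 a 11;
             RMul 40 40 41; RLoad 41 13 12; RAdd 40 41 40; RStore 13 12 40];
  Loop 2 [:: ILoad 11 1 10; ILoad 12 2 10; RLoad 40 0 10; RLoad 41 13 12;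
             RMul 40 40 41; RLoad 41 14 11; RAdd 40 41 40; RStore 14 11 40] ].

(* one sample of an entry of the current row, into integer register 24 *)
Definition Sample (l : seq instr) : program :=
  Seq (Rand 24 22) (Blk ([:: IAdd 24 24 23; ILoad 24 4 24; ILoad 11 1 24] ++ l)).

(** Registers 22 and 23 receive the length and the position of the block of the row in the entry
    table, 28 the real batch size, 26 and 27 the sum and the number of samples so far, and 45 the
    constant 1. *)
Definition step_pre : seq instr :=
  [:: ILoad 21 6 20; RLoad 40 7 21; RAdd 41 40 17; RMul 28 40 41;
      INum 13 1; IAdd 22 21 13; ILoad 22 0 22; ILoad 22 5 22;
      ILoad 23 0 21; ILoad 23 5 23; ISub 22 22 23;
      INum 24 0; RofI 26 24; RofI 27 24; RofI 45 13].

Definition sample_in : seq instr :=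
  [:: RLoad 40 12 11; RMul 40 23 40; RLoad 41 11 11; RMul 41 24 41;
      RAdd 40 40 41; RLoad 41 5 24; RMul 40 40 41; RAdd 26 26 40; RAdd 27 27 45].

(** The factor [1 - eta sig] goes into registers 23 and 24, so that no array is touched, and
    register 24 also receives the exact term [eta]. The increment in 26 is divided by the new
    register 23, since array 12 is stored without that factor. Subtracting register 27 from itself
    restarts the count of samples. *)
Definition step_mid : seq instr :=
  [:: RMul 40 15 12; RSub 40 45 40; RMul 23 23 40; RMul 24 24 40; RAdd 24 24 15;
      RLoad 41 6 21; RMul 26 26 41; RMul 26 26 15; RMul 41 27 27; RMul 41 41 23;
      RDiv 26 26 41; RSub 27 27 27].

Definition sample_out : seq instr :=
  [:: RLoad 40 5 24; RMul 40 26 40; RLoad 41 12 11; RAdd 40 41 40;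
      RStore 12 11 40; RAdd 27 27 45].

Definition Step : program := Seqs [::
  Rand 20 4; Blk step_pre;
  While (RLt 27 28) (Sample sample_in);
  Blk step_mid;
  While (RLt 27 28) (Sample sample_out);
  Blk [:: RAdd 25 25 45] ].

Definition Epoch : program := Seqs [::
  Loop 3 [:: ILoad 11 3 10; INum 14 0; RofI 40 14; RStore 12 11 40];
  Blk [:: INum 14 0; RofI 24 14; RofI 25 14; INum 13 1; RofI 23 13];
  While (RLt 25 16) Step;
  Loop 3 [:: ILoad 11 3 10; RLoad 40 12 11; RMul 40 23 40; RLoad 41 11 11;
             RMul 41 24 41; RAdd 40 40 41; RLoad 41 10 11; RAdd 40 41 40;
             RStore 10 11 40] ].

Definition Resid : program := Seqs [::
  MatVec 10;
  Loop 3 [:: ILoad 11 3 10; RLoad 40 10 11; RMul 40 12 40; RLoad 41 8 11;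
             RSub 40 41 40; RLoad 41 14 11; RAdd 40 40 41; RStore 11 11 40];
  Dot 11 11 22 ].

(** Register 14 holds [sig - rho]. The initial guess [y / (sig - rho)] would be exact for an
    eigenvector with eigenvalue [rho], so its error is governed by the residual. *)
Definition Solve : program := Seqs [::
  Loop 3 [:: ILoad 11 3 10; RLoad 40 8 11; RDiv 40 40 14; RStore 10 11 40];
  Dot 8 8 21; Blk [:: RMul 21 21 19];
  Resid;
  While (RLt 21 22) (Seq Epoch Resid) ].

Definition cheb_update : seq instr :=
  [:: ILoad 11 3 10; RLoad 40 10 11; RMul 40 13 40; RLoad 41 9 11; RSub 40 40 41;
      RLoad 41 8 11; RStore 9 11 41; RStore 8 11 40].

Definition Normalize : program := Seqs [::
  Dot 8 8 42; Blk [:: RSqrt 42 42];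
  Loop 3 [:: ILoad 11 3 10; RLoad 40 8 11; RDiv 40 40 42; RStore 1 11 40] ].

Definition num (x k : nat) : seq instr := [:: INum 14 k; RofI x 14].

Definition params (cK cw : nat) : seq instr :=
  [:: RAdd 10 5 7; RDiv 17 1 10; RSqrt 17 17;
      RMul 40 17 3; RAdd 40 2 40; RMul 40 10 40; RofI 41 2; RDiv 40 40 41; RSqrt 40 40;
      RAdd 11 7 40; RAdd 12 10 11; RAdd 14 11 7; RAdd 13 14 7; RAdd 13 13 13] ++
  num 40 30 ++ [:: RMul 40 40 1; RMul 40 40 10; RMul 41 11 11; RAdd 40 40 41] ++
  num 42 8 ++ [:: RMul 42 42 40; RDiv 15 11 42] ++
  num 42 54 ++ [:: RMul 42 42 40; RDiv 16 42 41] ++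
  num 18 cK ++ [:: RMul 18 18 9; RDiv 40 11 7; RSqrt 40 40; RMul 18 18 40] ++
  num 40 1 ++ [:: RAdd 40 40 18; RMul 41 40 40; RMul 40 41 40; RMul 41 8 8;
      RMul 41 41 8; RMul 40 40 41] ++
  num 41 cw ++ [:: RMul 40 40 41; RMul 40 40 1; RDiv 19 6 40; RMul 19 19 19;
      RSub 44 44 44; RAdd 44 44 6] ++ num 20 0.

Definition Block (cK cw : nat) : program := Seqs [::
  Blk (params cK cw);
  Loop 3 [:: ILoad 11 3 10; RLoad 40 1 11; RStore 8 11 40; INum 14 0; RofI 40 14;
             RStore 9 11 40];
  While (RLt 20 18) (Seqs [:: Solve; Loop 3 cheb_update;
                              Blk (num 40 1 ++ [:: RAdd 20 20 40])]);
  Normalize ].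

Definition Eval : program := Seqs [::
  MatVec 1; Dot 1 14 5; Dot 14 14 6;
  Blk [:: RMul 40 5 5; RSub 6 6 40; RSqrt 6 6] ].

(** For an overlap of at least [1 / (c0 P)], a residual of at most [eps rho / (c0 P)] gives
    [lam_1 - rho <= eps rho] by [rayl_certificate]. *)
Definition Thr (c0 : nat) : program :=
  Blk (num 40 c0 ++ [:: RMul 40 40 8; RMul 43 0 5; RDiv 43 43 40]).

(** The only decision of the main loop apart from its stopping test: if the residual exceeds its
    previous value divided by [P], then [G] is halved and [P] doubled. *)
Definition LevelUp : program :=
  Seq (Blk [:: RDiv 40 44 8])
      (If (RLt 40 6) (Blk (num 40 2 ++ [:: RDiv 7 7 40; RMul 8 8 40] ++
                           num 40 1 ++ [:: RAdd 9 9 40])) Skip).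

Definition Main (c0 cK cw : nat) : program := Seqs [::
  Eval; Thr c0;
  While (RLt 43 6) (Seqs [:: Block cK cw; Eval; LevelUp; Thr c0]) ].

(** Truncated subtraction replaces tests. [1 - (off (i + 1) - p)] is 1 exactly if entry [p] lies
    beyond row [i]. The column of every entry is written behind the list of columns, but the list
    gets longer only if the column is not yet marked in array 8. *)
Definition prep1 : seq instr :=
  [:: INum 15 1; IAdd 16 14 15; ILoad 16 0 16; ISub 16 16 10; ISub 16 15 16;
      IAdd 14 14 16; IStore 2 10 14;
      ILoad 11 1 10; IStore 3 3 11; ILoad 16 8 11; ISub 16 15 16; IAdd 3 3 16;
      IStore 8 11 15;
      RLoad 40 0 10; RMul 41 40 40; RSqrt 42 41;
      RLoad 43 3 14; RAdd 43 43 42; RStore 3 14 43;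
      RLoad 43 4 14; RAdd 43 43 41; RStore 4 14 43;
      RAdd 1 1 41].

Definition prep2 : seq instr :=
  [:: ILoad 12 2 10; RLoad 40 3 12; RLoad 41 4 12; RSqrt 41 41; RDiv 42 40 41;
      RStore 7 12 42; RLoad 43 0 10; RMul 43 43 43; RMul 44 43 42; RAdd 3 3 44;
      RSqrt 43 43; RMul 44 43 40; RAdd 2 2 44;
      INum 15 1; IAdd 16 12 15; ILoad 16 0 16; ILoad 17 0 12; ISub 16 16 17;
      RofI 44 16; RMul 44 44 43; RDiv 44 44 40; RStore 15 10 44;
      RofI 44 2; RLoad 43 4 10; RMul 44 44 43; RDiv 44 44 1; RStore 16 10 44].

(* copies of j, as many as the ceiling of entry j of array w, listed in array
   tab; array st holds the positions of the first copies *)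
Definition MkTab (w tab st : nat) : program := Seqs [::
  Blk [:: INum 20 0; INum 10 0];
  While (ILt 10 2) (Seqs [::
    Blk [:: IStore st 10 20; RLoad 40 w 10; INum 11 0; RofI 41 11; INum 13 1; RofI 42 13];
    While (RLt 41 40) (Blk [:: IStore tab 20 10; IAdd 20 20 13; RAdd 41 41 42]);
    Blk inc]);
  Blk [:: IStore st 10 20] ].

Definition prep3 : seq instr :=
  [:: ILoad 12 2 10; INum 15 1; IAdd 16 12 15; ILoad 16 0 16; ILoad 16 5 16;
      ILoad 17 0 12; ILoad 17 5 17; ISub 16 16 17;
      IAdd 18 10 15; ILoad 18 5 18; ILoad 19 5 10; ISub 18 18 19;
      RofI 40 16; RofI 41 18; RDiv 40 40 41; RLoad 41 0 10; RMul 40 40 41; RStore 5 10 40;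
      IAdd 18 10 15; ILoad 18 7 18; ILoad 19 7 10; ISub 18 18 19;
      RofI 40 4; RofI 41 18; RDiv 40 40 41; RStore 6 10 40].

Definition Prep : program := Seqs [::
  Blk [:: INum 14 0]; Loop 2 prep1; Loop 2 prep2;
  MkTab 15 4 5; MkTab 16 6 7; Blk [:: ILoad 4 7 2]; Loop 2 prep3 ].

(** There is one draw for each entry, written at its column, so a column keeps the last of its
    draws. The closing loop counts doublings up to [d] in order to bound a logarithm, which the
    machine cannot compute. *)
Definition Start (m : nat) : program := Seqs [::
  Blk [:: INum 21 m; INum 10 0];
  While (ILt 10 2) (Seqs [:: Blk [:: ILoad 11 1 10]; Rand 20 21;
                             Blk ([:: RofI 40 20; RStore 8 11 40] ++ inc)]);
  Normalize;
  Blk ([:: RSub 7 7 7; RAdd 7 7 1; RofI 8 1] ++ num 9 1 ++ num 40 1);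
  While (RLt 40 8) (Blk ([:: RAdd 40 40 40] ++ num 41 1 ++ [:: RAdd 9 9 41])) ].

Definition top_program (m c0 cK cw : nat) : program :=
  Seqs [:: Prep; Start m; Main c0 cK cw].

(** * Static data and vector operations *)

(** What the preparation leaves in memory, as functions independent of the store. [stat] ties a
    store to it, and [sgood] and [ssamp] state what the later code relies on. *)
Record sdata (R : realType) := SData {
  off : nat -> nat; ecol : nat -> nat; erow : nat -> nat; cl : nat -> nat;
  tab : nat -> nat; start : nat -> nat; rtab : nat -> nat;
  evl : nat -> R; gam : nat -> R; rfac : nat -> R; rs : nat -> R;
  nc : nat; rlen : nat; seps : R; sW : R; sX : R }.

Definition WI : seq nat := iota 10 20.
Definition fr (R : realType) (wR wB : seq nat) (s s' : store R) :=
  frm WI wR [::] wB s s'.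

Section Static.
Variables (R : realType) (n d : nat) (A : 'M[R]_(n, d)) (D : sdata R).
Local Notation N := (nnz A).
Implicit Types (s : store R).

Record stat s : Prop := Stat {
  st_n : ireg s 0 = n; st_d : ireg s 1 = d; st_N : ireg s 2 = N;
  st_nc : ireg s 3 = nc D; st_rlen : ireg s 4 = rlen D;
  st_off : iarr s 0 = off D; st_col : iarr s 1 = ecol D; st_row : iarr s 2 = erow D;
  st_cl : iarr s 3 = cl D; st_tab : iarr s 4 = tab D; st_start : iarr s 5 = start D;
  st_rtab : iarr s 6 = rtab D;
  st_val : rarr s 0 = evl D; st_gam : rarr s 5 = gam D;
  st_rfac : rarr s 6 = rfac D; st_rs : rarr s 7 = rs D;
  st_eps : rreg s 0 = seps D; st_F : rreg s 1 = frob2 A;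
  st_W : rreg s 2 = sW D; st_X : rreg s 3 = sX D }.

Lemma stat_frm wI wR wB s s' : frm wI wR [::] wB s s' ->
  all (fun x => x \notin wI) (iota 0 5) ->
  all (fun x => x \notin wR) (iota 0 4) ->
  all (fun x => x \notin wB) [:: 0; 5; 6; 7]%N ->
  stat s -> stat s'.
Proof.
move=> [f1 f2 f3 f4] /allP hI /allP hR /allP hB S.
have r0 : iarr s' =1 iarr s by move=> a; rewrite f3.
split; rewrite ?r0 ?f1 ?f2 ?f4 ?hI ?hR ?hB //; by case: S.
Qed.

Definition cls : seq nat := mkseq (cl D) (nc D).

(** The arbitrary [h] in [sg_entry] lets any sum over the entry list be turned into a sum over the
    matrix. *)
Record sgood : Prop := SGood {
  sg_N : (0 < N)%N; sg_ncN : (nc D <= N)%N;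
  sg_uniq : uniq cls; sg_lt : forall q, (q < nc D)%N -> (cl D q < d)%N;
  sg_col : forall p, (p < N)%N -> ecol D p \in cls;
  sg_row : forall p, (p < N)%N -> (erow D p < n)%N;
  sg_clcol : forall q, (q < nc D)%N -> exists2 p, (p < N)%N & cl D q = ecol D p;
  sg_rowex : forall i, (i < n)%N -> exists2 p, (p < N)%N & erow D p = i;
  sg_cov : forall i j, A i j != 0 -> (j : nat) \in cls;
  sg_entry : forall h : nat -> nat -> R -> R,
    \sum_(p < N) h (erow D p) (ecol D p) (evl D p) =
    \sum_(i < n) \sum_(j < d) if A i j != 0 then h i j (A i j) else 0 }.

Hypothesis good : sgood.

(** An array read as a vector that is zero on the zero columns of [A]. All loops over coordinates
    run over the nonzero columns, because [d] may exceed the number of nonzero entries. *)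
Definition cv (f : nat -> R) : 'cV[R]_d := \col_j (if (j : nat) \in cls then f j else 0).

Lemma cvE f (j : 'I_d) : cv f j 0 = if (j : nat) \in cls then f j else 0.
Proof. by rewrite mxE. Qed.

Lemma eq_cv f g : {in cls, f =1 g} -> cv f = cv g.
Proof. by move=> H; apply/colP => j; rewrite !cvE; case: ifP => // /H. Qed.

Lemma mem_cls j : (j \in cls) -> exists2 q, (q < nc D)%N & j = cl D q.
Proof. by move/mapP => [q]; rewrite mem_iota add0n => /andP[_ h] ->; exists q. Qed.

Lemma cl_cls q : (q < nc D)%N -> cl D q \in cls.
Proof. by move=> h; apply: map_f; rewrite mem_iota. Qed.

Lemma sum_cls (f : nat -> R) : \sum_(q < nc D) f (cl D q) =
  \sum_(j < d) if (j : nat) \in cls then f j else 0.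
Proof.
rewrite -big_mkcond /= -(big_mkord (fun j => j \in cls)) /index_iota subn0.
transitivity (\sum_(j <- cls) f j).
  by rewrite -(big_mkord predT (fun q => f (cl D q))) /cls /mkseq big_map /index_iota subn0.
rewrite -[RHS]big_filter; apply: perm_big; apply: uniq_perm.
- exact: sg_uniq good.
- by rewrite filter_uniq // iota_uniq.
move=> j; rewrite mem_filter mem_iota /= add0n.
case: (boolP (j \in cls)) => //= /mem_cls[q hq ->].
by rewrite (sg_lt good).
Qed.

Lemma dot_cv f g : dot (cv f) (cv g) = \sum_(q < nc D) f (cl D q) * g (cl D q).
Proof.
rewrite (sum_cls (fun j => f j * g j)); apply: eq_bigr => j _.
by rewrite !cvE; case: ifP => //; rewrite mul0r.
Qed.

Lemma mul_cv f (i : 'I_n) : (A *m cv f) i 0 =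
  \sum_(p < N | erow D p == i) evl D p * f (ecol D p).
Proof.
rewrite mxE [RHS]big_mkcond /=.
have /= -> := sg_entry good (fun i' j v => if i' == i then v * f j else 0).
rewrite (bigD1 i) //= [X in _ = _ + X]big1 ?addr0; last first.
  move=> i' /negbTE; rewrite -val_eqE /= => h.
  by apply: big1 => j _; rewrite h if_same.
apply: eq_bigr => j _; rewrite eqxx cvE; case: (boolP (A i j == 0)) => /= [/eqP->|h].
  by rewrite mul0r.
by rewrite (sg_cov good h).
Qed.

Lemma gram_cv f (h : nat -> R) : (forall i : 'I_n, h i = (A *m cv f) i 0) ->
  gram A *m cv f = cv (fun j => \sum_(p < N | ecol D p == j) evl D p * h (erow D p)).
Proof.
move=> Hh; rewrite /gram -mulmxA; apply/colP => j; rewrite cvE mxE.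
under eq_bigr => i _ do rewrite mxE -Hh.
have -> : \sum_(p < N | ecol D p == j) evl D p * h (erow D p) =
          \sum_(i < n) A i j * h i.
  rewrite big_mkcond /=.
  have /= -> := sg_entry good (fun i j' v => if j' == j then v * h i else 0).
  rewrite exchange_big /=.
  rewrite (bigD1 j) //= [X in _ + X]big1 ?addr0; last first.
    move=> j' /negbTE; rewrite -val_eqE /= => e.
    by apply: big1 => i _; rewrite e if_same.
  apply: eq_bigr => i _; rewrite eqxx; case: (boolP (A i j == 0)) => //= /eqP->.
  by rewrite mul0r.
case: ifP => // h0; apply: big1 => i _.
case: (eqVneq (A i j) 0) => [->|e]; first by rewrite mul0r.
by move: h0; rewrite (sg_cov good e).
Qed.

End Static.

Section Mach.
Variables (R : realType) (P : store R -> Prop) (kap : R).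
Hypothesis kap0 : 0 <= kap.
Variables (n d : nat) (A : 'M[R]_(n, d)) (D : sdata R).
Local Notation N := (nnz A).
Hypothesis good : sgood A D.
Implicit Types (s : store R) (k : seq program).
Local Notation B := (@bnd R P kap).
Local Notation stat := (stat A D).
Local Notation cv := (@cv R d D).
Local Notation cls := (cls D).

(** The loss of one pass over the entries; costs are rounded up to multiples of it. *)
Definition uu : R := kap * N%:R.

Lemma kap_uu : kap <= uu.
Proof. by rewrite /uu ler_peMr // ler1n (sg_N good). Qed.

Lemma uu_ge0 : 0 <= uu. Proof. exact: le_trans kap0 kap_uu. Qed.

Lemma kapn_uu (m : nat) : kap * m%:R <= m%:R * uu.
Proof. by rewrite mulrC ler_wpM2l // kap_uu. Qed.

Lemma seqsM nn c l k s x : B nn [:: c, Seqs l & k] s (x - uu) -> B nn (Seqs (c :: l) :: k) s x.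
Proof.
by move=> H; apply: bnd_seq => //; apply: bnd_le H; have := kap_uu; lra.
Qed.

Lemma seqs0 nn k s x : B nn k s (x - uu) -> B nn (Seqs [::] :: k) s x.
Proof.
by move=> H; apply: bnd_skip => //; apply: bnd_le H; have := kap_uu; lra.
Qed.

Lemma blkM nn l k s x :
  B nn k (execs l s) (x - (2 * size l + 1)%:R * uu) -> B nn (Blk l :: k) s x.
Proof.
by move=> H; apply: bnd_blk => //; apply: bnd_le H; have := kapn_uu (2 * size l + 1); lra.
Qed.

Lemma loopM nn (b m : nat) l k s x (wR wB : seq nat) (I : nat -> (nat -> R) -> (nat -> nat -> R) -> Prop) :
  (b = 2 /\ m = N \/ b = 3 /\ m = nc D)%N -> stat s ->
  all (mem WI) (10 :: 13 :: writes wi l)%N -> 10%N \notin writes wi l ->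
  writes wia l = [::] -> all (mem wR) (writes wr l) -> all (mem wB) (writes wra l) ->
  I 0%N (rreg s) (rarr s) ->
  (forall p s', (p < m)%N -> ireg s' 10 = p -> fr wR wB s s' ->
     I p (rreg s') (rarr s') ->
     I p.+1 (rreg (execs l s')) (rarr (execs l s'))) ->
  (forall s', fr wR wB s s' -> I m (rreg s') (rarr s') ->
     B nn k s' (x - (2 * size l + 10)%:R * uu)) ->
  B nn (Loop b l :: k) s x.
Proof.
move=> hb St hI h10 hia hR hB I0 IS IN.
have bm : ireg s b = m.
  by case: hb => -[-> ->]; [exact: st_N St|exact: st_nc St].
have mN : (m <= N)%N by case: hb => -[_ ->] //; exact: sg_ncN good.
have bI : b \notin (10 :: 13 :: writes wi l)%N.
  apply/negP => h; have : b \in WI by exact: (allP hI _ h).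
  by case: hb => -[-> _].
have sub s' : frm (10 :: 13 :: writes wi l)%N (writes wr l) (writes wia l)
               (writes wra l) s s' -> fr wR wB s s'.
  by apply: frm_sub => //; rewrite hia.
apply: (@bnd_loop R P kap kap0 nn b l k s x (fun p s' => I p (rreg s') (rarr s'))) => //.
- move=> p s' pm e10 f Ip; rewrite execs_cat /=.
  by apply: (IS p s') => //; [rewrite -bm|exact: sub].
- move=> s' f Im; rewrite bm in Im *; apply: bnd_le (IN s' (sub s' f) Im).
  rewrite lerD2l lerN2 /uu.
  have -> : (2 * size l + 10)%:R * (kap * N%:R) = kap * ((2 * size l + 10) * N)%:R.
    by rewrite natrM; ring.
  rewrite ler_wpM2l // ler_nat /loop_cost; have := sg_N good; nia.
Qed.

Lemma loopE nn l k s x (wR wB : seq nat) (I : nat -> (nat -> R) -> (nat -> nat -> R) -> Prop) :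
  stat s ->
  all (mem WI) (10 :: 13 :: writes wi l)%N -> 10%N \notin writes wi l ->
  writes wia l = [::] -> all (mem wR) (writes wr l) -> all (mem wB) (writes wra l) ->
  I 0%N (rreg s) (rarr s) ->
  (forall p s', (p < N)%N -> ireg s' 10 = p -> fr wR wB s s' ->
     I p (rreg s') (rarr s') ->
     I p.+1 (rreg (execs l s')) (rarr (execs l s'))) ->
  (forall s', fr wR wB s s' -> I (N) (rreg s') (rarr s') ->
     B nn k s' (x - (2 * size l + 10)%:R * uu)) ->
  B nn (Loop 2 l :: k) s x.
Proof. by move=> *; apply: (@loopM nn 2 (N) l k s x wR wB I) => //; left. Qed.

Lemma loopC nn l k s x (wR wB : seq nat) (I : nat -> (nat -> R) -> (nat -> nat -> R) -> Prop) :
  stat s ->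
  all (mem WI) (10 :: 13 :: writes wi l)%N -> 10%N \notin writes wi l ->
  writes wia l = [::] -> all (mem wR) (writes wr l) -> all (mem wB) (writes wra l) ->
  I 0%N (rreg s) (rarr s) ->
  (forall p s', (p < nc D)%N -> ireg s' 10 = p -> fr wR wB s s' ->
     I p (rreg s') (rarr s') ->
     I p.+1 (rreg (execs l s')) (rarr (execs l s'))) ->
  (forall s', fr wR wB s s' -> I (nc D) (rreg s') (rarr s') ->
     B nn k s' (x - (2 * size l + 10)%:R * uu)) ->
  B nn (Loop 3 l :: k) s x.
Proof. by move=> *; apply: (@loopM nn 3 (nc D) l k s x wR wB I) => //; right. Qed.

Lemma dotM nn (a b t : nat) k s x : stat s -> (3 < t)%N -> (t != 40)%N -> (t != 41)%N ->
  (forall s', fr [:: t; 40; 41]%N [::] s s' ->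
     rreg s' t = dot (cv (rarr s a)) (cv (rarr s b)) ->
     B nn k s' (x - 30 * uu)) ->
  B nn (Dot a b t :: k) s x.
Proof.
move=> St t3 n40 n41 H; pose wR := [:: t; 40; 41]%N.
apply: seqsM; apply: blkM; set s1 := execs _ s.
have f1 : fr wR [::] s s1.
  by apply: frm_sub (frm_execs _ _) => //; rewrite /writes /= inE eqxx.
have St1 : stat s1.
  by apply: stat_frm f1 _ _ _ St => //=; rewrite !inE; move: t3; clear; case: t => [|[|[|[|t]]]].
apply: seqsM.
apply: (@loopC nn _ _ s1 _ wR [::] (fun q r a' =>
   r t = \sum_(i < q) rarr s a (cl D i) * rarr s b (cl D i))) => //.
- by rewrite /writes /= !inE !eqxx !orbT.
- by rewrite big_ord0 /s1 /= /upd eqxx.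
- move=> q s' _ e10 f E; rewrite big_ord_recr /= -E.
  have ar : rarr s' =1 rarr s by move=> z; rewrite (frm_ra f) // (frm_ra f1).
  have cE : iarr s' 3 = cl D by rewrite (frm_ia f) // (st_cl St1).
  by rewrite /upd /= !eqxx (negbTE n40) (negbTE n41) e10 cE !ar.
move=> s' f E; apply: seqs0; apply: bnd_le (H s' (frm_trans f1 f) _).
  by rewrite /=; have := uu_ge0; lra.
by rewrite E (dot_cv good).
Qed.

Lemma matvecM nn (a : nat) k s x : stat s -> (a != 13)%N -> (a != 14)%N ->
  (forall s', fr [:: 40; 41]%N [:: 13; 14]%N s s' ->
     cv (rarr s' 14) = gram A *m cv (rarr s a) ->
     B nn k s' (x - 100 * uu)) ->
  B nn (MatVec a :: k) s x.
Proof.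
move=> St a13 a14 H.
pose F0 := @fr R [:: 40; 41]%N [:: 13; 14]%N.
have stF s1 s2 : F0 s1 s2 -> stat s1 -> stat s2 by move=> f; apply: stat_frm f _ _ _.
apply: seqsM.
(* Only cells that belong to an occurring row or column are cleared, at the cost of one pass. *)
apply: (@loopE nn _ _ s _ [:: 40; 41]%N [:: 13; 14]%N (fun q r ar =>
  (forall p, (p < q)%N -> ar 13%N (erow D p) = 0 /\ ar 14%N (ecol D p) = 0))) => //.
  move=> q s' qN e10 f E p; rewrite ltnS leq_eqVlt => /orP pq.
  have rE : iarr s' 2 = erow D by rewrite (frm_ia f) // (st_row St).
  have cE : iarr s' 1 = ecol D by rewrite (frm_ia f) // (st_col St).
  rewrite /= /upd /= e10 rE cE; case: pq => [/eqP->|/E[-> ->]]; first by rewrite !eqxx.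
  by rewrite !if_same.
move=> s1 f1 => E1.
have St1 := stF _ _ f1 St.
apply: seqsM.
apply: (@loopE nn _ _ s1 _ [:: 40; 41]%N [:: 13; 14]%N (fun q r ar =>
  (forall i, ar 13%N i = rarr s1 13 i + \sum_(p < q | erow D p == i) evl D p * rarr s1 a (ecol D p))
  /\ ar 14%N = rarr s1 14)) => //.
  by split=> // i; rewrite big_ord0 addr0.
  move=> q s' qN e10 f [E E']; split; last by rewrite -E' /= /upd /= E'.
  have rE : iarr s' 2 = erow D by rewrite (frm_ia f) // (st_row St1).
  have cE : iarr s' 1 = ecol D by rewrite (frm_ia f) // (st_col St1).
  have vE : rarr s' 0 = evl D by rewrite (frm_ra f) // (st_val St1).
  have aE : rarr s' a = rarr s1 a by rewrite (frm_ra f) // !inE negb_or a13 a14.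
  move=> i; rewrite big_mkcond big_ord_recr -big_mkcond /= /upd /= e10 rE cE vE aE !E.
  by rewrite [erow D q == i]eq_sym; case: eqP => [->|_]; rewrite ?addr0 ?addrA.
move=> s2 f2 => -[E2 E2'].
have St2 := stF _ _ f2 St1.
apply: seqsM.
apply: (@loopE nn _ _ s2 _ [:: 40; 41]%N [:: 13; 14]%N (fun q r ar =>
  (forall i, ar 14%N i = rarr s2 14 i + \sum_(p < q | ecol D p == i) evl D p * rarr s2 13 (erow D p))
  /\ ar 13%N = rarr s2 13)) => //.
  by split=> // i; rewrite big_ord0 addr0.
  move=> q s' qN e10 f [E E']; split; last by rewrite -E' /= /upd /= E'.
  have rE : iarr s' 2 = erow D by rewrite (frm_ia f) // (st_row St2).
  have cE : iarr s' 1 = ecol D by rewrite (frm_ia f) // (st_col St2).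
  have vE : rarr s' 0 = evl D by rewrite (frm_ra f) // (st_val St2).
  move=> i; rewrite big_mkcond big_ord_recr -big_mkcond /= /upd /= e10 rE cE vE E' !E.
  by rewrite [ecol D q == i]eq_sym; case: eqP => [->|_]; rewrite ?addr0 ?addrA.
move=> s3 f3 => -[E3 _].
have f13 := frm_trans f1 (frm_trans f2 f3).
apply: seqs0; apply: bnd_le (H s3 f13 _).
  by rewrite /=; have := uu_ge0; lra.
rewrite (@gram_cv R n d A D good (rarr s a) (rarr s2 13)).
  apply: eq_cv => j jc; rewrite E3 E2'.
  suff -> : rarr s1 14 j = 0 by rewrite add0r.
  have [q hq ->] := mem_cls jc.
  have [p pN ->] := sg_clcol good hq.
  by have [] := E1 p pN.
move=> i; rewrite E2 (mul_cv good).
suff -> : rarr s1 13 i = 0.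
  rewrite add0r; apply: eq_bigr => p _; rewrite (frm_ra f1) //.
  by rewrite !inE negb_or a13 a14.
have [p pN <-] := sg_rowex good (ltn_ord i).
by have [] := E1 p pN.
Qed.

End Mach.

Lemma uuE (R : realType) (kap : R) n d (A : 'M[R]_(n, d)) : uu kap A = kap * (nnz A)%:R.
Proof. by []. Qed.

(** * Sampling *)

Section Sampling.
Variables (R : realType) (n d : nat) (A : 'M[R]_(n, d)) (D : sdata R).
Local Notation N := (nnz A).
Local Notation a i := (mxrow_vec A i).
Variables (ppi qq : nat -> R).

Definition rbase (i : nat) : nat := start D (off D i).
Definition rlength (i : nat) : nat := (start D (off D i.+1) - start D (off D i))%N.

(** A uniform table cell yields entry [p] of the chosen row with probability [ppi p], and row [i]
    with probability [qq i]. [gam] and [rfac] are the importance weights that make the samples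
    unbiased. The factors 2 and the summand [1 / N] are the price of rounding weights up to numbers
    of table cells. *)
Record ssamp : Prop := SSamp {
  sa_len : forall i, (i < n)%N -> (0 < rlength i)%N;
  sa_tab : forall i r, (i < n)%N -> (r < rlength i)%N -> (tab D (r + rbase i) < N)%N;
  sa_avg : forall i (f : nat -> R), (i < n)%N ->
    (\sum_(r < rlength i) f (tab D (r + rbase i)%N)) / (rlength i)%:R =
    \sum_(p < N | erow D p == i) ppi p * f p;
  sa_ppi : forall (i : 'I_n) p, (p < N)%N -> erow D p = i ->
    [/\ 0 <= ppi p, ppi p * gam D p = evl D p & `|gam D p| <= 2 * norm1 (a i)];
  sa_rlen : (0 < rlen D)%N;
  sa_rtab : forall r, (r < rlen D)%N -> (rtab D r < n)%N;
  sa_ravg : forall f : nat -> R,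
    (\sum_(r < rlen D) f (rtab D r)) / (rlen D)%:R = \sum_(i < n) qq i * f i;
  sa_qq : forall i : 'I_n, [/\ 0 <= qq i, qq i * rfac D i = 1, 0 <= rfac D i,
    rfac D i * dot (a i) (a i) <= 2 * frob2 A &
    qq i <= dot (a i) (a i) / frob2 A + N%:R^-1];
  sa_rs : forall i : 'I_n, rs D i = rsp A i;
  sa_W : sW D = \sum_i norm1 (a i) ^+ 2;
  sa_X : sX D = \sum_i norm2 (a i) * norm1 (a i) }.

Hypothesis good : sgood A D.
Hypothesis samp : ssamp.
Hypothesis arow : forall i, 0 < dot (a i) (a i).

Definition vn (Y : 'cV[R]_d) (j : nat) : R :=
  if insub j is Some j' then Y j' 0 else 0.

Lemma vnE Y (j : 'I_d) : vn Y j = Y j 0.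
Proof. by rewrite /vn valK. Qed.

Lemma entry_row (i : 'I_n) (h : nat -> R -> R) :
  (forall j, h j 0 = 0) ->
  \sum_(p < N | erow D p == i) h (ecol D p) (evl D p) = \sum_(j < d) h j (A i j).
Proof.
move=> h0; rewrite big_mkcond /=.
have /= -> := sg_entry good (fun i' j v => if i' == i then h j v else 0).
rewrite (bigD1 i) //= [X in _ + X]big1 ?addr0; last first.
  move=> i' /negbTE; rewrite -val_eqE /= => e.
  by apply: big1 => j _; rewrite e if_same.
apply: eq_bigr => j _; rewrite eqxx; case: (eqVneq (A i j) 0) => [->|//].
by rewrite h0.
Qed.

Lemma row_dot (i : 'I_n) (Y : 'cV[R]_d) :
  \sum_(p < N | erow D p == i) evl D p * vn Y (ecol D p) = dot (a i) Y.
Proof.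
rewrite (@entry_row i (fun j v => v * vn Y j)); last by move=> j; rewrite mul0r.
by apply: eq_bigr => j _; rewrite vnE !mxE.
Qed.

Lemma ppi_dot (i : 'I_n) (Y : 'cV[R]_d) :
  \sum_(p < N | erow D p == i) ppi p * (gam D p * vn Y (ecol D p)) = dot (a i) Y.
Proof.
rewrite -row_dot; apply: eq_bigr => p /eqP Ep.
by have [_ <- _] := sa_ppi samp (ltn_ord p) Ep; rewrite mulrA.
Qed.

Lemma ppi_sum (i : 'I_n) : \sum_(p < N | erow D p == i) ppi p = 1.
Proof.
have := sa_avg samp (fun=> 1) (ltn_ord i).
rewrite sumr_const card_ord divff; last by rewrite pnatr_eq0 -lt0n (sa_len samp).
by move=> ->; apply: eq_bigr => p _; rewrite mulr1.
Qed.

(** Second moments rather than variances: keeping the squared mean only enlarges the bounds. *)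
Definition var_out (i : 'I_n) : R := \sum_(p < N | erow D p == i) ppi p * gam D p ^+ 2.
Definition var_in (i : 'I_n) (Y : 'cV[R]_d) : R :=
  \sum_(p < N | erow D p == i) ppi p * (gam D p * vn Y (ecol D p)) ^+ 2.

(** One factor [gam] cancels the probability and leaves the entry itself; the other is at most twice
    the 1-norm of the row. *)
Lemma var_in_bound i Y :
  0 <= var_in i Y <= 2 * norm1 (a i) * \sum_j `|A i j| * Y j 0 ^+ 2.
Proof.
apply/andP; split.
  by apply: sumr_ge0 => p /eqP Ep; have [h _ _] := sa_ppi samp (ltn_ord p) Ep;
    rewrite mulr_ge0 ?sqr_ge0.
have -> : \sum_j `|A i j| * Y j 0 ^+ 2 =
    \sum_(p < N | erow D p == i) `|evl D p| * vn Y (ecol D p) ^+ 2.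
  rewrite (@entry_row i (fun j v => `|v| * vn Y j ^+ 2)).
    by apply: eq_bigr => j _; rewrite vnE.
  by move=> j; rewrite normr0 mul0r.
rewrite mulr_sumr; apply: ler_sum => p /eqP Ep.
have [h0 h1 h2] := sa_ppi samp (ltn_ord p) Ep.
have -> : ppi p * (gam D p * vn Y (ecol D p)) ^+ 2 =
   (ppi p * gam D p) * gam D p * vn Y (ecol D p) ^+ 2 by ring.
rewrite h1 [leRHS]mulrA ler_wpM2r ?sqr_ge0 //.
by apply: le_trans (ler_norm _) _; rewrite normrM mulrC ler_wpM2r.
Qed.

Lemma var_out_bound i : 0 <= var_out i <= 4 * norm1 (a i) ^+ 2.
Proof.
apply/andP; split.
  by apply: sumr_ge0 => p /eqP Ep; have [h _ _] := sa_ppi samp (ltn_ord p) Ep;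
    rewrite mulr_ge0 ?sqr_ge0.
have -> : 4 * norm1 (a i) ^+ 2 =
    \sum_(p < N | erow D p == i) ppi p * (4 * norm1 (a i) ^+ 2).
  by rewrite -mulr_suml ppi_sum mul1r.
apply: ler_sum => p /eqP Ep.
have [h0 h1 h2] := sa_ppi samp (ltn_ord p) Ep.
rewrite ler_wpM2l // -real_normK ?num_real //.
have -> : 4 * norm1 (a i) ^+ 2 = (2 * norm1 (a i)) ^+ 2 by ring.
by rewrite lerXn2r // nnegrE mulr_ge0 // norm1_ge0.
Qed.

End Sampling.

(** * Expected effect of one stochastic step of the program *)

Section Step.
Variables (R : realType) (P : store R -> Prop) (kap : R).
Hypothesis kap0 : 0 <= kap.
Variables (n d : nat) (A : 'M[R]_(n, d)) (D : sdata R) (ppi qq : nat -> R).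
Local Notation N := (nnz A).
Local Notation a i := (mxrow_vec A i).
Hypothesis good : sgood A D.
Hypothesis samp : ssamp A D ppi qq.
Hypothesis arow : forall i, 0 < dot (a i) (a i).
Implicit Types (s : store R) (k : seq program).
Local Notation B := (@bnd R P kap).
Local Notation stat := (stat A D).
Local Notation cv := (@cv R d D).
Local Notation cls := (cls D).

Definition cw s : 'cV[R]_d := rreg s 23 *: cv (rarr s 12) + rreg s 24 *: cv (rarr s 11).

Lemma vn_cw s c : c \in cls -> (c < d)%N ->
  vn (cw s) c = rreg s 23 * rarr s 12 c + rreg s 24 * rarr s 11 c.
Proof. by move=> h hd; rewrite /vn insubT /cw !mxE /= h. Qed.

Lemma cls_lt c : c \in cls -> (c < d)%N.
Proof. by case/mem_cls => q hq ->; exact: sg_lt good _ hq. Qed.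

Definition rowst (i : 'I_n) (M : nat) s : Prop :=
  [/\ stat s, ireg s 22 = rlength D i, ireg s 23 = rbase D i, rreg s 45 = 1 &
      forall j : nat, (j%:R < rreg s 28) = (j < M)%N].

(** What follows the loop is assumed to have a loss quadratic in the sum accumulated in register 26;
    its expectation then depends on the mean and the second moment of a sample only. [outloop]
    produces a loss of this form. *)
Lemma zloop nn (i : 'I_n) M m k s x (a2 a1 a0 : R) : 0 <= a2 ->
  rowst i M s -> (m <= M)%N -> rreg s 27 = (M - m)%:R ->
  (forall s', frm [:: 24; 11]%N [:: 26; 27; 40; 41]%N [::] [::] s s' ->
     rreg s' 27 = M%:R ->
     B nn k s' (a2 * rreg s' 26 ^+ 2 + a1 * rreg s' 26 + a0)) ->
  let w := cw s in
  let z := rreg s 26 + m%:R * dot (a i) w in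
  a2 * (z ^+ 2 + m%:R * var_in A D ppi i w) + a1 * z + a0 + kap * (30 * m%:R + 1) <= x ->
  B nn (While (RLt 27 28) (Sample sample_in) :: k) s x.
Proof.
move=> a20; elim: m s x => [|m IH] s x rw mM e27 H w z Hx.
  have [St e22 e23 e45 e28] := rw.
  apply: bnd_while => //=; rewrite e27 e28 subn0 ltnn.
  apply: bnd_le (H s (frm_refl _ _ _ _ _) _); last by rewrite e27 subn0.
  by move: Hx; rewrite /z !mul0r !addr0 mulr0 add0r; lra.
have [St e22 e23 e45 e28] := rw.
apply: bnd_while => //=; rewrite e27 e28.
have -> : (M - m.+1 < M)%N by lia.
apply: bnd_seq => //.
have len0 := sa_len samp (ltn_ord i).
have vin0 : 0 <= var_in A D ppi i w by have /andP[] := var_in_bound good samp i w.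
have [V EV] : exists V, V = var_in A D ppi i w by eexists.
rewrite -EV in vin0 Hx.
pose xi p := gam D p * vn w (ecol D p).
pose gz (y : R) := a2 * (y ^+ 2 + m%:R * V) + a1 * y + a0
  + kap * (30 * m%:R + 1) + kap * 25.
pose g p := gz (rreg s 26 + xi p + m%:R * dot (a i) w).
apply: (@bnd_rand _ _ _ kap0 _ _ _ _ _ _ (fun r => g (tab D (r + rbase D i)%N))).
- by rewrite e22.
- rewrite e22 => r rl; apply: bnd_blk => //.
  set s1 := execs _ _.
  have f1 : frm [:: 24; 11]%N [:: 26; 27; 40; 41]%N [::] [::] s s1.
    have f0 : frm [:: 24; 11]%N [:: 26; 27; 40; 41]%N [::] [::] s (set_ireg s 24 r).
      by split=> b //=; rewrite /upd !inE negb_or => /andP[/negbTE-> _].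
    by apply: frm_trans f0 _; apply: frm_sub (frm_execs _ _).
  have pN := sa_tab samp (ltn_ord i) rl.
  have cc := sg_col good pN.
  have e26 : rreg s1 26 = rreg s 26 + xi (tab D (r + rbase D i)).
    rewrite /s1 /= /upd /= e23 (st_tab St) (st_col St) (st_gam St) /xi.
    by rewrite (vn_cw _ cc (cls_lt cc)); ring.
  have e27' : rreg s1 27 = (M - m)%:R.
    by rewrite /s1 /= /upd /= e27 e45 natr1; congr _%:R; lia.
  have rw1 : rowst i M s1.
    split; rewrite ?(frm_i f1) ?(frm_r f1) //.
    by apply: stat_frm f1 _ _ _ St.
  have cw1 : cw s1 = w by rewrite /cw !(frm_r f1) // !(frm_ra f1).
  apply: (IH s1 _ rw1 (ltnW mM) e27').
    move=> s' f' E'; apply: H => //; exact: frm_trans f1 f'.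
  rewrite cw1 -EV e26 /g /gz /=; set q := a2 * _ + _ + _ + _ * (30 * _ + _).
  by have := kap0; lra.
rewrite e22 (sa_avg samp g (ltn_ord i)).
have E : \sum_(p < N | erow D p == i) ppi p * g p =
  a2 * ((rreg s 26 + m%:R * dot (a i) w) ^+ 2
        + 2 * (rreg s 26 + m%:R * dot (a i) w) * dot (a i) w
        + V + m%:R * V)
  + a1 * (rreg s 26 + m%:R * dot (a i) w + dot (a i) w) + a0
  + kap * (30 * m%:R + 1) + kap * 25.
  set Z := rreg s 26 + _ * _.
  transitivity ((a2 * (Z ^+ 2 + m%:R * V) + a1 * Z + a0
     + kap * (30 * m%:R + 1) + kap * 25) * (\sum_(p < N | erow D p == i) ppi p)
     + (2 * a2 * Z + a1) * (\sum_(p < N | erow D p == i) ppi p * xi p)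
     + a2 * (\sum_(p < N | erow D p == i) ppi p * xi p ^+ 2)).
    rewrite !mulr_sumr -!big_split /=; apply: eq_bigr => p _.
    rewrite /g (_ : rreg s 26 + xi p + m%:R * dot (a i) w = Z + xi p); last by rewrite /Z; ring.
    by rewrite /gz; move: Z => z1; ring.
  by rewrite (ppi_sum samp) (ppi_dot good samp) -/(var_in A D ppi i w) -EV; ring.
rewrite E; move: Hx; rewrite /z -natr1.
(* The second moment stands in for the variance, so the squared mean is given away. *)
have := sqr_ge0 (dot (a i) w); have := kap0.
set q := dot (a i) w; set y := rreg s 26.
move=> k0 q0 Hx; have : 0 <= a2 * q ^+ 2 by rewrite mulr_ge0.
by move: Hx; lra.
Qed.

(** The counterpart for vectors: the loss afterwards is affine in the squared distance to [ws], and
    each sample adds to the iterate a multiple of a unit vector with mean [zeta] times the row. *)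
Lemma outloop nn (i : 'I_n) M m k s x (ws : 'cV[R]_d) (Ac Bc : R) : 0 <= Ac ->
  rowst i M s -> (m <= M)%N -> rreg s 27 = (M - m)%:R ->
  (forall s', frm [:: 24; 11]%N [:: 27; 40; 41]%N [::] [:: 12]%N s s' ->
     B nn k s' (Ac * dot (cw s' - ws) (cw s' - ws) + Bc)) ->
  forall zeta U, zeta = rreg s 23 * rreg s 26 -> U = cw s - ws + (m%:R * zeta) *: a i ->
  Ac * (dot U U + m%:R * zeta ^+ 2 * var_out A D ppi i) + Bc + kap * (30 * m%:R + 1) <= x ->
  B nn (While (RLt 27 28) (Sample sample_out) :: k) s x.
Proof.
move=> Ac0; elim: m s x => [|m IH] s x rw mM e27 H zeta U Ez EU Hx.
  have [St e22 e23 e45 e28] := rw.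
  apply: bnd_while => //=; rewrite e27 e28 subn0 ltnn.
  apply: bnd_le (H s (frm_refl _ _ _ _ _)).
  by move: Hx; rewrite EU !mul0r scale0r !addr0 mulr0 add0r; lra.
have [St e22 e23 e45 e28] := rw.
apply: bnd_while => //=; rewrite e27 e28.
have -> : (M - m.+1 < M)%N by lia.
apply: bnd_seq => //.
have len0 := sa_len samp (ltn_ord i).
have vout0 : 0 <= var_out A D ppi i by have /andP[] := var_out_bound samp i.
have [V EV] : exists V, V = var_out A D ppi i by eexists.
rewrite -EV in Hx vout0.
pose Y := cw s - ws + (m%:R * zeta) *: a i.
pose g p := Ac * (dot Y Y + 2 * zeta * (gam D p * vn Y (ecol D p)) + zeta ^+ 2 * gam D p ^+ 2
   + m%:R * zeta ^+ 2 * V) + Bc + kap * (30 * m%:R + 1) + kap * 25.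
apply: (@bnd_rand _ _ _ kap0 _ _ _ _ _ _ (fun r => g (tab D (r + rbase D i)%N))).
- by rewrite e22.
- rewrite e22 => r rl; apply: bnd_blk => //.
  set s1 := execs _ _.
  have f1 : frm [:: 24; 11]%N [:: 27; 40; 41]%N [::] [:: 12]%N s s1.
    have f0 : frm [:: 24; 11]%N [:: 27; 40; 41]%N [::] [:: 12]%N s (set_ireg s 24 r).
      by split=> b //=; rewrite /upd !inE negb_or => /andP[/negbTE-> _].
    by apply: frm_trans f0 _; apply: frm_sub (frm_execs _ _).
  set p := tab D (r + rbase D i).
  have pN : (p < N)%N := sa_tab samp (ltn_ord i) rl.
  have cc := sg_col good pN; have cd := cls_lt cc.
  have e27' : rreg s1 27 = (M - m)%:R.
    by rewrite /s1 /= /upd /= e27 e45 natr1; congr _%:R; lia.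
  have rw1 : rowst i M s1.
    split; rewrite ?(frm_i f1) ?(frm_r f1) //.
    by apply: stat_frm f1 _ _ _ St.
  pose ec : 'cV[R]_d := delta_mx (Ordinal cd) 0.
  have cw1 : cw s1 = cw s + (zeta * gam D p) *: ec.
    have a12 : rarr s1 12 = upd (rarr s 12) (ecol D p) (rarr s 12 (ecol D p) + rreg s 26 * gam D p).
      by rewrite /s1 /= /upd /= e23 (st_tab St) (st_col St) (st_gam St).
    have a11 : rarr s1 11 = rarr s 11 by rewrite (frm_ra f1).
    apply/colP => j; rewrite /cw !(frm_r f1) // a11 a12 !mxE Ez.
    rewrite /upd -val_eqE /= eqxx andbT.
    case: eqP => [->|_]; last by rewrite mulr0 addr0.
    by rewrite cc -[true%:R]/(1 : R); ring.
  apply: (IH s1 _ rw1 (ltnW mM) e27' _ zeta (Y + (zeta * gam D p) *: ec)).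
  - move=> s' f'; apply: H => //; exact: frm_trans f1 f'.
  - by rewrite !(frm_r f1).
  - by rewrite cw1 /Y; apply/colP => j; rewrite !mxE; ring.
  have dec (Z : 'cV[R]_d) : dot ec Z = vn Z (ecol D p).
    rewrite /vn insubT /= /dot (bigD1 (Ordinal cd)) //= big1 ?addr0.
      rewrite mxE !eqxx mul1r; congr (Z _ _); exact: val_inj.
    by move=> j /negbTE jc; rewrite mxE jc mul0r.
  have dY (Y' : 'cV[R]_d) : dot (Y' + (zeta * gam D p) *: ec) (Y' + (zeta * gam D p) *: ec) =
     dot Y' Y' + 2 * zeta * (gam D p * vn Y' (ecol D p)) + zeta ^+ 2 * gam D p ^+ 2.
    have vec : vn ec (ecol D p) = 1.
      by rewrite /vn insubT mxE (_ : Sub _ _ = Ordinal cd) ?eqxx //; exact: val_inj.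
    by rewrite !dotE (dotC Y') !dec vec; ring.
  rewrite dY.
  by rewrite /g -EV; set q := Ac * _ + Bc + _; rewrite /=; have := kap0; lra.
rewrite e22 (sa_avg samp g (ltn_ord i)).
have E : \sum_(p < N | erow D p == i) ppi p * g p =
  Ac * (dot Y Y + 2 * zeta * dot (a i) Y + zeta ^+ 2 * V + m%:R * zeta ^+ 2 * V) + Bc
  + kap * (30 * m%:R + 1) + kap * 25.
  transitivity ((Ac * (dot Y Y + m%:R * zeta ^+ 2 * V) + Bc + kap * (30 * m%:R + 1) + kap * 25)
     * (\sum_(p < N | erow D p == i) ppi p)
     + (Ac * 2 * zeta) * (\sum_(p < N | erow D p == i) ppi p * (gam D p * vn Y (ecol D p)))
     + (Ac * zeta ^+ 2) * (\sum_(p < N | erow D p == i) ppi p * gam D p ^+ 2)).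
    rewrite !mulr_sumr -!big_split /=; apply: eq_bigr => p _.
    by rewrite /g; move: (dot Y Y) (vn Y _) => y1 y2; ring.
  by rewrite (ppi_sum samp) (ppi_dot good samp) -/(var_out A D ppi i) -EV; ring.
rewrite E; move: Hx.
have -> : U = Y + zeta *: a i.
  by rewrite EU /Y -natr1; apply/colP => j; rewrite !mxE; ring.
move: Y (a i) {E g} (arow i) => Y ai; rewrite !dotE (dotC ai Y) -natr1 => ai0 Hx.
have : 0 <= Ac * (zeta * zeta * dot ai ai) by rewrite mulr_ge0 // mulr_ge0 ?dot_ge0 // -expr2 sqr_ge0.
have := kap0; set mm : R := m%:R in Hx *.
by move: Hx; rewrite !expr2 => Hx k0 h; lra.
Qed.

End Step.

(** * Linear systems *)

(** Concavity of the logarithm. It replaces a logarithmic potential by an affine function of the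
    squared error, whose expectation is known. *)
Lemma ln_tangent (R : realType) (b c : R) : 0 < b -> 0 < c -> ln b <= ln c + (b - c) / c.
Proof.
move=> b0 c0; have -> : b = c * (1 + (b - c) / c) by field; rewrite gt_eqF.
have h : 0 < 1 + (b - c) / c.
  by have -> : 1 + (b - c) / c = b / c by [field; rewrite gt_eqF]; rewrite divr_gt0.
rewrite lnM ?posrE // lerD2l; apply: le_trans (le_ln1Dx _) _; first by lra.
by rewrite [leLHS](_ : _ = (c * (1 + (b - c) / c) - c) / c) //; field; rewrite gt_eqF.
Qed.

Lemma step_budget (R : realType) (k a1 a2 b q x : R) : 0 <= k -> a1 <= a2 ->
  a2 + b + k * (200 + 60 * q) <= x -> a1 + b + k * (60 * q + 190) + k <= x - k.
Proof. by lra. Qed.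

Section Solve.
Variables (R : realType) (P : store R -> Prop) (kap : R).
Hypothesis kap0 : 0 <= kap.
Variables (n d : nat) (A : 'M[R]_(n, d)) (D : sdata R) (ppi qq : nat -> R).
Local Notation N := (nnz A).
Local Notation a i := (mxrow_vec A i).
Hypothesis good : sgood A D.
Hypothesis samp : ssamp A D ppi qq.
Hypothesis arow : forall i, 0 < dot (a i) (a i).
Implicit Types (s : store R) (k : seq program).
Local Notation B := (@bnd R P kap).
Local Notation stat := (stat A D).
Local Notation cv := (@cv R d D).
Local Notation cls := (cls D).
Local Notation cw := (@cw R d D).
Local Notation uu := (uu kap A).
Local Notation F := (frob2 A).

Variables (lam1 Lam sig mu eta V : R).
Hypothesis Lam0 : 0 < Lam.
Hypothesis lamLam : lam1 <= Lam.
Hypothesis Hlam : forall x, dot x (gram A *m x) <= lam1 * dot x x.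
Hypothesis F0 : 0 < F.

Definition batch (i : 'I_n) : nat := nceil (rsp A i * (rsp A i + sF A Lam)).
(** The expected batch size of a step. *)
Definition qM : R := \sum_(i < n) qq i * (batch i)%:R.

Lemma qq_sum : \sum_(i < n) qq i = 1.
Proof.
have := sa_ravg samp (fun=> 1); rewrite sumr_const card_ord divff; last first.
  by rewrite pnatr_eq0 -lt0n (sa_rlen samp).
by move=> ->; apply: eq_bigr => i _; rewrite mulr1.
Qed.

Lemma sF_ge0 : 0 <= sF A Lam. Proof. exact: sqrtr_ge0. Qed.

Lemma batch_ge i : rsp A i * (rsp A i + sF A Lam) <= (batch i)%:R.
Proof. exact: nceil_ge. Qed.

Lemma batch_gt0 i : (0 < batch i)%N.
Proof.
by apply: nceil_gt0; have := rsp_ge1 arow i; have := sF_ge0; nra.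
Qed.

Definition stepR := [:: 23; 24; 25; 26; 27; 28; 40; 41; 45]%N.

Definition step_rest : program := Seqs [:: Blk step_pre;
  While (RLt 27 28) (Sample sample_in); Blk step_mid;
  While (RLt 27 28) (Sample sample_out); Blk [:: RAdd 25 25 45] ].

Definition row_cost (Ac Bc : R) (u w : 'cV[R]_d) (i : 'I_n) : R :=
  Ac * (dot u u + 2 * eta * rfac D i * (dot (a i) u * dot (a i) w)
    + eta ^+ 2 * rfac D i ^+ 2 * ((dot (a i) (a i) + var_out A D ppi i / (batch i)%:R)
        * (dot (a i) w ^+ 2 + var_in A D ppi i w / (batch i)%:R)))
  + Bc + kap * (60 * (batch i)%:R + 190).

(** The two sampling loops composed backwards: [outloop] turns the loss after the step into a
    quadratic in the sampled inner product, which is the postcondition required by [zloop]. *)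
Lemma step_row nn k s (ws u w : 'cV[R]_d) (Ac Bc : R) r (il : (rtab D r < n)%N) : 0 <= Ac -> stat s ->
  rreg s 12 = sig -> rreg s 15 = eta -> rreg s 17 = sF A Lam ->
  0 < rreg s 23 -> 0 < 1 - eta * sig ->
  (forall s', frm WI stepR [::] [:: 12]%N s s' ->
     rreg s' 23 = rreg s 23 * (1 - eta * sig) -> rreg s' 25 = rreg s 25 + 1 ->
     B nn k s' (Ac * dot (cw s' - ws) (cw s' - ws) + Bc)) ->
  w = cw s -> u = (1 - eta * sig) *: w + eta *: cv (rarr s 11) - ws ->
  B nn (step_rest :: k) (set_ireg s 20 r) (row_cost Ac Bc u w (Ordinal il)).
Proof.
move=> Ac0 St e12 e15 e17 al0 es0 H Ew Eu; pose i := Ordinal il.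
  pose M := batch i; have M0 : (0 < M)%N := batch_gt0 i.
  have MR : (M%:R : R) != 0 by rewrite pnatr_eq0 -lt0n.
  apply: bnd_seq => //; apply: bnd_blk => //.
  set s0 := set_ireg s 20 r; set s1 := execs _ _.
  have f0 : frm WI stepR [::] [:: 12]%N s s0.
    by split=> b //= Hb; rewrite /upd; case: eqP => // E; move: Hb; rewrite E.
  have f1 : frm WI stepR [::] [:: 12]%N s s1.
    by apply: frm_trans f0 _; apply: frm_sub (frm_execs _ _).
  have St1 : stat s1 by apply: stat_frm f1 _ _ _ St.
  have e28 : rreg s1 28 = rsp A i * (rsp A i + sF A Lam).
    by rewrite /s1 rvalE /= (st_rtab St) (st_rs St) e17 -[rtab D r]/(nat_of_ord i) (sa_rs samp).
  have fp := frm_execs step_pre s0.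
  have e23 : rreg s1 23 = rreg s 23 by rewrite (frm_r fp).
  have e24 : rreg s1 24 = rreg s 24 by rewrite (frm_r fp).
  have e25 : rreg s1 25 = rreg s 25 by rewrite (frm_r fp).
  have a12 b : rarr s1 b = rarr s b by rewrite (frm_ra fp).
  have cw1 : cw s1 = w by rewrite Ew /cw e23 e24 !a12.
  have rw1 : rowst A D i M s1.
    split=> //.
    - by rewrite /s1 ivalE /= (st_rtab St) (st_off St) (st_start St) addn1.
    - by rewrite /s1 ivalE /= (st_rtab St) (st_off St) (st_start St).
    - by move=> j; rewrite e28 nceilP.
  have e26 : rreg s1 26 = 0 by rewrite /s1 rvalE.
  have e27 : rreg s1 27 = (M - M)%:R by rewrite subnn /s1 rvalE.
  have i21 : ireg s1 21 = i by rewrite /s1 ivalE /= (st_rtab St).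
  apply: bnd_seq => //.
  (* For a sum [z] of [M] samples, [c * z] is the coefficient of the row in this step: [z / M]
     estimates the inner product and [f] corrects for the row probability. *)
  pose f := rfac D i; pose c := f * eta / M%:R.
  pose V2 := var_out A D ppi i; pose V1 := var_in A D ppi i w.
  have V20 : 0 <= V2 by have /andP[] := var_out_bound samp i.
  apply: (@zloop R P kap kap0 n d A D ppi qq good samp nn i M M _ s1 _
    (Ac * (c ^+ 2 * (dot (a i) (a i) + V2 / M%:R))) (Ac * (2 * c * dot (a i) u))
    (Ac * dot u u + Bc + kap * (30 * M%:R + 60)) _ rw1 (leqnn M) e27).
  + by rewrite mulr_ge0 // mulr_ge0 ?sqr_ge0 // addr_ge0 ?dot_ge0 // divr_ge0.
  + move=> s2 f2 e27'; apply: bnd_seq => //; apply: bnd_blk => //.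
    set s3 := execs _ s2.
    have g23 : rreg s2 23 = rreg s 23 by rewrite (frm_r f2).
    have g24 : rreg s2 24 = rreg s 24 by rewrite (frm_r f2).
    have g45 : rreg s2 45 = 1 by rewrite (frm_r f2) // /s1 rvalE.
    have g12 : rreg s2 12 = sig by rewrite (frm_r f2) // (frm_r f1).
    have g15 : rreg s2 15 = eta by rewrite (frm_r f2) // (frm_r f1).
    have g6 : rarr s2 6 = rfac D by rewrite (frm_ra f2) // (st_rfac St1).
    have h23 : rreg s3 23 = rreg s 23 * (1 - eta * sig).
      by rewrite /s3 rvalE /= g23 g45 g15 g12.
    have h24 : rreg s3 24 = rreg s 24 * (1 - eta * sig) + eta.
      by rewrite /s3 rvalE /= g24 g45 g15 g12.
    have f3 : frm WI stepR [::] [:: 12]%N s s3.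
      apply: frm_trans (_ : frm WI stepR [::] [:: 12]%N s2 s3); last by apply: frm_sub (frm_execs _ _).
      by apply: frm_trans f1 _; apply: frm_sub f2.
    have a3 : rarr s3 =1 rarr s by move=> b; rewrite -a12 -(frm_ra f2) // /s3 (frm_ra (frm_execs step_mid s2)).
    have rw3 : rowst A D i M s3.
      have [St1' r22 r23 r45 r28] := rw1.
      split; first by apply: stat_frm f3 _ _ _ St.
      - by rewrite /s3 ivalE /= (frm_i f2).
      - by rewrite /s3 ivalE /= (frm_i f2).
      - by rewrite /s3 rvalE /= (frm_r f2).
      - by move=> j; rewrite /s3 rvalE /= (frm_r f2).
    have h27 : rreg s3 27 = (M - M)%:R by rewrite subnn /s3 rvalE /= subrr.
    have h26 : rreg s3 26 = rreg s2 26 * f * eta / (M%:R * M%:R * (rreg s 23 * (1 - eta * sig))).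
      by rewrite /s3 rvalE /= g23 g45 g15 g12 g6 e27' (frm_i f2) // i21.
    have cw3 : cw s3 - ws = u.
      rewrite Eu Ew /cw h23 h24 !a3; congr (_ - _).
      by apply/colP => j; rewrite !mxE; ring.
    apply: bnd_seq => //.
    apply: (@outloop R P kap kap0 n d A D ppi qq good samp arow nn i M M _ s3 _ ws Ac (Bc + kap * 10) Ac0 rw3 (leqnn M) h27 _
       (c * rreg s2 26 / M%:R) (u + (c * rreg s2 26) *: a i)).
    * move=> s4 f4; apply: bnd_seq => //; apply: bnd_blk => //.
      set s5 := execs _ s4; apply: bnd_skip => //.
      have f5 : frm WI stepR [::] [:: 12]%N s s5.
        apply: frm_trans (_ : frm WI stepR [::] [:: 12]%N s4 s5); last by apply: frm_sub (frm_execs _ _).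
        by apply: frm_trans f3 _; apply: frm_sub f4.
      have fq := frm_execs [:: RAdd 25 25 45] s4.
      have E23 : rreg s5 23 = rreg s4 23 by rewrite (frm_r fq).
      have cw5 : cw s5 = cw s4 by rewrite /cw !(frm_r fq) // !(frm_ra fq).
      rewrite -cw5; apply: bnd_le (H s5 f5 _ _).
      - by clear h23 h24 h26 h27 E23; rewrite /=; have := kap0; lra.
      - by rewrite E23 (frm_r f4).
      - by rewrite /s5 rvalE /= !(frm_r f4) // /s3 !rvalE /= !(frm_r f2) // -/s1 e25 /s1 rvalE.
    * by rewrite h23 h26 /c; field; rewrite MR !gt_eqF.
    * by rewrite cw3; congr (_ + _ *: _); field.
    have -> : dot (u + (c * rreg s2 26) *: a i) (u + (c * rreg s2 26) *: a i) =
        dot u u + 2 * (c * rreg s2 26) * dot (a i) u + (c * rreg s2 26) ^+ 2 * dot (a i) (a i).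
      by rewrite !dotE (dotC u); ring.
    rewrite -/V2; have := kap0; set z := rreg s2 26; move=> k0.
    have -> : M%:R * (c * z / M%:R) ^+ 2 * V2 = (c * z) ^+ 2 * (V2 / M%:R) by field.
    by clear h23 h24 h26 h27; rewrite /=; lra.
  rewrite cw1 e26 add0r -/V1 /row_cost -/i -/M -/f -/V2 -/V1.
  have -> : eta ^+ 2 * f ^+ 2 * ((dot (a i) (a i) + V2 / M%:R) * (dot (a i) w ^+ 2 + V1 / M%:R))
    = c ^+ 2 * (dot (a i) (a i) + V2 / M%:R) * ((M%:R * dot (a i) w) ^+ 2 + M%:R * V1).
    by rewrite /c; field.
  have -> : 2 * eta * f * (dot (a i) u * dot (a i) w) = 2 * c * dot (a i) u * (M%:R * dot (a i) w).
    by rewrite /c; field.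
  rewrite /=; have := kap0; lra.
Qed.

(** Average over the rows: [rfac] cancels the row probability in the linear term, and in the
    quadratic term one of its two factors remains and is handled by [svrg_variance]. *)
Lemma stepM nn k s x (ws : 'cV[R]_d) (Ac Bc : R) : 0 <= Ac -> stat s ->
  rreg s 12 = sig -> rreg s 15 = eta -> rreg s 17 = sF A Lam ->
  0 < rreg s 23 -> 0 < 1 - eta * sig ->
  (forall s', frm WI stepR [::] [:: 12]%N s s' ->
     rreg s' 23 = rreg s 23 * (1 - eta * sig) -> rreg s' 25 = rreg s 25 + 1 ->
     B nn k s' (Ac * dot (cw s' - ws) (cw s' - ws) + Bc)) ->
  forall u, u = (1 - eta * sig) *: cw s + eta *: cv (rarr s 11) - ws ->
  Ac * (dot u u + 2 * eta * dot u (gram A *m cw s)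
      + eta ^+ 2 * (30 * F * Lam) * dot (cw s) (cw s)) + Bc + kap * (200 + 60 * qM) <= x ->
  B nn (Step :: k) s x.
Proof.
move=> Ac0 St e12 e15 e17 al0 es0 H u Eu Hx.
have [w Ew] : exists w, w = cw s by eexists.
rewrite -Ew in Eu Hx.
pose hq := row_cost Ac Bc u w.
pose hn (i : nat) : R := if insub i is Some i' then hq i' else 0.
have hnE (i : 'I_n) : hn i = hq i by rewrite /hn valK.
apply: bnd_seq => //.
apply: (@bnd_rand _ _ _ kap0 _ _ _ _ _ _ (fun r => hn (rtab D r))).
- by rewrite (st_rlen St) (sa_rlen samp).
- rewrite (st_rlen St) => r rl; have il := sa_rtab samp rl.
  pose i := Ordinal il.
  have -> : hn (rtab D r) = hq i by rewrite -[rtab D r]/(nat_of_ord i) hnE.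
  exact: step_row Ac0 St e12 e15 e17 al0 es0 H Ew Eu.
rewrite (st_rlen St) (sa_ravg samp hn).
have E : \sum_(i < n) qq i * hn i =
   Ac * (dot u u + 2 * eta * dot u (gram A *m w)
    + eta ^+ 2 * (\sum_(i < n) rfac D i * ((dot (a i) (a i) + var_out A D ppi i / (batch i)%:R)
        * (dot (a i) w ^+ 2 + var_in A D ppi i w / (batch i)%:R))))
   + Bc + kap * (60 * qM + 190).
  rewrite dot_gram /qM.
  have [c0 Ec0] : exists c0, c0 = Ac * dot u u + Bc + kap * 190 by eexists.
  transitivity (c0 * (\sum_(i < n) qq i)
   + Ac * (2 * eta) * (\sum_i dot (a i) u * dot (a i) w)
   + Ac * eta ^+ 2 * (\sum_(i < n) rfac D i * ((dot (a i) (a i) + var_out A D ppi i / (batch i)%:R)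
        * (dot (a i) w ^+ 2 + var_in A D ppi i w / (batch i)%:R)))
   + kap * 60 * (\sum_(i < n) qq i * (batch i)%:R)); last by rewrite qq_sum Ec0; ring.
  rewrite !mulr_sumr -!big_split /=; apply: eq_bigr => i _; rewrite hnE /hq /row_cost.
  have [_ qf _ _ _] := sa_qq samp i.
  move: (var_out _ _ _ _ / _) (var_in _ _ _ _ _ / _) => v2 v1.
  set t := (_ + v2) * (_ + v1).
  transitivity (qq i * (Ac * dot u u + Bc + kap * (60 * (batch i)%:R + 190))
    + Ac * 2 * eta * (qq i * rfac D i) * (dot (a i) u * dot (a i) w)
    + Ac * eta ^+ 2 * (qq i * rfac D i) * rfac D i * t); first by ring.
  by rewrite qf Ec0; ring.
rewrite E; have k0 := kap0.
have := svrg_variance arow Lam0 lamLam Hlam (f := fun i => rfac D i)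
  (v1 := fun i => var_in A D ppi i w) (v2 := fun i => var_out A D ppi i)
  (m := fun i => (batch i)%:R) (w := w) F0.
move=> sv.
have {}sv : \sum_(i < n) rfac D i * ((dot (a i) (a i) + var_out A D ppi i / (batch i)%:R)
        * (dot (a i) w ^+ 2 + var_in A D ppi i w / (batch i)%:R)) <= 30 * F * Lam * dot w w.
  apply: sv => i.
  - by have [_ _ ? ? _] := sa_qq samp i.
  - exact: (var_out_bound samp i).
  - exact: (var_in_bound good samp i w).
  - exact: batch_ge.
have {sv} sv2 : Ac * (dot u u + 2 * eta * dot u (gram A *m w)
    + eta ^+ 2 * (\sum_(i < n) rfac D i * ((dot (a i) (a i) + var_out A D ppi i / (batch i)%:R)
        * (dot (a i) w ^+ 2 + var_in A D ppi i w / (batch i)%:R)))) <=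
   Ac * (dot u u + 2 * eta * dot u (gram A *m w) + eta ^+ 2 * (30 * F * Lam) * dot w w).
  by rewrite ler_wpM2l // lerD2l -mulrA ler_wpM2l ?sqr_ge0.
move: sv2 Hx; set a1 := Ac * _; set a2 := Ac * _; move: a1 a2 => a1 a2.
set qm := qM; move: qm => qm h Hx.
exact: step_budget k0 h Hx.
Qed.

Local Notation shift := (shift (gram A) sig).
Hypothesis Hmu : forall x, mu * dot x x <= dot x (shift x).
Hypothesis Hsig : forall x, dot (shift x) (shift x) <= sig * dot x (shift x).
Hypothesis Hsig2 : forall x, dot (shift x) (shift x) <= sig ^+ 2 * dot x x.
Hypothesis mu0 : 0 < mu.
Hypothesis VE : V = 30 * F * Lam + mu ^+ 2.
Hypothesis etaE : eta = mu / (8 * V).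
Hypothesis etasig : eta * sig < 1.
Hypothesis sig0 : 0 < sig.

Lemma V_gt0 : 0 < V.
Proof. by rewrite VE ltr_wpDl ?exprn_gt0 // !mulr_ge0 // ltW. Qed.

Definition rate : R := 3 / 4 * (eta * mu).

Lemma rate_bounds : 0 < rate <= 1.
Proof.
have V0 := V_gt0; have m2 : 0 < mu ^+ 2 by rewrite exprn_gt0.
have mV : mu ^+ 2 <= V by rewrite VE lerDr !mulr_ge0 // ltW.
rewrite /rate etaE; apply/andP; split; first by rewrite !mulr_gt0 // invr_gt0 mulr_gt0.
have -> : 3 / 4 * (mu / (8 * V) * mu) = 3 / 32 * (mu ^+ 2 / V) by field; rewrite gt_eqF.
have : mu ^+ 2 / V <= 1 by rewrite ler_pdivrMr // mul1r.
by lra.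
Qed.

(** [W] is the fixed point of the affine recursion of [svrg_contraction], and the distance to it
    shrinks by [1 - rate] in every step. *)
Lemma epoch_loop nn Mt m k s x (ws : 'cV[R]_d) (Ac Bc : R) : 0 <= Ac -> stat s ->
  rreg s 12 = sig -> rreg s 15 = eta -> rreg s 17 = sF A Lam ->
  0 < rreg s 23 -> (forall j : nat, (j%:R < rreg s 16) = (j < Mt)%N) ->
  (m <= Mt)%N -> rreg s 25 = (Mt - m)%:R ->
  shift ws = cv (rarr s 11) ->
  (forall s', frm WI stepR [::] [:: 12]%N s s' ->
     B nn k s' (Ac * dot (cw s' - ws) (cw s' - ws) + Bc)) ->
  let W := dot ws ws / 3 in
  Ac * ((1 - rate) ^+ m * (dot (cw s - ws) (cw s - ws) - W) + W) + Bc
    + kap * (m%:R * (202 + 60 * qM) + 2) <= x ->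
  B nn (While (RLt 25 16) Step :: k) s x.
Proof.
move=> Ac0; have /andP[r0 r1] := rate_bounds.
elim: m s x => [|m IH] s x St e12 e15 e17 al0 e16 mM e25 Hws H W Hx.
  apply: bnd_while => //=; rewrite e25 e16 subn0 ltnn.
  apply: bnd_le (H s (frm_refl _ _ _ _ _)).
  by move: Hx; rewrite expr0 mul1r subrK; have := kap0; lra.
apply: bnd_while => //=; rewrite e25 e16.
have -> : (Mt - m.+1 < Mt)%N by rewrite ltn_subrL /= (leq_ltn_trans (leq0n m) mM).
have p0 : 0 <= (1 - rate) ^+ m by rewrite exprn_ge0 // subr_ge0.
pose Bc' := Ac * (W - (1 - rate) ^+ m * W) + Bc + kap * (m%:R * (202 + 60 * qM) + 2).
apply: (@stepM nn _ s _ ws (Ac * (1 - rate) ^+ m) Bc' _ St e12 e15 e17 al0 _ _ _ erefl).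
- by rewrite mulr_ge0.
- by rewrite subr_gt0.
- move=> s' f' E23 E25; apply: IH.
  + by apply: stat_frm f' _ _ _ St.
  + by rewrite (frm_r f').
  + by rewrite (frm_r f').
  + by rewrite (frm_r f').
  + by rewrite E23 mulr_gt0 // subr_gt0.
  + by move=> j; rewrite (frm_r f').
  + exact: ltnW.
  + by rewrite E25 e25 natr1 subnSK.
  + by rewrite (frm_ra f').
  + by move=> s2 f2; apply: H; apply: frm_trans f' f2.
  rewrite -/W /Bc'; set e := dot (cw s' - ws) _; set q := kap * _.
  by rewrite mulrBr; lra.
have := svrg_contraction Hmu Hsig mu0 V_gt0 etaE (ltW etasig) Hws erefl (w := cw s).
set u := (1 - eta * sig) *: cw s + _ - ws.
have -> : eta * mu / 4 * dot ws ws = rate * W by rewrite /rate /W; field.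
rewrite -/rate; set E := dot (cw s - ws) _ in Hx *; set q := dot (cw s) (cw s).
have q0 : 0 <= q by exact: dot_ge0.
have b0 : 0 <= eta ^+ 2 * dot (gram A *m cw s) (gram A *m cw s).
  by rewrite mulr_ge0 ?sqr_ge0 ?dot_ge0.
have vq : eta ^+ 2 * (30 * F * Lam) * q <= eta ^+ 2 * V * q.
  by rewrite ler_wpM2r // ler_wpM2l ?sqr_ge0 // VE lerDl sqr_ge0.
move=> hc.
have : dot u u + 2 * eta * dot u (gram A *m cw s) + eta ^+ 2 * (30 * F * Lam) * q
   <= (1 - rate) * E + rate * W by lra.
move/(ler_wpM2l (mulr_ge0 Ac0 p0)) => hd.
apply: le_trans (_ : Ac * (1 - rate) ^+ m * ((1 - rate) * E + rate * W) + Bc'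
   + kap * (200 + 60 * qM) <= _); first by lra.
move: Hx; rewrite /Bc' exprS -natr1 => Hx.
have := kap0; set p := (1 - rate) ^+ m in Hx *; set qm := qM in Hx *.
move: Hx; set mm : R := m%:R; move: rate => rt; lra.
Qed.

(** With 54, [rate * epochT] is 162 / 32, just above 5, so [geometric_le_inv] leaves a factor of at
    most 1 / 6. *)
Definition epochT : R := 54 * V / mu ^+ 2.

Variable cEp : R.
Hypothesis Hcost : (epochT + 1) * (202 + 60 * qM) <= cEp * N%:R.

(** The iterate starts at 0 and aims at the correction [ws], so the initial error is [ws] itself. In
    expectation at most 1/6 * 2/3 + 1/3 = 4/9 of its square is left. *)
Lemma epochM nn k s x (ws : 'cV[R]_d) (Ac Bc : R) : 0 <= Ac -> stat s ->
  rreg s 12 = sig -> rreg s 15 = eta -> rreg s 16 = epochT -> rreg s 17 = sF A Lam ->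
  shift ws = cv (rarr s 11) ->
  (forall s', frm WI stepR [::] [:: 10; 12]%N s s' ->
     forall e, e = cv (rarr s' 10) - (cv (rarr s 10) + ws) ->
     B nn k s' (Ac * dot e e + Bc)) ->
  Ac * (dot ws ws / 2) + Bc + (cEp + 200) * uu <= x ->
  B nn (Epoch :: k) s x.
Proof.
move=> Ac0 St e12 e15 e16 e17 Hws H Hx.
have u0 := uu_ge0 kap0 good; have ku := kap_uu kap0 good.
apply: (seqsM kap0 good).
apply: (@loopC _ _ _ kap0 _ _ _ _ good nn _ _ s _ [:: 40]%N [:: 12]%N (fun q r ar =>
  forall p, (p < q)%N -> ar 12%N (cl D p) = 0)) => //.
  move=> q s' qN e10 f E p; rewrite ltnS leq_eqVlt => /orP pq.
  have cE : iarr s' 3 = cl D by rewrite (frm_ia f) // (st_cl St).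
  rewrite /= /upd /= e10 cE; case: pq => [/eqP->|/E->]; first by rewrite eqxx.
  by rewrite if_same.
move=> s1 f1 E1; apply: (seqsM kap0 good); apply: (blkM kap0 good).
set s2 := execs _ s1; apply: (seqsM kap0 good).
have f2 : frm WI stepR [::] [:: 10; 12]%N s s2.
  apply: frm_trans (_ : frm WI stepR [::] [:: 10; 12]%N s1 s2); first by apply: frm_sub f1.
  by apply: frm_sub (frm_execs _ _).
have St2 : stat s2 by apply: stat_frm f2 _ _ _ St.
have cw2 : cw s2 = 0.
  rewrite /cw (_ : rreg s2 24 = 0) ?scale0r ?addr0; last by rewrite /s2 /= /upd.
  apply/colP => j; rewrite mxE cvE [RHS]mxE; case: ifP => [|_]; last by rewrite mulr0.
  by case/mem_cls => q hq ->; rewrite E1 // mulr0.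
pose Mt := nceil epochT.
have T0 : 0 < epochT by rewrite /epochT divr_gt0 ?exprn_gt0 // mulr_gt0 // V_gt0.
apply: (@epoch_loop nn Mt Mt _ s2 _ ws Ac (Bc + 60 * uu) Ac0 St2).
- by rewrite (frm_r f2).
- by rewrite (frm_r f2).
- by rewrite (frm_r f2).
- by rewrite /s2 /= /upd /=; lra.
- by move=> j; rewrite (frm_r f2) // e16 nceilP.
- by [].
- by rewrite subnn /s2 /= /upd.
- by rewrite Hws (frm_ra f2).
- move=> s3 f3; apply: (seqsM kap0 good).
  have St3 : stat s3 by apply: stat_frm f3 _ _ _ St2.
  apply: (@loopC _ _ _ kap0 _ _ _ _ good nn _ _ s3 _ [:: 40; 41]%N [:: 10]%N (fun q r ar =>
    forall j, j \in cls -> ar 10%N j = rarr s3 10 j +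
      if j \in take q cls then rreg s3 23 * rarr s3 12 j + rreg s3 24 * rarr s3 11 j else 0)) => //.
    by move=> j _; rewrite take0 addr0.
    move=> q s' qn e10 f E j jc.
    have cE : iarr s' 3 = cl D by rewrite (frm_ia f) // (st_cl St3).
    have szc : size cls = nc D by rewrite size_mkseq.
    have tk : take q.+1 cls = rcons (take q cls) (cl D q).
      by rewrite (take_nth 0%N) ?szc // nth_mkseq.
    have nin : cl D q \notin take q cls.
      have := take_uniq q.+1 (sg_uniq good).
      by rewrite tk rcons_uniq => /andP[].
    have r23 : rreg s' 23 = rreg s3 23 by rewrite (frm_r f).
    have r24 : rreg s' 24 = rreg s3 24 by rewrite (frm_r f).
    have b12 : rarr s' 12 = rarr s3 12 by rewrite (frm_ra f).
    have b11 : rarr s' 11 = rarr s3 11 by rewrite (frm_ra f).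
    rewrite tk mem_rcons inE /= /upd /= e10 cE r23 r24 b12 b11.
    case: eqP => [->|_] /=; last exact: E.
    by rewrite (E _ (cl_cls qn)) (negbTE nin) addr0.
  move=> s4 f4 E4; apply: (seqs0 kap0 good).
  have f24 : frm WI stepR [::] [:: 10; 12]%N s s4.
    apply: frm_trans f2 _; apply: frm_trans (_ : frm WI stepR [::] [:: 10; 12]%N s2 s3) _.
      by apply: frm_sub f3.
    by apply: frm_sub f4.
  apply: bnd_le (H s4 f24 (cw s3 - ws) _); first by rewrite /=; lra.
  have -> : cv (rarr s4 10) = cv (rarr s 10) + cw s3.
    apply/colP => j; rewrite /cw !mxE; case: ifP => jc; last by rewrite !mulr0 !addr0.
    rewrite E4 // take_oversize ?size_mkseq // jc.
    have -> : rarr s3 10 = rarr s 10 by rewrite (frm_ra f3) // /s2 /= (frm_ra f1).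
    by [].
  by apply/colP => j; rewrite !mxE; ring.
have /andP[r0 r1] := rate_bounds.
rewrite cw2 sub0r dotNl dotNr opprK.
have g : (1 - rate) ^+ Mt <= 1 / 6.
  have := @geometric_le_inv R rate Mt (introT andP (conj (ltW r0) r1)).
  have MT : epochT <= Mt%:R by exact: nceil_ge.
  have : 5 <= rate * Mt%:R.
    apply: le_trans (_ : rate * epochT <= _); last by rewrite ler_wpM2l // ltW.
    rewrite /rate /epochT etaE.
    have -> : 3 / 4 * (mu / (8 * V) * mu) * (54 * V / mu ^+ 2) = 162 / 32.
      by field; rewrite !gt_eqF // V_gt0.
    lra.
  have : 0 <= (1 - rate) ^+ Mt by rewrite exprn_ge0 // subr_ge0.
  by set p := (1 - rate) ^+ Mt; set q := rate * _; nra.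
have W0 := dot_ge0 ws.
have : Ac * ((1 - rate) ^+ Mt * (dot ws ws - dot ws ws / 3) + dot ws ws / 3) <= Ac * (dot ws ws / 2).
  by rewrite ler_wpM2l //; move: g; set p := (1 - rate) ^+ Mt; set W := dot ws ws in W0 *; nra.
have qM0 : 0 <= qM.
  by apply: sumr_ge0 => i _; rewrite mulr_ge0 //; have [] := sa_qq samp i.
have : kap * (Mt%:R * (202 + 60 * qM) + 2) <= (cEp + 2) * uu.
  have h : Mt%:R * (202 + 60 * qM) <= cEp * N%:R.
    apply: le_trans Hcost; rewrite ler_wpM2r ?nceil_le ?(ltW T0) //; lra.
  have : kap * (Mt%:R * (202 + 60 * qM)) <= kap * (cEp * N%:R) by rewrite ler_wpM2l.
  by rewrite !uuE in ku *; lra.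
rewrite /=; lra.
Qed.

Lemma residM nn k s x : stat s -> rreg s 12 = sig ->
  (forall s', frm WI [:: 22; 40; 41]%N [::] [:: 11; 13; 14]%N s s' ->
     forall e, e = cv (rarr s 8) - shift (cv (rarr s 10)) ->
     cv (rarr s' 11) = e -> rreg s' 22 = dot e e -> B nn k s' (x - 200 * uu)) ->
  B nn (Resid :: k) s x.
Proof.
move=> St e12 H; have u0 := uu_ge0 kap0 good.
apply: (seqsM kap0 good); apply: (matvecM kap0 good) => // s1 f1 E1.
have St1 : stat s1 by apply: stat_frm f1 _ _ _ St.
apply: (seqsM kap0 good).
apply: (@loopC _ _ _ kap0 _ _ _ _ good nn _ _ s1 _ [:: 40; 41]%N [:: 11]%N (fun q r ar =>
  forall p, (p < q)%N -> ar 11%N (cl D p) =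
    rarr s1 8 (cl D p) - sig * rarr s1 10 (cl D p) + rarr s1 14 (cl D p))) => //.
  move=> q s' qN e10 f E p; rewrite ltnS leq_eqVlt => /orP pq.
  have cE : iarr s' 3 = cl D by rewrite (frm_ia f) // (st_cl St1).
  have r12 : rreg s' 12 = sig by rewrite (frm_r f) // (frm_r f1).
  have b8 : rarr s' 8 = rarr s1 8 by rewrite (frm_ra f).
  have b10 : rarr s' 10 = rarr s1 10 by rewrite (frm_ra f).
  have b14 : rarr s' 14 = rarr s1 14 by rewrite (frm_ra f).
  rewrite /= /upd /= e10 cE r12 b8 b10 b14.
  case: eqP => [->//|ne]; case: pq => [/eqP pq|/E-> //].
  by case: ne; rewrite pq.
move=> s2 f2 E2; apply: (seqsM kap0 good).
have St2 : stat s2 by apply: stat_frm f2 _ _ _ St1.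
apply: (dotM kap0 good) => // s3 f3 E3; apply: (seqs0 kap0 good).
have f13 : frm WI [:: 22; 40; 41]%N [::] [:: 11; 13; 14]%N s s3.
  apply: frm_trans (_ : frm WI [:: 22; 40; 41]%N [::] [:: 11; 13; 14]%N s s2) _; last by apply: frm_sub f3.
  by apply: frm_trans (_ : frm WI [:: 22; 40; 41]%N [::] [:: 11; 13; 14]%N s s1) _;
    [apply: frm_sub f1|apply: frm_sub f2].
have b8 : rarr s1 8 = rarr s 8 by rewrite (frm_ra f1).
have b10 : rarr s1 10 = rarr s 10 by rewrite (frm_ra f1).
have e11 : cv (rarr s2 11) = cv (rarr s 8) - shift (cv (rarr s 10)).
  rewrite !shiftE -E1; apply/colP => j; rewrite !mxE; case: ifP => jc; last by ring.
  by case/mem_cls: jc => q hq ->; rewrite E2 // b8 b10; ring.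
apply: bnd_le (H s3 f13 _ erefl _ _); first by rewrite /=; lra.
  by rewrite (frm_ra f3).
by rewrite E3 e11.
Qed.

Lemma shiftB x y : shift (x - y) = shift x - shift y.
Proof.
rewrite !shiftE scalerBr mulmxBr; move: (gram A *m x) (gram A *m y) => p q.
by apply/colP => j; rewrite !mxE; ring.
Qed.

Definition solveR := [:: 21; 22]%N ++ stepR.
Definition solveA := [:: 10; 11; 12; 13; 14]%N.

Lemma cEp_ge0 : 0 <= cEp.
Proof.
have V0 := V_gt0; have N0 : (0 : R) < N%:R by rewrite ltr0n (sg_N good).
have qM0 : 0 <= qM.
  by apply: sumr_ge0 => i _; rewrite mulr_ge0 //; have [] := sa_qq samp i.
have T0 : 0 < epochT by rewrite /epochT divr_gt0 ?exprn_gt0 // mulr_gt0.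
rewrite -(pmulr_lge0 _ N0); apply: le_trans Hcost.
by rewrite mulr_ge0 //; lra.
Qed.

(** The potential is [K * ln (1 + |z|^2 / tl)], for [z] the error of the approximate solution. As
    the residual is at most [sig |z|], a failed test implies [tl <= |z|^2]; an epoch then lowers the
    expected logarithm by at least 1 / 4, and [K / 4] pays for the epoch and the next test. *)
Lemma solveM nn k s x x0 (xs y z0 : 'cV[R]_d) (tf dv tl : R) : stat s ->
  rreg s 12 = sig -> rreg s 15 = eta -> rreg s 16 = epochT -> rreg s 17 = sF A Lam ->
  rreg s 14 = dv -> rreg s 19 = tf -> 0 < tf -> y = cv (rarr s 8) -> 0 < dot y y ->
  shift xs = y -> 0 <= x0 ->
  (forall s', frm WI solveR [::] solveA s s' ->
     forall e, e = y - shift (cv (rarr s' 10)) -> dot e e <= tf * dot y y ->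
     B nn k s' x0) ->
  z0 = dv^-1 *: y - xs -> tl = tf * dot y y / sig ^+ 2 ->
  x0 + 4 * (cEp + 5 * 100) * uu * ln (1 + dot z0 z0 / tl) + 6 * 100 * uu <= x ->
  B nn (Solve :: k) s x.
Proof.
move=> St e12 e15 e16 e17 e14 e19 tf0 Ey y0 Hxs x00 H Ez0 Etl Hx.
have u0 := uu_ge0 kap0 good; have ku := kap_uu kap0 good; have c0 := cEp_ge0.
have tl0 : 0 < tl by rewrite Etl divr_gt0 ?exprn_gt0 // mulr_gt0.
pose K := 4 * (cEp + 5 * 100) * uu.
have K0 : 0 <= K by rewrite /K !mulr_ge0 //; lra.
apply: (seqsM kap0 good).
apply: (@loopC _ _ _ kap0 _ _ _ _ good nn _ _ s _ [:: 40]%N [:: 10]%N (fun q r ar =>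
  forall p, (p < q)%N -> ar 10%N (cl D p) = rarr s 8 (cl D p) / dv)) => //.
  move=> q s' qN e10 f E p; rewrite ltnS leq_eqVlt => /orP pq.
  have cE : iarr s' 3 = cl D by rewrite (frm_ia f) // (st_cl St).
  have r14 : rreg s' 14 = dv by rewrite (frm_r f).
  have b8 : rarr s' 8 = rarr s 8 by rewrite (frm_ra f).
  rewrite /= /upd /= e10 cE r14 b8.
  case: eqP => [->//|ne]; case: pq => [/eqP pq|/E-> //].
  by case: ne; rewrite pq.
move=> s1 f1 E1; apply: (seqsM kap0 good).
have St1 : stat s1 by apply: stat_frm f1 _ _ _ St.
have x1 : cv (rarr s1 10) = dv^-1 *: y.
  apply/colP => j; rewrite Ey !mxE; case: ifP => jc; last by rewrite mulr0.
  by case/mem_cls: jc => q hq ->; rewrite E1 // mulrC.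
apply: (dotM kap0 good) => // s2 f2 E2; apply: (seqsM kap0 good); apply: (blkM kap0 good).
set s3 := execs _ s2; apply: (seqsM kap0 good).
have f13 : frm WI solveR [::] solveA s s3.
  apply: frm_trans (_ : frm WI solveR [::] solveA s s2) _; last by apply: frm_sub (frm_execs _ _).
  by apply: frm_trans (_ : frm WI solveR [::] solveA s s1) _;
    [apply: frm_sub f1|apply: frm_sub f2].
have St3 : stat s3 by apply: stat_frm f13 _ _ _ St.
have e21 : rreg s3 21 = dot y y * tf.
  by rewrite /s3 /= /upd /= E2 (frm_r f2) // (frm_r f1) // e19 !(frm_ra f1) // -Ey.
have a3 : rarr s3 =1 rarr s1 by move=> b; rewrite /s3 /= (frm_ra f2).
apply: residM => //; first by rewrite (frm_r f13).
move=> s4 f4 e0 Ee0 c11 e22; apply: (seqsM kap0 good).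
have f14 : frm WI solveR [::] solveA s s4 by apply: frm_trans f13 _; apply: frm_sub f4.
pose J s1 (x1 : R) : Prop := [/\ frm WI solveR [::] solveA s s1, rreg s1 21 = dot y y * tf,
  exists2 e, e = y - shift (cv (rarr s1 10)) & cv (rarr s1 11) = e /\ rreg s1 22 = dot e e &
  exists2 z, z = cv (rarr s1 10) - xs & x0 + K * ln (1 + dot z z / tl) + 2 * uu <= x1].
have lnp (z : 'cV[R]_d) : 0 <= ln (1 + dot z z / tl).
  by apply: ln_ge0; rewrite lerDl divr_ge0 ?dot_ge0 // ltW.
have Jinit xx : x0 + K * ln (1 + dot z0 z0 / tl) + 2 * uu <= xx -> J s4 xx.
  split=> //.
  - by rewrite (frm_r f4).
  - by exists e0; rewrite // Ee0 !a3 (frm_ra f4) // a3 Ey (frm_ra f1).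
  by exists z0; rewrite // Ez0 (frm_ra f4) // a3 x1.
apply: (@bnd_while_inv _ _ _ kap0 J); last first.
  by apply: Jinit; move: Hx; rewrite -/K /=; lra.
2: by move=> sa xa [_ _ _ [z _ Hz]]; have := mulr_ge0 K0 (lnp z); move: Hz; lra.
move=> m sa xa mn IH [fa ea [e Ee [ce1 ce2]] [z Ez Hz]].
have Sta : stat sa by apply: stat_frm fa _ _ _ St.
have lz := mulr_ge0 K0 (lnp z).
rewrite /= ea ce2; case: ltP => hq; last first.
  apply: bnd_skip => //; apply: bnd_leq mn _; apply: bnd_le (H sa fa e Ee _).
    by move: Hz; lra.
  by rewrite mulrC.
pose ws := xs - cv (rarr sa 10).
have wsE : shift ws = cv (rarr sa 11) by rewrite shiftB Hxs ce1.
have zE : dot ws ws = dot z z.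
  by rewrite Ez /ws -opprB dotNl dotNr opprK.
pose Y := dot z z; have Y0 : 0 <= Y by exact: dot_ge0.
have tY : tl <= Y.
  rewrite Etl ler_pdivrMr ?exprn_gt0 // mulrC; apply: le_trans (ltW hq) _.
  by rewrite Ee -Hxs -shiftB -/ws mulrC; apply: le_trans (Hsig2 ws) _; rewrite zE.
pose mm := Y / 2.
have tm0 : 0 < tl + mm by rewrite /mm; lra.
(* The coefficients of the tangent at the halved squared error [mm], so that the potential becomes a
   postcondition of [epochM]. *)
pose Ac := K / (tl + mm).
pose Bc := K * (ln (1 + mm / tl) - mm / (tl + mm)) + x0 + 3 * 100 * uu.
have Ac0 : 0 <= Ac by rewrite divr_ge0 // ltW.
have pos (t : R) : 0 <= t -> 0 < 1 + t / tl.
  by move=> t0; rewrite ltr_wpDr // divr_ge0 // ltW.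
have mm0 : 0 <= mm by rewrite /mm; lra.
apply: bnd_seq => //.
apply: (@epochM m _ sa _ ws Ac Bc Ac0 Sta _ _ _ _ wsE).
- by rewrite (frm_r fa).
- by rewrite (frm_r fa).
- by rewrite (frm_r fa).
- by rewrite (frm_r fa).
- move=> sb fb e1 Ee1.
  have fab : frm WI solveR [::] solveA s sb by apply: frm_trans fa _; apply: frm_sub fb.
  have Stb : stat sb by apply: stat_frm fab _ _ _ St.
  apply: residM => //; first by rewrite (frm_r fab).
  move=> sc fc e2 Ee2 c11' e22'; apply: IH.
  have fac : frm WI solveR [::] solveA s sc by apply: frm_trans fab _; apply: frm_sub fc.
  split=> //.
  + by rewrite (frm_r fc) // (frm_r fb).
  + by exists e2; rewrite // Ee2 Ey (frm_ra fc) // (frm_ra fab).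
  exists e1.
    by rewrite Ee1 (frm_ra fc) // /ws [_ + (xs - _)]addrC subrK.
  have e10 := dot_ge0 e1; set Y1 := dot e1 e1 in e10 *.
  have := @ln_tangent R (1 + Y1 / tl) (1 + mm / tl) (pos _ e10) (pos _ mm0).
  have -> : (1 + Y1 / tl - (1 + mm / tl)) / (1 + mm / tl) = (Y1 - mm) / (tl + mm).
    by field; rewrite !gt_eqF.
  move/(ler_wpM2l K0); rewrite /Ac /Bc; set l1 := ln (1 + Y1 / tl); set l2 := ln (1 + mm / tl).
  have -> : K * (l2 + (Y1 - mm) / (tl + mm)) = K / (tl + mm) * Y1 + K * (l2 - mm / (tl + mm)).
    by field; rewrite gt_eqF.
  by lra.
rewrite zE -/Y -/mm.
(* [mm / (tl + Y) = Y / (2 (tl + Y))], which is at least 1 / 4 because of [tl <= Y]. *)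
have h1 : ln (1 + mm / tl) + 1 / 4 <= ln (1 + Y / tl).
  have := @ln_tangent R (1 + mm / tl) (1 + Y / tl) (pos _ mm0) (pos _ Y0).
  have -> : (1 + mm / tl - (1 + Y / tl)) / (1 + Y / tl) = - (mm / (tl + Y)).
    by rewrite /mm; field; rewrite !gt_eqF //; lra.
  have : 1 / 4 <= mm / (tl + Y) by rewrite ler_pdivlMr ?/mm; lra.
  by lra.
have h2 := ler_wpM2l K0 h1.
have -> : Ac * mm + Bc = K * ln (1 + mm / tl) + x0 + 3 * 100 * uu.
  by rewrite /Ac /Bc; field; rewrite gt_eqF.
have KE : K / 4 = (cEp + 5 * 100) * uu by rewrite /K; field.
by move: Hz h2 KE; rewrite -/Y; set a1 := K * ln _; set a2 := ln (1 + Y / tl); lra.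
Qed.

End Solve.

(** * Blocks of Chebyshev steps *)

Section Diagonal.
Variables (R : realType) (n d : nat) (A : 'M[R]_(n, d)) (Q : 'M[R]_d) (lam : 'I_d -> R).
Hypothesis QQ : Q *m Q^T = 1%:M.
Hypothesis Qg : Q *m gram A = diag_mx (\row_j lam j) *m Q.
Implicit Types (x y : 'cV[R]_d).

Lemma QTQ : Q^T *m Q = 1%:M. Proof. exact: mulmx1C QQ. Qed.

Lemma dot_Q x y : dot (Q *m x) (Q *m y) = dot x y.
Proof. by rewrite -!dot_mx trmx_mul mulmxA -(mulmxA x^T) QTQ mulmx1. Qed.

Lemma norm2_Q x : norm2 (Q *m x) = norm2 x.
Proof. by rewrite !norm2E dot_Q. Qed.

Lemma mulQK y : Q *m (Q^T *m y) = y.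
Proof. by rewrite mulmxA QQ mul1mx. Qed.

Lemma Q_inj x y : Q *m x = Q *m y -> x = y.
Proof. by move=> E; rewrite -[x]mul1mx -[y]mul1mx -QTQ -!mulmxA E. Qed.

Lemma Q_gram x : Q *m (gram A *m x) = dmul lam (Q *m x).
Proof.
rewrite mulmxA Qg -mulmxA; apply/colP => j; rewrite mul_diag_mx !mxE; congr (_ * _).
Qed.

Lemma dot_gramQ x : dot x (gram A *m x) = rayl lam (Q *m x).
Proof. by rewrite -dot_Q Q_gram dotC. Qed.

Lemma lam_ge0 j : 0 <= lam j.
Proof.
have : 0 <= dot (Q^T *m delta_mx j 0) (gram A *m (Q^T *m delta_mx j 0)).
  by rewrite dot_gram; apply: sumr_ge0 => i _; rewrite -expr2 sqr_ge0.
rewrite dot_gramQ mulQK /rayl dot_dmul (bigD1 j) //= !mxE !eqxx !mulr1 big1 ?addr0 //.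
by move=> k /negbTE kj; rewrite !mxE kj !mulr0.
Qed.

Variable j0 : 'I_d.
Hypothesis lam_le : forall j, lam j <= lam j0.

Lemma gram_le x : dot x (gram A *m x) <= lam j0 * dot x x.
Proof.
rewrite dot_gramQ /rayl dot_dmul -(dot_Q x x) /dot mulr_sumr; apply: ler_sum => j _.
by rewrite ler_wpM2r // -expr2 sqr_ge0.
Qed.

Lemma lam_le_frob : lam j0 <= frob2 A.
Proof.
pose u := Q^T *m (delta_mx j0 0 : 'cV[R]_d).
have d1 : dot (delta_mx j0 0) (delta_mx j0 0) = 1 :> R.
  rewrite /dot (bigD1 j0) //= !mxE !eqxx mulr1 big1 ?addr0 // => k kj.
  by rewrite !mxE (negbTE kj) mulr0.
have u1 : dot u u = 1 by rewrite -dot_Q /u mulQK.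
have -> : lam j0 = dot u (gram A *m u).
  rewrite dot_gramQ mulQK /rayl dot_dmul (bigD1 j0) //= !mxE !eqxx !mulr1 big1 ?addr0 //.
  by move=> k /negbTE kj; rewrite !mxE kj !mulr0.
rewrite dot_gram; apply: ler_sum => i _.
by have := dot_CS (mxrow_vec A i) u; rewrite u1 mulr1 expr2.
Qed.

Variables (sig mu : R).
Hypothesis sigmu : mu <= sig - lam j0.
Hypothesis mu0 : 0 < mu.

Local Notation shift := (shift (gram A) sig).

Lemma Q_shift x : Q *m shift x = dmul (fun j => sig - lam j) (Q *m x).
Proof.
rewrite /shift mulmxBr -scalemxAr Q_gram; apply/colP => j.
by move: (Q *m x) => z; rewrite !mxE; ring.
Qed.

Lemma gap_mu j : mu <= sig - lam j.
Proof. by have := lam_le j; have := sigmu; lra. Qed.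

Lemma shift_mu x : mu * dot x x <= dot x (shift x).
Proof.
rewrite -(dot_Q x x) -(dot_Q x (shift x)) Q_shift [X in _ <= X]dotC dot_dmul /dot mulr_sumr.
by apply: ler_sum => j _; rewrite ler_wpM2r ?gap_mu // -expr2 sqr_ge0.
Qed.

Lemma shift_sig x : dot (shift x) (shift x) <= sig * dot x (shift x).
Proof.
rewrite -(dot_Q x (shift x)) -(dot_Q (shift x)) Q_shift [X in _ <= _ * X]dotC !dot_dmul mulr_sumr.
apply: ler_sum => j _; rewrite !mxE; set q := (Q *m x) j 0 => {q}.
rewrite [leLHS](_ : _ = (sig - lam j) * ((sig - lam j) * ((Q *m x) j 0 * (Q *m x) j 0))); last by rewrite mxE; ring.
have a0 := gap_mu j; have b0 := lam_ge0 j.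
rewrite [leRHS](_ : _ = sig * ((sig - lam j) * ((Q *m x) j 0 * (Q *m x) j 0))); last by rewrite mxE.
apply: ler_wpM2r; last by lra.
by rewrite mulr_ge0 -?expr2 ?sqr_ge0 //; have := mu0; lra.
Qed.

Lemma shift_sig2 x : dot (shift x) (shift x) <= sig ^+ 2 * dot x x.
Proof.
have s0 : 0 < sig by have := gap_mu j0; have := lam_ge0 j0; have := mu0; lra.
apply: le_trans (shift_sig x) _; rewrite expr2 -mulrA ler_wpM2l ?(ltW s0) //.
rewrite -(dot_Q x x) -(dot_Q x (shift x)) Q_shift [X in X <= _]dotC dot_dmul /dot mulr_sumr.
apply: ler_sum => j _; rewrite ler_wpM2r //; first by rewrite -expr2 sqr_ge0.
by have := lam_ge0 j; lra.
Qed.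

Definition solution y : 'cV[R]_d := Q^T *m dmul (fun j => (sig - lam j)^-1) (Q *m y).

Lemma Q_solution y : Q *m solution y = dmul (fun j => (sig - lam j)^-1) (Q *m y).
Proof. exact: mulQK. Qed.

Lemma shift_solution y : shift (solution y) = y.
Proof.
apply: Q_inj; rewrite Q_shift Q_solution; apply/colP => j; rewrite [LHS]mxE mxE mulrA mulfV ?mul1r //.
by rewrite gt_eqF // (lt_le_trans mu0) // gap_mu.
Qed.

End Diagonal.

(** * Correctness and cost of the Chebyshev loop *)

Section ChebLoop.
Variables (R : realType) (P : store R -> Prop) (kap : R).
Hypothesis kap0 : 0 <= kap.
Variables (n d : nat) (A : 'M[R]_(n, d)) (D : sdata R) (ppi qq : nat -> R).
Local Notation N := (nnz A).
Local Notation a i := (mxrow_vec A i).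
Hypothesis good : sgood A D.
Hypothesis samp : ssamp A D ppi qq.
Hypothesis arow : forall i, 0 < dot (a i) (a i).
Implicit Types (s : store R).
Local Notation B := (@bnd R P kap).
Local Notation stat := (stat A D).
Local Notation cv := (@cv R d D).
Local Notation cls := (cls D).
Local Notation uu := (uu kap A).
Local Notation F := (frob2 A).
Local Notation shift := (shift (gram A)).

Variables (Q : 'M[R]_d) (lam : 'I_d -> R) (j0 : 'I_d).
Hypothesis QQ : Q *m Q^T = 1%:M.
Hypothesis Qg : Q *m gram A = diag_mx (\row_j lam j) *m Q.
Hypothesis lam_le : forall j, lam j <= lam j0.
Local Notation L1 := (lam j0).
Hypothesis L10 : 0 < L1.

Variables (rho r G Lam mu sig eta V K om gam cEp : R) (v : 'cV[R]_d).
Hypothesis LamE : Lam = rho + G.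
Hypothesis lamLam : L1 <= Lam.
Hypothesis G0 : 0 < G.
Hypothesis Gmu : G <= mu.
Hypothesis sigE : sig = Lam + mu.
Hypothesis VE : V = 30 * F * Lam + mu ^+ 2.
Hypothesis etaE : eta = mu / (8 * V).
Hypothesis etasig : eta * sig < 1.
Hypothesis Hcost : (epochT mu V + 1) * (202 + 60 * qM A qq Lam) <= cEp * N%:R.
Hypothesis v1 : dot v v = 1.
Hypothesis rhoE : rho = dot v (gram A *m v).
Hypothesis rE : r = resid lam rho (Q *m v).
Hypothesis r0 : 0 < r.
Hypothesis gam0 : 0 < gam.
Hypothesis cg : gam <= `|(Q *m v) j0 0|.
Hypothesis om0 : 0 < om.

(** The top eigenvalue is known up to [G] only: [sig - L1] lies between [mu] and [mu + G]. The
    numerator [mu + 2 G] puts the top argument beyond 1 by an amount of order [G / mu] in either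
    case. *)
Definition tau : R := mu + 2 * G.
Definition xsp (j : 'I_d) : R := tau / (sig - lam j).
Local Notation x1 := (xsp j0).
Definition Mit : nat := nceil K.
(** The relative error of the whole block: [6 * om] per step by [solution_err], accumulated as in
    [cheb_inv_bound]. *)
Definition epsM : R := 2 * (6 * om) * Mit%:R ^+ 3.
Hypothesis eps_gam : epsM <= gam / 2.
Hypothesis eps_1 : epsM <= 1.
Hypothesis eps_r : epsM * F <= r.

Let c := Q *m v.
Let mu0 : 0 < mu. Proof. exact: lt_le_trans Gmu. Qed.
Let sigmu : mu <= sig - L1. Proof. by rewrite sigE; have := lamLam; lra. Qed.
Let gmu j : mu <= sig - lam j. Proof. by have := lam_le j; have := sigmu; lra. Qed.
Let F0 : 0 < F. Proof. exact: lt_le_trans (lam_le_frob QQ Qg j0). Qed.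
Let Lam0 : 0 < Lam. Proof. exact: lt_le_trans lamLam. Qed.
Let c1 : dot c c = 1. Proof. by rewrite /c dot_Q. Qed.
Let rhoc : rho = rayl lam c. Proof. by rewrite rhoE /c (dot_gramQ QQ Qg). Qed.
Let lge0 j : 0 <= lam j. Proof. exact: lam_ge0 QQ Qg j. Qed.

Lemma rho_le : 0 <= rho <= L1.
Proof. by rewrite rhoc; apply: rayl_bounds. Qed.

Lemma xsp_le j : 0 <= xsp j <= x1.
Proof.
have t0 : 0 < tau by rewrite /tau; have := mu0; have := G0; lra.
have aj := gmu j; have a0 := gmu j0.
rewrite /xsp divr_ge0 ?(ltW t0) //=; last by have := mu0; lra.
rewrite ler_pM2l // lef_pV2 ?posrE; first by have := lam_le j; lra.
all: by have := mu0; lra.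
Qed.

Lemma x1_bounds : 1 + G / mu / 2 <= x1 <= 1 + 2 * (G / mu).
Proof.
have /andP[_ rL] := rho_le; have m0 := mu0.
have b0 : 0 < sig - L1 by have := gmu j0; lra.
rewrite /xsp ler_pdivlMr // ler_pdivrMr //; apply/andP; split.
  have h : sig - L1 <= mu + G by rewrite sigE LamE; lra.
  apply: le_trans (ler_wpM2l _ h) _; first by rewrite addr_ge0 // !divr_ge0 // ltW.
  have -> : (1 + G / mu / 2) * (mu + G) = mu + G + G / 2 + G / 2 * (G / mu) by field; rewrite gt_eqF.
  have : G / 2 * (G / mu) <= G / 2.
    by rewrite ler_piMr ?divr_ge0 ?(ltW G0) // ler_pdivrMr // mul1r.
  by rewrite /tau; have := G0; lra.
apply: le_trans (_ : (1 + 2 * (G / mu)) * mu <= _).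
  by rewrite mulrDl mul1r -(mulrA 2) mulfVK ?gt_eqF.
by rewrite ler_wpM2l ?gmu // addr_ge0 // mulr_ge0 // divr_ge0 // ltW.
Qed.

Lemma x1_ge1 : 1 <= x1.
Proof.
have /andP[h _] := x1_bounds; apply: le_trans h; rewrite lerDl !divr_ge0 //; exact: ltW.
Qed.

(** The relative decrease of the argument is [(L1 - lam j) / (sig - lam j)]. At distance [G / 4]
    this is at least [(G / 4) / (mu + G + G / 4)], and [G <= mu] bounds the denominator by
    [9 mu / 4]. *)
Lemma xsp_far j : lam j <= L1 - G / 4 -> xsp j <= x1 - G / mu / 9.
Proof.
move=> hj; have /andP[_ rL] := rho_le; have m0 := mu0; have g0 := G0.
have b0 : 0 < sig - L1 by have := gmu j0; lra.
have bj : 0 < sig - lam j by have := gmu j; lra.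
have h : sig - L1 <= mu + G by rewrite sigE LamE; lra.
rewrite lerBrDr -lerBrDl /xsp.
have -> : tau / (sig - L1) - tau / (sig - lam j) = x1 * ((L1 - lam j) / (sig - lam j)).
  by rewrite /xsp; field; rewrite !gt_eqF.
apply: le_trans (_ : (L1 - lam j) / (sig - lam j) <= _); last first.
  rewrite ler_peMl ?x1_ge1 // divr_ge0 ?(ltW bj) //; lra.
rewrite -mulrA -invfM ler_pdivlMr // mulrAC ler_pdivrMr ?mulr_gt0 //.
set t := L1 - lam j; have Et : sig - lam j = (sig - L1) + t by rewrite /t; lra.
have tG : G / 4 <= t by rewrite /t; lra.
rewrite Et; have := Gmu; have := sigmu => s1 gm.
have : G * t <= mu * t by rewrite ler_wpM2r //; lra.
have : G * (sig - L1) <= G * (2 * mu) by rewrite ler_wpM2l //; lra.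
have : mu * (G / 4) <= mu * t by rewrite ler_wpM2l // ltW.
by lra.
Qed.

Local Notation chebI k y yo := (cheb_inv xsp x1 (6 * om) c k y yo).

Lemma eps_mono (k : nat) : (k <= Mit)%N -> 2 * (6 * om) * k%:R ^+ 3 <= epsM.
Proof.
move=> kM; rewrite /epsM ler_wpM2l //; first by rewrite !mulr_ge0 // ltW.
by rewrite lerXn2r ?nnegrE // ler_nat.
Qed.

Lemma norm2_cc : norm2 c <= 1. Proof. by rewrite norm2E c1 sqrtr1. Qed.

Lemma cheb_bnd k y yo : (k <= Mit)%N -> chebI k y yo ->
  norm2 (y - dmul (fun j => chebU (xsp j) k.+1) c) <= epsM * chebU x1 k.+1.
Proof.
move=> kM iv; have e1 := le_trans (eps_mono kM) eps_1.
have [h _] := cheb_inv_bound x1_ge1 xsp_le norm2_cc (mulr_ge0 (ler0n _ 6) (ltW om0)) e1 iv.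
apply: le_trans h _; rewrite ler_wpM2r ?eps_mono //; exact: ltW (chebU_gt0 _ x1_ge1).
Qed.

Definition initR : R := 4 * r * sig / ((mu + G) * mu * om * gam).

(** Up to sign, the error of the initial guess is [(lam j - rho) / ((sig - rho) (sig - lam j))]
    times [y] in eigencoordinates, hence at most the residual of [y] over [(mu + G) mu]. The filter
    has not increased that residual beyond [2 r] times its maximum, so the initial error is
    proportional to [r]. *)
Lemma solve_init k (y yo : 'cV[R]_d) : (k <= Mit)%N -> chebI k (Q *m y) yo ->
  forall z, z = (mu + G)^-1 *: y - solution Q lam sig y ->
  0 < dot y y /\ dot z z / (om ^+ 2 * dot y y / sig ^+ 2) <= initR ^+ 2 .
Proof.
move=> kM iv z Ez; have hb := cheb_bnd kM iv.
have U0 := chebU_gt0 k x1_ge1; set U := chebU x1 k.+1 in U0 hb.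
have m0 := mu0; have g0 := G0.
have uU j : `|chebU (xsp j) k.+1| <= U by apply: chebU_max; [exact: xsp_le|exact: x1_ge1].
have s0 : 0 < sig by have := gmu j0; have := L10; lra.
have ng := block_norm_ge U0 erefl hb cg eps_gam.
have rn := block_resid_num lge0 lam_le (lam_le_frob QQ Qg j0) c1 rhoc rE U0 uU hb.
rewrite norm2_Q // in ng.
have ny : 0 < norm2 y by apply: lt_le_trans ng; rewrite divr_gt0 // mulr_gt0.
split; first by rewrite -norm2_sq exprn_gt0.
have nz : norm2 z <= resid lam rho (Q *m y) / ((mu + G) * mu).
  rewrite -(norm2_Q QQ) Ez mulmxBr -scalemxAr Q_solution //.
  have -> : (mu + G)^-1 *: (Q *m y) - dmul (fun j => (sig - lam j)^-1) (Q *m y) =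
     dmul (fun j => - ((mu + G) * (sig - lam j))^-1) (dmul (fun j => lam j - rho) (Q *m y)).
    apply/colP => j; move: (Q *m y) => t; rewrite !mxE; move: (t j 0) => {}t.
    have -> : mu + G = sig - rho by rewrite sigE LamE; lra.
    have b1 : sig - rho != 0 by rewrite gt_eqF // sigE LamE; lra.
    have b2 : sig - lam j != 0 by rewrite gt_eqF //; have := gmu j; lra.
    by field; rewrite b1 b2.
  rewrite mulrC; apply: norm2_dmul => [|j].
    by rewrite invr_ge0 mulr_ge0 //; lra.
  rewrite normrN ger0_norm ?invr_ge0 ?mulr_ge0 //; try (by have := gmu j; lra).
  rewrite lef_pV2 ?posrE ?mulr_gt0 //; try (by have := gmu j; lra).
  by rewrite ler_wpM2l ?gmu //; lra.
have nz2 : norm2 z <= 2 * U * r / ((mu + G) * mu).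
  apply: le_trans nz _; rewrite ler_wpM2r ?invr_ge0 ?mulr_ge0 //; try lra.
  apply: le_trans rn _; have : U * (epsM * F) <= U * r by rewrite ler_wpM2l // ltW.
  by lra.
rewrite -!norm2_sq.
have -> : om ^+ 2 * norm2 y ^+ 2 / sig ^+ 2 = (om * norm2 y / sig) ^+ 2 by field; rewrite gt_eqF.
rewrite -expr_div_n lerXn2r ?nnegrE //.
- by rewrite divr_ge0 ?norm2_ge0 // divr_ge0 ?(ltW s0) // mulr_ge0 ?norm2_ge0 // ltW.
- by rewrite /initR !mulr_ge0 ?invr_ge0 ?mulr_ge0 // ?ltW // addr_gt0.
rewrite ler_pdivrMr ?divr_gt0 ?mulr_gt0 //; apply: le_trans nz2 _.
rewrite /initR.
have -> : 2 * U * r / ((mu + G) * mu) =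
   4 * r * sig / ((mu + G) * mu * om * gam) * (om * (U * gam / 2) / sig).
  by field; rewrite !gt_eqF //; lra.
rewrite ler_wpM2l //.
  by rewrite !mulr_ge0 ?invr_ge0 ?mulr_ge0 // ?ltW // addr_gt0.
by rewrite ler_wpM2r ?invr_ge0 ?(ltW s0) // ler_wpM2l ?(ltW om0).
Qed.

Definition iterC : R := 4 * (cEp + 5 * 100) * uu * ln (1 + initR ^+ 2) + 7 * 100 * uu.

Definition chebR := 20%N :: solveR.
Definition chebA := [:: 8; 9]%N ++ solveA.

Lemma updateM nn k s x (c13 : R) : stat s -> rreg s 13 = c13 ->
  (forall s', frm WI [:: 40; 41]%N [::] [:: 8; 9]%N s s' ->
     cv (rarr s' 8) = c13 *: cv (rarr s 10) - cv (rarr s 9) ->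
     cv (rarr s' 9) = cv (rarr s 8) -> B nn k s' (x - 26 * uu)) ->
  B nn (Loop 3 cheb_update :: k) s x.
Proof.
move=> St e13 H.
have inj p q : (p < nc D)%N -> (q < nc D)%N -> cl D p = cl D q -> p = q.
  by have /mkseq_uniqP inj := sg_uniq good; move=> hp hq; apply: inj.
apply: (@loopC _ _ _ kap0 _ _ _ _ good nn _ _ s _ [:: 40; 41]%N [:: 8; 9]%N (fun q r ar =>
  forall p, (p < nc D)%N ->
    ar 8%N (cl D p) = (if (p < q)%N then c13 * rarr s 10 (cl D p) - rarr s 9 (cl D p)
                       else rarr s 8 (cl D p)) /\
    ar 9%N (cl D p) = if (p < q)%N then rarr s 8 (cl D p) else rarr s 9 (cl D p))) => //.
  move=> q s' qN e10 f E p pN; have [E8 E9] := E p pN.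
  have cE : iarr s' 3 = cl D by rewrite (frm_ia f) // (st_cl St).
  have r13 : rreg s' 13 = c13 by rewrite (frm_r f).
  have b10 : rarr s' 10 = rarr s 10 by rewrite (frm_ra f).
  rewrite /= /upd /= e10 cE r13 b10; case: eqP => [e|ne].
    have pq := inj _ _ pN qN e; rewrite -pq ltnn in E8 E9.
    by rewrite -pq ltnSn E8 E9.
  have pq : (p < q.+1)%N = (p < q)%N.
    by rewrite ltnS leq_eqVlt; case: eqP => // pq; case: ne; rewrite pq.
  by rewrite pq E8 E9.
move=> s' f E; apply: H => //.
  apply/colP => j; rewrite !mxE; case: ifP => jc; last by rewrite mulr0 subr0.
  by case/mem_cls: jc => q hq ->; have [-> _] := E q hq; rewrite hq.
apply/colP => j; rewrite !mxE; case: ifP => jc //.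
by case/mem_cls: jc => q hq ->; have [_ ->] := E q hq; rewrite hq.
Qed.

(** Coercivity bounds the error by the residual over [mu], and [2 tau <= 6 mu]. *)
Lemma solution_err (x y : 'cV[R]_d) : norm2 (y - shift sig x) <= om * norm2 y ->
  norm2 (Q *m (2 * tau *: (x - solution Q lam sig y))) <= 6 * om * norm2 (Q *m y).
Proof.
move=> H; have [z Ez] : exists z, z = x - solution Q lam sig y by eexists.
have m0 := mu0; have t0 : 0 <= tau by rewrite /tau; have := G0; lra.
rewrite !(norm2_Q QQ) norm2Z -Ez ger0_norm ?mulr_ge0 //.
have zM : mu * norm2 z <= om * norm2 y.
  have h1 := shift_mu QQ Qg lam_le sigmu z.
  have h2 : shift sig z = - (y - shift sig x).
    rewrite Ez -{2}(shift_solution QQ Qg lam_le sigmu mu0 y) !shiftE mulmxBr scalerBr.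
    move: (sig *: x) (sig *: solution _ _ _ _) (gram A *m x) (gram A *m _) => a1 a2 a3 a4.
    by apply/colP => i; rewrite !mxE; ring.
  have h3 : dot z (shift sig z) <= norm2 z * norm2 (shift sig z).
    by apply: le_trans (norm_dot_le _ _); exact: ler_norm.
  have nE : norm2 (shift sig z) = norm2 (y - shift sig x).
    by rewrite h2 !norm2E dotNl dotNr opprK.
  have nz0 := norm2_ge0 z.
  move: (le_trans h1 h3); rewrite nE -norm2_sq expr2 mulrA mulrAC [leLHS]mulrC.
  have [->|nz] := eqVneq (norm2 z) 0.
    by rewrite mulr0 => _; rewrite mulr_ge0 ?norm2_ge0 // ltW.
  rewrite ler_pM2l; last by rewrite lt_def nz nz0.
  by move=> h; apply: le_trans h H.
have : tau * norm2 z <= 3 * mu * norm2 z.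
  by rewrite ler_wpM2r ?norm2_ge0 // /tau; have := Gmu; lra.
by lra.
Qed.

Lemma iterC_ge0 : 0 <= cEp -> 0 <= iterC.
Proof.
move=> c0; have u0 := uu_ge0 kap0 good; rewrite /iterC.
have l0 : 0 <= ln (1 + initR ^+ 2) by apply: ln_ge0; rewrite lerDl sqr_ge0.
by rewrite addr_ge0 ?mulr_ge0 //; lra.
Qed.

Lemma chebM nn k s x x0 : stat s -> 0 <= cEp ->
  rreg s 12 = sig -> rreg s 13 = 2 * tau -> rreg s 14 = mu + G -> rreg s 15 = eta ->
  rreg s 16 = epochT mu V -> rreg s 17 = sF A Lam -> rreg s 18 = K ->
  rreg s 19 = om ^+ 2 -> rreg s 20 = 0 ->
  cv (rarr s 8) = v -> cv (rarr s 9) = 0 -> 0 <= x0 ->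
  (forall s', frm WI chebR [::] chebA s s' ->
     forall y yo, y = cv (rarr s' 8) -> chebI Mit (Q *m y) yo -> B nn k s' x0) ->
  x0 + Mit%:R * iterC + 2 * uu <= x ->
  B nn (While (RLt 20 18) (Seqs [:: Solve; Loop 3 cheb_update;
                              Blk (num 40 1 ++ [:: RAdd 20 20 40])]) :: k) s x.
Proof.
move=> St cE0 e12 e13 e14 e15 e16 e17 e18 e19 e20 y0 yo0 x00 H Hx.
have u0 := uu_ge0 kap0 good; have ku := kap_uu kap0 good; have C0 := iterC_ge0 cE0.
pose J s1 (x1 : R) : Prop := exists2 j : nat, (j <= Mit)%N &
  [/\ frm WI chebR [::] chebA s s1, rreg s1 20 = j%:R,
      chebI j (Q *m cv (rarr s1 8)) (Q *m cv (rarr s1 9)) &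
      x0 + (Mit - j)%:R * iterC + 2 * uu <= x1].
apply: (@bnd_while_inv _ _ _ kap0 J); last first.
  exists 0%N => //; split=> //; last by rewrite subn0.
  by rewrite y0 yo0 mulmx0; apply: cheb_inv0.
2: by move=> s1 x1' [j _ [_ _ _ h]]; have := mulr_ge0 (ler0n _ (Mit - j)) C0; lra.
move=> m s1 x1' mn IH [j jM [f1 ej iv Hj]].
have St1 : stat s1 by apply: stat_frm f1 _ _ _ St.
rewrite [holds _ _]/= ej (frm_r f1) // e18 nceilP -/Mit; case: ltnP => hj; last first.
  have jE : j = Mit by apply/eqP; rewrite eqn_leq jM hj.
  apply: bnd_leq mn _; apply: bnd_le (H s1 f1 _ _ erefl _); last first.
    by rewrite -jE; exact: iv.
  by move: Hj; rewrite jE subnn mul0r; lra.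
have [y Ey] : exists y, y = cv (rarr s1 8) by eexists.
rewrite -Ey in iv; have [y2 hz] := solve_init jM iv erefl.
apply: (seqsM kap0 good).
have Hlam := gram_le QQ Qg lam_le.
have s0 : 0 < sig by have := gmu j0; have := L10; have := mu0; lra.
pose x2 := x0 + (Mit - j.+1)%:R * iterC + 8 * uu + 50 * uu.
have x20 : 0 <= x2 by have := mulr_ge0 (ler0n _ (Mit - j.+1)) C0; rewrite /x2; lra.
apply: (@solveM _ _ _ kap0 _ _ _ _ _ _ good samp arow L1 Lam sig mu eta V Lam0 lamLam Hlam F0
  (shift_mu QQ Qg lam_le sigmu) (shift_sig QQ Qg lam_le sigmu mu0)
  (shift_sig2 QQ Qg lam_le sigmu mu0) mu0 VE etaE etasig s0 cEp Hcost
  m _ s1 _ x2 (solution Q lam sig y) y _ (om ^+ 2) (mu + G) _ St1) => //.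
all: try by rewrite (frm_r f1).
- by rewrite exprn_gt0.
- exact: shift_solution.
- move=> s2 f2 e Ee he; apply: (seqsM kap0 good).
  have f12 : frm WI chebR [::] chebA s s2 by apply: frm_trans f1 _; apply: frm_sub f2.
  have St2 : stat s2 by apply: stat_frm f12 _ _ _ St.
  apply: (@updateM _ _ _ _ (2 * tau) St2); first by rewrite (frm_r f12).
  move=> s3 f3 E8 E9; apply: (seqsM kap0 good); apply: (blkM kap0 good); apply: (seqs0 kap0 good).
  set s4 := execs _ _.
  have f4 : frm WI [:: 20; 40]%N [::] [::] s3 s4 by apply: frm_sub (frm_execs _ _).
  have f13 : frm WI chebR [::] chebA s s3 by apply: frm_trans f12 _; apply: frm_sub f3.
  have f14 : frm WI chebR [::] chebA s s4 by apply: frm_trans f13 _; apply: frm_sub f4.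
  apply: IH; exists j.+1 => //; split=> //.
  + by rewrite /s4 rvalE /= (frm_r f3) // (frm_r f2) // ej natr1.
  + have a8 : rarr s4 8 = rarr s3 8 by rewrite (frm_ra f4).
    have a9 : rarr s4 9 = rarr s3 9 by rewrite (frm_ra f4).
    have b8 : rarr s2 8 = rarr s1 8 by rewrite (frm_ra f2).
    have b9 : rarr s2 9 = rarr s1 9 by rewrite (frm_ra f2).
    rewrite a8 a9 E8 E9 b8 b9 -Ey.
    have he2 : norm2 (y - shift sig (cv (rarr s2 10))) <= om * norm2 y.
      rewrite -Ee; apply: norm2_le; first by rewrite mulr_ge0 ?norm2_ge0 // ltW.
      by rewrite exprMn !norm2_sq.
    have := cheb_inv_step x1_ge1 xsp_le norm2_cc (mulr_ge0 (ler0n _ 6) (ltW om0))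
      (le_trans (eps_mono jM) eps_1) iv (solution_err he2).
    congr (cheb_inv _ _ _ _ _ _ _).
    rewrite scalerBr !mulmxBr -!scalemxAr Q_solution //.
    have -> : 2 *: dmul xsp (Q *m y) = (2 * tau) *: dmul (fun j => (sig - lam j)^-1) (Q *m y).
      by apply/colP => i; rewrite !mxE /xsp !mulrA.
    move: (dmul _ (Q *m y)) (Q *m cv (rarr s1 9)) (Q *m cv (rarr s2 10)) => a b c0.
    by apply/colP => i; rewrite !mxE; ring.
  + by rewrite /x2 /=; lra.
have lb : ln (1 + dot ((mu + G)^-1 *: y - solution Q lam sig y)
      ((mu + G)^-1 *: y - solution Q lam sig y) / (om ^+ 2 * dot y y / sig ^+ 2))
     <= ln (1 + initR ^+ 2).
  rewrite ler_ln ?posrE ?lerD2l //; last by rewrite ltr_wpDr ?sqr_ge0.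
  by rewrite ltr_wpDr // divr_ge0 ?dot_ge0 // divr_ge0 ?sqr_ge0 // mulr_ge0 ?sqr_ge0 ?dot_ge0.
have lb2 := ler_wpM2l (mulr_ge0 (_ : 0 <= 4 * (cEp + 5 * 100)) u0) lb.
have {lb2} := lb2 ltac:(lra).
move: Hj; rewrite /x2 -(subnSK hj) -natr1 mulrDl mul1r {2}/iterC.
by lra.
Qed.

Lemma normalizeM nn k s x y : stat s -> y = cv (rarr s 8) ->
  (forall s', frm WI [:: 40; 41; 42]%N [::] [:: 1]%N s s' ->
     cv (rarr s' 1) = (norm2 y)^-1 *: y ->
     (forall j, j \notin cls -> rarr s' 1 j = rarr s 1 j) -> B nn k s' (x - 60 * uu)) ->
  B nn (Normalize :: k) s x.
Proof.
move=> St Ey H; apply: (seqsM kap0 good); apply: (dotM kap0 good) => // s1 f1 E1.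
apply: (seqsM kap0 good); apply: (blkM kap0 good); apply: (seqsM kap0 good).
set s2 := execs _ _.
have f2 : frm WI [:: 40; 41; 42]%N [::] [:: 1]%N s s2.
  by apply: frm_trans (_ : frm _ _ _ _ s s1) _;
   [apply: frm_sub f1|apply: frm_sub (frm_execs _ _)].
have e42 : rreg s2 42 = norm2 y by rewrite /s2 rvalE /= E1 -Ey norm2E.
have St2 : stat s2 by apply: stat_frm f2 _ _ _ St.
have a12 b : rarr s2 b = rarr s b by rewrite /s2 /= (frm_ra f1).
apply: (@loopC _ _ _ kap0 _ _ _ _ good nn _ _ s2 _ [:: 40]%N [:: 1]%N (fun q r ar =>
  (forall p, (p < q)%N -> ar 1%N (cl D p) = rarr s 8 (cl D p) / norm2 y) /\
  forall j, j \notin cls -> ar 1%N j = rarr s 1 j)) => //.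
- by split=> // j _; rewrite a12.
- move=> q s' qN e10 f [E E'].
  have cE : iarr s' 3 = cl D by rewrite (frm_ia f) // (st_cl St2).
  have r42 : rreg s' 42 = norm2 y by rewrite (frm_r f).
  have b8 : rarr s' 8 = rarr s 8 by rewrite (frm_ra f).
  rewrite /= /upd /= e10 cE r42 b8; split=> [p|j jc].
    rewrite ltnS leq_eqVlt => /orP pq.
    case: eqP => [->//|ne]; case: pq => [/eqP pq|/E-> //].
    by case: ne; rewrite pq.
  by case: eqP => [e|_]; [move: jc; rewrite e cl_cls|exact: E'].
move=> s3 f3 [E E']; apply: (seqs0 kap0 good).
have u0 := uu_ge0 kap0 good.
apply: bnd_le (H s3 _ _ _) => //=; first by lra.
  by apply: frm_trans f2 _; apply: frm_sub f3.
apply/colP => j; rewrite Ey !mxE; case: ifP => jc; last by rewrite mulr0.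
by case/mem_cls: jc => q hq ->; rewrite E // -Ey mulrC.
Qed.

(** The bound for the filter at eigenvalues below [L1 - G / 4], relative to its top value. *)
Definition decay : R := Mit.+1%:R * expR (- (Num.sqrt (G / mu) / 156) * Mit%:R).

Lemma block_outcome (y yo v' : 'cV[R]_d) (rho' r' : R) : chebI Mit (Q *m y) yo ->
  v' = (norm2 y)^-1 *: y -> rho' = dot v' (gram A *m v') -> r' = resid lam rho' (Q *m v') ->
  [/\ dot v' v' = 1,
      (`|(Q *m v) j0 0| - epsM) / (1 + epsM) <= `|(Q *m v') j0 0|,
      r' <= 2 * (r + epsM * F) / gam,
      L1 - rho' <= G / 4 + F * (8 * (decay ^+ 2 + epsM ^+ 2) / gam ^+ 2) &
      (forall j, j != j0 -> lam j <= L1 - 4 * G) ->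
      r' <= 3 * F * (decay * (r / (3 * G)) + epsM) / gam].
Proof.
move=> iv Ev' Erho' Er'; have hb := cheb_bnd (leqnn _) iv.
have U0 := chebU_gt0 Mit x1_ge1; set U := chebU x1 Mit.+1 in U0 hb.
have m0 := mu0; have g0 := G0.
have uU j : `|chebU (xsp j) Mit.+1| <= U by apply: chebU_max; [exact: xsp_le|exact: x1_ge1].
have LF := lam_le_frob QQ Qg j0.
have q0 : 0 <= decay by rewrite mulr_ge0 // expR_ge0.
have far j : lam j <= L1 - G / 4 -> `|chebU (xsp j) Mit.+1| <= decay * U.
  move=> hj; apply: chebU_ratio x1_bounds _; rewrite ?divr_gt0 //=.
    by rewrite ler_pdivrMr ?mul1r.
  by have /andP[-> _] := xsp_le j; rewrite xsp_far.
pose u j := chebU (xsp j) Mit.+1.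
have cE : Q *m v' = (norm2 (Q *m y))^-1 *: (Q *m y) by rewrite Ev' -scalemxAr norm2_Q.
have rE' : rho' = rayl lam (Q *m v') by rewrite Erho' (dot_gramQ QQ Qg).
split.
- by rewrite -(dot_Q QQ) cE (block_unit U0 erefl hb gam0 cg eps_gam).
- by rewrite cE; exact: (block_overlap c1 U0 uU erefl hb gam0 cg eps_gam).
- rewrite Er' rE' cE.
  exact: (block_resid lge0 lam_le LF c1 rhoc rE U0 uU erefl hb gam0 cg eps_gam).
- rewrite rE' cE.
  have Hq j : lam j < L1 - G / 4 -> `|chebU (xsp j) Mit.+1| <= decay * U by move=> /ltW; exact: far.
  exact: (@block_acc _ _ lam j0 F G c u U epsM gam _ lge0 lam_le LF c1 U0 erefl hb gam0 cg eps_gam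
    decay q0 (ltW g0) Hq).
- move=> H; rewrite Er' rE' cE.
  have LG : L1 <= rho + G by rewrite -LamE.
  have Hq j : j != j0 -> `|chebU (xsp j) Mit.+1| <= decay * U /\ lam j <= L1 - 4 * G.
    by move=> jj; have hj := H j jj; split=> //; apply: far; lra.
  exact: (@block_gap _ _ lam j0 F G rho r c u U epsM gam _ lge0 lam_le LF rE U0 erefl hb gam0 cg
    eps_gam decay q0 g0 LG Hq).
Qed.

End ChebLoop.

(** * Choice of the parameters *)

Section Sparsity.
Variables (R : realType) (n d : nat) (A : 'M[R]_(n, d)) (D : sdata R) (ppi qq : nat -> R).
Local Notation N := (nnz A).
Local Notation a i := (mxrow_vec A i).
Local Notation F := (frob2 A).
Hypothesis good : sgood A D.
Hypothesis samp : ssamp A D ppi qq.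
Hypothesis arow : forall i, 0 < dot (a i) (a i).
Variables (lam1 Lam : R).
Hypothesis lam10 : 0 < lam1.
Hypothesis lamLam : lam1 <= Lam.
Hypothesis Hlam : forall x, dot x (gram A *m x) <= lam1 * dot x x.

Definition row_nnz (i : 'I_n) : R := \sum_(j < d) if A i j != 0 then 1 else 0.

Lemma nnz_sum : N%:R = \sum_i row_nnz i.
Proof.
have /= <- := sg_entry good (fun _ _ _ => 1).
by rewrite sumr_const card_ord.
Qed.

Lemma NR_gt0 : 0 < N%:R :> R. Proof. by rewrite ltr0n (sg_N good). Qed.

Lemma rsp_sq_le i : rsp A i ^+ 2 <= row_nnz i.
Proof.
rewrite /rsp expr_div_n norm2_sq ler_pdivrMr //.
pose x : 'cV[R]_d := \col_j `|A i j|; pose y : 'cV[R]_d := \col_j if A i j != 0 then 1 else 0.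
have := dot_CS y x.
have -> : dot y x = norm1 (a i).
  apply: eq_bigr => j _; rewrite !mxE; case: eqP => [->|_]; last by rewrite mul1r.
  by rewrite normr0 mulr0.
have -> : dot x x = dot (a i) (a i).
  by apply: eq_bigr => j _; rewrite !mxE -expr2 real_normK ?num_real // expr2.
have -> : dot y y = row_nnz i.
  by apply: eq_bigr => j _; rewrite !mxE; case: ifP => _; rewrite ?mulr1 ?mulr0.
by [].
Qed.

Lemma row_nnz_ge1 i : 1 <= row_nnz i.
Proof. by have := rsp_sq_le i; have := rsp_ge1 arow i; nra. Qed.

Lemma rsp_le i : rsp A i <= row_nnz i.
Proof. by have := rsp_sq_le i; have := rsp_ge1 arow i; nra. Qed.

Lemma row_nnz_le i : row_nnz i <= N%:R.
Proof.
rewrite nnz_sum (bigD1 i) //= lerDl; apply: sumr_ge0 => k _.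
by apply: le_trans (row_nnz_ge1 k).
Qed.

Lemma frob_le_N : F <= N%:R * lam1.
Proof.
rewrite nnz_sum mulr_suml; apply: ler_sum => i _.
apply: le_trans (_ : lam1 <= _); last by rewrite ler_peMl ?row_nnz_ge1 // ltW.
have := Hlam (a i); rewrite dot_gram (bigD1 i) //= => h.
have : dot (a i) (a i) * dot (a i) (a i) <= lam1 * dot (a i) (a i).
  by apply: le_trans h; rewrite lerDl; apply: sumr_ge0 => k _; rewrite -expr2 sqr_ge0.
by rewrite ler_pM2r.
Qed.

Lemma frob_le_d : F <= d%:R * lam1.
Proof.
have -> : F = \sum_(j < d) \sum_i A i j ^+ 2.
  rewrite exchange_big /=; apply: eq_bigr => i _; apply: eq_bigr => j _.
  by rewrite !mxE expr2.
rewrite -[d in d%:R]card_ord mulr_natl -sumr_const; apply: ler_sum => j _.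
exact: (@col_sq_le _ _ _ _ lam1 lam1 (lexx _) Hlam j).
Qed.

(** Divided by [F], the expected batch size before rounding, for rows drawn exactly in proportion to
    their squared norms; see [sum_pc]. *)
Definition wsum : R := sW D + sF A Lam * sX D.

Lemma sF_ge0' : 0 <= sF A Lam. Proof. exact: sqrtr_ge0. Qed.

Lemma sW_ge : F <= sW D.
Proof.
rewrite (sa_W samp); apply: ler_sum => i _.
by rewrite -norm2_sq lerXn2r ?nnegrE ?norm2_ge0 ?norm1_ge0 ?norm2_le_norm1.
Qed.

Lemma sX_ge : F <= sX D.
Proof.
rewrite (sa_X samp); apply: ler_sum => i _.
by rewrite -norm2_sq expr2 ler_wpM2l ?norm2_ge0 ?norm2_le_norm1.
Qed.

Hypothesis F0 : 0 < F.

Lemma wsum_ge : F <= wsum.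
Proof.
rewrite /wsum; have := sW_ge; have := mulr_ge0 sF_ge0' (le_trans (ltW F0) sX_ge); lra.
Qed.

Lemma wsum_le : wsum <= 2 * N%:R * F.
Proof.
have N0 := NR_gt0; have q0 : 0 <= Num.sqrt (N%:R : R) by exact: sqrtr_ge0.
have l1 i : norm1 (a i) <= Num.sqrt N%:R * norm2 (a i).
  rewrite -(rsp_norm arow) ler_wpM2r ?norm2_ge0 //.
  have r0 : 0 <= rsp A i by have := rsp_ge1 arow i; lra.
  by rewrite -[leLHS]ger0_norm // -sqrtr_sqr ler_wsqrtr // (le_trans (rsp_sq_le i)) // row_nnz_le.
have w : sW D <= N%:R * F.
  rewrite (sa_W samp) mulr_sumr; apply: ler_sum => i _.
  rewrite -norm2_sq -[N%:R](@sqr_sqrtr _ _ (ltW N0)) -exprMn.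
  by rewrite lerXn2r ?nnegrE ?mulr_ge0 ?norm2_ge0 ?norm1_ge0.
have x : sX D <= Num.sqrt N%:R * F.
  rewrite (sa_X samp) mulr_sumr; apply: ler_sum => i _.
  by rewrite -norm2_sq expr2 mulrCA ler_wpM2l ?norm2_ge0.
have s : sF A Lam <= Num.sqrt N%:R.
  rewrite /sF ler_wsqrtr // ler_pdivrMr ?(lt_le_trans lam10) //.
  by apply: le_trans frob_le_N _; rewrite ler_wpM2l // ltW.
have := ler_pM sF_ge0' (le_trans (ltW F0) sX_ge) s x.
rewrite mulrA -expr2 sqr_sqrtr ?(ltW N0) // /wsum; lra.
Qed.

Lemma sum_pc : \sum_i dot (a i) (a i) / F * (rsp A i * (rsp A i + sF A Lam)) = wsum / F.
Proof.
rewrite /wsum (sa_W samp) (sa_X samp) mulr_sumr -big_split /= mulr_suml.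
apply: eq_bigr => i _; rewrite -(rsp_norm arow) -norm2_sq.
by field; rewrite gt_eqF.
Qed.

(** Rounding adds at most [1 / N] to a row probability and at most doubles a batch. The added part
    stays small because the [rsp^2] sum to at most [N]. *)
Lemma qM_le : qM A qq Lam <= 4 * (wsum / F).
Proof.
have N0 := NR_gt0; have s0 := sF_ge0'.
have c1 i : 1 <= rsp A i * (rsp A i + sF A Lam) by have := rsp_ge1 arow i; nra.
apply: le_trans (_ : \sum_i (dot (a i) (a i) / F + N%:R^-1) *
   (2 * (rsp A i * (rsp A i + sF A Lam))) <= _).
  apply: ler_sum => i _; have [q0 _ _ _ ql] := sa_qq samp i.
  have := nceil_le (le_trans ler01 (c1 i)); rewrite -/(batch A Lam i) => bl.
  by apply: ler_pM => //; have := c1 i; lra.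
have -> : \sum_i (dot (a i) (a i) / F + N%:R^-1) * (2 * (rsp A i * (rsp A i + sF A Lam))) =
  2 * (wsum / F + N%:R^-1 * \sum_i rsp A i * (rsp A i + sF A Lam)).
  rewrite -sum_pc [X in _ = 2 * (_ + X)]mulr_sumr -big_split mulr_sumr /=.
  by apply: eq_bigr => i _; ring.
have h1 : N%:R^-1 * \sum_i rsp A i * (rsp A i + sF A Lam) <= 1 + sF A Lam.
  rewrite mulrC ler_pdivrMr // nnz_sum mulr_sumr; apply: ler_sum => i _.
  by have := rsp_sq_le i; have := ler_wpM2l s0 (rsp_le i); lra.
have h2 : 1 + sF A Lam <= wsum / F.
  rewrite ler_pdivlMr // /wsum; have := sW_ge; have := ler_wpM2l s0 sX_ge; lra.
lra.
Qed.

(** The origin of the choice of [mu]: an epoch has about [F Lam / mu^2] steps with about [wsum / F]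
    samples each, and the hypothesis on [mu^2] bounds the product by [N]. *)
Lemma cost_le mu V : 0 < mu -> V = 30 * F * Lam + mu ^+ 2 -> Lam * wsum / N%:R <= mu ^+ 2 ->
  (epochT mu V + 1) * (202 + 60 * qM A qq Lam) <= 10 * 100 * (8 * 100) * N%:R.
Proof.
move=> mu0 -> h; have N0 := NR_gt0; have L0 : 0 < Lam by exact: lt_le_trans lamLam.
have m2 : 0 < mu ^+ 2 by rewrite exprn_gt0.
pose C := wsum / F; pose z := F * Lam / mu ^+ 2.
have C1 : 1 <= C by rewrite /C ler_pdivlMr // mul1r wsum_ge.
have CN : C <= 2 * N%:R by rewrite /C ler_pdivrMr // wsum_le.
have zC : z * C <= N%:R.
  have -> : z * C = Lam * wsum / mu ^+ 2 by rewrite /z /C; field; rewrite !gt_eqF.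
  by rewrite ler_pdivrMr // [leRHS]mulrC -ler_pdivrMr.
have z0 : 0 <= z by rewrite /z divr_ge0 ?mulr_ge0 ?ltW.
have -> : epochT mu (30 * F * Lam + mu ^+ 2) + 1 = 54 * 30 * z + 55.
  by rewrite /epochT /z; field; rewrite gt_eqF.
have q4 := qM_le; rewrite -/C in q4.
apply: le_trans (_ : (54 * 30 * z + 55) * (442 * C) <= _); last by lra.
by rewrite ler_wpM2l //; lra.
Qed.

End Sparsity.

(** * Numerical estimates for a block *)

Section Consts.
Variable R : realType.
Implicit Types (F G P r rho mu K om gam Lg e q : R).

Lemma ln2_ge : 1 / 2 <= ln (2 : R).
Proof. by have := @ln_tangent R 1 2 ltac:(lra) ltac:(lra); rewrite ln1; lra. Qed.

Lemma lnP_ge P : 2 <= P -> 1 / 2 <= ln P.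
Proof. by move=> h; apply: le_trans ln2_ge _; rewrite ler_ln ?posrE; lra. Qed.

Lemma ln_le_sub P : 0 < P -> ln P <= P - 1.
Proof. by move=> h; have := @ln_tangent R P 1 h ltac:(lra); rewrite ln1 divr1; lra. Qed.

Lemma sqrt_ge1 (m : R) : 1 <= m -> 1 <= Num.sqrt m <= m.
Proof.
move=> m1; have s1 : 1 <= Num.sqrt m by rewrite -[leLHS]sqrtr1 ler_wsqrtr.
by rewrite s1 /= -{2}[m]sqr_sqrtr ?expr2 ?ler_peMl //; lra.
Qed.

Lemma K_le (cK Lg P m : R) : 2 <= P -> 1 <= Lg -> Lg <= 2 + 2 * ln P -> 1 <= m -> m <= 2 * P ->
  1 <= cK -> cK <= cK * Lg * Num.sqrt m <= 4 * cK * P ^+ 2.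
Proof.
move=> P2 L1 L2 m1 m2 c1; have /andP[s1 s2] := sqrt_ge1 m1.
have LP : Lg <= 2 * P by have := @ln_le_sub P ltac:(lra); lra.
have h1 : 1 <= Lg * Num.sqrt m by nra.
have h2 : Lg * Num.sqrt m <= 2 * P * (2 * P) by apply: ler_pM; lra.
by rewrite -mulrA; apply/andP; split; nra.
Qed.

Lemma expn_ge (c0 : nat) P : 2 <= P -> (0 < c0)%N -> c0%:R * P ^+ 4 * 2 ^+ 13 <= P ^+ (17 + c0).
Proof.
move=> P2 c1.
have -> : (17 + c0 = 4 + 13 + c0)%N by [].
rewrite !exprD [leLHS](_ : _ = P ^+ 4 * 2 ^+ 13 * c0%:R); last by ring.
have P0 : 0 <= P by lra.
apply: ler_pM; rewrite ?mulr_ge0 ?exprn_ge0 //.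
  by rewrite ler_wpM2l ?exprn_ge0 // lerXn2r ?nnegrE.
apply: le_trans (_ : 2 ^+ c0 <= _); last by rewrite lerXn2r ?nnegrE.
by rewrite -natrX ler_nat ltnW // ltn_expl.
Qed.

(** Half of the exponent absorbs the factor [M + 1], leaving [2 / ga <= 624 P]; the other half is at
    most the inverse of [P ^ (17 + c0)], which is at least [c0 P^4 2^13]. Hence the 2 and the
    [17 + c0] in the number of steps; 156 is the rate of [chebU_ratio]. *)
Lemma decay_le (c0 : nat) P G mu Lg K : (0 < c0)%N -> 2 <= P -> P <= expR Lg -> 1 <= Lg -> 0 < G ->
  G <= mu -> mu <= 2 * P * G -> K = (156 * (2 * (17 + c0)))%:R * Lg * Num.sqrt (mu / G) ->
  decay G mu K * (8 * c0%:R * P ^+ 3) <= 1.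
Proof.
move=> c1 P2 PL L1 G0 Gmu muP EK; have mu0 : 0 < mu by exact: lt_le_trans Gmu.
have g0 : 0 < G / mu by rewrite divr_gt0.
pose sg := Num.sqrt (G / mu); have s0 : 0 < sg by rewrite sqrtr_gt0.
have s1 : sg <= 1 by rewrite -[leRHS]sqrtr1 ler_wsqrtr // ler_pdivrMr ?mul1r.
have ssE : sg * Num.sqrt (mu / G) = 1.
  rewrite /sg -sqrtrM ?(ltW g0) // -[RHS]sqrtr1; congr Num.sqrt.
  by field; rewrite !gt_eqF.
pose M : R := (Mit K)%:R; have KM : K <= M by exact: nceil_ge.
pose ga := sg / 156; have ga0 : 0 < ga by rewrite divr_gt0.
have ga2 : ga <= 2 by rewrite /ga; lra.
have M0 : 0 <= M by exact: ler0n.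
have tK : (17 + c0)%:R * Lg <= ga * M / 2.
  apply: le_trans (_ : ga * K / 2 <= _); last by rewrite ler_wpM2r // ler_wpM2l // ltW.
  have -> : ga * K / 2 = (17 + c0)%:R * Lg * (sg * Num.sqrt (mu / G)).
    by rewrite EK /ga natrM natrM; field.
  by rewrite ssE mulr1.
have dE : decay G mu K = (M + 1) * expR (- (ga * M / 2)) * expR (- (ga * M / 2)).
  rewrite /decay -natr1 -mulrA -expRD; congr (_ * expR _).
  by rewrite /ga /sg -/M; field.
have e1 : (M + 1) * expR (- (ga * M / 2)) <= 2 / ga.
  have p0 : 0 < 1 + ga * M / 2 by have := mulr_ge0 (ltW ga0) M0; lra.
  rewrite expRN ler_pdivrMr ?expR_gt0 //.
  apply: le_trans (_ : 2 / ga * (1 + ga * M / 2) <= _); last first.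
    by rewrite ler_wpM2l ?expR_ge1Dx // divr_ge0 // ltW.
  have -> : 2 / ga * (1 + ga * M / 2) = 2 / ga + M by field; rewrite gt_eqF.
  by have : 1 <= 2 / ga by [rewrite ler_pdivlMr // mul1r]; lra.
have gaP : 2 / ga <= 312 * (2 * P).
  have -> : 2 / ga = 312 * Num.sqrt (mu / G).
    have -> : Num.sqrt (mu / G) = sg^-1.
      by apply: (@mulfI _ sg); rewrite ?ssE ?mulfV // gt_eqF.
    by rewrite /ga; field; rewrite gt_eqF.
  have m1 : 1 <= mu / G by rewrite ler_pdivlMr // mul1r.
  have /andP[_ h] := sqrt_ge1 m1.
  by apply: ler_wpM2l (ler0n R 312) _ _ _; rewrite (le_trans h) // ler_pdivrMr.
have P0 : 0 < P by lra.
have e2 : expR (- (ga * M / 2)) * (c0%:R * P ^+ 4 * 2 ^+ 13) <= 1.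
  apply: le_trans (_ : expR (- (ga * M / 2)) * expR (ga * M / 2) <= _); last first.
    by rewrite -expRD addNr expR0.
  rewrite ler_wpM2l ?expR_ge0 //; apply: le_trans (expn_ge P2 c1) _.
  apply: le_trans (_ : expR Lg ^+ (17 + c0) <= _); first by rewrite lerXn2r ?nnegrE ?expR_ge0 // ltW.
  by rewrite -expRM_natl ler_expR.
rewrite dE; set E := expR _ in e1 e2 *.
have E0 : 0 <= E by exact: expR_ge0.
have c00 : 0 <= c0%:R * P ^+ 3 by rewrite mulr_ge0 // exprn_ge0 // ltW.
apply: le_trans (_ : 312 * (2 * P) * E * (8 * c0%:R * P ^+ 3) <= _).
  apply: ler_wpM2r; first by rewrite -mulrA mulr_ge0.
  by apply: ler_wpM2r => //; exact: le_trans gaP.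
apply: le_trans e2.
rewrite [leLHS](_ : _ = E * (c0%:R * P ^+ 4 * (312 * 16))); last by ring.
rewrite ler_wpM2l // ler_wpM2l ?mulr_ge0 ?exprn_ge0 ?(ltW P0) //.
have : (312 : R) <= 2 ^+ 9 by rewrite -natrX ler_nat.
by rewrite -[13%N]/(9 + 4)%N exprD; lra.
Qed.

Section Outcome.
Variables (c0 : nat) (P F G r e gam : R).
Hypothesis c1 : (0 < c0)%N.
Hypothesis P2 : 2 <= P.
Hypothesis F0 : 0 < F.
Hypothesis G0 : 0 < G.
Hypothesis FG : 2 * F <= P * G.
Hypothesis r0 : 0 < r.
Hypothesis rF : r <= F.
Hypothesis e0 : 0 <= e.
Hypothesis Ee : e * (200 * c0%:R * F * P ^+ 3) <= 12 * r.
Hypothesis gamE : gam = (1 + r / F) / (c0%:R * P).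

Local Notation h := (r / F).
Local Notation b := (c0%:R * P).

Lemma h_bounds : 0 < h <= 1.
Proof. by rewrite divr_gt0 //= ler_pdivrMr // mul1r. Qed.

Lemma b_ge2 : 2 <= b.
Proof. by have : 1 <= (c0%:R : R) by [rewrite ler1n]; have := P2; nra. Qed.

Lemma ebP : e * b * P ^+ 2 <= 3 / 50 * h.
Proof.
rewrite [leRHS]mulrA ler_pdivlMr //; have := Ee.
by rewrite [P ^+ 3]exprS; lra.
Qed.

Lemma eb_le : e * b <= 3 / 200 * h.
Proof.
have P4 : 4 <= P ^+ 2 by have := P2; nra.
have := ebP; have : e * b * 4 <= e * b * P ^+ 2.
  by rewrite ler_wpM2l // mulr_ge0 //; have := b_ge2; lra.
by lra.
Qed.

Lemma e_le : e <= 3 / 400 * h.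
Proof.
have := eb_le; have : e * 2 <= e * b by rewrite ler_wpM2l // b_ge2.
lra.
Qed.

Lemma gam_gt0 : 0 < gam.
Proof.
have /andP[h0 h1] := h_bounds; have b2 := b_ge2.
by rewrite gamE divr_gt0 //; lra.
Qed.

Lemma b_mul_gam : b * gam = 1 + h.
Proof. by rewrite gamE mulrC divfK // gt_eqF //; have := b_ge2; lra. Qed.

Lemma gamV : gam^-1 <= b.
Proof.
have /andP[h0 h1] := h_bounds; have g0 := gam_gt0; have b2 := b_ge2.
have := b_mul_gam => E; rewrite -[gam^-1]mul1r ler_pdivrMr //; lra.
Qed.

Lemma eps_gamma : e <= gam / 2.
Proof.
have /andP[h0 h1] := h_bounds; have b2 := b_ge2; have := eb_le; have := b_mul_gam => bg eb.
rewrite -(@ler_pM2l _ b); last by lra.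
by rewrite mulrA bg mulrC; lra.
Qed.

Lemma eps_one : e <= 1.
Proof. by have := e_le; have /andP[] := h_bounds; lra. Qed.

Lemma eps_res : e * F <= r.
Proof.
have := ler_wpM2r (ltW F0) e_le; rewrite -[_ * h * F]mulrA divfK ?gt_eqF //; have := r0; lra.
Qed.

(** The residual at least halves, so the required overlap falls from [(1 + h) / b] to at most
    [(1 + h / 2) / b]; the error [e] is a small fraction of [h] even after multiplication by [b],
    and fits into this margin. *)
Lemma overlap_stay c r' : gam <= c -> r' <= r / P ->
  (1 + r' / F) / b <= (c - e) / (1 + e).
Proof.
move=> gc rr; have /andP[h0 h1] := h_bounds; have b2 := b_ge2; have el := e_le; have ebl := eb_le.
have h' : r' / F <= h / 2.
  rewrite ler_pdivrMr //; apply: le_trans rr _.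
  rewrite mulrAC divfK ?gt_eqF // ler_pM2l // lef_pV2 ?posrE //; have := P2; lra.
have bc : 1 + h <= b * c by rewrite -b_mul_gam ler_wpM2l //; lra.
rewrite ler_pdivlMr; last by have := e0; lra.
rewrite mulrAC ler_pdivrMr; last by lra.
have h2 : (1 + r' / F) * (1 + e) <= (1 + h / 2) * (1 + e).
  by rewrite ler_wpM2r ?lerD2l //; have := e0; lra.
have h3 : h * e <= e by rewrite ler_piMl.
by rewrite [leRHS]mulrC mulrBr [b * e]mulrC; lra.
Qed.

(** Here the residual may grow, and the numerator reach 2; the doubling of [P] compensates for
    that. *)
Lemma overlap_up c r' : gam <= c -> r' <= F ->
  (1 + r' / F) / (c0%:R * (2 * P)) <= (c - e) / (1 + e).
Proof.
move=> gc rr; have /andP[h0 h1] := h_bounds; have b2 := b_ge2; have el := e_le; have ebl := eb_le.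
have h' : r' / F <= 1 by rewrite ler_pdivrMr // mul1r.
have bc : 1 + h <= b * c by rewrite -b_mul_gam ler_wpM2l //; lra.
rewrite ler_pdivlMr; last by have := e0; lra.
rewrite mulrAC ler_pdivrMr; last by lra.
have h2 : (1 + r' / F) * (1 + e) <= 2 * (1 + e).
  by rewrite ler_wpM2r //; have := e0; lra.
rewrite [leRHS](_ : _ = 2 * (b * c - e * b)); last by ring.
by lra.
Qed.

Lemma acc_half q : 0 <= q -> q * (8 * c0%:R * P ^+ 3) <= 1 ->
  F * (8 * (q ^+ 2 + e ^+ 2) / gam ^+ 2) <= G / 4.
Proof.
move=> q0 qP; have /andP[h0 h1] := h_bounds; have b2 := b_ge2; have g0 := gam_gt0.
have P0 : 0 < P by have := P2; lra.
have qb : q * b * P ^+ 2 <= 1 / 8 by move: qP; rewrite [P ^+ 3]exprS; lra.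
have eb := ebP.
have P4 : 4 <= P ^+ 2 by have := P2; nra.
have sq (x : R) : 0 <= x -> x * b * P ^+ 2 <= 1 / 8 -> (x * b) ^+ 2 * P ^+ 2 <= 1 / 4 / 64.
  move=> x0 hx; have y0 : 0 <= x * b by rewrite mulr_ge0 //; lra.
  have : x * b <= 1 / 32.
    by have : x * b * 4 <= x * b * P ^+ 2 by [rewrite ler_wpM2l]; lra.
  move=> hy; rewrite expr2 -mulrA; apply: le_trans (_ : 1 / 32 * (1 / 8) <= _); last by lra.
  by apply: ler_pM => //; rewrite mulr_ge0 // exprn_ge0 // ltW.
have sq1 := sq q q0 qb; have sq2 : (e * b) ^+ 2 * P ^+ 2 <= 1 / 4 / 64 by apply: sq => //; lra.
have gV : gam ^- 2 <= b ^+ 2.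
  by rewrite -exprVn lerXn2r ?nnegrE ?gamV ?invr_ge0 ?(ltW g0) //; lra.
have s0 : 0 <= 8 * (q ^+ 2 + e ^+ 2) by rewrite mulr_ge0 // addr_ge0 ?sqr_ge0.
apply: le_trans (_ : P * G / 2 * (8 * (q ^+ 2 + e ^+ 2) * b ^+ 2) <= _).
  apply: ler_pM; rewrite ?(ltW F0) ?mulr_ge0 ?invr_ge0 ?exprn_ge0 ?(ltW g0) //.
  - by rewrite addr_ge0 ?sqr_ge0.
  - by have := FG; lra.
  by rewrite ler_wpM2l.
have -> : P * G / 2 * (8 * (q ^+ 2 + e ^+ 2) * b ^+ 2) =
   G * (4 * (((q * b) ^+ 2 + (e * b) ^+ 2) * P)) by field.
have : ((q * b) ^+ 2 + (e * b) ^+ 2) * P <= ((q * b) ^+ 2 + (e * b) ^+ 2) * P ^+ 2.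
  by rewrite ler_wpM2l ?addr_ge0 ?sqr_ge0 // expr2 ler_peMl //; have := P2; lra.
rewrite [X in _ <= X -> _]mulrDl => hh.
by rewrite -[G / 4]mulr1 mulrAC -mulrA ler_wpM2l ?(ltW G0) //; lra.
Qed.

Lemma resid_shrink q : 0 <= q -> q * (8 * c0%:R * P ^+ 3) <= 1 ->
  3 * F * (q * (r / (3 * G)) + e) / gam <= r / P.
Proof.
move=> q0 qP; have /andP[h0 h1] := h_bounds; have b2 := b_ge2; have g0 := gam_gt0.
have P0 : 0 < P by have := P2; lra.
have qb : q * b * P ^+ 2 <= 1 / 8 by move: qP; rewrite [P ^+ 3]exprS; lra.
have eb := ebP.
apply: le_trans (_ : 3 * F * (q * (r / (3 * G)) + e) * b <= _).
  rewrite ler_wpM2l ?gamV // mulr_ge0 ?mulr_ge0 ?(ltW F0) //.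
  by rewrite addr_ge0 // mulr_ge0 // divr_ge0 ?mulr_ge0 // ltW.
have -> : 3 * F * (q * (r / (3 * G)) + e) * b = q * b * r * (F / G) + 3 * F * (e * b).
  by field; rewrite gt_eqF.
have fg : F / G <= P / 2 by rewrite ler_pdivrMr // mulrAC; have := FG; lra.
have t1 : q * b * r * (F / G) <= q * b * r * (P / 2).
  by rewrite ler_wpM2l // ?mulr_ge0 // ?(ltW r0) //; lra.
have t3 : 3 * F * (e * b) * P ^+ 2 <= 9 / 50 * r.
  have := ler_wpM2l (ltW F0) eb; rewrite [F * (_ * h)]mulrCA [F * h]mulrC divfK ?gt_eqF //; lra.
have t2 := ler_wpM2l (ltW r0) qb.
rewrite ler_pdivlMr //.
have -> : (q * b * r * (F / G) + 3 * F * (e * b)) * P = q * b * r * (F / G) * P + 3 * F * (e * b) * P by ring.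
have t4 : 3 * F * (e * b) * P <= 9 / 100 * r.
  have : 3 * F * (e * b) * P * 2 <= 3 * F * (e * b) * P ^+ 2.
    rewrite [P ^+ 2]expr2 [leRHS]mulrA; apply: ler_wpM2l; last exact: P2.
    by rewrite mulr_ge0 ?(ltW P0) // mulr_ge0 ?mulr_ge0 ?(ltW F0) //; lra.
  by lra.
have := ler_wpM2r (ltW P0) t1.
rewrite (_ : q * b * r * (P / 2) * P = r * (q * b * P ^+ 2) / 2); last by rewrite expr2; field.
by move: r0; lra.
Qed.

Lemma resid_grow : 2 * (r + e * F) / gam <= 4 * r * b.
Proof.
have g0 := gam_gt0; have er := eps_res.
apply: le_trans (_ : 2 * (r + e * F) * b <= _).
  by rewrite ler_wpM2l ?gamV // mulr_ge0 // addr_ge0 ?mulr_ge0 // ltW.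
by rewrite ler_wpM2r //; have := b_ge2; lra.
Qed.

(** The tolerance [om] contains the factor [r], which cancels. The remaining ratios are bounded
    through [F / G <= P / 2], so the logarithm of [initR] is of order [ln P]. *)
Lemma initR_le (cw cK mu sig om K : R) : 1 <= cw -> 1 <= cK -> G <= mu -> sig <= 5 * F ->
  0 < sig -> 0 < K -> K <= 4 * cK * P ^+ 2 -> om = r / (cw * F * ((1 + K) ^+ 3 * P ^+ 3)) ->
  0 <= initR r G mu sig om gam <= 5 * 125 * cw * c0%:R * cK ^+ 3 * P ^+ 12.
Proof.
move=> cw1 cK1 Gmu s5 s0 K0 KP Eom; have g0 := gam_gt0; have P0 : 0 < P by have := P2; lra.
have mu0 : 0 < mu by have := G0; lra.
have w0 : 0 < cw by lra.
have k0 : 0 < 1 + K by lra.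
have -> : initR r G mu sig om gam =
   4 * sig * (cw * F * ((1 + K) ^+ 3 * P ^+ 3)) * (((mu + G) * mu)^-1 * gam^-1).
  rewrite /initR Eom; field; rewrite !gt_eqF ?addr_gt0 ?mulr_gt0 ?exprn_gt0 //.
have d0 : 0 < (mu + G) * mu by rewrite mulr_gt0 // addr_gt0.
have d1 : ((mu + G) * mu)^-1 <= (G ^+ 2)^-1.
  rewrite lef_pV2 ?posrE ?exprn_gt0 // expr2; apply: ler_pM; rewrite ?(ltW G0) // lerDr; exact: ltW.
have b2 := b_ge2; have b0 : 0 <= b by lra.
have n0 : 0 <= 4 * sig * (cw * F * ((1 + K) ^+ 3 * P ^+ 3)).
  by rewrite ?mulr_ge0 ?exprn_ge0 ?ltW.
apply/andP; split.
  by rewrite mulr_ge0 // mulr_ge0 // invr_ge0 ltW.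
apply: le_trans (_ : 4 * sig * (cw * F * ((1 + K) ^+ 3 * P ^+ 3)) * ((G ^+ 2)^-1 * b) <= _).
  by rewrite ler_wpM2l //; apply: ler_pM; rewrite ?invr_ge0 ?gamV ?(ltW g0) ?(ltW d0).
rewrite [leLHS](_ : _ = cw * c0%:R * (4 * (sig / G) * (F / G)) * (1 + K) ^+ 3 * P ^+ 4); last first.
  by field; rewrite gt_eqF.
have fg : F / G <= P / 2 by rewrite ler_pdivrMr // mulrAC; have := FG; lra.
have sg : sig / G <= 5 * (P / 2).
  by apply: le_trans (_ : 5 * (F / G) <= _); [rewrite mulrA ler_wpM2r ?invr_ge0 // ltW|lra].
have k1 : 1 + K <= 5 * cK * P ^+ 2.
  by have : 1 <= cK * P ^+ 2 by [have := P2; nra]; lra.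
have k3 : (1 + K) ^+ 3 <= 125 * cK ^+ 3 * P ^+ 6.
  rewrite [leRHS](_ : _ = (5 * cK * P ^+ 2) ^+ 3); last by ring.
  by rewrite lerXn2r ?nnegrE ?(ltW k0) ?(le_trans (ltW k0)).
have sf : 4 * (sig / G) * (F / G) <= 5 * P ^+ 2.
  have : sig / G * (F / G) <= 5 * (P / 2) * (P / 2).
    by apply: ler_pM => //; rewrite divr_ge0 // ltW.
  by rewrite expr2; lra.
rewrite [leRHS](_ : _ = cw * c0%:R * (5 * P ^+ 2) * (125 * cK ^+ 3 * P ^+ 6) * P ^+ 4); last by ring.
rewrite ler_wpM2r ?exprn_ge0 ?(ltW P0) //; apply: ler_pM => //.
- by rewrite !mulr_ge0 ?invr_ge0 //; exact: ltW.
- by rewrite exprn_ge0 // ltW.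
by rewrite ler_wpM2l // mulr_ge0 // ltW.
Qed.

End Outcome.

Lemma ln_initR (x c3 P : R) : 2 <= P -> 1 <= c3 -> 0 <= x <= c3 * P ^+ 12 ->
  ln (1 + x ^+ 2) <= (24 + 4 * ln (2 * c3)) * ln P.
Proof.
move=> P2 c31 /andP[x0 xc]; have l2 := lnP_ge P2; have P0 : 0 < P by lra.
have : 1 <= P ^+ 12 by apply: exprn_ege1; lra.
have p0 : 0 < P ^+ 12 by rewrite exprn_gt0.
have lE : ln (P ^+ 12) = ln P *+ 12 by rewrite lnXn.
move: (P ^+ 12) p0 lE xc => y p0 lE xc y1.
have c0 : 0 < 2 * c3 by lra.
have x1 : 1 + x ^+ 2 <= (2 * c3 * y) ^+ 2.
  have : x ^+ 2 <= (c3 * y) ^+ 2 by rewrite lerXn2r ?nnegrE //; lra.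
  have z1 : 1 <= c3 * y by rewrite -[leLHS]mulr1; apply: ler_pM; lra.
  rewrite -[2 * c3 * _]mulrA; move: (c3 * y) z1 => z z1 h.
  by have : 1 <= z ^+ 2 by [rewrite exprn_ege1]; lra.
have lc : 0 <= ln (2 * c3) by apply: ln_ge0; lra.
have := ler_wpM2l lc l2; move: (2 * c3) c0 x1 => w w0 x1 l3.
have z0 : 0 < 1 + x ^+ 2 by rewrite ltr_wpDr ?sqr_ge0.
have t0 : 0 < w * y by rewrite mulr_gt0.
have h : ln (1 + x ^+ 2) <= ln (w * y * (w * y)) by rewrite ler_ln ?posrE ?mulr_gt0 // -expr2.
apply: le_trans h _; rewrite !lnM ?posrE // lE -mulr_natl.
by move: (ln P) (ln w) l3 => u t; lra.
Qed.

Lemma eps_def (c0 : nat) P F r K om : (0 < c0)%N -> 0 < P -> 0 < F -> 0 < r -> 0 < K ->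
  om = r / ((200 * c0)%:R * F * ((1 + K) ^+ 3 * P ^+ 3)) ->
  [/\ 0 < om, 0 <= epsM K om & epsM K om * (200 * c0%:R * F * P ^+ 3) <= 12 * r].
Proof.
move=> c1 P0 F0 r0 K0 Eom.
have k0 : 0 < 1 + K by lra.
have cR : 0 < (c0%:R : R) by rewrite ltr0n.
have om0 : 0 < om.
  rewrite Eom; apply: divr_gt0 r0 (mulr_gt0 (mulr_gt0 _ F0) (mulr_gt0 (exprn_gt0 3 k0) (exprn_gt0 3 P0))).
  by rewrite ltr0n muln_gt0.
split=> //; first by rewrite /epsM !mulr_ge0 ?exprn_ge0 // ltW.
have M3 : (Mit K)%:R ^+ 3 <= (1 + K) ^+ 3.
  by rewrite lerXn2r ?nnegrE ?(ltW k0) // addrC nceil_le // ltW.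
have -> : epsM K om * (200 * c0%:R * F * P ^+ 3) = 12 * r * ((Mit K)%:R ^+ 3 / (1 + K) ^+ 3).
  by rewrite /epsM Eom natrM; field; rewrite !gt_eqF ?exprn_gt0.
by rewrite ler_piMr ?mulr_ge0 ?(ltW r0) // ler_pdivrMr ?exprn_gt0 // mul1r.
Qed.

End Consts.

(** * The main loop *)

Lemma block_slack (R : realType) (u x : R) : 0 <= u -> x <= x + 70 * u - u - 60 * u - u.
Proof. by lra. Qed.

Lemma block_budget (R : realType) (p q : nat) (u x x0 z w : R) : (p <= 150)%N -> (q <= 50)%N ->
  0 <= u -> z + 20 * 100 * u <= w -> x0 + w - 16 * 100 * u <= x ->
  x0 + 70 * u + z + 2 * u <= x - u - p%:R * u - u - q%:R * u - u.
Proof.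
move=> p1 q1 u0 h1 h2.
have : p%:R * u <= 150 * u by rewrite ler_wpM2r // ler_nat.
have : q%:R * u <= 50 * u by rewrite ler_wpM2r // ler_nat.
by lra.
Qed.

Lemma halve_bound (R : realType) (D G : R) : D < 4 * G -> D / 8 <= G / 2.
Proof. by lra. Qed.

Lemma loop_budget_up (R : realType) (p q r : nat) (u k x y z C : R) :
  (p <= 100)%N -> (q <= 100)%N -> (r <= 100)%N -> 0 <= u -> k <= u ->
  y + C <= z -> z + 5 * u <= x ->
  y + 5 * u <= x - C + 15 * 100 * u - u - 200 * u - u - k - p%:R * u - k - q%:R * u - u
    - r%:R * u - u.
Proof.
move=> p1 q1 r1 u0 ku h1 h2.
have : p%:R * u <= 100 * u by rewrite ler_wpM2r // ler_nat.
have : q%:R * u <= 100 * u by rewrite ler_wpM2r // ler_nat.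
have : r%:R * u <= 100 * u by rewrite ler_wpM2r // ler_nat.
by lra.
Qed.

Lemma loop_budget_stay (R : realType) (p r : nat) (u k x y z C : R) :
  (p <= 100)%N -> (r <= 100)%N -> 0 <= u -> k <= u -> y + C <= z -> z + 5 * u <= x ->
  y + 5 * u <= x - C + 15 * 100 * u - u - 200 * u - u - k - p%:R * u - k - k - u
    - r%:R * u - u.
Proof.
move=> p1 r1 u0 ku h1 h2.
have : p%:R * u <= 100 * u by rewrite ler_wpM2r // ler_nat.
have : r%:R * u <= 100 * u by rewrite ler_wpM2r // ler_nat.
by lra.
Qed.

Section Main.
Variables (R : realType) (P : store R -> Prop) (kap : R).
Hypothesis kap0 : 0 <= kap.
Variables (n d : nat) (A : 'M[R]_(n, d)) (D : sdata R) (ppi qq : nat -> R).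
Local Notation N := (nnz A).
Local Notation a i := (mxrow_vec A i).
Hypothesis good : sgood A D.
Hypothesis samp : ssamp A D ppi qq.
Hypothesis arow : forall i, 0 < dot (a i) (a i).
Implicit Types (s : store R).
Local Notation B := (@bnd R P kap).
Local Notation stat := (stat A D).
Local Notation cv := (@cv R d D).
Local Notation cls := (cls D).
Local Notation uu := (uu kap A).
Local Notation F := (frob2 A).

Variables (Q : 'M[R]_d) (lam : 'I_d -> R) (j0 : 'I_d).
Hypothesis QQ : Q *m Q^T = 1%:M.
Hypothesis Qg : Q *m gram A = diag_mx (\row_j lam j) *m Q.
Hypothesis lam_le : forall j, lam j <= lam j0.
Local Notation L1 := (lam j0).
Hypothesis L10 : 0 < L1.
Hypothesis d2 : (1 < d)%N.

Variable c0 : nat.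
Hypothesis c01 : (0 < c0)%N.
Definition stepsC : nat := 156 * (2 * (17 + c0)).
Definition tolC : nat := 200 * c0.
Local Notation cK := stepsC.
Local Notation cwt := tolC.

(** [G] plus the shift at which, by [cost_le], an epoch costs about one pass over the matrix. *)
Definition mu_of (rho G : R) : R :=
  G + Num.sqrt ((rho + G) * wsum A D (rho + G) / N%:R).

(** [PP] is [d F / G], and [Lg] is a computed bound for its logarithm. The numerator of [ms_c]
    decreases with the residual: this decrease pays for the overlap lost in the blocks that keep
    [G]. *)
Record mst (v : 'cV[R]_d) (rho r G PP Lg : R) : Prop := Mst {
  ms_v : dot v v = 1;
  ms_rho : rho = dot v (gram A *m v);
  ms_r : r = resid lam rho (Q *m v);
  ms_up : L1 <= rho + G;
  ms_G : 0 < G <= F;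
  ms_PG : PP * G = d%:R * F;
  ms_P : 2 <= PP;
  ms_e : PP <= expR Lg;
  ms_L : 1 <= Lg <= 2 + 2 * ln PP;
  ms_c : (1 + r / F) / (c0%:R * PP) <= `|(Q *m v) j0 0| }.

Let F0 : 0 < F. Proof. exact: lt_le_trans (lam_le_frob QQ Qg j0). Qed.
Let LF : L1 <= F := lam_le_frob QQ Qg j0.
Let Hlam := gram_le QQ Qg lam_le.
Let c0R : 1 <= (c0%:R : R). Proof. by rewrite ler1n. Qed.
Let lge0 j : 0 <= lam j. Proof. exact: lam_ge0 QQ Qg j. Qed.

Lemma rho_bounds v rho : dot v v = 1 -> rho = dot v (gram A *m v) -> 0 <= rho <= L1.
Proof.
move=> v1 ->; rewrite (dot_gramQ QQ Qg); apply: rayl_bounds => //; by rewrite dot_Q.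
Qed.

Lemma res_le v rho r : dot v v = 1 -> rho = dot v (gram A *m v) ->
  r = resid lam rho (Q *m v) -> 0 <= r <= F.
Proof.
move=> v1 Er ->; have /andP[h0 h1] := rho_bounds v1 Er.
rewrite /resid norm2_ge0 /=; apply: le_trans LF.
have := @norm2_dmul _ _ (fun j => lam j - rho) (Q *m v) L1 (ltW L10).
rewrite (norm2_Q QQ) [norm2 v]norm2E v1 sqrtr1 mulr1; apply=> j.
by rewrite ler_norml; have := lge0 j; have := lam_le j; lra.
Qed.

Lemma mu_facts rho G : L1 <= rho + G -> rho <= L1 -> 0 < G <= F ->
  forall mu, mu = mu_of rho G -> [/\ G <= mu, mu <= G + 2 * F, mu <= 3 * F &
    (rho + G) * wsum A D (rho + G) / N%:R <= mu ^+ 2].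
Proof.
move=> up rL /andP[G0 GF] mu ->; rewrite /mu_of; set Lam := rho + G.
have L0 : 0 < Lam by exact: lt_le_trans up.
have N0 := NR_gt0 good.
have w1 := wsum_le good samp arow L10 up Hlam F0.
have w0 := wsum_ge samp Lam F0.
set z := Lam * _ / _; have z0 : 0 <= z.
  by rewrite /z divr_ge0 ?mulr_ge0 //; [exact: ltW|exact: le_trans (ltW F0) w0].
have s0 : 0 <= Num.sqrt z by exact: sqrtr_ge0.
have L2 : Lam <= 2 * F by rewrite /Lam; have := LF; lra.
have zF : z <= (2 * F) ^+ 2.
  rewrite /z ler_pdivrMr // expr2; apply: le_trans (_ : 2 * F * (2 * N%:R * F) <= _); last by lra.
  by apply: ler_pM => //; [exact: ltW|exact: le_trans (ltW F0) w0].
have s2 : Num.sqrt z <= 2 * F.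
  by rewrite -[leRHS]ger0_norm ?mulr_ge0 ?(ltW F0) // -sqrtr_sqr ler_wsqrtr.
split; try lra.
rewrite -{1}[z]sqr_sqrtr // lerXn2r ?nnegrE //; lra.
Qed.

Definition cEp : R := 10 * 100 * (8 * 100).
Definition logC : R := 24 + 4 * ln (2 * (5 * 125 * cwt%:R * c0%:R * cK%:R ^+ 3)).
Definition blkC : R := 12 * cK%:R * (4 * (cEp + 5 * 100) * logC + 14 * 100) + 90 * 100.

Lemma cKR : 1 <= (cK%:R : R). Proof. by rewrite ler1n /stepsC muln_gt0. Qed.
Lemma cwR : 1 <= (cwt%:R : R). Proof. by rewrite ler1n /tolC muln_gt0. Qed.

Lemma logC_ge0 : 0 <= logC.
Proof.
rewrite /logC addr_ge0 ?mulr_ge0 // ln_ge0 //.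
have k3 : 1 <= (cK%:R : R) ^+ 3 by apply: exprn_ege1; exact: cKR.
have h1 : 1 <= cwt%:R * c0%:R :> R by rewrite -[leLHS]mulr1 ler_pM // cwR.
have : 1 <= cwt%:R * c0%:R * cK%:R ^+ 3 :> R by rewrite -[leLHS]mulr1 ler_pM.
by move: (cK%:R ^+ 3) => z; lra.
Qed.

Lemma blkC_ge0 : 0 <= blkC.
Proof.
have l0 := logC_ge0; have k := cKR.
by rewrite /blkC addr_ge0 ?mulr_ge0 // addr_ge0 // mulr_ge0 // /cEp mulr_ge0 // addr_ge0.
Qed.

Section BlockState.
Variables (v : 'cV[R]_d) (rho r G PP Lg : R).
Hypothesis st : mst v rho r G PP Lg.
Hypothesis r0 : 0 < r.

Definition bmu := mu_of rho G.
Definition bK := cK%:R * Lg * Num.sqrt (bmu / G).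
Definition bom := r / (cwt%:R * F * ((1 + bK) ^+ 3 * PP ^+ 3)).
Definition bgam := (1 + r / F) / (c0%:R * PP).
Definition bsig := rho + G + bmu.
Definition bV := 30 * F * (rho + G) + bmu ^+ 2.

Let G0 : 0 < G. Proof. by have /andP[] := ms_G st. Qed.
Let rL : 0 <= rho <= L1. Proof. exact: rho_bounds (ms_v st) (ms_rho st). Qed.
Let muF : [/\ G <= bmu, bmu <= G + 2 * F, bmu <= 3 * F &
    (rho + G) * wsum A D (rho + G) / N%:R <= bmu ^+ 2].
Proof. by apply: mu_facts (ms_G st) _ erefl; [exact: ms_up st|have /andP[] := rL]. Qed.
Let mu0 : 0 < bmu. Proof. by have [h _ _ _] := muF; exact: lt_le_trans h. Qed.
Let FG : 2 * F <= PP * G.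
Proof. by rewrite (ms_PG st) ler_wpM2r ?(ltW F0) // ler_nat. Qed.
Let muP : bmu <= 2 * PP * G.
Proof. by have [_ h _ _] := muF; have := FG; have := ms_P st; have := G0; nra. Qed.
Let m12 : 1 <= bmu / G <= 2 * PP.
Proof.
by have [h _ _ _] := muF; rewrite ler_pdivlMr // mul1r h /= ler_pdivrMr // muP.
Qed.
Let Kb : cK%:R <= bK <= 4 * cK%:R * PP ^+ 2.
Proof.
have /andP[m1 m2] := m12; have /andP[l1 l2] := ms_L st.
exact: K_le (ms_P st) l1 l2 m1 m2 cKR.
Qed.
Let K0 : 0 < bK. Proof. by have /andP[h _] := Kb; have := cKR; lra. Qed.
Let P0 : 0 < PP. Proof. by have := ms_P st; lra. Qed.
Let rF : r <= F. Proof. by have /andP[] := res_le (ms_v st) (ms_rho st) (ms_r st). Qed.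
Let eD : [/\ 0 < bom, 0 <= epsM bK bom & epsM bK bom * (200 * c0%:R * F * PP ^+ 3) <= 12 * r].
Proof. exact: eps_def c01 P0 F0 r0 K0 erefl. Qed.
Let e0 : 0 <= epsM bK bom. Proof. by case: eD. Qed.
Let Ee : epsM bK bom * (200 * c0%:R * F * PP ^+ 3) <= 12 * r. Proof. by case: eD. Qed.
Let om0 : 0 < bom. Proof. by case: eD. Qed.
Let gam0 : 0 < bgam. Proof. exact: gam_gt0 c01 (ms_P st) F0 r0 rF erefl. Qed.
Let egam : epsM bK bom <= bgam / 2.
Proof. exact: (eps_gamma c01 (ms_P st) F0 r0 rF e0 Ee erefl). Qed.
Let e1 : epsM bK bom <= 1. Proof. exact: (eps_one c01 (ms_P st) F0 r0 rF e0 Ee). Qed.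
Let eF : epsM bK bom * F <= r. Proof. exact: (eps_res c01 (ms_P st) F0 r0 e0 Ee). Qed.
Let decB : decay G bmu bK * (8 * c0%:R * PP ^+ 3) <= 1.
Proof.
have [h _ _ _] := muF; have /andP[l1 _] := ms_L st.
exact: decay_le c01 (ms_P st) (ms_e st) l1 G0 h muP erefl.
Qed.

Lemma block_result (y yo v' : 'cV[R]_d) (rho' r' : R) :
  cheb_inv (xsp lam G bmu bsig) (xsp lam G bmu bsig j0) (6 * bom) (Q *m v) (Mit bK) (Q *m y) yo ->
  v' = (norm2 y)^-1 *: y -> rho' = dot v' (gram A *m v') -> r' = resid lam rho' (Q *m v') ->
  [/\ dot v' v' = 1,
      r' <= r / PP -> (1 + r' / F) / (c0%:R * PP) <= `|(Q *m v') j0 0|,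
      (1 + r' / F) / (c0%:R * (2 * PP)) <= `|(Q *m v') j0 0|,
      r' <= 4 * r * (c0%:R * PP) /\ L1 - rho' <= G / 2 &
      (forall j, j != j0 -> lam j <= L1 - 4 * G) -> r' <= r / PP].
Proof.
move=> iv Ev' Erho' Er'; have [h _ _ _] := muF.
have [v1' ov rg ac ga] := block_outcome QQ Qg lam_le erefl (ms_up st) G0 h erefl (ms_v st)
  (ms_rho st) (ms_r st) gam0 (ms_c st) om0 egam e1 iv Ev' Erho' Er'.
have q0 : 0 <= decay G bmu bK by rewrite mulr_ge0 ?expR_ge0.
have /andP[_ rF'] := res_le v1' Erho' Er'.
split=> //.
- move=> hr; apply: le_trans ov.
  exact: (overlap_stay c01 (ms_P st) F0 r0 rF e0 Ee erefl (ms_c st) hr).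
- apply: le_trans ov.
  exact: (overlap_up c01 (ms_P st) F0 r0 rF e0 Ee erefl (ms_c st) rF').
- split.
    apply: le_trans rg _; exact: (resid_grow c01 (ms_P st) F0 r0 rF e0 Ee erefl).
  have := acc_half c01 (ms_P st) F0 G0 FG r0 rF e0 Ee erefl q0 decB.
  by move: ac; rewrite -/bgam; lra.
- move=> hg; apply: le_trans (ga hg) _.
  exact: (resid_shrink c01 (ms_P st) F0 G0 FG r0 rF e0 Ee erefl q0 decB).
Qed.

(** About [sm * ln PP] systems with about [ln PP] epochs each, every epoch costing a constant number
    of passes. *)
Lemma block_cost sm : Num.sqrt (bmu / G) <= sm ->
  (Mit bK)%:R * iterC kap A r G bmu bsig bom bgam cEp + 20 * 100 * uu <=
  blkC * sm * ln PP ^+ 2 * uu.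
Proof.
move=> hs; have u0 := uu_ge0 kap0 good; have [hG _ h3 _] := muF; have k1 := cKR.
have /andP[l1 l2] := ms_L st; have lP := lnP_ge (ms_P st).
have /andP[rh0 rh1] := rL; have /andP[_ GF] := ms_G st.
have /andP[K1 K2] := Kb.
have sg5 : bsig <= 5 * F by rewrite /bsig; have := LF; lra.
have sg0 : 0 < bsig by rewrite /bsig; have := ms_up st; have := L10; have := mu0; lra.
have /andP[i0 i1] := initR_le c01 (ms_P st) F0 G0 FG r0 rF erefl cwR k1 hG sg5 sg0 K0 K2 erefl.
have /andP[s1 _] := sqrt_ge1 (proj1 (andP m12)).
have c3 : 1 <= 5 * 125 * cwt%:R * c0%:R * cK%:R ^+ 3 :> R.
  have h1 : 1 <= cwt%:R * c0%:R :> R by rewrite -[leLHS]mulr1 ler_pM // cwR.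
  have h2 : 1 <= cwt%:R * c0%:R * cK%:R ^+ 3 :> R.
    by rewrite -[leLHS]mulr1 ler_pM // exprn_ege1.
  by move: (cK%:R ^+ 3) h2 => z; lra.
have li := @ln_initR _ _ _ PP (ms_P st) c3 (introT andP (conj i0 i1)).
have lC := logC_ge0.
have it : iterC kap A r G bmu bsig bom bgam cEp <=
    (4 * (cEp + 5 * 100) * logC + 14 * 100) * (ln PP * uu).
  rewrite /iterC.
  have := ler_wpM2l (_ : 0 <= 4 * (cEp + 5 * 100) * uu) li.
  rewrite -/logC => /(_ ltac:(by rewrite mulr_ge0 // /cEp mulr_ge0 // addr_ge0 // mulr_ge0)).
  have := ler_wpM2r u0 lP; lra.
have it0 : 0 <= 4 * (cEp + 5 * 100) * logC + 14 * 100.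
  by rewrite addr_ge0 // mulr_ge0 // mulr_ge0 // /cEp addr_ge0.
have M2 : (Mit bK)%:R <= 12 * cK%:R * (sm * ln PP).
  apply: le_trans (nceil_le (ltW K0)) _.
  apply: le_trans (_ : 2 * bK <= _); first by lra.
  rewrite /bK; apply: le_trans (_ : 2 * (cK%:R * (6 * ln PP) * sm) <= _); last by lra.
  rewrite ler_wpM2l //; apply: ler_pM => //; first by rewrite mulr_ge0 //; lra.
  by rewrite ler_wpM2l //; lra.
have i00 : 0 <= iterC kap A r G bmu bsig bom bgam cEp.
  by apply: (iterC_ge0 kap0 good); rewrite /cEp.
have m := ler_pM (ler0n _ _) i00 M2 it.
apply: le_trans (_ : 12 * cK%:R * (sm * ln PP) * ((4 * (cEp + 5 * 100) * logC + 14 * 100) * (ln PP * uu))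
   + 90 * 100 * sm * ln PP ^+ 2 * uu <= _); last by rewrite /blkC; move: (cK%:R) (cEp) (logC) => x y z; lra.
apply: lerD => //; rewrite ler_wpM2r //.
have l4 : 1 / 4 <= ln PP ^+ 2.
  by rewrite (_ : 1 / 4 = (1 / 2) ^+ 2 :> R); [rewrite lerXn2r ?nnegrE //; lra|field].
have h : 1 * (1 / 4) <= sm * ln PP ^+ 2 by apply: ler_pM => //; lra.
by rewrite -mulrA; move: (sm * _) h => z; lra.
Qed.

Lemma block_epoch : (epochT bmu bV + 1) * (202 + 60 * qM A qq (rho + G)) <= cEp * N%:R.
Proof.
have [_ _ _ h4] := muF.
rewrite /cEp; apply: (@cost_le _ _ _ _ _ _ _ good samp arow L1 (rho + G) L10 (ms_up st) Hlam F0
    bmu bV mu0 erefl h4).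
Qed.

Lemma block_step : bmu / (8 * bV) * bsig < 1.
Proof.
have [_ _ h3 _] := muF; have m0 := mu0; have f0 := F0.
have L0 : 0 < rho + G by exact: lt_le_trans (ms_up st).
rewrite /bV /bsig; move: (rho + G) (bmu) L0 h3 m0 => x y L0 h3 m0.
have FL : 0 < F * x by rewrite mulr_gt0.
have y2 : 0 < y ^+ 2 by rewrite exprn_gt0.
have yx : y * x <= 3 * F * x by rewrite ler_wpM2r // ltW.
have V0 : 0 < 30 * F * x + y ^+ 2 by lra.
rewrite mulrAC ltr_pdivrMr ?mulr_gt0 // mul1r mulrDr -expr2; lra.
Qed.

Definition blockR := [:: 10; 11; 12; 13; 14; 15; 16; 17; 18; 19; 42; 44]%N ++ chebR.
Definition blockA := 1%N :: chebA.

Lemma blockM nn k s x x0 sm : stat s -> cv (rarr s 1) = v ->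
  rreg s 5 = rho -> rreg s 6 = r -> rreg s 7 = G -> rreg s 8 = PP -> rreg s 9 = Lg ->
  Num.sqrt (bmu / G) <= sm -> 0 <= x0 ->
  (forall s', frm WI blockR [::] blockA s s' -> rreg s' 44 = r ->
     (forall j, j \notin cls -> rarr s' 1 j = rarr s 1 j) ->
     forall v' y yo, v' = cv (rarr s' 1) -> v' = (norm2 y)^-1 *: y ->
     cheb_inv (xsp lam G bmu bsig) (xsp lam G bmu bsig j0) (6 * bom) (Q *m v) (Mit bK) (Q *m y) yo ->
     B nn k s' x0) ->
  x0 + blkC * sm * ln PP ^+ 2 * uu - 16 * 100 * uu <= x ->
  B nn (Block cK cwt :: k) s x.
Proof.
move=> St Ev e5 e6 e7 e8 e9 hs x00 H Hx.
have bc := block_cost hs; have u0 := uu_ge0 kap0 good.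
apply: (seqsM kap0 good); apply: (blkM kap0 good).
set s1 := execs _ _.
have f1 : frm WI blockR [::] blockA s s1 by apply: frm_sub (frm_execs _ _).
have St1 : stat s1 by apply: stat_frm f1 _ _ _ St.
have nn2 (x' : R) : x' - x' + r = r by rewrite subrr add0r.
have g17 : rreg s1 17 = sF A (rho + G) by rewrite /s1 rvalE /= (st_F St) e5 e7.
have g11 : rreg s1 11 = bmu.
  by rewrite /s1 rvalE /= (st_F St) (st_W St) (st_X St) (st_N St) e5 e7.
have g12 : rreg s1 12 = bsig.
  by rewrite /s1 rvalE /= (st_F St) (st_W St) (st_X St) (st_N St) e5 e7.
have g14 : rreg s1 14 = bmu + G.
  by rewrite /s1 rvalE /= (st_F St) (st_W St) (st_X St) (st_N St) e5 e7.
have g13 : rreg s1 13 = 2 * tau G bmu.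
  rewrite /s1 rvalE /= (st_F St) (st_W St) (st_X St) (st_N St) e5 e7.
  by rewrite -/(wsum A D (rho + G)) -/(mu_of rho G) /tau -/bmu; ring.
have g15 : rreg s1 15 = bmu / (8 * bV).
  by rewrite /s1 rvalE /= (st_F St) (st_W St) (st_X St) (st_N St) e5 e7.
have g16 : rreg s1 16 = epochT bmu bV.
  by rewrite /s1 rvalE /= (st_F St) (st_W St) (st_X St) (st_N St) e5 e7.
have g18 : rreg s1 18 = bK.
  by rewrite /s1 rvalE /= (st_F St) (st_W St) (st_X St) (st_N St) e5 e7 e9.
have g19 : rreg s1 19 = bom ^+ 2.
  rewrite /s1 rvalE /= (st_F St) (st_W St) (st_X St) (st_N St) e5 e6 e7 e8 e9.
  rewrite -/(wsum A D (rho + G)) -/(mu_of rho G) -/bmu -/bK /bom expr2.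
  have -> : (1 + bK) * (1 + bK) * (1 + bK) * (PP * PP * PP) * cwt%:R * F =
     cwt%:R * F * ((1 + bK) ^+ 3 * PP ^+ 3) by ring.
  by [].
have g20 : rreg s1 20 = 0 by rewrite /s1 rvalE.
have g44 : rreg s1 44 = r by rewrite /s1 rvalE /= e6.
have a1 b : rarr s1 b = rarr s b by rewrite (frm_ra (frm_execs _ s)).
apply: (seqsM kap0 good).
apply: (@loopC _ _ _ kap0 _ _ _ _ good nn _ _ s1 _ [:: 40]%N [:: 8; 9]%N (fun q r ar =>
  forall p, (p < q)%N -> ar 8%N (cl D p) = rarr s 1 (cl D p) /\ ar 9%N (cl D p) = 0)) => //.
  move=> q s' qN e10 f E p; rewrite ltnS leq_eqVlt => /orP pq.
  have cE : iarr s' 3 = cl D by rewrite (frm_ia f) // (st_cl St1).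
  have b1 : rarr s' 1 = rarr s 1 by rewrite (frm_ra f) // a1.
  rewrite /= /upd /= e10 cE b1.
  case: eqP => [->//|ne]; case: pq => [/eqP pq|/E //].
  by case: ne; rewrite pq.
move=> s2 f2 E2.
have f12 : frm WI blockR [::] blockA s s2 by apply: frm_trans f1 _; apply: frm_sub f2.
have St2 : stat s2 by apply: stat_frm f12 _ _ _ St.
have [hG _ h3 h4] := muF.
apply: (seqsM kap0 good).
apply: (@chebM _ _ _ kap0 _ _ _ _ _ _ good samp arow _ _ _ QQ Qg lam_le L10 rho r G (rho + G) bmu
   bsig _ bV bK bom bgam cEp v erefl (ms_up st) G0 hG erefl erefl erefl block_step block_epoch (ms_v st) (ms_rho st)
   (ms_r st) r0 gam0 (ms_c st) om0 egam e1 eF nn _ s2 _ (x0 + 70 * uu)) => //; rewrite ?(frm_r f2) //.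
- by rewrite /cEp.
- rewrite -Ev; apply/colP => j; rewrite !mxE; case: ifP => // jc.
  by case/mem_cls: jc => q hq ->; have [-> _] := E2 q hq.
- apply/colP => j; rewrite !mxE; case: ifP => // jc.
  by case/mem_cls: jc => q hq ->; have [_ ->] := E2 q hq.
- by rewrite addr_ge0 // mulr_ge0.
- move=> s3 f3 y yo Ey iv; apply: (seqsM kap0 good).
  have f13 : frm WI blockR [::] blockA s s3 by apply: frm_trans f12 _; apply: frm_sub f3.
  have St3 : stat s3 by apply: stat_frm f13 _ _ _ St.
  apply: (normalizeM kap0 good St3 Ey) => s4 f4 E4 E4'; apply: (seqs0 kap0 good).
  apply: bnd_le (H s4 _ _ _ _ y yo erefl E4 iv) => //; first exact: block_slack.
  + by apply: frm_trans f13 _; apply: frm_sub f4.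
  + by rewrite (frm_r f4) // (frm_r f3) // (frm_r f2).
  + by move=> j jc; rewrite E4' // (frm_ra f3) // (frm_ra f2) // a1.
exact: (block_budget _ _ u0 bc Hx).
Qed.

End BlockState.

Lemma evalM nn k s x v : stat s -> v = cv (rarr s 1) -> dot v v = 1 ->
  (forall s', frm WI [:: 5; 6; 40; 41]%N [::] [:: 13; 14]%N s s' ->
     rreg s' 5 = dot v (gram A *m v) ->
     rreg s' 6 = resid lam (dot v (gram A *m v)) (Q *m v) -> B nn k s' (x - 200 * uu)) ->
  B nn (Eval :: k) s x.
Proof.
move=> St Ev v1 H; have u0 := uu_ge0 kap0 good.
apply: (seqsM kap0 good); apply: (matvecM kap0 good) => // s1 f1 E1.
have St1 : stat s1 by apply: stat_frm f1 _ _ _ St.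
apply: (seqsM kap0 good); apply: (dotM kap0 good) => // s2 f2 E2.
have St2 : stat s2 by apply: stat_frm f2 _ _ _ St1.
apply: (seqsM kap0 good); apply: (dotM kap0 good) => // s3 f3 E3.
apply: (seqsM kap0 good); apply: (blkM kap0 good); apply: (seqs0 kap0 good).
set s4 := execs _ _.
have b1 : rarr s1 1 = rarr s 1 by rewrite (frm_ra f1).
have e5 : rreg s4 5 = dot v (gram A *m v).
  by rewrite /s4 rvalE /= (frm_r f3) // E2 b1 E1 -Ev.
have e6 : rreg s4 6 = resid lam (dot v (gram A *m v)) (Q *m v).
  rewrite /s4 rvalE /= E3 (frm_r f3) // E2 b1 (frm_ra f2) // E1 -Ev /resid norm2E; congr Num.sqrt.
  have -> : dmul (fun j => lam j - dot v (gram A *m v)) (Q *m v) =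
     Q *m (gram A *m v - dot v (gram A *m v) *: v).
    rewrite mulmxBr -scalemxAr (Q_gram Qg); move: (Q *m v) (dot v _) => w t.
    by apply/colP => j; rewrite !mxE mulrBl.
  rewrite (dot_Q QQ); move: (gram A *m v) => w.
  have [t Et] : exists t, t = dot v w by eexists.
  by rewrite -Et !dotE v1 (dotC w) -Et; ring.
apply: bnd_le (H s4 _ e5 e6) => /=; first by lra.
apply: frm_trans (_ : frm _ _ _ _ s s3) _; last by apply: frm_sub (frm_execs _ _).
apply: frm_trans (_ : frm _ _ _ _ s s2) _; last by apply: frm_sub f3.
by apply: frm_trans (_ : frm _ _ _ _ s s1) _; [apply: frm_sub f1|apply: frm_sub f2].
Qed.

Variables (Delta eps sm Pm : R).
Hypothesis Delta0 : 0 < Delta.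
Hypothesis Dgap : forall j, j != j0 -> lam j <= L1 - Delta.
Hypothesis epsD : seps D = eps.
Hypothesis eps01 : 0 < eps < 1.
Hypothesis Hsm : forall rho G, L1 <= rho + G -> rho <= L1 -> Delta / 8 <= G ->
  Num.sqrt (mu_of rho G / G) <= sm.
Hypothesis HPm : 8 * d%:R * F / Delta <= Pm.
Hypothesis DL : Delta <= L1.

(** A lower bound for the residual over [P] while the main loop runs; see [in_loop]. *)
Definition rmin : R := eps * L1 / (c0%:R ^+ 3 * Pm ^+ 4).
Definition Lm : R := ln Pm.
Definition upC : R := 2 * (2 + 2 * ln (4 * c0%:R)).
Definition Kblk : R := 2 * blkC * sm * Lm * uu.
(** A block divides [r] by [P], or else halves [G] and multiplies [r] by at most [4 c0 P]. In the
    first case the first logarithm falls by [ln P / 2] at least; in the second case the other term,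
    of weight [upC * Lm], falls by more than the first logarithm can grow, with [ln P / 2] to spare.
    A block costs about [ln P ^ 2], and the factor [Lm >= ln P] in [Kblk] turns either decrease into
    a payment for it. *)
Definition pot (r G : R) : R := Kblk * (ln (1 + r / rmin) + upC * Lm * ln (16 * G / Delta)).

Let P_le v rho r G PP Lg : mst v rho r G PP Lg -> Delta / 8 <= G -> PP <= Pm.
Proof.
move=> st DG; apply: le_trans HPm.
have PG := ms_PG st; have P2 := ms_P st.
rewrite ler_pdivlMr // -mulrA -PG mulrCA ler_wpM2l //; lra.
Qed.

Let Pm2 : 2 <= Pm.
Proof.
apply: le_trans HPm; rewrite ler_pdivlMr //.
have dR : 2 <= d%:R :> R by rewrite ler_nat.
have : 2 * Delta <= d%:R * F.
  by apply: ler_pM => //; [exact: ltW|have := LF; have := DL; lra].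
have : 0 <= d%:R * F by rewrite mulr_ge0 ?(ltW F0).
by lra.
Qed.

Let Lm2 : 1 / 2 <= Lm. Proof. exact: lnP_ge Pm2. Qed.

Let rmin0 : 0 < rmin.
Proof.
have /andP[e0 _] := eps01.
have cc : 0 < (c0%:R : R) by have := c0R; lra.
have pp : 0 < Pm by have := Pm2; lra.
by rewrite /rmin divr_gt0 // ?mulr_gt0 // exprn_gt0.
Qed.

Let sm1 : 1 <= sm.
Proof.
have G0 : 0 < F by [].
have D8 : Delta / 8 <= F by have := LF; have := DL; have := Delta0; lra.
have h := @Hsm L1 F _ (lexx _) D8; apply: le_trans (h _); last by have := F0; lra.
have [m1 _ _ _] := @mu_facts L1 F ltac:(have := F0; lra) (lexx _) ltac:(by rewrite F0 /=) _ erefl.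
by have /andP[] := @sqrt_ge1 R (mu_of L1 F / F) ltac:(by rewrite ler_pdivlMr // mul1r).
Qed.

Let Kblk0 : 0 <= Kblk.
Proof.
have u0 := uu_ge0 kap0 good; have b0 := blkC_ge0; have s1 := sm1; have l2 := Lm2.
by rewrite /Kblk !mulr_ge0 //; lra.
Qed.

(** Doubled and exponentiated, with [u = b / q], this is [(1 + u)^2 q <= (1 + u q)^2], that is,
    [q - 1 <= u^2 q (q - 1)]. *)
Lemma ln_progress (b q : R) : 2 <= q -> q <= b -> ln (1 + b / q) + ln q / 2 <= ln (1 + b).
Proof.
move=> q2 qb; have q0 : 0 < q by lra.
have [u Eu] : exists u, u = b / q by eexists.
have u1 : 1 <= u by rewrite Eu ler_pdivlMr // mul1r.
have -> : b = u * q by rewrite Eu divfK ?gt_eqF.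
rewrite mulfK ?gt_eqF //.
have h : ln ((1 + u) ^+ 2 * q) <= ln ((1 + u * q) ^+ 2).
  rewrite ler_ln ?posrE ?mulr_gt0 ?exprn_gt0 //; try nra.
  have : 1 * (q - 1) <= u ^+ 2 * q * (q - 1).
    rewrite ler_wpM2r; [by []|by lra|].
    by rewrite -[leLHS]mulr1 ler_pM //; [exact: exprn_ege1|lra].
  by lra.
move: h; rewrite lnM ?posrE ?exprn_gt0 //; try lra.
by rewrite !lnXn; try nra.
Qed.

(** The overlap gives [rho >= L1 / (c0 P)^2], so the stopping threshold [eps rho / (c0 P)] is at
    least [P * rmin]. *)
Lemma in_loop v rho r G PP Lg : mst v rho r G PP Lg -> Delta / 8 <= G ->
  eps * rho / (c0%:R * PP) < r -> PP <= r / rmin.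
Proof.
move=> st DG hr; have PP2 := ms_P st; have PPm := P_le st DG; have /andP[e0 _] := eps01.
have P0 : 0 < PP by lra. have c00 : 0 < (c0%:R : R) by have := c0R; lra.
have b0 : 0 < c0%:R * PP by rewrite mulr_gt0.
have rL : L1 / (c0%:R * PP) ^+ 2 <= rho.
  rewrite (ms_rho st) (dot_gramQ QQ Qg) /rayl dot_dmul (bigD1 j0) //=.
  rewrite -[leLHS]addr0 lerD //; last first.
    by apply: sumr_ge0 => j _; rewrite mulr_ge0 // -expr2 sqr_ge0.
  rewrite ler_wpM2l ?(ltW L10) // -expr2 -[leRHS]real_normK ?num_real // -exprVn.
  rewrite lerXn2r ?nnegrE ?invr_ge0 ?(ltW b0) //.
  apply: le_trans (ms_c st); rewrite ler_peMl ?invr_ge0 ?(ltW b0) //.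
  by rewrite lerDl divr_ge0 ?(ltW F0) //; have /andP[] := res_le (ms_v st) (ms_rho st) (ms_r st).
rewrite ler_pdivlMr //; apply: le_trans (ltW hr).
apply: le_trans (_ : eps * (L1 / (c0%:R * PP) ^+ 2) / (c0%:R * PP) <= _); last first.
  by rewrite ler_wpM2r ?invr_ge0 ?(ltW b0) // ler_wpM2l // ltW.
have -> : eps * (L1 / (c0%:R * PP) ^+ 2) / (c0%:R * PP) = eps * L1 / c0%:R ^+ 3 / PP ^+ 3.
  by field; rewrite !gt_eqF.
rewrite ler_pdivlMr ?exprn_gt0 //.
have -> : PP * rmin * PP ^+ 3 = eps * L1 / c0%:R ^+ 3 * (PP ^+ 4 / Pm ^+ 4).
  by rewrite /rmin; field; rewrite !gt_eqF //; lra.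
rewrite ler_piMr //; first by rewrite ?divr_ge0 ?mulr_ge0 ?exprn_ge0 ?ltW.
by rewrite ler_pdivrMr ?exprn_gt0 ?mul1r ?lerXn2r ?nnegrE //; lra.
Qed.

Lemma pot_stay r r' G PP : 2 <= PP -> PP <= Pm -> 0 <= r' -> r' <= r / PP -> PP <= r / rmin ->
  pot r' G + blkC * sm * ln PP ^+ 2 * uu <= pot r G.
Proof.
move=> P2 PPm r0' hr hb; have lp := ln_progress P2 hb; have l1 := lnP_ge P2.
have lm : ln PP <= Lm by rewrite ler_ln ?posrE //; lra.
have u0 := uu_ge0 kap0 good; have b0 := blkC_ge0; have s1 := sm1.
have h : ln (1 + r' / rmin) <= ln (1 + r / rmin / PP).
  rewrite ler_ln ?posrE ?lerD2l.
  - by rewrite [leRHS]mulrAC ler_wpM2r // invr_ge0 ltW.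
  - by rewrite ltr_wpDr // divr_ge0 // ltW.
  by rewrite ltr_wpDr // divr_ge0 //; lra.
have h2 : ln (1 + r' / rmin) + ln PP / 2 <= ln (1 + r / rmin) by lra.
have := ler_wpM2l Kblk0 h2.
have : blkC * sm * ln PP ^+ 2 * uu <= Kblk * (ln PP / 2).
  have -> : Kblk * (ln PP / 2) = blkC * sm * (Lm * ln PP) * uu by rewrite /Kblk; field.
  rewrite ler_wpM2r // ler_wpM2l ?expr2 ?ler_wpM2r //; try lra.
  by rewrite mulr_ge0 //; lra.
by rewrite /pot; move: (Kblk) (upC * Lm * _) => x y; lra.
Qed.

Lemma pot_up r r' G PP : 2 <= PP -> PP <= Pm -> 0 <= r' -> 0 < G -> r' <= 4 * r * (c0%:R * PP) ->
  0 <= r -> pot r' (G / 2) + blkC * sm * ln PP ^+ 2 * uu <= pot r G.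
Proof.
move=> P2 PPm r0' G0 hr r0; have l1 := lnP_ge P2.
have lm : ln PP <= Lm by rewrite ler_ln ?posrE //; lra.
have u0 := uu_ge0 kap0 good; have b0 := blkC_ge0; have s1 := sm1; have c1 := c0R.
have c4 : 0 < 4 * c0%:R * PP by rewrite !mulr_gt0 //; lra.
have c41 : 1 <= 4 * c0%:R * PP by nra.
have q0 : 0 <= r / rmin by rewrite divr_ge0 // ltW.
have h : ln (1 + r' / rmin) <= ln (4 * c0%:R) + ln PP + ln (1 + r / rmin).
  have y0 : 0 < 1 + r / rmin by rewrite ltr_wpDr.
  have c40 : 0 < 4 * c0%:R :> R by lra.
  have P0 : 0 < PP by lra.
  rewrite -(lnM c40 P0) -(lnM c4 y0).
  have y0' : 0 < 1 + r' / rmin by rewrite ltr_wpDr // divr_ge0 // ltW.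
  have y2 := mulr_gt0 c4 y0; rewrite ler_ln ?posrE //.
  rewrite mulrDr mulr1; apply: lerD => //.
  by rewrite ler_pdivrMr // -[_ * (r / rmin) * _]mulrA divfK ?gt_eqF //; lra.
have lE : ln (16 * (G / 2) / Delta) = ln (16 * G / Delta) - ln 2.
  rewrite -ln_div ?posrE ?divr_gt0 ?mulr_gt0 //; congr ln.
  by field; rewrite gt_eqF.
have lc : 0 <= ln (4 * c0%:R : R) by apply: ln_ge0; lra.
have l2 := @ln2_ge R.
have h3 : ln (1 + r' / rmin) + upC * Lm * ln (16 * (G / 2) / Delta) + ln PP / 2 <=
   ln (1 + r / rmin) + upC * Lm * ln (16 * G / Delta).
  rewrite lE mulrBr.
  have t1 : upC * Lm * (1 / 2) <= upC * Lm * ln 2.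
    by rewrite ler_wpM2l // mulr_ge0 /upC //; have := Lm2; lra.
  have t2 : (2 + 2 * ln (4 * c0%:R)) * Lm = upC * Lm * (1 / 2) by rewrite /upC; field.
  have t3 := ler_wpM2l lc Lm2.
  by move: t1 t2 t3 h; rewrite -/Lm; move: (upC * Lm) (ln (16 * G / Delta)) => x y; have := Lm2; lra.
have := ler_wpM2l Kblk0 h3.
have : blkC * sm * ln PP ^+ 2 * uu <= Kblk * (ln PP / 2).
  have -> : Kblk * (ln PP / 2) = blkC * sm * (Lm * ln PP) * uu by rewrite /Kblk; field.
  rewrite ler_wpM2r // ler_wpM2l ?expr2 ?ler_wpM2r //; try lra.
  by rewrite mulr_ge0 //; lra.
by rewrite /pot; move: (Kblk) (upC * Lm * _) (upC * Lm * _) => x y z; lra.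
Qed.

Lemma pot_ge0 r G : 0 <= r -> Delta / 8 <= G -> 0 <= pot r G.
Proof.
move=> r0 DG; rewrite /pot mulr_ge0 // addr_ge0 ?mulr_ge0 //.
- by apply: ln_ge0; rewrite lerDl divr_ge0 // ltW.
- by rewrite addr_ge0 // mulr_ge0 // ln_ge0 //; have := c0R; lra.
- by have := Lm2; lra.
- by apply: ln_ge0; rewrite ler_pdivlMr //; have := Delta0; lra.
Qed.

Lemma mst_up v rho r G PP Lg w rhow rw : mst v rho r G PP Lg -> dot w w = 1 ->
  rhow = dot w (gram A *m w) -> rw = resid lam rhow (Q *m w) -> L1 - rhow <= G / 2 ->
  (1 + rw / F) / (c0%:R * (2 * PP)) <= `|(Q *m w) j0 0| ->
  mst w rhow rw (G / 2) (2 * PP) (Lg + 1).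
Proof.
move=> [_ _ _ _ /andP[G0 GF] PG P2 PL /andP[l1 l2] _] w1 Erho Er acc ov; have l := @ln2_ge R.
split=> //.
- by lra.
- by apply/andP; split; lra.
- by rewrite -PG; field.
- by lra.
- by rewrite expRD mulrC; apply: ler_pM => //; [lra|have := expR_ge1Dx (1 : R); lra].
by rewrite lnM ?posrE; [apply/andP; split; lra| |lra].
Qed.

Lemma mst_stay v rho r G PP Lg w rhow rw : mst v rho r G PP Lg -> dot w w = 1 ->
  rhow = dot w (gram A *m w) -> rw = resid lam rhow (Q *m w) -> L1 - rhow <= G / 2 ->
  (1 + rw / F) / (c0%:R * PP) <= `|(Q *m w) j0 0| -> mst w rhow rw G PP Lg.
Proof.
move=> [_ _ _ _ /andP[G0 GF] PG P2 PL L _] w1 Erho Er acc ov.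
by split=> //; [lra|rewrite G0].
Qed.

Lemma mainM nn k s x v G PP Lg : stat s -> v = cv (rarr s 1) ->
  (forall j, j \notin cls -> rarr s 1 j = 0) ->
  rreg s 7 = G -> rreg s 8 = PP -> rreg s 9 = Lg -> Delta / 8 <= G ->
  (forall rho r, rho = dot v (gram A *m v) -> r = resid lam rho (Q *m v) ->
     mst v rho r G PP Lg) ->
  (forall s', stat s' -> forall v', v' = cv (rarr s' 1) ->
    (forall j, j \notin cls -> rarr s' 1 j = 0) ->
    dot v' v' = 1 -> (1 - eps) * L1 <= dot v' (gram A *m v') -> B nn k s' 0) ->
  pot F G + 3 * 100 * uu <= x ->
  B nn (Main c0 cK cwt :: k) s x.
Proof.
move=> St Ev out e7 e8 e9 DG Hst Hend Hx.
have u0 := uu_ge0 kap0 good; have ku := kap_uu kap0 good.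
have := Hst _ _ erefl erefl; set rho := dot v _; set r := resid lam rho _ => st.
apply: (seqsM kap0 good); apply: (evalM St Ev (ms_v st)) => s1 f1 e5 e6.
apply: (seqsM kap0 good); apply: (blkM kap0 good); set s2 := execs _ _.
apply: (seqsM kap0 good).
have f12 : frm WI [:: 40; 43]%N [::] [::] s1 s2 by apply: frm_sub (frm_execs _ _).
have f2 : frm WI [:: 5; 6; 40; 41; 43]%N [::] [:: 13; 14]%N s s2.
  by apply: frm_trans (_ : frm _ _ _ _ s s1) _; [apply: frm_sub f1|apply: frm_sub f12].
have St2 : stat s2 by apply: stat_frm f2 _ _ _ St.
pose J s1 (x1 : R) : Prop := exists v rho r G PP Lg,
  [/\ [/\ stat s1, v = cv (rarr s1 1), forall j, j \notin cls -> rarr s1 1 j = 0 &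
         mst v rho r G PP Lg],
      [/\ rreg s1 5 = rho, rreg s1 6 = r, rreg s1 7 = G & rreg s1 8 = PP /\ rreg s1 9 = Lg],
      rreg s1 43 = eps * rho / (c0%:R * PP) , Delta / 8 <= G & pot r G + 5 * uu <= x1].
apply: (@bnd_while_inv _ _ _ kap0 J); last first.
- exists v, rho, r, G, PP, Lg; split.
  + split=> //; first by rewrite Ev (frm_ra f2).
    by move=> j jc; rewrite (frm_ra f2) // out.
  + by split; [rewrite (frm_r f12)|rewrite (frm_r f12)|rewrite (frm_r f2)|rewrite !(frm_r f2)].
  + have e50 : rreg s1 0 = eps by rewrite (frm_r f1) // (st_eps St).
    by rewrite /s2 rvalE /= e50 e5 (frm_r f1) // e8.
  + by [].
  have /andP[r0 rF] := res_le (ms_v st) (ms_rho st) (ms_r st).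
  have : pot r G <= pot F G.
    rewrite /pot ler_wpM2l // lerD2r ler_ln ?posrE ?lerD2l //.
    - by rewrite ler_wpM2r // invr_ge0 ltW.
    - by rewrite ltr_wpDr // divr_ge0 // ltW.
    by rewrite ltr_wpDr // divr_ge0 // ltW.
  by move: Hx => /=; lra.
2: {
  move=> sa xa [v' [rho' [r' [G' [PP' [Lg' [[_ _ _ st'] _ _ DG' h]]]]]]].
  have /andP[r0 _] := res_le (ms_v st') (ms_rho st') (ms_r st').
  by have := pot_ge0 r0 DG'; lra. }
move=> m sa xa mn IH [v' [rho' [r' [G' [PP' [Lg' [[Sta Ev' outa sta] [a5 a6 a7 [a8 a9]] a43 DG' Ha]]]]]]].
have /andP[ra0 raF] := res_le (ms_v sta) (ms_rho sta) (ms_r sta).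
have /andP[rho0 rhoL] := rho_bounds (ms_v sta) (ms_rho sta).
have P2 := ms_P sta; have c1 := c0R; have /andP[ep0 ep1] := eps01.
have b0 : 0 < c0%:R * PP' by rewrite mulr_gt0 //; lra.
rewrite [holds _ _]/= a43 a6; case: ltP => hq; last first.
  apply: (seqs0 kap0 good); apply: bnd_leq mn _; apply: bnd_le (Hend sa Sta v' Ev' outa (ms_v sta) _).
    by have := pot_ge0 ra0 DG'; lra.
  rewrite -(ms_rho sta).
  (* The loop stops here: with an overlap of at least [1 / (c0 P)] the small residual implies
     [L1 - rho' <= eps * rho']. *)
  have ce := rayl_certificate j0 (ms_r sta).
  have cb : (c0%:R * PP')^-1 <= `|(Q *m v') j0 0|.
    apply: le_trans (ms_c sta); rewrite ler_peMl ?invr_ge0 ?(ltW b0) //.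
    by rewrite lerDl divr_ge0 // ltW.
  have h1 : (L1 - rho') / (c0%:R * PP') <= eps * rho' / (c0%:R * PP').
    apply: le_trans hq; apply: le_trans ce; rewrite ler_wpM2l //; lra.
  have h2 : L1 - rho' <= eps * rho' by move: h1; rewrite ler_pM2r // invr_gt0.
  have : eps * rho' <= eps * L1 by rewrite ler_wpM2l // ltW.
  by move: h2; lra.
have r0 : 0 < r'.
  by apply: le_lt_trans hq; rewrite divr_ge0 ?(ltW b0) // mulr_ge0 // ltW.
have PPm := P_le sta DG'; have inl := in_loop sta DG' hq.
have /andP[G0 GF] := ms_G sta.
have hs := Hsm (ms_up sta) rhoL DG'.
pose C := blkC * sm * ln PP' ^+ 2 * uu.
have P0 : 0 < PP' by lra.
(* The potential covers the cost of the block, as is seen by letting the block end with residual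
   0. *)
have xC : 0 <= xa - C + 15 * 100 * uu.
  have := @pot_stay r' 0 G' PP' P2 PPm (lexx _) (divr_ge0 ra0 (ltW P0)) inl; rewrite -/C.
  by have := pot_ge0 (lexx 0) DG'; move: Ha; move: (pot 0 G') (pot r' G') (C) => z1 z2 z3; lra.
apply: (seqsM kap0 good).
apply: (@blockM v' rho' r' G' PP' Lg' sta r0 m _ sa _ (xa - C + 15 * 100 * uu) sm Sta (esym Ev')
   a5 a6 a7 a8 a9 hs xC); last by rewrite -/C; lra.
move=> sb fb b44 outb w y yo Ew Ew' iv.
have [rhow Erho] : exists t, t = dot w (gram A *m w) by eexists.
have [rw Erw] : exists t, t = resid lam rhow (Q *m w) by eexists.
have [w1 ostay oup [rgrow acc] shrink] := block_result sta r0 iv Ew' Erho Erw.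
have Stb : stat sb by apply: stat_frm fb _ _ _ Sta.
apply: (seqsM kap0 good); apply: (evalM Stb Ew w1) => sc fc c5 c6.
rewrite -Erho in c5 c6; rewrite -Erw in c6.
have fac : frm WI (5%N :: 6%N :: 41%N :: blockR) [::] blockA sa sc.
  by apply: frm_trans (_ : frm _ _ _ _ sa sb) _; [apply: frm_sub fb|apply: frm_sub fc].
have Stc : stat sc by apply: stat_frm fac _ _ _ Sta.
apply: (seqsM kap0 good); apply: bnd_seq => //; apply: (blkM kap0 good); set sd := execs _ _.
have fd : frm [::] [:: 40]%N [::] [::] sc sd by apply: frm_sub (frm_execs _ _).
have q44 : rreg sc 44 = r' by rewrite (frm_r fc).
have q8 : rreg sc 8 = PP' by rewrite (frm_r fac).
have d40 : rreg sd 40 = r' / PP' by rewrite /sd rvalE /= q44 q8.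
have d6 : rreg sd 6 = rw by rewrite (frm_r fd).
have fad : frm WI (5%N :: 6%N :: 41%N :: blockR) [::] blockA sa sd.
  by apply: frm_trans fac _; apply: frm_sub fd.
have /andP[rw0 rwF] := res_le w1 Erho Erw.
have outd se : (forall b, rarr se b = rarr sd b) -> w = cv (rarr se 1) /\
    forall j, j \notin cls -> rarr se 1 j = 0.
  move=> hse; have h1 : rarr se 1 = rarr sb 1 by rewrite hse (frm_ra fd) // (frm_ra fc).
  by rewrite h1; split=> // j jc; rewrite outb // outa.
have hE : holds (RLt 40 6) sd = (r' / PP' < rw) by rewrite -d40 -d6.
clearbody sd; apply: bnd_if => //; rewrite hE; case: ltP => hlev; cbv iota.
(* The residual has not shrunk, so by [shrink] the other eigenvalues cannot all be [4 G'] below the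
   top. Hence [Delta < 4 G'], and the halved [G'] is still at least [Delta / 8]. *)
- have D4 : Delta < 4 * G'.
    rewrite ltNge; apply/negP => D4; move: hlev; rewrite ltNge => /negP; apply; apply: shrink => j jj.
    by apply: le_trans (Dgap jj) _; rewrite lerD2l lerN2.
  apply: (blkM kap0 good); set se := execs _ _.
  apply: (seqsM kap0 good); apply: (blkM kap0 good); set sf := execs _ _.
  apply: (seqs0 kap0 good).
  have ff : frm WI [:: 40; 43]%N [::] [::] se sf by apply: frm_sub (frm_execs _ _).
  have fe : frm WI [:: 7; 8; 9; 40]%N [::] [::] sd se by apply: frm_sub (frm_execs _ _).
  have Ste : stat se by apply: stat_frm fe _ _ _ (stat_frm fad _ _ _ Sta).
  have p7 : rreg se 7 = G' / 2 by rewrite /se rvalE /= (frm_r fad) // a7.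
  have p8 : rreg se 8 = 2 * PP' by rewrite /se rvalE /= (frm_r fad) // a8 mulrC.
  have p9 : rreg se 9 = Lg' + 1 by rewrite /se rvalE /= (frm_r fad) // a9.
  have p5 : rreg se 5 = rhow by rewrite (frm_r fe) // (frm_r fd).
  have p6 : rreg se 6 = rw by rewrite (frm_r fe).
  have p0 : rreg se 0 = eps by rewrite (st_eps Ste).
  have g43 : rreg sf 43 = eps * rhow / (c0%:R * (2 * PP')).
    by rewrite /sf; clearbody se; rewrite rvalE /= p8 p5 p0.
  apply: IH; exists w, rhow, rw, (G' / 2), (2 * PP'), (Lg' + 1).
  have [h1 h2] := outd sf ltac:(by move=> b; rewrite (frm_ra ff) // (frm_ra fe)).
  have g7 : rreg sf 7 = G' / 2 by rewrite (frm_r ff).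
  have g8 : rreg sf 8 = 2 * PP' by rewrite (frm_r ff).
  have g9 : rreg sf 9 = Lg' + 1 by rewrite (frm_r ff).
  have g5 : rreg sf 5 = rhow by rewrite (frm_r ff).
  have g6 : rreg sf 6 = rw by rewrite (frm_r ff).
  split=> //.
  + split=> //; first by apply: stat_frm ff _ _ _ Ste.
    exact: mst_up sta w1 Erho Erw acc oup.
  + exact: halve_bound.
  have := pot_up P2 PPm rw0 G0 rgrow ra0; rewrite -/C => hp.
  exact: (loop_budget_up _ _ _ u0 ku hp Ha).
apply: bnd_skip => //.
apply: (seqsM kap0 good); apply: (blkM kap0 good); set sf := execs _ _.
apply: (seqs0 kap0 good).
have ff : frm WI [:: 40; 43]%N [::] [::] sd sf by apply: frm_sub (frm_execs _ _).
have Std : stat sd by apply: stat_frm fad _ _ _ Sta.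
apply: IH; exists w, rhow, rw, G', PP', Lg'.
have [h1 h2] := outd sf ltac:(by move=> b; rewrite (frm_ra ff)).
have g7 : rreg sf 7 = G' by rewrite (frm_r ff) // (frm_r fad).
have g8 : rreg sf 8 = PP' by rewrite (frm_r ff) // (frm_r fad).
have g9 : rreg sf 9 = Lg' by rewrite (frm_r ff) // (frm_r fad).
have g5 : rreg sf 5 = rhow by rewrite (frm_r ff) // (frm_r fd).
have g6 : rreg sf 6 = rw by rewrite (frm_r ff) // (frm_r fd).
split=> //.
- split=> //; first by apply: stat_frm ff _ _ _ Std.
  exact: mst_stay sta w1 Erho Erw acc (ostay hlev).
- have p8 : rreg sd 8 = PP' by rewrite -(frm_r ff).
  have p5 : rreg sd 5 = rhow by rewrite -(frm_r ff).
  by rewrite /sf rvalE /= p8 p5 (st_eps Std) epsD.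
have := @pot_stay r' rw G' PP' P2 PPm rw0 hlev inl; rewrite -/C => hp.
exact: (loop_budget_stay _ _ u0 ku hp Ha).
Qed.

End Main.

(** * Compressed sparse rows *)

Section Csr.
Variables (R : realType) (n d : nat) (A : 'M[R]_(n, d)).
Hypothesis rows : forall i : 'I_n, row i A != 0.
Local Notation N := (nnz A).
Local Notation supp i := (row_support A i).

Definition row_sizes : seq nat := [seq size (supp i) | i <- enum 'I_n].
Definition offN : nat -> nat := nth 0%N (csr_offsets A).
Definition colN : nat -> nat := nth 0%N (csr_columns A).
Definition valN : nat -> R := nth 0 (csr_values A).
Definition rowN (p : nat) : nat := reshape_index row_sizes p.

Lemma size_row_sizes : size row_sizes = n.
Proof. by rewrite size_map size_enum_ord. Qed.

Lemma nth_row_sizes (i : 'I_n) : nth 0%N row_sizes i = size (supp i).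
Proof. by rewrite (nth_map i) ?size_enum_ord // nth_ord_enum. Qed.

Lemma mem_supp (i : 'I_n) j : (j \in supp i) = (A i j != 0).
Proof. by rewrite mem_filter mem_enum andbT. Qed.

Lemma supp_gt0 (i : 'I_n) : (0 < size (supp i))%N.
Proof.
have /existsP[j jA] : [exists j, A i j != 0].
  apply: contraR (rows i); rewrite negb_exists => /forallP H.
  by apply/eqP/rowP => j; rewrite !mxE; apply/eqP; have := H j; rewrite negbK.
by have := mem_supp i j; rewrite jA; case: (supp i).
Qed.

Lemma offN_take k : (k <= n)%N -> offN k = sumn (take k row_sizes).
Proof.
rewrite /offN => kn; rewrite nth_mkseq //.
elim: k kn => [|k IH] kn; first by rewrite take0 big_pred0.
rewrite (take_nth 0%N) ?size_row_sizes // sumn_rcons -IH; last exact: ltnW.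
pose i := Ordinal kn; rewrite (nth_row_sizes i) (bigD1 i) //= addnC; congr (_ + _)%N.
apply: eq_bigl => j; rewrite ltnS -val_eqE /= [RHS]ltn_neqAle.
by rewrite andbC.
Qed.

Lemma offS (i : 'I_n) : offN i.+1 = (offN i + size (supp i))%N.
Proof.
rewrite !offN_take //; last exact: ltnW.
by rewrite (take_nth 0%N) ?size_row_sizes // sumn_rcons nth_row_sizes.
Qed.

Lemma size_suppE (i : 'I_n) : size (supp i) = (\sum_(j | A i j != 0%R) 1)%N.
Proof. by rewrite size_filter -sum1_count big_enum_cond. Qed.

Lemma nnzE : N = (\sum_(i < n) size (supp i))%N.
Proof.
under eq_bigr do rewrite size_suppE.
rewrite pair_big_dep /= /nnz -sum1_card; apply: eq_bigl => ij.
by rewrite inE.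
Qed.

Lemma sumn_row_sizes : sumn row_sizes = N.
Proof. by rewrite nnzE sumnE big_map big_enum. Qed.

Lemma offN0 : offN 0 = 0%N. Proof. by rewrite offN_take // take0. Qed.

Lemma offNn : offN n = N.
Proof. by rewrite offN_take // take_oversize ?size_row_sizes // sumn_row_sizes. Qed.

Lemma off_lt (i : 'I_n) : (offN i < offN i.+1)%N.
Proof. by rewrite offS -[ltnLHS]addn0 ltn_add2l supp_gt0. Qed.

(** All lists over the nonzero entries have the same shape, so one pair [i], [j] serves for every
    [f]. *)
Lemma entryP p : (p < N)%N -> exists i j, [/\ rowN p = nat_of_ord i, A i j != 0,
  (offN i <= p < offN i.+1)%N &
  forall (T : Type) (x0 : T) (f : 'I_n -> 'I_d -> T),
    nth x0 [seq f i j | i <- enum 'I_n, j <- supp i] p = f i j].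
Proof.
rewrite -sumn_row_sizes => pN; have r1 := reshape_indexP pN; have r2 := reshape_offsetP pN.
have r3 := reshape_indexK row_sizes p.
rewrite -/(rowN p) in r1 r2 r3; rewrite size_row_sizes in r1; pose i := Ordinal r1.
rewrite -[rowN p]/(nat_of_ord i) nth_row_sizes in r2.
have j0 : 'I_d by case: (supp i) r2 => // j.
pose c := reshape_offset row_sizes p; exists i, (nth j0 (supp i) c); split=> //.
- by rewrite -mem_supp mem_nth.
- have pE : p = (offN i + c)%N by rewrite offN_take ?(ltnW r1) // -[LHS]r3.
  by rewrite offS; apply/andP; split; [rewrite [leqRHS]pE leq_addr|rewrite [ltnLHS]pE ltn_add2l].
move=> T x0 f; rewrite nth_flatten.
have -> : shape [seq [seq f x y | y <- supp x] | x <- enum 'I_n] = row_sizes.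
  by rewrite /shape -map_comp; apply: eq_map => x /=; rewrite size_map.
rewrite -/(rowN p) (nth_map i) ?size_enum_ord // -[rowN p]/(nat_of_ord i) nth_ord_enum.
by rewrite (nth_map j0).
Qed.

Lemma entry_sum (h : nat -> nat -> R -> R) :
  \sum_(p < N) h (rowN p) (colN p) (valN p) =
  \sum_(i < n) \sum_(j < d) if A i j != 0 then h i j (A i j) else 0.
Proof.
pose L := [seq h i j (A i j) | i : 'I_n <- enum 'I_n, j : 'I_d <- supp i].
have sL : size L = N.
  by rewrite size_allpairs_dep -sumn_row_sizes.
transitivity (\sum_(x <- L) x).
  rewrite (big_nth 0) sL big_mkord; apply: eq_bigr => p _.
  have [i [j [-> _ _ E]]] := entryP (ltn_ord p).
  rewrite /colN /valN /csr_columns /csr_values (E _ 0%N (fun _ j => nat_of_ord j)).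
  by rewrite (E _ 0 (fun i j => A i j)) (E _ 0 (fun i j => h i j (A i j))).
rewrite big_allpairs_dep big_enum /=; apply: eq_bigr => i _.
by rewrite big_filter big_enum_cond /= [RHS]big_mkcond -big_mkcond.
Qed.

Lemma entry_val p : (p < N)%N -> [/\ (rowN p < n)%N, (colN p < d)%N, valN p != 0 &
  (offN (rowN p) <= p < offN (rowN p).+1)%N].
Proof.
move=> pN; have [i [j [-> Aij h E]]] := entryP pN.
rewrite /colN /valN /csr_columns /csr_values (E _ 0%N (fun _ j => nat_of_ord j)).
by rewrite (E _ 0 (fun i j => A i j)).
Qed.

Lemma off_mono (a b : nat) : (a <= b)%N -> (b <= n)%N -> (offN a <= offN b)%N.
Proof.
elim: b => [|b IH]; first by rewrite leqn0 => /eqP ->.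
rewrite leq_eqVlt => /orP[/eqP -> //|]; rewrite ltnS => ab bn.
exact: leq_trans (IH ab (ltnW bn)) (ltnW (off_lt (Ordinal bn))).
Qed.

Lemma row_unique p i : (p < N)%N -> (i < n)%N -> (offN i <= p < offN i.+1)%N -> rowN p = i.
Proof.
move=> pN ni /andP[h1 h2]; have [rn _ _ /andP[g1 g2]] := entry_val pN.
apply/eqP; rewrite eqn_leq; apply/andP; split; rewrite leqNgt; apply/negP => lt.
  by have := leq_trans h2 (leq_trans (off_mono lt (ltnW rn)) g1); rewrite ltnn.
by have := leq_trans g2 (leq_trans (off_mono lt (ltnW ni)) h1); rewrite ltnn.
Qed.

Lemma row_interval (f : nat -> R) i : (i < n)%N ->
  \sum_(p < N | rowN p == i) f p = \sum_(offN i <= p < offN i.+1) f p.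
Proof.
move=> ni; have h2 : (offN i.+1 <= N)%N by rewrite -offNn off_mono.
have h1 : (offN i <= offN i.+1)%N by rewrite off_mono.
have z1 : \sum_(0 <= p < offN i | rowN p == i) f p = 0.
  rewrite big_nat_cond big_pred0 // => p; apply/negbTE/negP => /andP[/andP[_ lt] /eqP E].
  have pN : (p < N)%N by apply: leq_trans lt (leq_trans h1 h2).
  by have [_ _ _ /andP[g _]] := entry_val pN; rewrite E leqNgt lt in g.
have z3 : \sum_(offN i.+1 <= p < N | rowN p == i) f p = 0.
  rewrite big_nat_cond big_pred0 // => p; apply/negbTE/negP => /andP[/andP[g pN] /eqP E].
  by have [_ _ _ /andP[_ g2]] := entry_val pN; rewrite E ltnNge g in g2.
rewrite -(big_mkord (fun p => rowN p == i)) (big_cat_nat (n := offN i.+1)) //=.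
rewrite (big_cat_nat (n := offN i)) //= z1 z3 add0r addr0.
rewrite big_nat_cond [RHS]big_nat_cond; apply: eq_bigl => p; rewrite andbT.
apply: andb_idr => E; have /andP[_ b] := E; apply/eqP/row_unique => //.
exact: leq_trans b h2.
Qed.

End Csr.

(** * Tables of repeated indices for sampling *)

Section Tables.
Variables (R : realType) (m : nat) (w : nat -> R) (tab st : nat -> nat).

(** A uniform cell of such a table, or of an interval between two positions in [st], is a draw
    proportional to the rounded weights; so a sample takes one [Rand] and constant time. *)
Record table : Prop := Table {
  tb_st : forall p, (p <= m)%N -> st p = (\sum_(q < p) nceil (w q))%N;
  tb_tab : forall p r, (p < m)%N -> (r < nceil (w p))%N -> tab (st p + r)%N = p }.

Hypothesis tb : table.

Lemma st_S p : (p < m)%N -> st p.+1 = (st p + nceil (w p))%N.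
Proof. by move=> h; rewrite !(tb_st tb) ?big_ord_recr //; exact: ltnW. Qed.

Lemma st_mono p q : (p <= q)%N -> (q <= m)%N -> (st p <= st q)%N.
Proof.
elim: q => [|q IH]; first by rewrite leqn0 => /eqP ->.
rewrite leq_eqVlt => /orP[/eqP -> //|]; rewrite ltnS => pq qm.
by rewrite st_S // (leq_trans (IH pq (ltnW qm))) // leq_addr.
Qed.

Lemma table_sum (f : nat -> R) p q : (p <= q)%N -> (q <= m)%N ->
  \sum_(st p <= r < st q) f (tab r) = \sum_(p <= k < q) (nceil (w k))%:R * f k.
Proof.
elim: q => [|q IH]; first by rewrite leqn0 => /eqP -> _; rewrite !big_geq.
rewrite leq_eqVlt => /orP[/eqP -> _|]; first by rewrite !big_geq.
rewrite ltnS => pq qm; have qm' := ltnW qm.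
rewrite (big_cat_nat (n := st q)) ?st_mono //= IH // big_nat_recr //=; congr (_ + _).
rewrite st_S // -{1}[st q]add0n big_addn addKn big_mkord.
rewrite (eq_bigr (fun=> f q)); last by move=> r _; rewrite addnC (tb_tab tb).
by rewrite sumr_const card_ord mulr_natl.
Qed.

Lemma table_block r p q : (p <= q)%N -> (q <= m)%N -> (st p <= r < st q)%N ->
  exists2 k, (p <= k < q)%N & tab r = k /\ (0 < nceil (w k))%N.
Proof.
elim: q => [|q IH]; first by rewrite leqn0 => /eqP -> _ /andP[h1 h2]; move: (leq_ltn_trans h1 h2); rewrite ltnn.
move=> pq qm /andP[h1 h2]; have [lt|ge] := ltnP r (st q).
  have pq' : (p <= q)%N.
    move: pq; rewrite leq_eqVlt => /orP[/eqP E|//]; move: (leq_ltn_trans h1 lt).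
    by rewrite E ltnNge st_mono.
  have [k /andP[k1 k2] kk] := IH pq' (ltnW qm) ltac:(by rewrite h1 lt).
  by exists k => //; rewrite k1 ltnW.
have hr : (r - st q < nceil (w q))%N by rewrite ltn_subLR // -st_S.
exists q; last by split; [rewrite -(subnKC ge) (tb_tab tb)|exact: leq_ltn_trans hr].
rewrite ltnSn andbT; move: pq; rewrite leq_eqVlt => /orP[/eqP E|//].
by move: (leq_ltn_trans h1 h2); rewrite E ltnn.
Qed.

End Tables.

(** * Preparation *)

Section MkTable.
Variables (R : realType) (P : store R -> Prop) (kap : R).
Hypothesis kap0 : 0 <= kap.
Implicit Types (s : store R).
Local Notation B := (@bnd R P kap).
Variables (w tab st m : nat).
Hypothesis tabst : tab != st.

Definition tabI := [:: 10; 11; 13; 20]%N.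
Definition tabR := [:: 40; 41; 42]%N.

Let body := Blk [:: IStore tab 20 10; IAdd 20 20 13; RAdd 41 41 42].

Lemma copyM nn k s x (p c r b : nat) (z : R) : rreg s 40 = z -> c = nceil z -> (r <= c)%N ->
  ireg s 10 = p -> ireg s 20 = b -> ireg s 13 = 1%N -> rreg s 41 = r%:R -> rreg s 42 = 1 ->
  (forall s', frm [:: 20]%N [:: 41]%N [:: tab] [::] s s' ->
     ireg s' 20 = (b + (c - r))%N ->
     (forall t, (t < b)%N -> iarr s' tab t = iarr s tab t) ->
     (forall t, (t < c - r)%N -> iarr s' tab (b + t)%N = p) ->
     B nn k s' (x - kap * (8 * (c - r) + 1)%:R)) ->
  B nn (While (RLt 41 40) body :: k) s x.
Proof.
move=> ez ->; have [q] : exists q, (nceil z - r <= q)%N by exists (nceil z - r)%N.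
elim: q s x r b ez => [|q IH] s x r b ez qr rc e10 e20 e13 e41 e42 H.
  have rE : (nceil z - r = 0)%N by apply/eqP; rewrite -leqn0.
  have hE : holds (RLt 41 40) s = false by rewrite /= e41 ez nceilP -subn_gt0 rE.
  apply: bnd_while => //; rewrite hE; cbv iota.
  have := H s (frm_refl _ _ _ _ _); rewrite rE muln0 mulr1 addn0; apply=> //.
case: (ltnP r (nceil z)) => [lt|ge]; last first.
  by apply: IH ez _ rc e10 e20 e13 e41 e42 H; rewrite (eqP (_ : nceil z - r == 0)%N) // subn_eq0.
have hE : holds (RLt 41 40) s = true by rewrite /= e41 ez nceilP.
apply: bnd_while => //; rewrite hE; cbv iota.
apply: bnd_blk => //; set s1 := execs _ _.
have f1 : frm [:: 20]%N [:: 41]%N [:: tab] [::] s s1 by apply: frm_sub (frm_execs _ _) => //=; rewrite ?inE eqxx.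
have a1 t : iarr s1 tab t = if t == b then p else iarr s tab t.
  by rewrite /s1 iavalE /= eqxx /upd e20 e10.
have b1 : ireg s1 20 = b.+1 by rewrite /s1 ivalE /= e20 e13 addn1.
have cr : (nceil z - r = (nceil z - r.+1).+1)%N by rewrite subnSK.
apply: (IH s1 _ r.+1 b.+1).
- by rewrite (frm_r f1).
- by move: qr; rewrite cr.
- by [].
- by rewrite (frm_i f1).
- by [].
- by rewrite (frm_i f1).
- by rewrite /s1 rvalE /= e41 e42 natr1.
- by rewrite (frm_r f1).
move=> s' f' E20 El Eh; have f : frm [:: 20]%N [:: 41]%N [:: tab] [::] s s' by apply: frm_trans f1 f'.
apply: bnd_le (H s' f _ _ _).
- rewrite cr [size _]/=; have [y Ey] : exists y : R, y = (nceil z - r.+1)%:R by eexists.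
  have -> : (8 * (nceil z - r.+1).+1 + 1)%:R = 8 * y + 9 :> R by rewrite Ey natrD natrM -[_.+1%:R]natr1; ring.
  have -> : (8 * (nceil z - r.+1) + 1)%:R = 8 * y + 1 :> R by rewrite natrD natrM Ey.
  have -> : (2 * 3 + 1)%:R = 7 :> R by [].
  by have := kap0; lra.
- by rewrite E20 cr addSnnS.
- by move=> t tb; rewrite El ?a1; [rewrite ltn_eqF|exact: ltnW].
- move=> [|t] ht; first by rewrite addn0 El // a1 eqxx.
  by rewrite -addSnnS Eh //; move: ht; rewrite cr.
Qed.

Lemma mktabM nn k s x : ireg s 2 = m ->
  (forall s', frm tabI tabR [:: tab; st] [::] s s' ->
     table m (rarr s w) (iarr s' tab) (iarr s' st) ->
     B nn k s' (x - kap * (30 * m + 8 * (\sum_(q < m) nceil (rarr s w q)) + 30)%:R)) ->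
  B nn (MkTab w tab st :: k) s x.
Proof.
move=> e2 H; pose c q := nceil (rarr s w q).
have W := frm_execs.
apply: bnd_seq => //; apply: bnd_blk => //; set s1 := execs _ s.
have f1 : frm tabI tabR [:: tab; st] [::] s s1 by apply: frm_sub (frm_execs _ _).
apply: bnd_seq => //.
pose C p : R := (30 * p + 8 * (\sum_(q < p) c q) + 8)%:R.
suff: forall q p s1 y, (m - p <= q)%N -> (p <= m)%N -> frm tabI tabR [:: tab; st] [::] s s1 ->
   ireg s1 10 = p -> ireg s1 20 = (\sum_(q < p) c q)%N ->
   (forall t, (t < p)%N -> iarr s1 st t = (\sum_(q < t) c q)%N) ->
   (forall t r, (t < p)%N -> (r < c t)%N -> iarr s1 tab (\sum_(q < t) c q + r)%N = t) ->
   x - kap * C p <= y ->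
   B nn [:: While (ILt 10 2) (Seqs [::
      Blk [:: IStore st 10 20; RLoad 40 w 10; INum 11 0; RofI 41 11; INum 13 1; RofI 42 13];
      While (RLt 41 40) body; Blk inc]), Seqs [:: Blk [:: IStore st 10 20]] & k] s1 y.
  move=> HH; apply: (HH m 0%N s1) => //.
  - by rewrite subn0.
  - by rewrite big_ord0.
  - by rewrite /C big_ord0 /=; have := kap0; lra.
move=> {f1} q; elim: q => [|q IH] p {}s1 y pq pm f1 e10 e20 Est Etab Hy.
all: have s12 : ireg s1 2 = m by rewrite (frm_i f1).
all: have hE : holds (ILt 10 2) s1 = (p < m)%N by rewrite /= e10 s12.
all: have fin : p = m -> B nn [:: Seqs [:: Blk [:: IStore st 10 20]] & k] s1 (y - kap).
1,3: move=> pE; apply: bnd_seq => //; apply: bnd_blk => //; apply: bnd_skip => //; set s2 := execs _ _.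
1,2: have f2 : frm tabI tabR [:: tab; st] [::] s1 s2 by apply: frm_sub (frm_execs _ _) => //=; rewrite ?inE eqxx ?orbT.
1,2: apply: bnd_le (H s2 (frm_trans f1 f2) _).
1,3: by move: Hy; rewrite /C pE /c !natrD /=; have := kap0; move: (_%:R) (_%:R) => u v; lra.
1,2: have a1 t : iarr s2 st t = if t == m then (\sum_(q < p) c q)%N else iarr s1 st t
  by rewrite /s2 iavalE /= eqxx /upd e20 e10 pE.
1,2: have a2 t : iarr s2 tab t = iarr s1 tab t by rewrite /s2 iavalE /= (negbTE tabst).
1,2: have a3 t : (t <= m)%N -> iarr s2 st t = (\sum_(q < t) c q)%N
  by rewrite a1 leq_eqVlt => /orP[/eqP ->|lt]; [rewrite eqxx pE|rewrite (ltn_eqF lt) Est // pE].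
1,2: by split=> [t /a3 //|t r tm rc]; rewrite a2 a3 ?(ltnW tm) // Etab // pE.
  apply: bnd_while => //; rewrite hE; case: ltnP => [lt|ge]; cbv iota.
    by move: pq; rewrite leqn0 subn_eq0 leqNgt lt.
  by apply: fin; apply/eqP; rewrite eqn_leq pm.
apply: bnd_while => //; rewrite hE; case: ltnP => [lt|ge]; cbv iota; last first.
  by apply: fin; apply/eqP; rewrite eqn_leq pm.
apply: bnd_seq => //; apply: bnd_blk => //; set s2 := execs _ _.
have f2 : frm tabI tabR [:: tab; st] [::] s1 s2.
  by apply: frm_sub (frm_execs _ _) => //=; rewrite ?inE eqxx ?orbT.
have g40 : rreg s2 40 = rarr s w p by rewrite /s2 rvalE /= e10 (frm_ra f1).
have g10 : ireg s2 10 = p by rewrite /s2 ivalE.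
have g20 : ireg s2 20 = (\sum_(q < p) c q)%N by rewrite /s2 ivalE.
have g13 : ireg s2 13 = 1%N by rewrite /s2 ivalE.
have g41 : rreg s2 41 = 0%:R by rewrite /s2 rvalE.
have g42 : rreg s2 42 = 1 by rewrite /s2 rvalE.
have gst t : iarr s2 st t = if t == p then (\sum_(q < p) c q)%N else iarr s1 st t.
  by rewrite /s2 iavalE /= eqxx /upd e20 e10.
have gtab t : iarr s2 tab t = iarr s1 tab t by rewrite /s2 iavalE /= (negbTE tabst).
apply: bnd_seq => //; apply: (copyM g40 erefl (leq0n _) g10 g20 g13 g41 g42) => s3 f3.
rewrite subn0 -/(c p) => h20 hlo hhi.
apply: bnd_seq => //; apply: bnd_blk => //; apply: bnd_skip => //; set s4 := execs _ _.
have f4 : frm tabI tabR [:: tab; st] [::] s3 s4 by apply: frm_sub (frm_execs _ _).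
have f3' : frm tabI tabR [:: tab; st] [::] s2 s3 by apply: frm_sub f3 => //=; rewrite ?inE eqxx.
have a4 b : iarr s4 b = iarr s3 b by rewrite (frm_ia (W _ _ _)).
have st3 t : iarr s3 st t = iarr s2 st t by rewrite (frm_ia f3) // inE eq_sym.
apply: (IH p.+1 s4).
- by move: pq; rewrite -(subnSK lt).
- by [].
- by apply: frm_trans f1 _; apply: frm_trans f2 _; apply: frm_trans f3' _.
- by rewrite /s4 ivalE /= (frm_i f3) // g10 addn1.
- by rewrite (frm_i (W _ _ _)) // h20 big_ord_recr.
- move=> t; rewrite ltnS leq_eqVlt a4 st3 gst => /orP[/eqP ->|tp]; first by rewrite eqxx.
  by rewrite (ltn_eqF tp) Est.
- move=> t r; rewrite ltnS leq_eqVlt a4 => /orP[/eqP ->|tp] rc; first by rewrite hhi.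
  rewrite hlo ?gtab ?Etab //.
  apply: leq_trans (_ : \sum_(q < t.+1) c q <= _)%N; first by rewrite big_ord_recr ltn_add2l.
  by rewrite -!(big_mkord xpredT) (big_cat_nat (n := t.+1) (p := p)) //= leq_addr.
move: Hy; rewrite /C big_ord_recr /=.
have -> : (30 * p.+1 + 8 * (\sum_(q < p) c q + c p) + 8)%:R =
   (30 * p + 8 * (\sum_(q < p) c q) + 8)%:R + 30 + 8 * (c p)%:R :> R.
  by rewrite -[30]/(30%:R) -natrM -!natrD; congr _%:R; lia.
have -> : (8 * c p + 1)%:R = 8 * (c p)%:R + 1 :> R by rewrite natrD natrM.
have -> : (2 * 6 + 1)%:R = 13 :> R by [].
have -> : (2 * 2 + 1)%:R = 5 :> R by [].
by have := kap0; lra.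
Qed.

End MkTable.

(** * Correctness of the prepared data *)

Section Prep.
Variables (R : realType) (P : store R -> Prop) (kap : R).
Hypothesis kap0 : 0 <= kap.
Implicit Types (s : store R).
Local Notation B := (@bnd R P kap).
Variables (n d : nat) (A : 'M[R]_(n, d)) (eps : R).
Hypothesis rows : forall i : 'I_n, row i A != 0.
Local Notation N := (nnz A).
Local Notation a i := (mxrow_vec A i).
Local Notation F := (frob2 A).
Hypothesis N0 : (0 < N)%N.
Local Notation rowN := (rowN A).
Local Notation colN := (colN A).
Local Notation valN := (valN A).
Local Notation offN := (offN A).
Local Notation uu := (uu kap A).

Let n0 : (0 < n)%N.
Proof. by have [h _ _ _] := entry_val N0; exact: leq_ltn_trans h. Qed.

Lemma weighted_sum (g : R -> R) (f : nat -> R) : g 0 = 0 ->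
  \sum_(q < N) g (valN q) * f (rowN q) = \sum_(i < n) f i * \sum_(j < d) g (A i j).
Proof.
move=> g0; have /= -> := entry_sum A (fun i _ v => g v * f i).
apply: eq_bigr => i _; rewrite mulr_sumr; apply: eq_bigr => j _.
by case: eqP => [->|_] /=; rewrite ?g0 ?mulr0 // mulrC.
Qed.

Lemma row_sum (g : R -> R) (i : 'I_n) : g 0 = 0 ->
  \sum_(q < N | rowN q == i) g (valN q) = \sum_(j < d) g (A i j).
Proof.
move=> g0; rewrite big_mkcond /=.
rewrite (eq_bigr (fun q : 'I_N => g (valN q) * (if rowN q == i then 1 else 0))); last first.
  by move=> q _; case: ifP; rewrite ?mulr1 ?mulr0.
rewrite (weighted_sum (fun k => if k == i then 1 else 0) g0) (bigD1 i) //= eqxx mul1r.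
by rewrite [X in _ + X]big1 ?addr0 // => k ki; rewrite val_eqE (negbTE ki) mul0r.
Qed.

Definition l1N i : R := \sum_(q < N | rowN q == i) `|valN q|.
Definition sqN i : R := \sum_(q < N | rowN q == i) valN q ^+ 2.

Lemma l1NE (i : 'I_n) : l1N i = norm1 (a i).
Proof. by rewrite /l1N row_sum ?normr0 //; apply: eq_bigr => j _; rewrite !mxE. Qed.

Lemma sqNE (i : 'I_n) : sqN i = dot (a i) (a i).
Proof.
rewrite /sqN (row_sum (g := fun v => v ^+ 2)) ?expr0n //.
by apply: eq_bigr => j _; rewrite !mxE expr2.
Qed.

(** The row table is built over [N >= n] indices by the code for the entry table; indices from [n]
    on have weight 0 and get no copies. *)
Lemma sqN_out i : (n <= i)%N -> sqN i = 0.
Proof.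
move=> ni; apply: big_pred0 => q; apply/negbTE/negP => /eqP E.
by have [h _ _ _] := entry_val (ltn_ord q); rewrite E ltnNge ni in h.
Qed.

Lemma frobNE : \sum_(q < N) valN q ^+ 2 = F.
Proof.
have /= E := @weighted_sum (fun v => v ^+ 2) (fun=> 1) ltac:(by rewrite /= expr0n).
rewrite (eq_bigr (fun q : 'I_N => valN q ^+ 2 * 1)); last by move=> q _; rewrite mulr1.
rewrite E; apply: eq_bigr => i _; rewrite mul1r.
by apply: eq_bigr => j _; rewrite !mxE expr2.
Qed.

Record base s : Prop := Base {
  bs_n : ireg s 0 = n; bs_d : ireg s 1 = d; bs_N : ireg s 2 = N; bs_eps : rreg s 0 = eps;
  bs_off : iarr s 0 = offN; bs_col : iarr s 1 = colN; bs_val : rarr s 0 = valN;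
  bs_out : forall j, rarr s 1 j = 0 }.

Lemma base_frm wI wR wA wB s s' : frm wI wR wA wB s s' ->
  all (fun x => x \notin wI) [:: 0; 1; 2]%N -> 0%N \notin wR ->
  all (fun x => x \notin wA) [:: 0; 1]%N -> all (fun x => x \notin wB) [:: 0; 1]%N ->
  base s -> base s'.
Proof.
move=> [f1 f2 f3 f4] /and4P[i0 i1 i2 _] r0 /and3P[a0 a1 _] /and3P[b0 b1 _] [].
by split; rewrite ?f1 ?f2 ?f3 ?f4.
Qed.

Record inv1 (p : nat) s : Prop := Inv1 {
  i1_row : ireg s 14 = (if p is q.+1 then rowN q else 0%N);
  i1_rows : forall q, (q < p)%N -> iarr s 2 q = rowN q;
  i1_uniq : uniq (mkseq (iarr s 3) (ireg s 3));
  i1_mem : mkseq (iarr s 3) (ireg s 3) =i mkseq colN p;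
  i1_mark : forall c, iarr s 8 c = (c \in mkseq colN p);
  i1_l1 : forall i, rarr s 3 i = \sum_(q < p | rowN q == i) `|valN q|;
  i1_sq : forall i, rarr s 4 i = \sum_(q < p | rowN q == i) valN q ^+ 2;
  i1_F : rreg s 1 = \sum_(q < p) valN q ^+ 2 }.

(** No row is empty, so from one entry to the next the row advances by at most 1. *)
Lemma next_row p i : (p < N)%N -> i = (if p is q.+1 then rowN q else 0%N) ->
  (i + (1 - (offN (i + 1) - p)))%N = rowN p.
Proof.
move=> pN iE; rewrite addn1.
have [ni /andP[h1 h2]] : (i < n)%N /\ (offN i <= p <= offN i.+1)%N.
  case: p pN iE => [|q] pN ->; first by rewrite offN0.
  by have [rn _ _ /andP[g1 g2]] := entry_val (ltnW pN); rewrite rn (leqW g1) g2.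
case: (ltnP p (offN i.+1)) => [lt|ge].
  have -> : (1 - (offN i.+1 - p) = 0)%N by apply/eqP; rewrite subn_eq0 subn_gt0.
  by rewrite addn0; apply/esym; apply: row_unique => //; rewrite h1 lt.
have pE : p = offN i.+1 by apply/eqP; rewrite eqn_leq h2.
rewrite -pE subnn subn0 addn1; apply/esym.
have ni1 : (i.+1 < n)%N.
  rewrite ltn_neqAle ni andbT; apply/eqP => E.
  by move: pN; rewrite pE E offNn // ltnn.
by apply: row_unique => //; rewrite pE leqnn (off_lt rows (Ordinal ni1)).
Qed.

Lemma mkseq_upd (f : nat -> nat) m c : mkseq (upd f m c) m = mkseq f m.
Proof.
apply/eq_in_map => i; rewrite mem_iota add0n => /andP[_ im].
by rewrite /upd ltn_eqF.
Qed.

Lemma cond_sumS (f : nat -> R) (c : pred nat) p : \sum_(q < p.+1 | c q) f q =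
  \sum_(q < p | c q) f q + (if c p then f p else 0).
Proof. by rewrite big_mkcond big_ord_recr /= -big_mkcond. Qed.

Lemma inv1_step p s : base s -> (p < N)%N -> ireg s 10 = p -> inv1 p s ->
  inv1 p.+1 (execs (prep1 ++ inc) s).
Proof.
move=> bs pN e10 [h14 h2 hu hm h8 h3 h4 hF]; set s' := execs _ _.
have nr := next_row pN h14.
have e14 : ireg s' 14 = rowN p by rewrite /s' ivalE /= e10 (bs_off bs).
have e2 q : iarr s' 2 q = if q == p then rowN p else iarr s 2 q.
  by rewrite /s' iavalE /= /upd e10 (bs_off bs) nr.
have e3 : iarr s' 3 =1 upd (iarr s 3) (ireg s 3) (colN p).
  by move=> q; rewrite /s' iavalE /= e10 (bs_col bs).
have r3 : ireg s' 3 = (ireg s 3 + (1 - iarr s 8 (colN p)))%N.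
  by rewrite /s' ivalE /= e10 (bs_col bs).
have e8 c : iarr s' 8 c = if c == colN p then 1%N else iarr s 8 c.
  by rewrite /s' iavalE /= /upd e10 (bs_col bs).
have b3 i : rarr s' 3 i = if i == rowN p then rarr s 3 i + `|valN p| else rarr s 3 i.
  rewrite /s' ravalE /= /upd e10 (bs_off bs) nr (bs_val bs) -expr2 sqrtr_sqr.
  by case: eqP => // ->.
have b4 i : rarr s' 4 i = if i == rowN p then rarr s 4 i + valN p ^+ 2 else rarr s 4 i.
  rewrite /s' ravalE /= /upd e10 (bs_off bs) nr (bs_val bs) -expr2.
  by case: eqP => // ->.
have eF : rreg s' 1 = rreg s 1 + valN p ^+ 2 by rewrite /s' rvalE /= e10 (bs_val bs) expr2.
clearbody s'.
have mE : mkseq (iarr s' 3) (ireg s' 3) = if colN p \in mkseq colN p then mkseq (iarr s 3) (ireg s 3)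
    else rcons (mkseq (iarr s 3) (ireg s 3)) (colN p).
  have mu : mkseq (iarr s' 3) (ireg s 3) = mkseq (iarr s 3) (ireg s 3).
    by rewrite -[RHS](mkseq_upd _ _ (colN p)); apply: eq_mkseq.
  rewrite r3 h8; case: ifP => _ /=; first by rewrite subnn addn0.
  by rewrite subn0 addn1 mkseqS mu e3 /upd eqxx.
split=> //.
- by move=> q; rewrite ltnS leq_eqVlt e2 => /orP[/eqP ->|lt]; [rewrite eqxx|rewrite ltn_eqF // h2].
- rewrite mE; case: ifP => // /negbT nc; rewrite rcons_uniq hu andbT hm.
  exact: nc.
- move=> c; rewrite mE mkseqS mem_rcons inE; case: ifP => mc; last by rewrite mem_rcons inE hm.
  by rewrite hm; case: eqP => // ->.
- by move=> c; rewrite e8 mkseqS mem_rcons inE h8; case: eqP.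
- by move=> i; rewrite b3 h3 (cond_sumS (fun q => `|valN q|) (fun q => rowN q == i)) eq_sym;
  case: ifP; rewrite ?addr0.
- by move=> i; rewrite b4 h4 (cond_sumS (fun q => valN q ^+ 2) (fun q => rowN q == i)) eq_sym;
  case: ifP; rewrite ?addr0.
by rewrite eF hF big_ord_recr.
Qed.

Definition rsN i : R := l1N i / Num.sqrt (sqN i).
(** Scaled so that the weights of a row sum to its number of entries; likewise the [wR] sum to [N].
    As the average is 1, rounding up at most doubles the totals, and the tables have at most [2 N]
    cells. *)
Definition wE q : R := (offN (rowN q).+1 - offN (rowN q))%:R * `|valN q| / l1N (rowN q).
Definition wR q : R := N%:R * sqN q / F.

Record aux s : Prop := Aux {
  ax_row : forall q, (q < N)%N -> iarr s 2 q = rowN q;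
  ax_l1 : forall i, rarr s 3 i = l1N i; ax_sq : forall i, rarr s 4 i = sqN i;
  ax_F : rreg s 1 = F }.

Record inv2 (p : nat) s : Prop := Inv2 {
  i2_rs : forall q, (q < p)%N -> rarr s 7 (rowN q) = rsN (rowN q);
  i2_wE : forall q, (q < p)%N -> rarr s 15 q = wE q;
  i2_wR : forall q, (q < p)%N -> rarr s 16 q = wR q;
  i2_X : rreg s 3 = \sum_(q < p) valN q ^+ 2 * rsN (rowN q);
  i2_W : rreg s 2 = \sum_(q < p) `|valN q| * l1N (rowN q) }.

Lemma inv2_step p s : base s -> aux s -> (p < N)%N -> ireg s 10 = p -> inv2 p s ->
  inv2 p.+1 (execs (prep2 ++ inc) s).
Proof.
move=> bs [ar al asq aF] pN e10 [h7 hE hR hX hW]; set s' := execs _ _.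
have e7 i : rarr s' 7 i = if i == rowN p then rsN (rowN p) else rarr s 7 i.
  by rewrite /s' ravalE /= /upd e10 ar // al asq.
have e15 q : rarr s' 15 q = if q == p then wE p else rarr s 15 q.
  by rewrite /s' ravalE /= /upd e10 ar // al (bs_off bs) (bs_val bs) -expr2 sqrtr_sqr addn1.
have e16 q : rarr s' 16 q = if q == p then wR p else rarr s 16 q.
  by rewrite /s' ravalE /= /upd e10 asq aF (bs_N bs).
have eX : rreg s' 3 = rreg s 3 + valN p ^+ 2 * rsN (rowN p).
  by rewrite /s' rvalE /= e10 ar // al asq (bs_val bs) expr2.
have eW : rreg s' 2 = rreg s 2 + `|valN p| * l1N (rowN p).
  by rewrite /s' rvalE /= e10 ar // al (bs_val bs) -expr2 sqrtr_sqr.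
clearbody s'; split.
- move=> q; rewrite ltnS leq_eqVlt e7 => /orP[/eqP ->|lt]; first by rewrite eqxx.
  by case: eqP => [->//|_]; rewrite h7.
- by move=> q; rewrite ltnS leq_eqVlt e15 => /orP[/eqP ->|lt]; [rewrite eqxx|rewrite ltn_eqF // hE].
- by move=> q; rewrite ltnS leq_eqVlt e16 => /orP[/eqP ->|lt]; [rewrite eqxx|rewrite ltn_eqF // hR].
- by rewrite eX hX big_ord_recr.
by rewrite eW hW big_ord_recr.
Qed.

Record inv3 (s1 : store R) (p : nat) s : Prop := Inv3 {
  i3_g : forall q, (q < p)%N -> rarr s 5 q =
    (iarr s1 5 (offN (rowN q).+1) - iarr s1 5 (offN (rowN q)))%:R /
    (iarr s1 5 q.+1 - iarr s1 5 q)%:R * valN q;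
  i3_f : forall q, (q < p)%N -> rarr s 6 q =
    (ireg s1 4)%:R / (iarr s1 7 q.+1 - iarr s1 7 q)%:R }.

Lemma inv3_step s1 p s : base s -> (forall q, (q < N)%N -> iarr s 2 q = rowN q) ->
  iarr s 5 = iarr s1 5 -> iarr s 7 = iarr s1 7 -> ireg s 4 = ireg s1 4 ->
  (p < N)%N -> ireg s 10 = p -> inv3 s1 p s -> inv3 s1 p.+1 (execs (prep3 ++ inc) s).
Proof.
move=> bs ar a5 a7 a4 pN e10 [hg hf]; set s' := execs _ _.
have e5 q : rarr s' 5 q = if q == p then
    (iarr s1 5 (offN (rowN p).+1) - iarr s1 5 (offN (rowN p)))%:R /
    (iarr s1 5 p.+1 - iarr s1 5 p)%:R * valN p else rarr s 5 q.
  by rewrite /s' ravalE /= /upd e10 ar // (bs_off bs) (bs_val bs) a5 !addn1.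
have e6 q : rarr s' 6 q = if q == p then
    (ireg s1 4)%:R / (iarr s1 7 p.+1 - iarr s1 7 p)%:R else rarr s 6 q.
  by rewrite /s' ravalE /= /upd e10 a7 a4 !addn1.
clearbody s'; split.
- by move=> q; rewrite ltnS leq_eqVlt e5 => /orP[/eqP ->|lt]; [rewrite eqxx|rewrite ltn_eqF // hg].
- by move=> q; rewrite ltnS leq_eqVlt e6 => /orP[/eqP ->|lt]; [rewrite eqxx|rewrite ltn_eqF // hf].
Qed.

Lemma table_ext (m : nat) (w w' : nat -> R) tab st : (forall q, (q < m)%N -> w q = w' q) ->
  table m w tab st -> table m w' tab st.
Proof.
move=> E [h1 h2]; split=> [p pm|p r pm]; last by rewrite -E //; exact: h2.
by rewrite h1 //; apply: eq_bigr => q _; rewrite E // (leq_trans (ltn_ord q)).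
Qed.

Lemma row_dot_gt0 i : 0 < dot (a i) (a i).
Proof.
rewrite lt_def dot_ge0 andbT; apply/eqP => E; move: (rows i) => /eqP; apply; apply/rowP => j.
have := norm2_coord (a i) j; rewrite norm2E E sqrtr0 normr_le0 !mxE => /eqP ->.
by [].
Qed.

Let arow i : 0 < dot (a i) (a i). Proof. exact: row_dot_gt0. Qed.

Lemma l1N_gt0 i : (i < n)%N -> 0 < l1N i.
Proof.
move=> ni; rewrite (l1NE (Ordinal ni)); apply: lt_le_trans (norm2_le_norm1 _).
by rewrite norm2_row_gt0.
Qed.

Let size_R i : R := (offN i.+1 - offN i)%:R.

Lemma wE_gt0 q : (q < N)%N -> 0 < wE q.
Proof.
move=> qN; have [rn _ v0 /andP[g1 g2]] := entry_val qN.
rewrite /wE divr_gt0 ?l1N_gt0 // mulr_gt0 ?normr_gt0 // ltr0n subn_gt0.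
exact: (off_lt rows (Ordinal rn)).
Qed.

Lemma wR_ge0 q : 0 <= wR q.
Proof.
rewrite /wR divr_ge0 ?mulr_ge0 // ?frob2_ge0 //; apply: sumr_ge0 => ? _; exact: sqr_ge0.
Qed.

Lemma F_gt0 : 0 < F.
Proof.
rewrite /frob2 (bigD1 (Ordinal n0)) //= ltr_wpDr // sumr_ge0 // => i _; exact: dot_ge0.
Qed.

Lemma interval_one i : (i < n)%N -> \sum_(q < N | rowN q == i) 1 = size_R i.
Proof. by move=> ni; rewrite (row_interval rows (fun=> 1)) // sumr_const_nat. Qed.

Lemma row_wE i : (i < n)%N -> \sum_(q < N | rowN q == i) wE q = size_R i.
Proof.
move=> ni; rewrite (eq_bigr (fun q : 'I_N => size_R i / l1N i * `|valN q|)); last first.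
  by move=> q /eqP E; rewrite /wE E mulrAC.
by rewrite -mulr_sumr -/(l1N i) divfK // gt_eqF // l1N_gt0.
Qed.

Lemma sum_size : \sum_(i < n) size_R i = N%:R.
Proof.
rewrite (eq_bigr (fun i : 'I_n => (size (row_support A i))%:R)); last first.
  by move=> i _; rewrite /size_R offS addKn.
by rewrite -natr_sum -nnzE.
Qed.

Lemma sum_wE : \sum_(q < N) wE q = N%:R.
Proof.
rewrite -sum_size (partition_big (fun q : 'I_N => inord (rowN q) : 'I_n.-1.+1) xpredT) //=.
have nE : n.-1.+1 = n by rewrite prednK.
rewrite -[in RHS]nE.
apply: eq_bigr => i _; rewrite -row_wE; last by rewrite -[ltnRHS]nE.
apply: eq_bigl => q; rewrite -val_eqE /= inordK // nE.
by have [] := entry_val (ltn_ord q).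
Qed.

Lemma nN : (n <= N)%N.
Proof.
rewrite nnzE -[leqLHS]card_ord -sum1_card; apply: leq_sum => i _; exact: supp_gt0.
Qed.

Lemma sum_sqN : \sum_(q < N) sqN q = F.
Proof.
rewrite -(big_mkord xpredT) (big_cat_nat (n := n)) ?nN //= big_mkord.
rewrite [X in _ + X]big_nat_cond [X in _ + X]big1 ?addr0; last first.
  by move=> q /andP[/andP[h _] _]; rewrite sqN_out.
by apply: eq_bigr => i _; rewrite sqNE.
Qed.

Lemma sum_wR : \sum_(q < N) wR q = N%:R.
Proof. by rewrite /wR -mulr_suml -mulr_sumr sum_sqN mulfK // gt_eqF // F_gt0. Qed.

Lemma sum_nceil (w : nat -> R) : (forall q, (q < N)%N -> 0 <= w q) ->
  \sum_(q < N) w q = N%:R -> (\sum_(q < N) nceil (w q) <= 2 * N)%N.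
Proof.
move=> w0 E; rewrite -(ler_nat R) natr_sum natrM mulr_natl mulr2n -{1}E.
have -> : N%:R = \sum_(q < N) 1 :> R by rewrite sumr_const card_ord.
by rewrite -big_split; apply: ler_sum => q _; rewrite nceil_le // w0.
Qed.

Section Sound.
Variable s : store R.
Hypothesis bs : base s.
Hypothesis hrow : forall q, (q < N)%N -> iarr s 2 q = rowN q.
Hypothesis hu : uniq (mkseq (iarr s 3) (ireg s 3)).
Hypothesis hm : mkseq (iarr s 3) (ireg s 3) =i mkseq colN N.
Variable rst : nat -> nat.
Hypothesis T1 : table N wE (iarr s 4) (iarr s 5).
Hypothesis T2 : table N wR (iarr s 6) rst.
Hypothesis h4 : ireg s 4 = rst N.
Hypothesis hg : forall q, (q < N)%N -> rarr s 5 q =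
    (iarr s 5 (offN (rowN q).+1) - iarr s 5 (offN (rowN q)))%:R /
    (iarr s 5 q.+1 - iarr s 5 q)%:R * valN q.
Hypothesis hf : forall q, (q < N)%N -> rarr s 6 q =
    (ireg s 4)%:R / (rst q.+1 - rst q)%:R.
Hypothesis hrs : forall q, (q < N)%N -> rarr s 7 (rowN q) = rsN (rowN q).
Hypothesis hF : rreg s 1 = F.
Hypothesis hX : rreg s 3 = \sum_(q < N) valN q ^+ 2 * rsN (rowN q).
Hypothesis hW : rreg s 2 = \sum_(q < N) `|valN q| * l1N (rowN q).

Definition prep_data : sdata R := SData (iarr s 0) (iarr s 1) (iarr s 2) (iarr s 3) (iarr s 4)
  (iarr s 5) (iarr s 6) (rarr s 0) (rarr s 5) (rarr s 6) (rarr s 7) (ireg s 3) (ireg s 4) eps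
  (rreg s 2) (rreg s 3).
Local Notation D := prep_data.

Lemma prep_stat : stat A D s.
Proof. by case: bs => *; split. Qed.

Lemma prep_good : sgood A D.
Proof.
have mcol c : reflect (exists2 p, (p < N)%N & c = colN p) (c \in mkseq colN N).
  apply: (iffP mapP) => [[p]|[p pN ->]]; last by exists p; rewrite // mem_iota.
  by rewrite mem_iota => /andP[_ h] ->; exists p.
have clc q : (q < ireg s 3)%N -> exists2 p, (p < N)%N & iarr s 3 q = colN p.
  by move=> h; apply/mcol; rewrite -hm; apply: map_f; rewrite mem_iota.
split=> //.
- have := uniq_leq_size hu (fun x => etrans (esym (hm x))).
  by rewrite !size_mkseq; apply=> x; rewrite hm.
- by move=> q /clc[p pN E]; rewrite -[cl D q]/(iarr s 3 q) E; have [] := entry_val pN.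
- by move=> p pN; rewrite /cls /= (bs_col bs) hm; apply/mcol; exists p.
- by move=> p pN /=; rewrite hrow //; have [] := entry_val pN.
- by move=> q /clc[p pN E]; exists p => //=; rewrite (bs_col bs).
- move=> i ni; have lt := off_lt rows (Ordinal ni).
  have h : (offN i < N)%N by rewrite -(offNn A); apply: leq_trans lt (off_mono rows ni (leqnn _)).
  by exists (offN i) => //=; rewrite hrow // (row_unique rows h ni) // leqnn lt.
- move=> i j Aij; rewrite /cls /= hm.
  have -> : mkseq colN N = csr_columns A.
    by rewrite -[RHS](mkseq_nth 0%N) size_allpairs_dep (sumn_row_sizes A).
  by apply/allpairsPdep; exists i, j; rewrite mem_enum mem_supp.
- move=> h; rewrite -entry_sum; apply: eq_bigr => p _ /=.
  by rewrite hrow // (bs_col bs) (bs_val bs).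
Qed.

Let cnt q : nat := nceil (wE q).
Let cnt0 q : (q < N)%N -> (0 < cnt q)%N. Proof. by move=> h; rewrite nceil_gt0 ?wE_gt0. Qed.
Let stS q : (q < N)%N -> (iarr s 5 q.+1 - iarr s 5 q = cnt q)%N.
Proof. by move=> h; rewrite (st_S T1 h) addKn. Qed.
Let rlenE i : (rlength D i = iarr s 5 (offN i.+1) - iarr s 5 (offN i))%N.
Proof. by rewrite /rlength /= (bs_off bs). Qed.
Let offle i : (i < n)%N -> (offN i <= offN i.+1 <= N)%N.
Proof.
by move=> ni; rewrite (off_mono rows) // -(offNn A) (off_mono rows).
Qed.

Lemma rlength_sum i : (i < n)%N ->
  (rlength D i)%:R = \sum_(q < N | rowN q == i) (cnt q)%:R :> R.
Proof.
move=> ni; have /andP[oa ob] := offle ni.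
rewrite (row_interval rows (fun q => (cnt q)%:R)) // rlenE.
have := table_sum T1 (fun=> 1) oa ob; rewrite sumr_const_nat => ->.
by apply: eq_bigr => q _; rewrite mulr1.
Qed.

Lemma rlength_le i : (i < n)%N -> (rlength D i)%:R <= 2 * size_R i.
Proof.
move=> ni; rewrite rlength_sum // mulr_natl mulr2n -{1}row_wE // -interval_one // -big_split /=.
by apply: ler_sum => q _; rewrite nceil_le // ltW // wE_gt0.
Qed.

Lemma rlength_gt0 i : (i < n)%N -> (0 < rlength D i)%N.
Proof.
move=> ni; have /andP[oa ob] := offle ni; have lt := off_lt rows (Ordinal ni).
rewrite rlenE subn_gt0 (leq_trans _ (st_mono T1 lt ob)) //.
have h : (offN i < N)%N by exact: leq_trans lt ob.
by rewrite (st_S T1 h) -[ltnLHS]addn0 ltn_add2l cnt0.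
Qed.

Definition prep_ppi q : R := (cnt q)%:R / (rlength D (rowN q))%:R.
Definition prep_qq i : R := (nceil (wR i))%:R / (ireg s 4)%:R.

Let rlenN : N%:R <= (ireg s 4)%:R :> R.
Proof.
rewrite h4 (tb_st T2) // natr_sum -{1}sum_wR; apply: ler_sum => q _; exact: nceil_ge.
Qed.
Let rlen2N : (ireg s 4)%:R <= 2 * N%:R :> R.
Proof.
rewrite h4 (tb_st T2) // -natrM ler_nat; apply: sum_nceil sum_wR => q _; exact: wR_ge0.
Qed.
Let NR0 : 0 < N%:R :> R. Proof. by rewrite ltr0n. Qed.
Let rl0 : 0 < (ireg s 4)%:R :> R. Proof. exact: lt_le_trans rlenN. Qed.
Let wRi (i : 'I_n) : 0 < wR i.
Proof. by rewrite /wR divr_gt0 ?F_gt0 // mulr_gt0 // sqNE. Qed.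

Lemma prep_samp : ssamp A D prep_ppi prep_qq.
Proof.
have rD q : (q < N)%N -> erow D q = rowN q by exact: hrow.
split.
- exact: rlength_gt0.
- move=> i r ni hr; have /andP[oa ob] := offle ni.
  have [|k /andP[_ k2] [h _]] := table_block T1 (r := r + iarr s 5 (offN i)) oa ob.
    by rewrite leq_addl /= addnC -ltn_subRL -rlenE.
  by rewrite /rbase /= (bs_off bs) h (leq_trans k2).
- move=> i f ni; have /andP[oa ob] := offle ni.
  rewrite (eq_bigl (fun p : 'I_N => rowN p == i)); last by move=> p; rewrite rD.
  rewrite (eq_bigr (fun p : 'I_N => (cnt p)%:R * f p / (rlength D i)%:R)); last first.
    by move=> p /eqP E; rewrite /prep_ppi E mulrAC.
  rewrite -mulr_suml (row_interval rows (fun q => (cnt q)%:R * f q)) // -(table_sum T1) //.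
  congr (_ / _); rewrite -{1}[iarr s 5 (offN i)]add0n big_addn -rlenE big_mkord.
  by rewrite /rbase /= (bs_off bs).
- move=> i p pN; rewrite rD // => Er; have ni := ltn_ord i; rewrite -Er in ni.
  have [_ _ v0 _] := entry_val pN.
  have c0 : 0 < (cnt p)%:R :> R by rewrite ltr0n cnt0.
  have l0 : 0 < (rlength D (rowN p))%:R :> R by rewrite ltr0n rlength_gt0.
  have gE : gam D p = (rlength D (rowN p))%:R / (cnt p)%:R * valN p.
    by rewrite -[gam D p]/(rarr s 5 p) hg // stS // -rlenE.
  have L0 := l1N_gt0 ni.
  split.
  + by rewrite divr_ge0.
  + by rewrite gE -[evl D p]/(rarr s 0 p) (bs_val bs) /prep_ppi; field; rewrite !gt_eqF.
  rewrite gE -l1NE -Er normrM ger0_norm ?divr_ge0 //.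
  (* The count of an entry is at least its weight, and the block of a row has at most twice as many
     cells as the row has entries; this is the factor 2. *)
  have := nceil_ge (wE p); rewrite -/(cnt p) /wE ler_pdivrMr // => cl.
  rewrite mulrAC ler_pdivrMr // -mulrA [l1N _ * _]mulrC.
  apply: le_trans (_ : 2 * (size_R (rowN p) * `|valN p|) <= _); last by rewrite ler_wpM2l.
  by rewrite mulrA ler_wpM2r // rlength_le.
- by rewrite -(ltr0n R).
- move=> r; rewrite -[rlen D]/(ireg s 4) h4 => hr.
  have [|k /andP[_ kN] [h c]] := table_block T2 (r := r) (leq0n N) (leqnn _).
    by rewrite (tb_st T2) // big_ord0.
  rewrite -[rtab D r]/(iarr s 6 r) h ltnNge; apply/negP => nk.
  by move: c; rewrite -nceilP /wR sqN_out // mulr0 mul0r ltxx.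
- move=> f; have := table_sum T2 f (leq0n N) (leqnn _).
  rewrite (tb_st T2) // big_ord0 -h4 !big_mkord => E.
  transitivity ((\sum_(i < N) (nceil (wR i))%:R * f i) / (ireg s 4)%:R); first by rewrite -E.
  rewrite -(big_mkord xpredT (fun i => (nceil (wR i))%:R * f i)) (big_cat_nat (n := n)) ?nN //=.
  rewrite [X in _ + X]big_nat_cond [X in _ + X]big1 ?addr0; last first.
    move=> q /andP[/andP[h _] _]; have -> : nceil (wR q) = 0%N; last by rewrite mul0r.
    apply/eqP; rewrite -leqn0 leqNgt -nceilP /wR sqN_out //.
    by rewrite mulr0 mul0r ltxx.
  by rewrite big_mkord mulr_suml; apply: eq_bigr => i _; rewrite /prep_qq mulrAC.
- move=> i; have iN : (i < N)%N by exact: leq_trans (ltn_ord i) nN.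
  have c0 : 0 < (nceil (wR i))%:R :> R by rewrite ltr0n nceil_gt0.
  have fE : rfac D i = (ireg s 4)%:R / (nceil (wR i))%:R.
    by rewrite -[rfac D i]/(rarr s 6 i) hf // (st_S T2) // addKn.
  have f0 := F_gt0; have sq0 := arow i.
  split.
  + by rewrite divr_ge0.
  + by rewrite fE /prep_qq; field; rewrite !gt_eqF.
  + by rewrite fE divr_ge0.
  + rewrite fE mulrAC ler_pdivrMr //.
    apply: le_trans (_ : 2 * N%:R * dot (a i) (a i) <= _); first by rewrite ler_wpM2r // ltW.
    have := nceil_ge (wR i); rewrite /wR sqNE ler_pdivrMr // => h.
    by move: h; lra.
  rewrite /prep_qq ler_pdivrMr //.
  apply: le_trans (nceil_le (ltW (wRi i))) _.
  apply: le_trans (_ : (dot (a i) (a i) / F + N%:R^-1) * N%:R <= _).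
    rewrite mulrDl mulVf ?gt_eqF // lerD2r /wR sqNE.
    by rewrite [leLHS](_ : _ = dot (a i) (a i) / F * N%:R) //; ring.
  by rewrite ler_wpM2l // addr_ge0 ?invr_ge0 // divr_ge0 // ltW.
- move=> i; have [p pN E] := sg_rowex prep_good (ltn_ord i).
  rewrite rD // in E; rewrite -[rs D i]/(rarr s 7 i) -E hrs // E /rsN l1NE sqNE /rsp.
  by rewrite norm2E.
- rewrite -[sW D]/(rreg s 2) hW (weighted_sum l1N) ?normr0 //; apply: eq_bigr => i _.
  by rewrite l1NE expr2; congr (_ * _); apply: eq_bigr => j _; rewrite !mxE.
rewrite -[sX D]/(rreg s 3) hX.
have /= -> := @weighted_sum (fun v => v ^+ 2) rsN ltac:(by rewrite /= expr0n).
apply: eq_bigr => i _; have -> : \sum_(j < d) A i j ^+ 2 = dot (a i) (a i).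
  by apply: eq_bigr => j _; rewrite !mxE expr2.
rewrite /rsN l1NE sqNE -norm2E -norm2_sq; field; rewrite gt_eqF //.
exact: norm2_row_gt0.
Qed.

End Sound.

Lemma prep_budget (c1 c2 c3 c4 c5 : nat) (x : R) :
  (c1 <= 100 * N)%N -> (c2 <= 100 * N)%N -> (c3 <= 100 * N)%N -> (c4 <= 100 * N)%N ->
  (c5 <= 90 * N)%N ->
  x - 6 * 100 * uu <= x - kap - kap * (2 * 1 + 1)%:R - kap - kap * c1%:R - kap - kap * c2%:R - kap
    - kap * c3%:R - kap - kap * c4%:R - kap - kap * 3%:R - kap - kap * c5%:R - kap.
Proof.
have H (c m : nat) : (c <= m * N)%N -> kap * c%:R <= m%:R * uu.
  by move=> h; rewrite /uu mulrCA ler_wpM2l // -natrM ler_nat.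
move=> /H h1 /H h2 /H h3 /H h4 /H h5.
have k1 : kap <= uu by rewrite /uu ler_peMr // ler1n.
have -> : (2 * 1 + 1)%:R = 3 :> R by [].
by have := kap0; lra.
Qed.

Lemma prepM nn k x :
  (forall s D ppi qq, stat A D s -> sgood A D -> ssamp A D ppi qq -> seps D = eps ->
     (forall j, rarr s 1 j = 0) -> B nn k s (x - 6 * 100 * uu)) ->
  B nn (Prep :: k) (input_store A eps) x.
Proof.
set s0 := input_store A eps => H.
have bs0 : base s0 by split=> // j; rewrite /= nth_nil.
apply: bnd_seq => //; apply: bnd_blk => //; set s1 := execs _ s0.
have f1 : frm [:: 14]%N [::] [::] [::] s0 s1 by apply: frm_sub (frm_execs _ _).
have bs1 : base s1 by apply: base_frm f1 _ _ _ _ bs0.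
apply: bnd_seq => //; apply: (@bnd_loop _ _ _ kap0 nn 2 prep1 _ s1 _ inv1) => //.
- split=> //.
  + by move=> c; rewrite /= nth_nil.
  + by move=> i; rewrite big_ord0 /= nth_nil.
  + by move=> i; rewrite big_ord0 /= nth_nil.
  + by rewrite big_ord0.
- move=> p s' pN e10 f; apply: inv1_step => //; by apply: base_frm f _ _ _ _ bs1.
rewrite (bs_N bs1) => s2 f2 [_ h2 hu hm _ hl hs hF].
have bs2 : base s2 by apply: base_frm f2 _ _ _ _ bs1.
have ax2 : aux s2 by split=> //; rewrite hF frobNE.
have q3 : rreg s2 3 = 0 by rewrite (frm_r f2).
have q2 : rreg s2 2 = 0 by rewrite (frm_r f2).
clearbody s1.
apply: bnd_seq => //; apply: (@bnd_loop _ _ _ kap0 nn 2 prep2 _ s2 _ inv2) => //.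
- by split=> //; rewrite big_ord0.
- move=> p s' pN e10 f; apply: inv2_step => //; first by apply: base_frm f _ _ _ _ bs2.
    case: ax2 => ar al asq aF; split=> [q qN|i|i|].
    + by rewrite (frm_ia f) // ar.
    + by rewrite (frm_ra f) // al.
    + by rewrite (frm_ra f) // asq.
    by rewrite (frm_r f).
  by rewrite -(bs_N bs2).
rewrite (bs_N bs2) => s3 f3 [g7 gE gR gX gW].
have bs3 : base s3 by apply: base_frm f3 _ _ _ _ bs2.
apply: bnd_seq => //; apply: (mktabM kap0 (m := N)) => //; first exact: (bs_N bs3).
move=> s4 f4 T1.
have bs4 : base s4 by apply: base_frm f4 _ _ _ _ bs3.
apply: bnd_seq => //; apply: (mktabM kap0 (m := N)) => //; first exact: (bs_N bs4).
move=> s5 f5 T2.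
have bs5 : base s5 by apply: base_frm f5 _ _ _ _ bs4.
apply: bnd_seq => //; apply: bnd_blk => //; set s6 := execs _ s5.
have f6 : frm [:: 4]%N [::] [::] [::] s5 s6 by apply: frm_sub (frm_execs _ _).
have e4 : ireg s6 4 = iarr s6 7 N by rewrite (frm_ia f6) // /s6 ivalE /= (bs_N bs5).
have bs6 : base s6 by apply: base_frm f6 _ _ _ _ bs5.
clearbody s6.
have r6 q : (q < N)%N -> iarr s6 2 q = rowN q.
  by move=> qN; rewrite (frm_ia f6) // (frm_ia f5) // (frm_ia f4) // (frm_ia f3) // h2.
apply: bnd_seq => //; apply: (@bnd_loop _ _ _ kap0 nn 2 prep3 _ s6 _ (inv3 s6)) => //.
- move=> p s' pN e10 f; apply: inv3_step => //.
  + by apply: base_frm f _ _ _ _ bs6.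
  + by move=> q qN; rewrite (frm_ia f) // r6.
  + by rewrite (frm_ia f).
  + by rewrite (frm_ia f).
  + by rewrite (frm_i f).
  by rewrite -(bs_N bs6).
rewrite (bs_N bs6) => s7 f7 [g5 g6]; apply: bnd_skip => //.
have bs7 : base s7 by apply: base_frm f7 _ _ _ _ bs6.
have i74 b : b \notin [::] -> iarr s7 b = iarr s6 b by move=> h; rewrite (frm_ia f7).
have T1' : table N wE (iarr s7 4) (iarr s7 5).
  rewrite !i74 // !(frm_ia f6) // !(frm_ia f5) //; exact: table_ext gE T1.
have gR' q : (q < N)%N -> rarr s4 16 q = wR q by move=> qN; rewrite (frm_ra f4) // gR.
have T2' : table N wR (iarr s7 6) (iarr s7 7).
  rewrite !i74 // !(frm_ia f6) //; exact: table_ext gR' T2.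
have r7 q : (q < N)%N -> iarr s7 2 q = rowN q by move=> qN; rewrite i74 // r6.
have E3 : iarr s7 3 = iarr s2 3.
  by rewrite i74 // (frm_ia f6) // (frm_ia f5) // (frm_ia f4) // (frm_ia f3).
have n3 : ireg s7 3 = ireg s2 3.
  by rewrite (frm_i f7) // (frm_i f6) // (frm_i f5) // (frm_i f4) // (frm_i f3).
have hu7 : uniq (mkseq (iarr s7 3) (ireg s7 3)) by rewrite E3 n3.
have hm7 : mkseq (iarr s7 3) (ireg s7 3) =i mkseq colN N by rewrite E3 n3.
have h74 : ireg s7 4 = iarr s7 7 N by rewrite i74 // (frm_i f7).
have rr b : b \notin [:: 5; 6]%N -> rarr s7 b = rarr s3 b.
  by move=> h; rewrite (frm_ra f7) // (frm_ra f6) // (frm_ra f5) // (frm_ra f4).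
have xr b : b \notin [:: 40; 41; 42]%N -> rreg s7 b = rreg s3 b.
  by move=> h; rewrite (frm_r f7) ?(frm_r f6) ?(frm_r f5) ?(frm_r f4) //;
    move: h; rewrite !inE !negb_or => /and3P[-> -> _].
have hg7 q : (q < N)%N -> rarr s7 5 q =
    (iarr s7 5 (offN (rowN q).+1) - iarr s7 5 (offN (rowN q)))%:R /
    (iarr s7 5 q.+1 - iarr s7 5 q)%:R * valN q by move=> qN; rewrite !i74 // g5.
have hf7 q : (q < N)%N -> rarr s7 6 q =
    (ireg s7 4)%:R / (iarr s7 7 q.+1 - iarr s7 7 q)%:R.
  by move=> qN; rewrite !i74 // g6 // (frm_i f7).
have hrs7 q : (q < N)%N -> rarr s7 7 (rowN q) = rsN (rowN q) by move=> qN; rewrite rr // g7.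
have hF7 : rreg s7 1 = F by rewrite xr // (frm_r f3) // (ax_F ax2).
have hX7 : rreg s7 3 = \sum_(q < N) valN q ^+ 2 * rsN (rowN q) by rewrite xr.
have hW7 : rreg s7 2 = \sum_(q < N) `|valN q| * l1N (rowN q) by rewrite xr.
have stD := prep_stat bs7 hF7.
have goodD := prep_good bs7 r7 hu7 hm7.
have sampD := prep_samp bs7 r7 hu7 hm7 T1' T2' h74 hg7 hf7 hrs7 hX7 hW7.
apply: bnd_le (H s7 _ _ _ stD goodD sampD erefl (bs_out bs7)).
have cnt1 : (\sum_(q < N) nceil (rarr s3 15 q) <= 2 * N)%N.
  rewrite (eq_bigr (fun q : 'I_N => nceil (wE q))); last by move=> q _; rewrite gE.
  by apply: sum_nceil sum_wE => q qN; rewrite ltW // wE_gt0.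
have cnt2 : (\sum_(q < N) nceil (rarr s4 16 q) <= 2 * N)%N.
  rewrite (eq_bigr (fun q : 'I_N => nceil (wR q))); last by move=> q _; rewrite gR'.
  by apply: sum_nceil sum_wR => q qN; rewrite wR_ge0.
move: cnt1 cnt2; set k1 := (\sum_(q < N) _)%N; set k2 := (\sum_(q < N) _)%N => cnt1 cnt2.
have nn1 := N0.
have b1 : (loop_cost prep1 * N + 4 <= 100 * N)%N by rewrite /loop_cost /=; clear -nn1; lia.
have b2 : (loop_cost prep2 * N + 4 <= 100 * N)%N by rewrite /loop_cost /=; clear -nn1; lia.
have b3 : (30 * N + 8 * k1 + 30 <= 100 * N)%N by clear -nn1 cnt1; lia.
have b4 : (30 * N + 8 * k2 + 30 <= 100 * N)%N by clear -nn1 cnt2; lia.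
have b5 : (loop_cost prep3 * N + 4 <= 90 * N)%N by rewrite /loop_cost /=; clear -nn1; lia.
exact: (prep_budget x b1 b2 b3 b4 b5).
Qed.

End Prep.

(** * Random start *)

Lemma upd_comm (T : Type) (f : nat -> T) a b x y : a != b ->
  upd (upd f a x) b y = upd (upd f b y) a x.
Proof.
move=> ab; apply: funext => z; rewrite /upd.
by case: (eqVneq z b) => // ->; rewrite eq_sym (negbTE ab).
Qed.

Section Start.
Variables (R : realType) (P : store R -> Prop) (kap : R).
Hypothesis kap0 : 0 <= kap.
Variables (n d : nat) (A : 'M[R]_(n, d)) (D : sdata R).
Local Notation N := (nnz A).
Hypothesis good : sgood A D.
Implicit Types (s : store R).
Local Notation B := (@bnd R P kap).
Local Notation stat := (stat A D).
Local Notation cv := (@cv R d D).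
Local Notation cls := (cls D).
Local Notation uu := (uu kap A).

Variables (Q : 'M[R]_d) (lam : 'I_d -> R) (j0 : 'I_d).
Hypothesis QQ : Q *m Q^T = 1%:M.
Hypothesis Qg : Q *m gram A = diag_mx (\row_j lam j) *m Q.
Hypothesis L10 : 0 < lam j0.
Hypothesis d0 : (0 < d)%N.
Variable M : nat.
Hypothesis M0 : (0 < M)%N.

Let MR : 0 < M%:R :> R. Proof. by rewrite ltr0n. Qed.

Lemma top_row_unit : \sum_j Q j0 j ^+ 2 = 1.
Proof.
have := congr1 (fun X : ('M[R]_d) => X j0 j0) QQ; rewrite !mxE eqxx mulr1n => <-.
by apply: eq_bigr => j _; rewrite !mxE expr2.
Qed.

Lemma top_row_supp (j : 'I_d) : (j : nat) \notin cls -> Q j0 j = 0.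
Proof.
move=> jc; have z i : A i j = 0.
  by apply/eqP; apply: contraNT jc => h; rewrite (sg_cov good h).
have := congr1 (fun X : ('M[R]_d) => X j0 j) Qg; rewrite mul_diag_mx !mxE big1.
  by move/esym/eqP; rewrite mulf_eq0 (gt_eqF L10) => /eqP.
by move=> k _; rewrite !mxE big1 ?mulr0 // => i _; rewrite !mxE z mulr0.
Qed.

(** Some coordinate of a unit vector has square at least [1 / d]. The top eigenvector vanishes on
    the zero columns since its eigenvalue is positive, so the coordinate is one that gets drawn. *)
Lemma top_coord : exists2 j : 'I_d, (j : nat) \in cls & 1 <= d%:R * Q j0 j ^+ 2.
Proof.
case: (pselect (exists j : 'I_d, 1 <= d%:R * Q j0 j ^+ 2)) => [[j hj]|nh].
  exists j => //; apply/negPn/negP => /top_row_supp z; move: hj.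
  by rewrite z expr0n mulr0 ler10.
have h j : Q j0 j ^+ 2 < d%:R^-1.
  rewrite ltNge; apply/negP => hj; apply: nh; exists j.
  by rewrite -[leLHS](mulfV (_ : d%:R != 0 :> R)) ?ler_pM2l ?ltr0n // pnatr_eq0 -lt0n.
have := top_row_unit; rewrite (bigD1 j0) //= => E.
have : 1 < d%:R * d%:R^-1 :> R.
  rewrite -{1}E; apply: lt_le_trans (_ : d%:R^-1 + \sum_(j | j != j0) d%:R^-1 <= _).
    by rewrite ltr_leD ?h // ler_sum // => j _; exact: ltW.
  rewrite (_ : _ + _ = \sum_(j < d) d%:R^-1); last by rewrite [RHS](bigD1 j0).
  by rewrite sumr_const card_ord mulr_natl lexx.
by rewrite mulfV ?ltxx // pnatr_eq0 -lt0n.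
Qed.

Definition ovl (g : nat -> R) : R := (Q *m cv g) j0 0.

Lemma ovlE g : ovl g = \sum_j Q j0 j * cv g j 0.
Proof. by rewrite /ovl mxE. Qed.

Lemma ovl_upd g (j : 'I_d) t : (j : nat) \in cls ->
  ovl (upd g j t) = ovl (upd g j 0) + Q j0 j * t.
Proof.
move=> jc; rewrite !ovlE (bigD1 j) //= [in RHS](bigD1 j) //= !cvE jc /upd eqxx mulr0 add0r addrC.
congr (_ + _); apply: eq_bigr => k kj; rewrite !cvE /upd.
by rewrite val_eqE (negbTE kj).
Qed.

Variable thr : R.

(* Failure probability of the remaining [r] draws, given the current array. *)
Fixpoint FP (r : nat) (g : nat -> R) : R :=
  if r is r'.+1 then (\sum_(t < M) FP r' (upd g (ecol D (N - r)) t%:R)) / M%:R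
  else if `|ovl g| < thr then 1 else 0.

Section Window.
Variable j : 'I_d.
Hypothesis jc : (j : nat) \in cls.
Hypothesis thrE : thr = `|Q j0 j| / 2.

(** Consecutive values of coordinate [j] move the overlap by [|Q j0 j|], the length of the open
    interval of bad overlaps; so at most one of the [M] values is bad. *)
Lemma window g : \sum_(t < M) FP 0 (upd g j t%:R) <= 1.
Proof.
rewrite /=; case: (pickP (fun t : 'I_M => `|ovl (upd g j t%:R)| < thr)) => [t ht|h]; last first.
  by rewrite big1 // => t _; rewrite h.
rewrite (bigD1 t) //= ht big1 ?addr0 // => t' tt'; case: ifP => // ht'.
move: ht ht'; rewrite (ovl_upd g t%:R jc) (ovl_upd g t'%:R jc) thrE; move: (ovl (upd g j 0)) (Q j0 j) => b u h1 h2.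
have hd : `|u * (t'%:R - t%:R)| < `|u|.
  have -> : u * (t'%:R - t%:R) = (b + u * t'%:R) - (b + u * t%:R) by ring.
  by apply: le_lt_trans (ler_normB _ _) _; rewrite [ltRHS]splitr ltrD.
have : 1 <= `|t'%:R - t%:R| :> R.
  have tn : (t' : nat) != t by rewrite val_eqE.
  case: (ltngtP (t' : nat) t) tn => // lt _.
    by rewrite distrC -natrB 1?ltnW // normr_nat ler1n subn_gt0.
  by rewrite -natrB 1?ltnW // normr_nat ler1n subn_gt0.
by move/(ler_wpM2l (normr_ge0 u)); rewrite mulr1 -normrM leNgt hd.
Qed.

(** After the last draw for column [j], the remaining draws change other coordinates only, and
    commute with it; [window] then applies to each of their outcomes. *)
Lemma FP_window r g : (forall q, (N - r <= q < N)%N -> ecol D q != j) ->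
  (r <= N)%N -> \sum_(t < M) FP r (upd g j t%:R) <= 1.
Proof.
elim: r g => [|r IH] g Hr rN; first exact: window.
have cj : ecol D (N - r.+1) != j by apply: Hr; rewrite leqnn ltn_subrL (sg_N good).
rewrite -mulr_suml exchange_big /= ler_pdivrMr // mul1r.
rewrite -[leRHS]mulr1 mulr_natl -[in leRHS](card_ord M) -sumr_const; apply: ler_sum => t _.
under eq_bigr do rewrite upd_comm 1?eq_sym //.
apply: IH; last exact: ltnW.
by move=> q /andP[h1 h2]; apply: Hr; rewrite h2 andbT (leq_trans _ h1) // leq_sub2l.
Qed.

(** Averaging keeps the bound until the last draw for column [j] is reached, where [FP_window] gives
    it. *)
Lemma FP_bound r g : (r <= N)%N ->
  (exists2 q, (N - r <= q < N)%N & ecol D q = j) -> FP r g <= M%:R^-1.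
Proof.
elim: r g => [|r IH] g rN [q /andP[q1 q2] Eq].
  by move: q2; rewrite ltnNge -{1}[N]subn0 q1.
rewrite /= ; case: (pselect (exists2 q, (N - r <= q < N)%N & ecol D q = j)) => [hq|nq].
  rewrite ler_pdivrMr // mulVf ?gt_eqF //.
  apply: le_trans (_ : \sum_(t < M) M%:R^-1 <= _).
    by apply: ler_sum => t _; apply: IH hq; exact: ltnW.
  by rewrite sumr_const card_ord -[leLHS]mulr_natl mulfV ?gt_eqF.
have no q' : (N - r <= q' < N)%N -> ecol D q' != j.
  by move=> h; apply/eqP => E; apply: nq; exists q'.
have qE : q = (N - r.+1)%N.
  apply/eqP; rewrite eqn_leq q1 andbT leqNgt; apply/negP => lt; have := no q.
  by rewrite Eq eqxx q2 andbT -subnSK // lt => /(_ isT).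
rewrite -qE Eq -[leRHS]mul1r ler_wpM2r ?invr_ge0 // FP_window //; exact: ltnW.
Qed.

End Window.

Lemma mean_affine (a b : R) (h : 'I_M -> R) :
  (\sum_t (a + h t + b)) / M%:R = a + (\sum_t h t) / M%:R + b.
Proof.
rewrite !big_split /= !sumr_const !card_ord -[a *+ M]mulr_natl -[b *+ M]mulr_natl.
by rewrite !mulrDl ![M%:R * _]mulrC !mulfK // gt_eqF.
Qed.

Lemma draw_budget (x0 z : R) (r : nat) : x0 + z + kap * (20 * r + 5)%:R <=
  x0 + z + kap * (20 * r + 18)%:R - kap - kap * (2 * 4 + 1)%:R - kap.
Proof.
have -> : (20 * r + 18)%:R = (20 * r + 5)%:R + 13 :> R.
  by rewrite -[13]/(13%:R) -natrD; congr _%:R; lia.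
by have -> : (2 * 4 + 1)%:R = 9 :> R; have := kap0; lra.
Qed.

Lemma draw_budgetS (x0 z x : R) (r : nat) : x0 + z + kap * (20 * r.+1 + 5)%:R <= x ->
  x0 + z + kap * (20 * r + 18)%:R + kap <= x - kap - kap - kap * (2 * 1 + 1)%:R - kap.
Proof.
have -> : (20 * r.+1 + 5)%:R = (20 * r + 18)%:R + 7 :> R.
  by rewrite -[7]/(7%:R) -natrD; congr _%:R; lia.
by have -> : (2 * 1 + 1)%:R = 3 :> R; have := kap0; lra.
Qed.

Lemma drawM nn k s x (r : nat) x0 : stat s -> (r <= N)%N -> 0 <= x0 -> ireg s 10 = (N - r)%N ->
  ireg s 21 = M ->
  (forall q, (q < N - r)%N -> 0 <= rarr s 8 (ecol D q) <= M%:R) ->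
  (forall s', frm WI [:: 40]%N [::] [:: 8]%N s s' -> thr <= `|ovl (rarr s' 8)| ->
     (forall q, (q < N)%N -> 0 <= rarr s' 8 (ecol D q) <= M%:R) -> B nn k s' x0) ->
  x0 + FP r (rarr s 8) + kap * (20 * r + 5)%:R <= x ->
  B nn (While (ILt 10 2) (Seqs [:: Blk [:: ILoad 11 1 10]; Rand 20 21;
     Blk ([:: RofI 40 20; RStore 8 11 40] ++ inc)]) :: k) s x.
Proof.
elim: r s x => [|r IH] s x St rN x00 e10 e21 Hb H Hx.
  have hE : holds (ILt 10 2) s = false by rewrite /= e10 (st_N St) subn0 ltnn.
  apply: bnd_while => //; rewrite hE; cbv iota; move: Hx => /=; case: ltP => ht Hx.
    (* A start with too small an overlap is charged the loss 1 and not followed any further. *)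
    by apply: bnd_triv; have := kap0; lra.
  apply: bnd_le (H s (frm_refl _ _ _ _ _) ht _); first by have := kap0; lra.
  by move=> q qN; apply: Hb; rewrite subn0.
have rp : (N - r.+1 < N)%N by rewrite ltn_subrL (sg_N good).
have hE : holds (ILt 10 2) s = true by rewrite /= e10 (st_N St).
apply: bnd_while => //; rewrite hE; cbv iota.
apply: bnd_seq => //; apply: bnd_blk => //; set s1 := execs _ s.
have f1 : frm WI [:: 40]%N [::] [:: 8]%N s s1 by apply: frm_sub (frm_execs _ _).
have a11 : ireg s1 11 = ecol D (N - r.+1) by rewrite /s1 ivalE /= e10 (st_col St).
have m21 : ireg s1 21 = M by rewrite /s1 ivalE.
have m10 : ireg s1 10 = (N - r.+1)%N by rewrite /s1 ivalE.
have b8 : rarr s1 8 = rarr s 8 by [].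
clearbody s1; apply: bnd_seq => //.
pose f t : R := x0 + FP r (upd (rarr s 8) (ecol D (N - r.+1)) t%:R) + kap * (20 * r + 18)%:R.
apply: (@bnd_rand _ _ _ kap0 nn 20 21 _ s1 _ f); rewrite m21 //.
  move=> t tM; set s2 := set_ireg s1 20 t.
  have f2 : frm WI [:: 40]%N [::] [:: 8]%N s1 s2.
    by split=> b //= Hb'; rewrite /upd; case: eqP => // E; move: Hb'; rewrite E.
  apply: bnd_seq => //; apply: bnd_blk => //; apply: bnd_skip => //; set s3 := execs _ _.
  have f3 : frm WI [:: 40]%N [::] [:: 8]%N s2 s3 by apply: frm_sub (frm_execs _ _).
  have f13 := frm_trans f1 (frm_trans f2 f3).
  have a8 : rarr s3 8 = upd (rarr s 8) (ecol D (N - r.+1)) t%:R.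
    by apply: funext => q; rewrite /s3 ravalE /= /upd /= a11 b8.
  have i10 : ireg s3 10 = (N - r)%N by rewrite /s3 ivalE /= /upd /= m10 addn1 subnSK.
  have i21 : ireg s3 21 = M by rewrite /s3 ivalE /= /upd /= m21.
  have St3 : stat s3 by apply: stat_frm f13 _ _ _ St.
  clearbody s3; apply: (IH s3 _ St3) => //; first exact: ltnW.
  - move=> q; rewrite -subnSK // ltnS leq_eqVlt a8 /upd => /orP[/eqP ->|lt].
      by rewrite eqxx ler0n ler_nat ltnW.
    by case: eqP => _; [rewrite ler0n ler_nat ltnW|exact: Hb].
  - by move=> s4 f4; apply: H; exact: frm_trans f13 f4.
  by rewrite a8 /f [size _]/=; exact: draw_budget.
have -> : (\sum_(t < M) f t) / M%:R = x0 + FP r.+1 (rarr s 8) + kap * (20 * r + 18)%:R.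
  exact: mean_affine.
by move: Hx; rewrite [size _]/=; exact: draw_budgetS.
Qed.

Lemma doublingM nn k s x (j : nat) : rreg s 8 = d%:R -> rreg s 40 = 2 ^+ j -> rreg s 9 = 1 + j%:R ->
  1 + j%:R <= 2 + 2 * ln (d%:R : R) ->
  (forall s' Lg, frm [:: 14]%N [:: 9; 40; 41]%N [::] [::] s s' -> rreg s' 9 = Lg ->
     d%:R <= expR Lg -> 1 <= Lg <= 2 + 2 * ln (d%:R : R) -> B nn k s' (x - kap * (24 + 24 * ln d%:R))) ->
  B nn (While (RLt 40 8) (Blk ([:: RAdd 40 40 40] ++ num 41 1 ++ [:: RAdd 9 9 41])) :: k) s
    (x - 12 * kap * j%:R).
Proof.
have dR : 1 <= d%:R :> R by rewrite ler1n.
have ln20 : 0 < ln (2 : R) by have := @ln2_ge R; lra.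
have jbound (i : nat) : 2 ^+ i < d%:R :> R -> i%:R <= 2 * ln (d%:R : R).
  move=> h; have : ln ((2 : R) ^+ i) <= ln d%:R by rewrite ler_ln ?posrE ?exprn_gt0 ?ltW //; lra.
  rewrite lnXn // -[ln 2 *+ i]mulr_natl => h1; have h2 := ler_wpM2l (ler0n R i) (@ln2_ge R).
  by move: h1 h2; lra.
move=> e8 e40 e9 jl H.
(* Fuel for the induction: [1 + j] stays at most [2 + 2 ln d], so [q] further doublings cannot all
   take place. *)
have [q hq] : exists q : nat, 2 + 2 * ln (d%:R : R) <= (j + q)%:R.
  have [q hq] : exists q : nat, 2 + 2 * ln (d%:R : R) <= q%:R.
    by exists (nceil (2 + 2 * ln (d%:R : R))); exact: nceil_ge.
  by exists q; apply: le_trans hq _; rewrite ler_nat leq_addl.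
suff H' : forall s1, rreg s1 8 = d%:R -> rreg s1 40 = 2 ^+ j -> rreg s1 9 = 1 + j%:R ->
    frm [:: 14]%N [:: 9; 40; 41]%N [::] [::] s s1 ->
    B nn (While (RLt 40 8) (Blk ([:: RAdd 40 40 40] ++ num 41 1 ++ [:: RAdd 9 9 41])) :: k) s1
      (x - 12 * kap * j%:R) by apply: H' => //; exact: frm_refl.
elim: q j jl hq {e8 e40 e9} => [|q IH] j jl hq s1 e8 e40 e9 f1.
  by exfalso; move: jl hq; rewrite addn0; lra.
have hE : holds (RLt 40 8) s1 = ((2 : R) ^+ j < d%:R) by rewrite /= e40 e8.
apply: bnd_while => //; rewrite hE; case: ltP => h; cbv iota; last first.
  apply: bnd_le (H s1 _ f1 e9 _ _).
  - have := ler_wpM2l kap0 jl; have := kap0; lra.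
  - apply: le_trans h _; elim: (j) => [|i IHi]; first by rewrite expr0 addr0; have := expR_ge1Dx (1 : R); lra.
    rewrite exprS -[i.+1%:R]natr1 addrA expRD mulrC; apply: ler_pM => //.
    by have := expR_ge1Dx (1 : R); lra.
  by rewrite jl andbT lerDl.
apply: bnd_blk => //; set s2 := execs _ s1.
have f2 : frm [:: 14]%N [:: 9; 40; 41]%N [::] [::] s1 s2 by apply: frm_sub (frm_execs _ _).
have g8 : rreg s2 8 = d%:R by rewrite (frm_r f2).
have g40 : rreg s2 40 = 2 ^+ j.+1 by rewrite /s2 rvalE /= e40 exprS; ring.
have g9 : rreg s2 9 = 1 + j.+1%:R by rewrite /s2 rvalE /= e9 -natr1; ring.
have jl' : 1 + j.+1%:R <= 2 + 2 * ln (d%:R : R) by have := jbound j h; rewrite -natr1; lra.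
apply: bnd_le (IH j.+1 jl' _ s2 g8 g40 g9 (frm_trans f1 f2)); last by rewrite addSnnS.
rewrite [size _]/= -natr1.
have -> : (2 * 4 + 1)%:R = 9 :> R by [].
by have := kap0; lra.
Qed.

End Start.

Section StartM.
Variables (R : realType) (P : store R -> Prop) (kap : R).
Hypothesis kap0 : 0 <= kap.
Variables (n d : nat) (A : 'M[R]_(n, d)) (D : sdata R).
Hypothesis good : sgood A D.
Variables (Q : 'M[R]_d) (lam : 'I_d -> R) (j0 : 'I_d).
Hypothesis QQ : Q *m Q^T = 1%:M.
Hypothesis Qg : Q *m gram A = diag_mx (\row_j lam j) *m Q.
Hypothesis L10 : 0 < lam j0.
Hypothesis d0 : (0 < d)%N.
Variable M : nat.
Hypothesis M0 : (0 < M)%N.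
Local Notation N := (nnz A).
Local Notation B := (@bnd R P kap).
Local Notation stat := (stat A D).
Local Notation cv := (@cv R d D).
Local Notation cls := (cls D).
Local Notation uu := (uu kap A).

(** The drawn vector has norm at most [sqrt d * M], and [1 <= sqrt d * |u|]; so the norm is at most
    [d M |u|], against an overlap of at least [|u| / 2]. *)
Lemma start_overlap (g : nat -> R) (u : R) : 1 <= d%:R * u ^+ 2 ->
  (forall q, (q < N)%N -> 0 <= g (ecol D q) <= M%:R) ->
  `|u| / 2 <= `|(Q *m cv g) j0 0| -> 0 < norm2 (cv g) /\
  (2 * d%:R * M%:R)^-1 <= `|(Q *m ((norm2 (cv g))^-1 *: cv g)) j0 0|.
Proof.
move=> hu hg ht; have dR : 0 < d%:R :> R by rewrite ltr0n.
have MR : 0 < M%:R :> R by rewrite ltr0n.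
have u0 : 0 < `|u|.
  by rewrite normr_gt0; apply/eqP => E; move: hu; rewrite E expr0n mulr0 ler10.
have c0 : 0 < `|(Q *m cv g) j0 0| by apply: lt_le_trans ht; rewrite divr_gt0.
have n0 : 0 < norm2 (cv g).
  apply: lt_le_trans c0 _; apply: le_trans (norm2_coord _ _) _; by rewrite (norm2_Q QQ).
split=> //; rewrite -scalemxAr mxE normrM gtr0_norm ?invr_gt0 //.
have nb : norm2 (cv g) <= d%:R * M%:R * `|u|.
  apply: norm2_le; first by rewrite !mulr_ge0 // ltW.
  rewrite (_ : (d%:R * M%:R * `|u|) ^+ 2 = d%:R * M%:R ^+ 2 * (d%:R * `|u| ^+ 2)); last by ring.
  rewrite real_normK ?num_real //; apply: le_trans (_ : d%:R * M%:R ^+ 2 <= _); last first.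
    by rewrite ler_peMr // mulr_ge0 // exprn_ge0.
  rewrite /dot -[d in d%:R]card_ord mulr_natl -sumr_const; apply: ler_sum => j _.
  rewrite cvE; case: ifP => [jc|_]; last by rewrite mulr0 exprn_ge0.
  case/mem_cls: jc => q hq Eq; have [p pN E] := sg_clcol good hq.
  by rewrite Eq E; have /andP[h1 h2] := hg p pN; rewrite expr2 ler_pM.
rewrite [leRHS]mulrC ler_pdivlMr // mulrC ler_pdivrMr ?mulr_gt0 //.
apply: le_trans nb _; apply: le_trans (_ : `|u| / 2 * (2 * d%:R * M%:R) <= _).
  by rewrite [leRHS](_ : _ = d%:R * M%:R * `|u|) //; field.
by rewrite ler_wpM2r // !mulr_ge0 // ltW.
Qed.

Lemma start_budget (p q : nat) (x x0 z m l : R) : (p <= 20)%N -> (q <= 40)%N -> z <= m ->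
  0 <= kap -> kap <= uu -> 0 <= l ->
  x0 + m + (3 * 100 + 24 * l) * uu <= x ->
  x0 + (160 + 24 * l) * uu + z + kap * (20 * N + 5)%:R <= x - uu - p%:R * uu - uu.
Proof.
move=> p1 q1 zm k0 ku l0 Hx.
have u0 : 0 <= uu by lra.
have : p%:R * uu <= 20 * uu by rewrite ler_wpM2r // ler_nat.
have -> : kap * (20 * N + 5)%:R = 20 * uu + 5 * kap by rewrite natrD natrM !uuE; ring.
by lra.
Qed.

Lemma start_budget2 (q : nat) (x0 l : R) : (q <= 30)%N -> 0 <= kap -> kap <= uu -> 0 <= l ->
  x0 <= x0 + (160 + 24 * l) * uu - uu - 60 * uu - uu - q%:R * uu - uu - kap * (24 + 24 * l) - uu.
Proof.
move=> q1 k0 ku l0; have u0 : 0 <= uu by lra.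
have : q%:R * uu <= 30 * uu by rewrite ler_wpM2r // ler_nat.
have : kap * (24 + 24 * l) <= uu * (24 + 24 * l) by rewrite ler_wpM2r //; lra.
by lra.
Qed.

Lemma startM nn k s x x0 : stat s -> (forall j, rarr s 1 j = 0) -> 0 <= x0 ->
  (forall s' v Lg, stat s' -> v = cv (rarr s' 1) -> (forall j, j \notin cls -> rarr s' 1 j = 0) ->
     rreg s' 7 = frob2 A -> rreg s' 8 = d%:R -> rreg s' 9 = Lg -> dot v v = 1 ->
     (2 * d%:R * M%:R)^-1 <= `|(Q *m v) j0 0| ->
     d%:R <= expR Lg -> 1 <= Lg <= 2 + 2 * ln (d%:R : R) -> B nn k s' x0) ->
  x0 + M%:R^-1 + (3 * 100 + 24 * ln d%:R) * uu <= x ->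
  B nn (Start M :: k) s x.
Proof.
move=> St out x00 H Hx; have u0 := uu_ge0 kap0 good; have ku := kap_uu kap0 good.
have [j jc hj] := top_coord good QQ Qg L10 d0.
have [q0 q0N Eq0] : exists2 q, (q < N)%N & ecol D q = j.
  by case/mem_cls: jc => q hq ->; have [p pN ->] := sg_clcol good hq; exists p.
have l0 : 0 <= ln (d%:R : R) by apply: ln_ge0; rewrite ler1n.
apply: (seqsM kap0 good); apply: (blkM kap0 good); set s1 := execs _ s.
have f1 : frm WI [::] [::] [::] s s1 by apply: frm_sub (frm_execs _ _).
have St1 : stat s1 by apply: stat_frm f1 _ _ _ St.
apply: (seqsM kap0 good).
have i10 : ireg s1 10 = (N - N)%N by rewrite subnn.
have i21 : ireg s1 21 = M by [].
have o1' i : rarr s1 1 i = 0 by rewrite (frm_ra f1).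
clearbody s1.
have q0N' : (N - N <= q0 < N)%N by rewrite subnn.
have fpb := @FP_bound _ _ _ _ _ good Q j0 M M0 (`|Q j0 j| / 2) j jc erefl N (rarr s1 8) (leqnn N)
   (ex_intro2 _ _ q0 q0N' Eq0).
apply: (@drawM _ _ _ kap0 _ _ _ _ good Q lam j0 L10 d0 M M0 (`|Q j0 j| / 2) nn _ s1 _ N
  (x0 + (160 + 24 * ln d%:R) * uu) St1 (leqnn _) _ i10 i21) => //.
- exact: addr_ge0 x00 (mulr_ge0 (addr_ge0 (ler0n R 160) (mulr_ge0 (ler0n R 24) l0)) u0).
- by move=> q; rewrite subnn.
- move=> s2 f2 ht hb.
  have St2 : stat s2 by apply: stat_frm f2 _ _ _ St1.
  have [n0 ov] := start_overlap hj hb ht.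
  apply: (seqsM kap0 good); apply: (normalizeM kap0 good St2 erefl) => s3 f3 E3 O3.
  have St3 : stat s3 by apply: stat_frm f3 _ _ _ St2.
  apply: (seqsM kap0 good); apply: (blkM kap0 good); set s4 := execs _ s3.
  apply: (seqsM kap0 good).
  have f4 : frm WI [:: 7; 8; 9; 40]%N [::] [::] s3 s4 by apply: frm_sub (frm_execs _ _).
  have St4 : stat s4 by apply: stat_frm f4 _ _ _ St3.
  have g7 : rreg s4 7 = frob2 A by rewrite /s4 rvalE /= subrr add0r (st_F St3).
  have g8 : rreg s4 8 = d%:R by rewrite /s4 rvalE /= (st_d St3).
  have g9 : rreg s4 9 = 1 + 0%:R by rewrite /s4 rvalE /= addr0.
  have g40 : rreg s4 40 = 2 ^+ 0 by rewrite /s4 rvalE.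
  clearbody s4.
  have lb : 1 + 0%:R <= 2 + 2 * ln (d%:R : R) by rewrite addr0; move: l0; lra.
  rewrite -[X in B _ _ _ X]subr0 -[0 in X in B _ _ _ X](mulr0 (12 * kap)).
  first [apply: (doublingM kap0 d0 g8 g40 g9 lb)|apply: (doublingM kap0 L10 d0 g8 g40 g9 lb)|apply: (doublingM kap0 L10 d0 M0 g8 g40 g9 lb)|apply: (doublingM kap0 d0 M0 g8 g40 g9 lb) |apply: (doublingM kap0 QQ L10 d0 M0 g8 g40 g9 lb)]=> s5 Lg f5 e9 hd hL.
  have St5 : stat s5 by apply: stat_frm f5 _ _ _ St4.
  have a1 : rarr s5 1 = rarr s3 1 by rewrite (frm_ra f5) // (frm_ra f4).
  apply: (seqs0 kap0 good).
  apply: bnd_le (H s5 _ Lg St5 erefl _ _ _ e9 _ _ hd hL).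
  + exact: start_budget2.
  + by move=> i ic; rewrite a1 O3 // (frm_ra f2).
  + by rewrite (frm_r f5).
  + by rewrite (frm_r f5).
  + by rewrite a1 E3 !dotE -norm2_sq; field; rewrite gt_eqF.
  by rewrite a1 E3.
exact: (start_budget (q := 0) _ _ fpb kap0 ku l0 Hx).
Qed.

End StartM.

(** * Total running time *)

Section SpectralNorm.
Variables (R : realType) (n d : nat) (A : 'M[R]_(n, d)).
Variables (Q : 'M[R]_d) (lam : 'I_d -> R) (j0 : 'I_d).
Hypothesis QQ : Q *m Q^T = 1%:M.
Hypothesis Qg : Q *m gram A = diag_mx (\row_j lam j) *m Q.
Hypothesis lam_le : forall j, lam j <= lam j0.

Lemma norm2_mulmx (x : 'cV[R]_d) : norm2 (A *m x) = Num.sqrt (dot x (gram A *m x)).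
Proof. by rewrite norm2E -!dot_mx trmx_mul /gram !mulmxA. Qed.

Lemma spectral_norm_sq : spectral_norm A ^+ 2 = lam j0.
Proof.
have l0 : 0 <= lam j0 by exact: lam_ge0 QQ Qg j0.
pose v : 'cV[R]_d := Q^T *m delta_mx j0 0.
have Qv : Q *m v = delta_mx j0 0 by rewrite mulmxA QQ mul1mx.
have dd (f : 'I_d -> R) : \sum_j f j * ((delta_mx j0 0 : 'cV[R]_d) j 0 * (delta_mx j0 0 : 'cV[R]_d) j 0) = f j0.
  rewrite (bigD1 j0) //= big1 ?addr0; last first.
    by move=> j jj; rewrite mxE (negbTE jj) mul0r mulr0.
  by rewrite mxE !eqxx !mulr1.
have vv : norm2 v = 1.
  rewrite -(norm2_Q QQ) Qv norm2E /dot.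
  by under eq_bigr do rewrite -[_ * _]mul1r; rewrite dd sqrtr1.
have vg : dot v (gram A *m v) = lam j0.
  rewrite (dot_gramQ QQ Qg) Qv /rayl /dot -[RHS](dd lam); apply: eq_bigr => j _.
  by rewrite mulrA /dmul mxE.
suff -> : spectral_norm A = Num.sqrt (lam j0) by rewrite sqr_sqrtr.
have ub : ubound [set norm2 (A *m x) | x in [set x : 'cV[R]_d | norm2 x = 1]]%classic
    (Num.sqrt (lam j0)).
  move=> _ [x /= x1 <-]; rewrite norm2_mulmx ler_wsqrtr //.
  by rewrite (le_trans (gram_le QQ Qg lam_le x)) // -norm2_sq x1 expr1n mulr1.
have mem : [set norm2 (A *m x) | x in [set x : 'cV[R]_d | norm2 x = 1]]%classic
    (Num.sqrt (lam j0)) by exists v => //; rewrite norm2_mulmx vg.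
apply/eqP; rewrite eq_le; apply/andP; split.
  by apply: ge_sup ub; exists (Num.sqrt (lam j0)).
by apply: sup_upper_bound => //; split; exists (Num.sqrt (lam j0)).
Qed.

Lemma frobenius_norm_sq : frobenius_norm A ^+ 2 = frob2 A.
Proof.
rewrite sqr_sqrtr; last by apply: sumr_ge0 => i _; apply: sumr_ge0 => j _; exact: sqr_ge0.
by apply: eq_bigr => i _; apply: eq_bigr => j _; rewrite !mxE expr2.
Qed.

Lemma stable_rankE : stable_rank A = frob2 A / lam j0.
Proof. by rewrite /stable_rank spectral_norm_sq frobenius_norm_sq. Qed.

End SpectralNorm.

(** * The sum in the time bound and the size of the shift *)

Section Weight.
Variables (R : realType) (n d : nat) (A : 'M[R]_(n, d)) (l1 : R).
Hypothesis rows : forall i : 'I_n, row i A != 0.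
Hypothesis l10 : 0 < l1.
Hypothesis srE : stable_rank A = frob2 A / l1.

Definition weight : R := \sum_(i < n) norm2 (mxrow_vec A i) ^+ 2 / l1 *
  ((Num.sqrt (numerical_sparsity (mxrow_vec A i)) + Num.sqrt (stable_rank A)) *
   Num.sqrt (numerical_sparsity (mxrow_vec A i))).

Lemma weight_ge0 : 0 <= weight.
Proof.
apply: sumr_ge0 => i _; apply: mulr_ge0; first by rewrite divr_ge0 ?sqr_ge0 ?(ltW l10).
by rewrite mulr_ge0 ?addr_ge0 ?sqrtr_ge0.
Qed.

Lemma weightE D ppi qq : ssamp A D ppi qq ->
  sW D + Num.sqrt (frob2 A / l1) * sX D = l1 * weight.
Proof.
move=> samp; rewrite (sa_W samp) (sa_X samp) /weight !mulr_sumr -big_split.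
apply: eq_bigr => i _; rewrite srE /=.
set q := Num.sqrt (frob2 A / l1).
have n0 : 0 < norm2 (mxrow_vec A i) by rewrite norm2E sqrtr_gt0 row_dot_gt0.
have -> : Num.sqrt (numerical_sparsity (mxrow_vec A i)) =
    norm1 (mxrow_vec A i) / norm2 (mxrow_vec A i).
  by rewrite /numerical_sparsity -expr_div_n sqrtr_sqr ger0_norm // divr_ge0 ?norm1_ge0 ?ltW.
by field; rewrite !gt_eqF.
Qed.

End Weight.

Lemma ratio_bound (R : realType) (l1 G Delta : R) : 0 < Delta -> Delta <= l1 -> Delta / 8 <= G ->
  (l1 + G) * l1 / G ^+ 2 <= 81 * (l1 / Delta) ^+ 2.
Proof.
move=> D0 Dl DG; have G0 : 0 < G by lra.
have -> : (l1 + G) * l1 / G ^+ 2 = l1 / G * (l1 / G) + l1 / G by field; rewrite gt_eqF.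
have h : l1 / G <= 8 * (l1 / Delta).
  rewrite (_ : 8 * (l1 / Delta) = l1 / (Delta / 8)); last by field; rewrite gt_eqF.
  by rewrite ler_wpM2l ?lef_pV2 ?posrE //; lra.
have h1 : 1 <= l1 / Delta by rewrite ler_pdivlMr // mul1r.
have h0 : 0 <= l1 / G by rewrite divr_ge0 //; lra.
move: h h1 h0; set a := l1 / G; set b := l1 / Delta => h h1 h0; nra.
Qed.

Lemma sqrt_1D (R : realType) (h : R) : 0 <= h -> Num.sqrt (1 + h) <= 1 + Num.sqrt h.
Proof.
move=> h0; have q0 := sqrtr_ge0 h.
rewrite -[leRHS]ger0_norm -?sqrtr_sqr ?addr_ge0 // ler_wsqrtr //.
by rewrite sqrrD sqr_sqrtr // expr1n mul1r; lra.
Qed.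

Section Shift.
Variables (R : realType) (n d : nat) (A : 'M[R]_(n, d)) (l1 : R).
Hypothesis rows : forall i : 'I_n, row i A != 0.
Hypothesis l10 : 0 < l1.
Hypothesis srE : stable_rank A = frob2 A / l1.
Hypothesis N0 : (0 < nnz A)%N.
Variable Delta : R.
Hypothesis Delta0 : 0 < Delta.
Hypothesis DL : Delta <= l1.
Local Notation NR := ((nnz A)%:R : R).

(** A bound for [sqrt (mu / G)] in the terms of the theorem, from
    [mu / G <= 1 + 9 sqrt (weight / N) / gap]. *)
Definition speed : R := 1 + 3 * Num.sqrt (Num.sqrt (weight A l1 / NR) / (Delta / l1)).

Lemma speed_ge1 : 1 <= speed.
Proof. by rewrite lerDl mulr_ge0. Qed.

Lemma shift_speed D ppi qq rho G : ssamp A D ppi qq -> l1 <= rho + G -> rho <= l1 ->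
  Delta / 8 <= G -> Num.sqrt (mu_of A D rho G / G) <= speed.
Proof.
move=> samp h1 h2 DG; have G0 : 0 < G by apply: lt_le_trans DG; rewrite divr_gt0.
have Gw := ltW G0.
have NR0 : 0 < NR by rewrite ltr0n.
have NRw := ltW NR0; have l1w := ltW l10; have Dw := ltW Delta0.
have S0 := weight_ge0 A l10; set S := weight A l1 in S0 *.
have X0 : 0 <= sX D.
  by rewrite (sa_X samp); apply: sumr_ge0 => i _; rewrite mulr_ge0 ?norm1_ge0 ?norm2_ge0.
have F0 : 0 <= frob2 A by apply: sumr_ge0 => i _; exact: dot_ge0.
have W0 : wsum A D (rho + G) <= l1 * S.
  rewrite -(weightE rows l10 srE samp) /wsum lerD2l ler_wpM2r // /sF ler_wsqrtr //.
  by rewrite ler_wpM2l // lef_pV2 ?posrE //; apply: lt_le_trans h1.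
rewrite /mu_of mulrDl divff ?gt_eqF //.
set H := Num.sqrt (_ * _ / _); have H0 : 0 <= H by exact: sqrtr_ge0.
apply: le_trans (sqrt_1D _) _; first by rewrite divr_ge0.
rewrite lerD2l /speed -/S.
have -> : 3 = Num.sqrt (3 ^+ 2) :> R by rewrite sqrtr_sqr ger0_norm.
rewrite -sqrtrM ?sqr_ge0 // ler_wsqrtr //.
have -> : H / G = Num.sqrt ((rho + G) * wsum A D (rho + G) / NR / G ^+ 2).
  by rewrite [in RHS]mulrC sqrtrM ?invr_ge0 ?sqr_ge0 // sqrtrV ?sqr_ge0 // sqrtr_sqr ger0_norm // mulrC.
have -> : 3 ^+ 2 * (Num.sqrt (S / NR) / (Delta / l1)) =
    Num.sqrt (S / NR * (9 * (l1 / Delta)) ^+ 2).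
  rewrite [in RHS]sqrtrM ?divr_ge0 // sqrtr_sqr ger0_norm; last first.
    by rewrite mulr_ge0 // divr_ge0.
  by field; rewrite !gt_eqF.
rewrite ler_wsqrtr //.
apply: le_trans (_ : S / NR * ((l1 + G) * l1 / G ^+ 2) <= _); last first.
  rewrite ler_wpM2l ?divr_ge0 // exprMn.
  have -> : (9 : R) ^+ 2 = 81 by rewrite expr2 -natrM.
  exact: ratio_bound.
rewrite [leRHS](_ : _ = (l1 + G) * (l1 * S) / NR / G ^+ 2); last by field; rewrite !gt_eqF.
rewrite ler_wpM2r ?invr_ge0 ?sqr_ge0 // ler_wpM2r ?invr_ge0 //.
apply: le_trans (_ : (rho + G) * (l1 * S) <= _).
  by rewrite ler_wpM2l //; lra.
by rewrite ler_wpM2r ?mulr_ge0 //; lra.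
Qed.

Lemma sqrt_sqrt_powR (x : R) : 0 <= x -> Num.sqrt (Num.sqrt x) = x `^ (1 / 4).
Proof.
move=> x0; rewrite -!powR12_sqrt ?powR_ge0 // -powRrM; congr (_ `^ _).
by field.
Qed.

(** [N (S / N)^(1/4) = N^(3/4) S^(1/4)]: the origin of the exponents in the theorem. *)
Lemma nnz_speed : NR * speed <=
  3 * (NR + NR `^ (3 / 4) / Num.sqrt (Delta / l1) * weight A l1 `^ (1 / 4)).
Proof.
have NR0 : 0 < NR by rewrite ltr0n.
have NRw := ltW NR0; have l1w := ltW l10; have Dw := ltW Delta0.
have S0 := weight_ge0 A l10; set S := weight A l1 in S0 *.
rewrite /speed -/S sqrtrM ?sqrtr_ge0 // sqrtrV ?divr_ge0 // sqrt_sqrt_powR ?divr_ge0 //.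
have -> : (S / NR) `^ (1 / 4) = S `^ (1 / 4) * NR `^ (3 / 4) / NR.
  rewrite powRM ?invr_ge0 // -mulrA; congr (_ * _).
  apply: (mulIf (lt0r_neq0 NR0)); rewrite mulfVK ?lt0r_neq0 //.
  rewrite -[X in _ * X]powRr1 // -{1}powR_inv1 // -powRrM -powRD; last first.
    by apply/implyP => _; rewrite lt0r_neq0.
  by congr (_ `^ _); field.
set g := (Num.sqrt _)^-1; set X := S `^ _; set Y := NR `^ _.
have -> : NR * (1 + 3 * (X * Y / NR * g)) = NR + 3 * (Y * g * X) by field; rewrite gt_eqF.
by lra.
Qed.

End Shift.

(** * From the loss to the stated time bound *)

Section Budget.
Variables (R : realType) (n d : nat) (A : 'M[R]_(n, d)).
Variables (lam : 'I_d -> R) (j0 : 'I_d) (c0 : nat) (Delta eps kap sm : R).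
Local Notation l1 := (lam j0).
Local Notation F := (frob2 A).
Local Notation z := (d%:R / (Delta / l1)).
Local Notation L := (ln z).
Local Notation E := (ln eps^-1).
Local Notation uu := (kap * (nnz A)%:R).
Hypothesis l10 : 0 < l1.
Hypothesis Delta0 : 0 < Delta.
Hypothesis DL : Delta <= l1.
Hypothesis d2 : (1 < d)%N.
Hypothesis c01 : (0 < c0)%N.
Hypothesis eps01 : 0 < eps < 1.
Hypothesis F0 : 0 < F.
Hypothesis Fd : F <= d%:R * l1.
Hypothesis kap0 : 0 <= kap.
Hypothesis sm1 : 1 <= sm.

Let dR : 2 <= d%:R :> R. Proof. by rewrite (ler_nat _ 2). Qed.

Lemma cond_ge_d : d%:R <= z.
Proof.
rewrite ler_pdivlMr ?divr_gt0 // -[leRHS]mulr1 ler_wpM2l ?ler0n //.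
by rewrite ler_pdivrMr // mul1r.
Qed.

Lemma cond_ge2 : 2 <= z. Proof. exact: le_trans dR cond_ge_d. Qed.

Lemma FDelta_le : F / Delta <= z.
Proof.
rewrite ler_pdivrMr //.
by have -> : z * Delta = d%:R * l1 by field; rewrite !gt_eqF.
Qed.

Lemma cond5_ge (y : R) : 0 <= y -> y <= z -> 16 * y <= z ^+ 5.
Proof.
move=> y0 yz; have z2 := cond_ge2; rewrite (_ : 16 = 2 ^+ 4); last by rewrite -natrX.
by rewrite (exprSr z 4) ler_pM // ?exprn_ge0 // lerXn2r ?nnegrE //; lra.
Qed.

Lemma Pm_bound : 8 * d%:R * F / Delta <= z ^+ 5.
Proof.
have z2 := cond_ge2; have h := FDelta_le; have h' := cond_ge_d.
have h0 : 0 <= F / Delta by rewrite divr_ge0 ?ltW.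
rewrite -mulrA; apply: le_trans (_ : 8 * z * z <= _).
  by rewrite ler_pM // ?mulr_ge0 // ler_wpM2l.
rewrite (_ : 8 = 2 ^+ 3); last by rewrite -natrX.
by rewrite (exprSr z 4) (exprSr z 3) !ler_wpM2r ?lerXn2r ?nnegrE //; lra.
Qed.

Lemma L_ge : 1 / 2 <= L. Proof. by apply: lnP_ge; exact: cond_ge2. Qed.

Lemma E_ge0 : 0 <= E.
Proof. by case/andP: eps01 => e0 e1; rewrite ln_ge0 // invf_ge1 // ltW. Qed.

Lemma ln_log_term : ln (16 * F / Delta) <= 5 * L.
Proof.
have z2 := cond_ge2; have z0 : 0 < z by lra.
have h0 : 0 < F / Delta by rewrite divr_gt0.
have <- : ln (z ^+ 5) = 5 * L by rewrite lnXn // -[L *+ 5]mulr_natl.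
rewrite -mulrA ler_ln ?posrE; [|by rewrite mulr_gt0|by rewrite exprn_gt0].
by apply: cond5_ge FDelta_le; exact: ltW.
Qed.

(** The dependence of the loss on [eps] is confined to this logarithm, which [pot] multiplies by one
    further logarithm only. *)
Lemma ln_res_term : ln (1 + F / rmin lam j0 c0 eps (z ^+ 5)) <= 3 * ln c0%:R + 22 * L + E.
Proof.
have z2 := cond_ge2; have z0 : 0 < z by lra.
case/andP: eps01 => e0 e1.
have cR : 1 <= c0%:R :> R by rewrite ler1n.
have c0' : 0 < c0%:R :> R by lra.
have -> : 3 * ln c0%:R + 22 * L + E = ln (c0%:R ^+ 3 * z ^+ 22 / eps).
  have lnE (a b e : R) : 0 < a -> 0 < b -> 0 < e ->
      3 * ln a + 22 * ln b + ln e^-1 = ln (a ^+ 3 * b ^+ 22 / e).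
    move=> a0 b0 ep; rewrite lnM ?posrE ?invr_gt0 ?mulr_gt0 ?exprn_gt0 //.
    by rewrite lnM ?posrE ?exprn_gt0 // !lnXn // -[ln a *+ _]mulr_natl -[ln b *+ _]mulr_natl.
  exact: lnE.
pose y := c0%:R ^+ 3 * z ^+ 21 / eps.
have y1 : 1 <= y.
  rewrite /y ler_pdivlMr // mul1r; apply: le_trans (ltW e1) _.
  by rewrite mulr_ege1 // exprn_ege1 //; lra.
have yE : c0%:R ^+ 3 * z ^+ 22 / eps = y * z by rewrite /y (exprSr z 21); ring.
have rE : F / rmin lam j0 c0 eps (z ^+ 5) <= y.
  have -> : F / rmin lam j0 c0 eps (z ^+ 5) = F / l1 * (c0%:R ^+ 3 * z ^+ 20 / eps).
    rewrite /rmin -exprM; move: (z ^+ _) (c0%:R ^+ 3) (exprn_gt0 (5 * 4) z0) (exprn_gt0 3 c0').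
    by move=> a b a0 b0; field; rewrite !gt_eqF.
  have -> : y = z * (c0%:R ^+ 3 * z ^+ 20 / eps) by rewrite /y (exprSr z 20); ring.
  apply: ler_wpM2r.
    exact: divr_ge0 (mulr_ge0 (exprn_ge0 3 (ltW c0')) (exprn_ge0 20 (ltW z0))) (ltW e0).
  by rewrite ler_pdivrMr // (le_trans Fd) //; exact: ler_wpM2r (ltW l10) _ _ cond_ge_d.
have q0 : 0 <= F / rmin lam j0 c0 eps (z ^+ 5).
  apply: divr_ge0 (ltW F0) (divr_ge0 (mulr_ge0 (ltW e0) (ltW l10)) (mulr_ge0 _ _)).
    exact: exprn_ge0 (ltW c0').
  exact: exprn_ge0 (exprn_ge0 5 (ltW z0)).
rewrite ler_ln ?posrE; [|lra|by rewrite yE mulr_gt0 //; lra].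
by rewrite yE; move: rE y1 z2; set r := F / _; nra.
Qed.

Definition potC : R := 12 * ln c0%:R + 44 + 25 * upC R c0 + 1.
Definition totC : R := 10 * blkC R c0 * potC + 100 * 100.

Let lc0 : 0 <= ln (c0%:R : R). Proof. by rewrite ln_ge0 // ler1n. Qed.

Let up0 : 0 <= upC R c0.
Proof.
have : 0 <= ln (4 * c0%:R : R).
  have h : 1 <= c0%:R :> R by rewrite ler1n.
  by rewrite ln_ge0 //; lra.
by rewrite /upC; lra.
Qed.

Lemma potC_ge1 : 1 <= potC.
Proof. by rewrite /potC; move: lc0 up0; lra. Qed.

Lemma totC_gt0 : 0 < totC.
Proof.
rewrite /totC ltr_wpDl // ?mulr_gt0 // !mulr_ge0 ?blkC_ge0 //.
exact: le_trans potC_ge1.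
Qed.

Lemma log_budget (l e a u t : R) : 1 / 2 <= l -> 0 <= e -> 0 <= a -> 0 <= u ->
  t <= 3 * a + 22 * l + e ->
  t + u * (5 * l) * (5 * l) <= (12 * a + 44 + 25 * u + 1) * (l ^+ 2 + e).
Proof.
move=> l12 e0 a0 u0 ht.
have l2 : l <= 2 * l ^+ 2 by rewrite expr2; nra.
have l1' : 1 <= 4 * l ^+ 2 by rewrite expr2; nra.
have h1 : a <= 4 * a * l ^+ 2 by nra.
have h2 : 0 <= (12 * a + 44 + 25 * u) * e by rewrite mulr_ge0 //; lra.
have h3 : 0 <= l ^+ 2 by exact: sqr_ge0.
have -> : u * (5 * l) * (5 * l) = 25 * u * l ^+ 2 by ring.
have -> : (12 * a + 44 + 25 * u + 1) * (l ^+ 2 + e) =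
  3 * (4 * a * l ^+ 2) + 22 * (2 * l ^+ 2) + 25 * u * l ^+ 2 + l ^+ 2 +
  (12 * a + 44 + 25 * u) * e + e by ring.
by lra.
Qed.

Lemma pot_bound : pot kap A lam j0 c0 Delta eps sm (z ^+ 5) F F <=
  10 * blkC R c0 * potC * (uu * sm * (L * (L ^+ 2 + E))).
Proof.
have L2 := L_ge; have e0 := E_ge0; have t1 := ln_log_term.
have L0 : 0 <= L by lra.
have u0 : 0 <= uu by rewrite mulr_ge0.
have z0 : 0 < z by apply: lt_le_trans cond_ge2.
rewrite /pot /Kblk !uuE /Lm lnXn // -[L *+ 5]mulr_natl.
have -> : 10 * blkC R c0 * potC * (uu * sm * (L * (L ^+ 2 + E))) =
  2 * blkC R c0 * sm * (5 * L) * uu * (potC * (L ^+ 2 + E)) by ring.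
apply: ler_wpM2l.
  by rewrite !mulr_ge0 ?blkC_ge0 //; exact: le_trans sm1.
apply: le_trans (log_budget L2 e0 lc0 up0 ln_res_term).
by rewrite lerD2l ler_wpM2l // mulr_ge0 // mulr_ge0.
Qed.

Lemma budget_sum (p b X u l : R) : 0 <= u -> p <= b * X -> u <= 8 * X -> l * u <= 4 * X ->
  p + (12 * 100 + 10) * u + 24 * l * u <= (b + 100 * 100) * X.
Proof.
move=> h0 h1 h2 h3; have X0 : 0 <= X by lra.
have -> : 24 * l * u = 24 * (l * u) by ring.
by rewrite mulrDl; lra.
Qed.

Lemma total_budget : pot kap A lam j0 c0 Delta eps sm (z ^+ 5) F F +
    (12 * 100 + 10) * uu + 24 * ln d%:R * uu <= totC * (uu * sm * (L * (L ^+ 2 + E))).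
Proof.
have L2 := L_ge; have e0 := E_ge0; have pb := pot_bound.
have u0 : 0 <= uu by rewrite mulr_ge0.
have ld : ln d%:R <= L.
  have d2' := dR; have z2 := cond_ge2.
  by rewrite ler_ln ?posrE ?cond_ge_d //; lra.
have h1 : 1 <= 8 * (L * (L ^+ 2 + E)).
  by move: L2 e0; move: L E => l e h1 h2; rewrite expr2; nra.
have h2 : L <= 4 * (L * (L ^+ 2 + E)).
  by move: L2 e0; move: L E => l e h1' h2; rewrite expr2; nra.
move: h1 h2; set T := L * _ => h1 h2.
have us : uu <= uu * sm by rewrite ler_peMr.
have sm0 : 0 <= sm by exact: le_trans sm1.
have T0 : 0 <= T by lra.
have c1 : uu <= 8 * (uu * sm * T).
  apply: le_trans us _; rewrite -[leLHS]mulr1 [leRHS](_ : _ = uu * sm * (8 * T)); last by ring.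
  by rewrite ler_wpM2l // mulr_ge0.
have c2 : ln d%:R * uu <= 4 * (uu * sm * T).
  apply: le_trans (_ : 4 * T * (uu * sm) <= _); last by rewrite le_eqVlt; apply/orP; left; apply/eqP; ring.
  by rewrite ler_pM // ?(le_trans ld) // ln_ge0 //; have := dR; lra.
exact: budget_sum u0 pb c1 c2.
Qed.

End Budget.

Lemma bnd_skip_nil (R : realType) (P : store R -> Prop) (kap : R) nn s x :
  P s -> 0 <= x -> bnd P kap nn [:: Skip] s x.
Proof.
move=> Ps x0; split=> // -[|t] tn kt /=; first by rewrite mulr0; lra.
have -> : halt_prob P t [::] s = 1 by case: t {tn kt} => [|t] /=; rewrite asboolT.
by lra.
Qed.

(** * Assembly of the program *)

Section TopProgram.
Variables (R : realType) (n d : nat) (A : 'M[R]_(n, d)) (eps : R).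
Hypothesis rows : forall i : 'I_n, row i A != 0.
Hypothesis N0 : (0 < nnz A)%N.
Variables (Q : 'M[R]_d) (lam : 'I_d -> R) (j0 : 'I_d).
Hypothesis QQ : Q *m Q^T = 1%:M.
Hypothesis Qg : Q *m gram A = diag_mx (\row_j lam j) *m Q.
Hypothesis lam_le : forall j, lam j <= lam j0.
Local Notation l1 := (lam j0).
Hypothesis l10 : 0 < l1.
Hypothesis d2 : (1 < d)%N.
Variable Delta : R.
Hypothesis Delta0 : 0 < Delta.
Hypothesis DL : Delta <= l1.
Hypothesis Dgap : forall j, j != j0 -> lam j <= l1 - Delta.
Hypothesis eps01 : 0 < eps < 1.
Variable M : nat.
Hypothesis M0 : (0 < M)%N.
Variable kap : R.
Hypothesis kap0 : 0 <= kap.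
Let c0 : nat := (4 * M)%N.
Local Notation F := (frob2 A).
Local Notation z := (d%:R / (Delta / l1)).
Local Notation uu := (kap * (nnz A)%:R).
Local Notation sm := (speed A l1 Delta).
Local Notation post := (fun s : store R => approx_top_eigenvector A l1 eps (output_vec d s)).

(** The reason for [c0 = 4 M]: initially [P = d], and the numerator of [ms_c] may be as large as
    2. *)
Lemma overlap_start (r F' w : R) : 0 < F' -> r <= F' -> (2 * d%:R * M%:R)^-1 <= w ->
  (1 + r / F') / (c0%:R * d%:R) <= w.
Proof.
move=> F0 rF; apply: le_trans.
have dR : 0 < d%:R :> R by rewrite ltr0n ltnW.
have MR : 0 < M%:R :> R by rewrite ltr0n.
have -> : (2 * d%:R * M%:R)^-1 = 2 / (c0%:R * d%:R) :> R.
  by rewrite /c0 natrM; field; rewrite !gt_eqF.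
rewrite ler_wpM2r ?invr_ge0 ?mulr_ge0 ?ler0n //.
have : r / F' <= 1 by rewrite ler_pdivrMr // mul1r.
by lra.
Qed.

Lemma program_bnd nn x :
  M%:R^-1 + (pot kap A lam j0 c0 Delta eps sm (z ^+ 5) F F + (12 * 100 + 10) * uu +
    24 * ln d%:R * uu) <= x ->
  bnd post kap nn [:: top_program M c0 (stepsC c0) (tolC c0)] (input_store A eps) x.
Proof.
move=> Hx; have NR1 : 1 <= (nnz A)%:R :> R by rewrite ler1n.
have ku : kap <= uu by rewrite ler_peMr.
have u0 : 0 <= uu by exact: le_trans ku.
have F0 : 0 < F by exact: F_gt0.
have Fd : F <= d%:R * l1 by exact: frob_le_d (gram_le QQ Qg lam_le).
have lF : l1 <= F by exact: lam_le_frob QQ Qg j0.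
have c01 : (0 < c0)%N by rewrite muln_gt0.
have d0 : (0 < d)%N by exact: ltnW.
have srE := stable_rankE QQ Qg lam_le.
have sm1 : 1 <= sm by exact: speed_ge1.
have HP : 8 * d%:R * F / Delta <= z ^+ 5 by exact: Pm_bound.
have DF : Delta / 8 <= F.
  have D8 : Delta / 8 <= Delta by move: Delta0; lra.
  exact: le_trans D8 (le_trans DL lF).
apply: bnd_seq => //; apply: (prepM kap0 rows N0) => s D ppi qq St good samp eD out.
have Hsm rho G : l1 <= rho + G -> rho <= l1 -> Delta / 8 <= G ->
  Num.sqrt (mu_of A D rho G / G) <= sm.
  exact: (shift_speed rows l10 srE N0 Delta0 DL samp).
have p0 : 0 <= pot kap A lam j0 c0 Delta eps sm (z ^+ 5) F F.
  exact: (pot_ge0 kap0 good samp (row_dot_gt0 rows) QQ Qg lam_le l10 d2 c01 Delta0 eps01 Hsm HP DL (ltW F0) DF).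
rewrite -[Seq (Start M) _]/(Seqs [:: Start M; Main c0 (stepsC c0) (tolC c0)]).
apply: (seqsM kap0 good).
pose x0 := pot kap A lam j0 c0 Delta eps sm (z ^+ 5) F F + 3 * 100 * uu + uu.
apply: (startM kap0 good QQ Qg l10 d0 M0 (x0 := x0) St out).
- by rewrite /x0 addr_ge0 // addr_ge0 // mulr_ge0.
- move=> s1 v Lg St1 Ev o1' e7 e8 e9 vv ov dL hL; apply: (seqsM kap0 good).
  apply: (mainM kap0 good samp (row_dot_gt0 rows) QQ Qg lam_le l10 d2 c01 Delta0 Dgap eD eps01
    Hsm HP DL St1 Ev o1' e7 e8 e9 DF).
  + move=> rho r Er Err.
    have /andP[r1 r2] := rho_bounds QQ Qg lam_le vv Er.
    have /andP[r3 r4] := res_le QQ Qg lam_le l10 vv Er Err.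
    split=> //; first by lra.
    * by rewrite F0 lexx.
    * by rewrite (ler_nat _ 2).
    exact: overlap_start.
  + move=> s2 St2 v2 Ev2 o2' n2 h2; apply: bnd_skip_nil => //.
    have -> : output_vec d s2 = v2.
      apply/matrixP => i j; rewrite Ev2 ord1 cvE mxE; case: ifP => // /negbT h; exact: o2'.
    split; first by rewrite norm2E n2 sqrtr1.
    by rewrite -mulmxA -mulmxA dot_mx mulmxA.
  by rewrite /x0 !uuE addrK.
by rewrite !uuE /x0; move: Hx ku u0; lra.
Qed.

(** For [kap = 1 / T], the inequality in [bnd] at time [T] bounds the failure probability by the
    loss: Markov's inequality for the running time, plus [1 / M] for the start. *)
Lemma program_success (K : R) : 0 < K -> 16 <= K -> let tb := time_bound A l1 (l1 - Delta) eps in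
  kap = (Num.truncn (K * tb))%:R^-1 ->
  1 - (M%:R^-1 + 6 * totC R c0 / K) <=
    success_prob A eps (approx_top_eigenvector A l1 eps) (Num.truncn (K * tb))
      (top_program M c0 (stepsC c0) (tolC c0)).
Proof.
move=> K0 K16 tb kE; have NR1 : 1 <= (nnz A)%:R :> R by rewrite ler1n.
have c01 : (0 < c0)%N by rewrite muln_gt0.
have F0 : 0 < F by exact: F_gt0.
have Fd : F <= d%:R * l1 by exact: frob_le_d (gram_le QQ Qg lam_le).
have gE : eigengap l1 (l1 - Delta) = Delta / l1 by rewrite /eigengap opprB addrC subrK.
have L2 : 1 / 2 <= ln z by exact: L_ge.
have e0 : 0 <= ln eps^-1 by exact: E_ge0.
have sp := nnz_speed l10 N0 Delta0.
set T1 := (_ + _ * _) in sp.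
have tbE : tb = T1 * (ln z * (ln z ^+ 2 + ln eps^-1)) by rewrite /tb /time_bound gE /T1; ring.
set T2 := ln z * _ in tbE.
have T2g : 1 / 8 <= T2.
  by rewrite /T2; move: L2 e0; move: (ln z) (ln eps^-1) => l e l2 e0; rewrite expr2; nra.
have T1g : 1 <= T1.
  by apply: le_trans NR1 _; rewrite lerDl !mulr_ge0 ?powR_ge0 ?invr_ge0 ?sqrtr_ge0.
have tb8 : 1 / 8 <= tb by rewrite tbE; nra.
have Kt : 2 <= K * tb by nra.
set T := Num.truncn _ in kE *.
(* Since [K * tb >= 2], truncation loses at most half. *)
have Tg : K * tb / 2 <= T%:R.
  have := truncnS_gt (K * tb); rewrite -/T -natr1; lra.
have T0 : 0 < T%:R :> R by lra.
have tot0 := totC_gt0 R c01.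
have [_ /(_ T (leqnn T))] := @program_bnd T _ (lexx _).
rewrite kE mulVf ?gt_eqF // => /(_ (lexx _)).
rewrite /success_prob; set hp := halt_prob _ _ _ _; set X := M%:R^-1 + _ => H.
have : X <= M%:R^-1 + 6 * totC R c0 / K.
  rewrite /X lerD2l -kE; apply: le_trans (total_budget l10 Delta0 DL d2 c01 eps01 F0 Fd kap0 (speed_ge1 _ _ _)) _.
  rewrite -/T2 [leRHS](_ : _ = totC R c0 * (6 / K)); last by ring.
  apply: ler_wpM2l; first exact: ltW.
  apply: le_trans (_ : kap * (3 * T1) * T2 <= _).
    by rewrite ler_wpM2r -?mulrA ?ler_wpM2l //; lra.
  have -> : kap * (3 * T1) * T2 = 3 * (kap * tb) by rewrite tbE; ring.
  have : kap * tb <= 2 / K; last by move=> h; move: h; set y := K^-1; lra.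
  by rewrite kE mulrC ler_pdivrMr // mulrAC ler_pdivlMr //; lra.
by move: H; lra.
Qed.

End TopProgram.

Theorem theorem2 (R : realType) (delta : R) (hdelta : 0 < delta) :
  exists (p : program) (K : R),
    0 < K /\
    forall (n d : nat) (A : 'M[R]_(n, d)) (lam : seq R) (eps : R),
      (1 < d)%N ->
      (forall i : 'I_n, row i A != 0) ->
      ordered_eigenvalues (A^T *m A) lam ->
      let l1 := nth 0 lam 0 in
      let l2 := nth 0 lam 1 in
      0 < eigengap l1 l2 ->
      0 < eps < 1 ->
      1 - delta <=
        success_prob A eps (approx_top_eigenvector A l1 eps)
          (Num.truncn (K * time_bound A l1 l2 eps)) p.
Proof.
(* One half of [delta] is for the starting vector, bad with probability at most [1 / M]; the other
   half is for the running time, through [K]. *)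
pose M := (Num.truncn (2 / delta)).+1.
have M0 : (0 < M)%N by [].
have MR : 0 < M%:R :> R by rewrite ltr0n.
have Md : M%:R^-1 <= delta / 2.
  rewrite -[leLHS]mul1r ler_pdivrMr // -ler_pdivrMl ?divr_gt0 // mulr1 invf_div.
  exact/ltW/truncnS_gt.
pose c0 := (4 * M)%N.
have c01 : (0 < c0)%N by rewrite muln_gt0.
have tot0 := totC_gt0 R c01.
(* The summand 16 ensures [K * tb >= 2], as [tb >= 1 / 8]. *)
pose K := 12 * totC R c0 / delta + 16.
have K16 : 16 <= K by rewrite lerDr divr_ge0 ?mulr_ge0 ?ltW.
have K0 : 0 < K by lra.
have Kd : 6 * totC R c0 / K <= delta / 2.
  have KE : K * delta = 12 * totC R c0 + 16 * delta by rewrite /K; field; rewrite gt_eqF.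
  by rewrite ler_pdivrMr //; move: hdelta KE; move: (K) (totC R c0) => y c; lra.
exists (top_program M c0 (stepsC c0) (tolC c0)), K; split=> // n d A lam eps d2 rows [srt chr] l1 l2 gap eps01.
have [Q [QQ Qg]] := symmetric_diagonalization (gram_sym A) chr.
have sz : size lam = d by apply/eqP; rewrite -eqSS -(size_prod_XsubC lam id) -chr size_char_poly.
have d0 : (0 < d)%N by exact: ltnW.
pose f (j : 'I_d) : R := nth 0 lam j; pose j0 := Ordinal d0; pose j1 := Ordinal d2.
have {}Qg : Q *m gram A = diag_mx (\row_j f j) *m Q by exact: Qg.
have nthle (i j : nat) : (i <= j)%N -> (j < d)%N -> nth 0 lam j <= nth 0 lam i.
  move=> ij jd; apply: (sorted_leq_nth ge_trans ge_refl 0 srt) => //; rewrite inE sz //.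
  exact: leq_ltn_trans jd.
have lam_le j : f j <= f j0 by apply: nthle.
have l1n : l1 != 0 by apply: contraTneq gap => ->; rewrite /eigengap invr0 mulr0 ltxx.
have l10 : 0 < f j0 by rewrite lt_def l1n (lam_ge0 QQ Qg j0).
have gE : (l1 - l2) / l1 = eigengap l1 l2 by [].
have D0 : 0 < l1 - l2 by move: gap; rewrite -gE pmulr_lgt0 // invr_gt0.
have l20 : 0 <= l2 := lam_ge0 QQ Qg j1.
have DL : l1 - l2 <= f j0 by rewrite lerBlDr lerDl.
have Dgap j : j != j0 -> f j <= f j0 - (l1 - l2).
  move=> jj; rewrite opprB addrC subrK; apply: nthle => //; rewrite lt0n; apply: contra jj => /eqP E.
  by apply/eqP/val_inj.
have N0 : (0 < nnz A)%N.
  rewrite lt0n; apply/eqP => nz; have := lt_le_trans l10 (lam_le_frob QQ Qg j0).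
  rewrite /frob2 big1 ?ltxx // => i _; exfalso; have := supp_gt0 rows i.
  by move/eqP: nz; rewrite nnzE sum_nat_eq0 => /forallP /(_ i) /eqP ->.
have kap0 : 0 <= (Num.truncn (K * time_bound A l1 l2 eps))%:R^-1 :> R by rewrite invr_ge0.
have l2E : l1 - (l1 - l2) = l2 by rewrite opprB addrC subrK.
have := @program_success _ _ _ A eps rows N0 Q f j0 QQ Qg lam_le l10 d2 (l1 - l2) D0 DL Dgap
  eps01 M M0 _ kap0 K K0 K16.
rewrite -[f j0]/l1 l2E => /(_ erefl); apply: le_trans.
by move: Md Kd; rewrite -/c0; lra.
Qed.
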